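(* Let $\Gamma$ be a finitely generated (discrete) group and let $m$ be an integer. If $\operatorname{obdim}(\Gamma)\geq m$, then $\Gamma$ cannot act properly discontinuously on a contractible manifold of dimension $<m$.
   Context: All (co)homology is with $\mathbb{Z}_2$ coefficients; simplicial complexes are identified with their geometric realizations. **Obstructor complexes.** Let $m\ge 0$ be an integer. A finite simplicial complex $K$ of dimension $\le m$ is an $m$-obstructor complex if: (1) there is a collection $\Sigma=\{\{\sigma_i,\tau_i\}\}_{i=1}^k$ of unordered pairs of disjoint simplices of $K$ with $\dim\sigma_i+\dim\tau_i=m$ which determines a cellular $m$-cycle over $\mathbb{Z}_2$ (the sum of the corresponding $m$-cells) in the cell complex $\bigl(\bigcup\{\sigma\times\tau\subset K\times K\mid \sigma\cap\tau=\emptyset\}\bigr)/\mathbb{Z}_2$, where $\mathbb{Z}_2$ acts by $(x,y)\mapsto(y,x)$; (2) for some (equivalently, any) general position map $f:K\to\mathbb{R}^m$ the finite number $\sum_{i=1}^k|f(\sigma_i)\cap f(\tau_i)|$ is odd; (3) for every $m$-simplex $\sigma$ of $K$ the number of vertices $v$ such that $\{\sigma,v\}\in\Sigma$ is even. (Here (1), (2), (3) refer to the same collection $\Sigma$.) **Cones and expanding maps.** For a finite complex $K$, $cone(K)=K\times[0,\infty)/K\times\{0\}$ is the open cone. Triangulate $cone(K)$ so that $cone(\sigma)$ is a subcomplex for every simplex $\sigma$ of $K$, and give the vertex set $cone(K)^{(0)}$ the edge-path metric. A map is proper if preimages of compact sets are compact (for maps between discrete proper spaces: preimages of finite sets are finite).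 Two maps $h_1:A_1\to B$, $h_2:A_2\to B$ into a metric space $B$ diverge if for every $D>0$ there are compact $C_i\subset A_i$ such that $h_1(A_1\setminus C_1)$ and $h_2(A_2\setminus C_2)$ are at distance $>D$. A proper map $h:cone(K)^{(0)}\to B$ is expanding if for all pairs of disjoint simplices $\sigma,\tau$ of $K$ the restrictions $h|cone(\sigma)^{(0)}$ and $h|cone(\tau)^{(0)}$ diverge. **Obstructor dimension.** Let $\Gamma$ be a finitely generated group with a word metric for some finite generating set. $\operatorname{obdim}(\Gamma)$ is $0$ if $\Gamma$ is finite, $1$ if $\Gamma$ is 2-ended, and otherwise $m+2$, where $m$ is the largest integer such that for some $m$-obstructor complex $K$ and some triangulation of $cone(K)$ in which $cone(\sigma)$ is a subcomplex for every simplex $\sigma$ of $K$ there exists a proper, Lipschitz, expanding map $cone(K)^{(0)}\to\Gamma$; if there is no largest such $m$, $\operatorname{obdim}(\Gamma)=\infty$. *)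

(* Defs.v *)
From HB Require Import structures.
From mathcomp Require Import all_boot all_order all_algebra finmap.
From mathcomp Require Import generic_quotient.
From mathcomp Require Import all_classical all_reals all_analysis.

Set Implicit Arguments.
Unset Strict Implicit.
Unset Printing Implicit Defensive.

Import Order.TTheory GRing.Theory Num.Theory.
Import numFieldNormedType.Exports.

Local Open Scope fset_scope.
Local Open Scope card_scope.
Local Open Scope classical_set_scope.
Local Open Scope ring_scope.

(* Abstract simplicial complex, possibly infinite, whose vertex set is the
   whole type [V]. *)
Record complex (V : choiceType) := Complex {
  faces :> set {fset V};
  face_neq0 : forall s, faces s -> s != fset0;
  face_sub : forall s t, faces s -> t != fset0 -> (t `<=` s)%fset -> faces t;
  face_vertex : forall v, faces [fset v]
}.

Section Realization.
Variables (R : realType) (V : choiceType).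

Definition vertex_point (v : V) : {ptws V -> R} := fun w => (w == v)%:R.

Definition simplex (s : {fset V}) : set {ptws V -> R} :=
  [set x | [/\ forall v, 0 <= x v, forall v, v \notin s -> x v = 0
             & \sum_(v <- s) x v = 1]].

(* The topology induced by [{ptws V -> R}] agrees with the weak topology when
   the complex is locally finite, which is the only case used below. *)
Definition realization (K : complex V) : set {ptws V -> R} :=
  \bigcup_(s in faces K) simplex s.

End Realization.

Arguments simplex R {V} s.
Arguments realization R {V} K.

Definition locally_finite (V : choiceType) (K : complex V) : Prop :=
  forall v, finite_set [set s | faces K s /\ v \in s].

Section ObstructorComplex.
Variables (R : realType) (V : choiceType) (K : complex V) (m : nat).
Implicit Types (s t : {fset V}) (Sigma : {fset {fset {fset V}}}).

(* As [dim s = #|` s| - 1], a pair has [dim s + dim t = d] exactly when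
   [#|` s| + #|` t| = d + 2]. *)
Definition disjoint_faces s t : Prop :=
  [/\ faces K s, faces K t & [disjoint s & t]%fset].

(* The involution of the deleted product acts freely on its cells, so the cells
   of the quotient are the unordered pairs of disjoint simplices. *)
Definition cell_facet (P Q : {fset {fset V}}) : Prop :=
  exists s t v, [/\ P = [fset s; t], v \in s, (s `\ v)%fset != fset0
                  & Q = [fset s `\ v; t]%fset].

Definition is_cell_chain Sigma : Prop :=
  forall P, P \in Sigma -> exists s t,
    [/\ P = [fset s; t], disjoint_faces s t & (#|` s| + #|` t| = m + 2)%N].

(* Each facet occurs in the boundary of a cell with multiplicity one. *)
Definition is_cell_cycle Sigma : Prop :=
  forall Q, ~~ odd #|` [fset P in Sigma | `[< cell_facet P Q >]] |.

(* At a point [(x, y)] over a double point, transversality of two cells of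
   complementary dimensions is expressed as local injectivity of
   [(x, y) |-> f x - f y]; transverse PL and smooth maps satisfy it. Maps with
   triple points among complementary pairs are excluded, so that points of
   [f s `&` f t] are counted with the right multiplicity. *)
Definition general_position (f : {ptws V -> R} -> 'rV[R]_m) : Prop :=
  [/\ {within realization R K, continuous f},
      forall s t, disjoint_faces s t -> (#|` s| + #|` t| < m + 2)%N ->
        f @` simplex R s `&` f @` simplex R t = set0
    & forall s t, disjoint_faces s t -> (#|` s| + #|` t| = m + 2)%N ->
        [/\ finite_set (f @` simplex R s `&` f @` simplex R t),
            forall x x' y y', simplex R s x -> simplex R s x' ->
              simplex R t y -> simplex R t y' ->
              f x = f y -> f x' = f x -> f y' = f y -> x' = x /\ y' = y
          & forall x y, simplex R s x -> simplex R t y -> f x = f y ->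
              exists U W, [/\ nbhs x U, nbhs y W &
                {in (U `&` simplex R s) `*` (W `&` simplex R t) &,
                  injective (fun p => f p.1 - f p.2)}]]].

Definition intersection_number (f : {ptws V -> R} -> 'rV[R]_m) Sigma : nat :=
  (\sum_(P <- Sigma)
    #|` fset_set (\bigcap_(s in [set` P]) f @` simplex R s)|)%N.

Definition obstructor_complex : Prop :=
  [/\ finite_set (faces K),
      forall s, faces K s -> (#|` s| <= m.+1)%N
    & exists Sigma,
      [/\ is_cell_chain Sigma /\ is_cell_cycle Sigma,
          exists2 f, general_position f & odd (intersection_number f Sigma)
        & forall s, faces K s -> #|` s| = m.+1 ->
            ~~ odd #|` fset_set [set v : V | [fset s; [fset v]] \in Sigma]|]].

End ObstructorComplex.

Section OpenCone.
Variables (R : realType) (V : choiceType) (K : complex V).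

Definition cylinder : topologicalType :=
  (set_type (realization R K) * set_type `[0 : R, +oo[)%type.

Definition cone_rel (p q : cylinder) : bool :=
  (p == q) || ((\val p.2 == 0 :> R) && (\val q.2 == 0 :> R)).

Lemma cone_rel_refl : reflexive cone_rel.
Proof. by move=> p; rewrite /cone_rel eqxx. Qed.

Lemma cone_rel_sym : symmetric cone_rel.
Proof. by move=> p q; rewrite /cone_rel eq_sym andbC. Qed.

Lemma cone_rel_trans : transitive cone_rel.
Proof.
move=> q p r; rewrite /cone_rel => /orP[/eqP->//|/andP[p0 q0]].
by move=> /orP[/eqP<-|/andP[_ r0]]; rewrite p0 ?q0 ?r0 orbT.
Qed.

Canonical cone_equiv := EquivRel cone_rel cone_rel_refl cone_rel_sym
  cone_rel_trans.

Definition open_cone : topologicalType :=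
  quotient_topology {eq_quot cone_equiv}%qT.

Definition cone_pi (p : cylinder) : open_cone :=
  (\pi_(quotient_topology {eq_quot cone_equiv}) p)%qT.

Definition subcone (s : {fset V}) : set open_cone :=
  [set cone_pi p | p in [set p : cylinder | simplex R s (\val p.1)]].

End OpenCone.

Arguments subcone R {V} K s.

Section Triangulation.
Variables (R : realType) (V W : choiceType) (K : complex V) (T : complex W).

Definition is_homeomorphism (X Y : topologicalType) (h : X -> Y) : Prop :=
  continuous h /\ exists g : Y -> X, [/\ continuous g, cancel h g & cancel g h].

Definition is_subcomplex (L : set {fset W}) : Prop :=
  L `<=` faces T /\
  forall s t, L s -> t != fset0 -> (t `<=` s)%fset -> L t.

(* A complex triangulating the locally compact space [open_cone R K] is
   necessarily locally finite. *)
Definition cone_triangulation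
    (h : set_type (realization R T) -> open_cone R K) : Prop :=
  [/\ locally_finite T, is_homeomorphism h
    & forall s, faces K s -> exists2 L, is_subcomplex L
        & h @^-1` subcone R K s
          = [set x | exists2 t, L t & simplex R t (\val x)]].

Definition cone_vertices
    (h : set_type (realization R T) -> open_cone R K) (s : {fset V}) : set W :=
  [set w | exists2 x, \val x = vertex_point R w & subcone R K s (h x)].

End Triangulation.

Section Metrics.
Variable R : realType.

Definition path_dist (X : eqType) (e : rel X) (x y : X) : \bar R :=
  ereal_inf [set (size p)%:R%:E | p in [set p | path e x p /\ last x p = y]].

Definition set_dist (X : Type) (d : X -> X -> \bar R) (A B : set X) : \bar R :=
  ereal_inf [set d p.1 p.2 | p in A `*` B].

Definition lipschitz_map (X Y : Type) (dX : X -> X -> \bar R)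
    (dY : Y -> Y -> \bar R) (h : X -> Y) : Prop :=
  exists2 L : R, 0 < L & forall x y, (dY (h x) (h y) <= L%:E * dX x y)%E.

(* The domains are discrete and locally finite, so that their compact subsets
   are the finite ones. *)
Definition proper_map (X Y : Type) (h : X -> Y) : Prop :=
  forall F : set Y, finite_set F -> finite_set (h @^-1` F).

Definition diverge (X Y : Type) (dY : Y -> Y -> \bar R) (h : X -> Y)
    (A1 A2 : set X) : Prop :=
  forall D : R, 0 < D -> exists C1 C2 : set X,
    [/\ finite_set C1, finite_set C2, C1 `<=` A1, C2 `<=` A2 &
        (D%:E < set_dist dY (h @` (A1 `\` C1)) (h @` (A2 `\` C2)))%E].

End Metrics.

Definition edge_rel (W : choiceType) (T : complex W) : rel W :=
  fun u v => (u != v) && ([fset u; v] \in faces T).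

Section Groups.
Variables (R : realType) (G : groupType) (S : seq G).

Definition generates : Prop :=
  forall H : groupClosed G, {subset S <= H} -> forall g : G, g \in H.

Definition cayley : rel G :=
  fun x y => ((x^-1 * y)%g \in S) || ((y^-1 * x)%g \in S).

Definition word_dist : G -> G -> \bar R := path_dist R cayley.

Definition infinite_components (F : set G) : set (set G) :=
  [set C | infinite_set C /\
    exists2 x, ~ F x &
      C = [set y | exists p, [/\ path cayley x p, last x p = y
                               & forall z, z \in p -> ~ F z]]].

(* The number of ends is the supremum, over finite [F], of the number of
   infinite components of the complement of [F] in the Cayley graph. *)
Definition two_ended : Prop :=
  (exists2 F, finite_set F & infinite_components F #= `I_2) /\
  (forall F, finite_set F -> infinite_components F #<= `I_2).

Definition expanding (V W : choiceType) (K : complex V) (T : complex W)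
    (tri : set_type (realization R T) -> open_cone R K) (h : W -> G) : Prop :=
  forall s t, disjoint_faces K s t ->
    diverge word_dist h (cone_vertices tri s) (cone_vertices tri t).

Definition has_obstructor (m : nat) : Prop :=
  exists (V : choiceType) (K : complex V) (W : choiceType) (T : complex W)
         (tri : set_type (realization R T) -> open_cone R K) (h : W -> G),
    [/\ obstructor_complex R K m, cone_triangulation tri, proper_map h,
        lipschitz_map (path_dist R (edge_rel T)) word_dist h
      & expanding tri h].

Definition obdim : \bar int :=
  if `[< finite_set [set: G] >] then 0%:E
  else if `[< two_ended >] then 1%:E
  else xget +oo%E
    [set d | exists2 m : nat, d = (m + 2)%N%:Z%:E &
       has_obstructor m /\ forall n : nat, has_obstructor n -> (n <= m)%N].

End Groups.

Section Manifolds.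
Variable (R : realType).

Definition manifold (n : nat) (M : topologicalType) : Prop :=
  [/\ hausdorff_space M, @second_countable M
    & forall x : M, exists (U : set M) (phi : M -> 'rV[R]_n)
                           (psi : 'rV[R]_n -> M),
        [/\ open U /\ U x, open (phi @` U), {within U, continuous phi},
            {within phi @` U, continuous psi}
          & {in U, cancel phi psi}]].

Definition contractible (M : topologicalType) : Prop :=
  exists (x0 : M) (H : M * R -> M),
    [/\ {within [set: M] `*` `[0, 1], continuous H},
        forall x, H (x, 0) = x & forall x, H (x, 1) = x0].

End Manifolds.

(* Point stabilisers are finite but need not be trivial. *)
Definition properly_discontinuous_action (G : groupType) (M : topologicalType)
    (act : G -> M -> M) : Prop :=
  [/\ forall x, act 1%g x = x,
      forall g h x, act (g * h)%g x = act g (act h x),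
      forall g, continuous (act g)
    & forall C : set M, compact C ->
        finite_set [set g | act g @` C `&` C !=set0]].

(* Main.v *)
(* A tower of length n over an involution t is a sequence c_0, ..., c_n of mod 2
   chains of tuples of points with c_0 odd and bd c_(j+1) = c_j + t c_j; it
   witnesses that the n-th power of the Smith class of the double cover does not
   vanish. If K is an m-obstructor complex, then the odd number of pairs of
   points in disjoint simplices of K with the same image in R^m gives, by a
   degree count, a tower of length m+1 of arbitrarily fine tuples in the deleted
   join of K. The expanding map cone(K) -> G turns it into a tower of tuples of
   bounded size in G x G, arbitrarily far from the diagonal. Let G act on a
   contractible M of dimension at most m+1. Filling tuples of bounded size through
   the contraction and the action makes this tower fine and keeps it off the
   diagonal of M x M, in a compact set. In a large compact set the contraction
   pulls the tower to a point of M x M; near the diagonal a chart turns (x,y) into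
   x - y in R^n minus 0, which is filled there, and the degree of the top chain
   contradicts the Borsuk-Ulam theorem, here obtained from Fan's lemma. *)
Require Import Defs.
From HB Require Import structures.
From mathcomp Require Import all_boot all_order all_algebra finmap.
From mathcomp Require Import generic_quotient.
From mathcomp Require Import all_classical all_reals all_analysis.
From mathcomp Require Import ring lra zify.

Set Implicit Arguments.
Unset Strict Implicit.
Unset Printing Implicit Defensive.

Import Order.TTheory GRing.Theory Num.Theory.
Import numFieldNormedType.Exports.
Local Open Scope fset_scope.
Local Open Scope classical_set_scope.
Local Open Scope ring_scope.

(** * Chains mod 2 *)

(** Chains are finite sets of tuples of points rather than singular simplices, so that a filling is
    controlled by numbers: the mesh of a tuple, its distance to a centre and the separation of its
    pairs. Every filling spoils these numbers, but a manifold of dimension n+1 calls for a bounded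
    number of fillings, so all constants can be fixed in advance, level by level. Equivariant
    choices need a free involution; on M x M the swap is not free, so each pair carries a boolean
    label while the contraction crosses the diagonal. The obstruction is a cocycle: fine tuples of
    pairs can be pushed off the diagonal up to dimension n, and in dimension n+1 the degree of the
    pushed boundary is an invariant mod 2 cocycle. It vanishes on a top chain far from the diagonal,
    its value does not change along the contraction, and at a constant pair it is 1 by Borsuk-Ulam.
    [obdim] is infinite also when there is no obstructor at all. Hence an infinite group that is not
    two-ended has to be given a 0-obstructor, the cone on three points. *)

Definition chain (S : choiceType) : Type := {fset S}.

Section Chains.
Variable S : choiceType.
Implicit Types (c d e : chain S) (x y : S).

HB.instance Definition _ := Choice.on (chain S).

Definition coef c x : bool := x \in (c : {fset S}).

Definition csum c d : chain S := ((c `\` d) `|` (d `\` c))%fset.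

Lemma coef_csum c d x : coef (csum c d) x = coef c x (+) coef d x.
Proof.
by rewrite /coef /csum in_fsetU !in_fsetD; case: (x \in _); case: (x \in _).
Qed.

Lemma chainP c d : (forall x, coef c x = coef d x) -> c = d.
Proof. by move=> h; apply/fsetP => x; apply: h. Qed.

Fact csumA : associative csum.
Proof. by move=> c d e; apply: chainP => x; rewrite !coef_csum addbA. Qed.
Fact csumC : commutative csum.
Proof. by move=> c d; apply: chainP => x; rewrite !coef_csum addbC. Qed.
Fact csum0 : left_id (fset0 : chain S) csum.
Proof. by move=> c; apply: chainP => x; rewrite !coef_csum /coef inE. Qed.
Fact csumN : left_inverse (fset0 : chain S) id csum.
Proof. by move=> c; apply: chainP => x; rewrite !coef_csum addbb /coef inE. Qed.

HB.instance Definition _ := GRing.isZmodule.Build (chain S) csumA csumC csum0 csumN.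

Lemma coefD c d x : coef (c + d) x = coef c x (+) coef d x.
Proof. exact: coef_csum. Qed.

Lemma coefD_or c d x : coef (c + d) x -> coef c x \/ coef d x.
Proof. by rewrite coefD; case: (coef c x) => //=; [left|right]. Qed.

Lemma coef0 x : coef 0 x = false.
Proof. by rewrite /coef inE. Qed.

Lemma addcc c : c + c = 0.
Proof. by apply: chainP => x; rewrite coefD addbb coef0. Qed.

Lemma addcK c d : c + d + d = c.
Proof. by rewrite -addrA addcc addr0. Qed.

Lemma addc_eq0 c d : c + d = 0 -> c = d.
Proof. by move=> h; rewrite -[LHS](addcK c d) h add0r. Qed.

Definition sg x : chain S := [fset x]%fset.

Lemma coef_sg x y : coef (sg x) y = (y == x).
Proof. by rewrite /coef inE. Qed.

Definition cfilter (P : pred S) c : chain S := [fset x in (c : {fset S}) | P x]%fset.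

Lemma coef_filter P c x : coef (cfilter P c) x = coef c x && P x.
Proof. by rewrite /coef !inE. Qed.

Lemma cfilterD P c d : cfilter P (c + d) = cfilter P c + cfilter P d.
Proof.
by apply: chainP => x; rewrite !(coefD, coef_filter); case: (P x); rewrite ?andbT ?andbF.
Qed.

Section Lin.
Variables (V : zmodType) (V2 : forall v : V, v + v = 0) (f : S -> V).

(** The target has exponent two, so this extension from simplices to chains is additive. *)
Definition linV c : V := \sum_(x <- enum_fset c) f x.

Lemma linV_big (A : {fset S}) c : ((c : {fset S}) `<=` A)%fset ->
  linV c = \sum_(x <- enum_fset A) (if coef c x then f x else 0).
Proof.
move=> /fsubsetP cA; rewrite -big_mkcond /= -big_filter; apply: perm_big.
apply: uniq_perm; rewrite ?filter_uniq ?fset_uniq// => x.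
by rewrite mem_filter /coef; case: (boolP (x \in _)) => //= /cA.
Qed.

Lemma linVD c d : linV (c + d) = linV c + linV d.
Proof.
have s (e : chain S) : (forall x, coef e x -> coef c x || coef d x) ->
    ((e : {fset S}) `<=` ((c : {fset S}) `|` d))%fset.
  by move=> h; apply/fsubsetP => x /h; rewrite in_fsetU.
rewrite !(@linV_big ((c : {fset S}) `|` d)%fset); last 3 first.
- by apply: s => x ->; rewrite orbT.
- by apply: s => x ->.
- by apply: s => x; rewrite coefD; case: coef.
rewrite -big_split /=; apply: eq_bigr => x _; rewrite coefD.
by case: coef; case: coef; rewrite /= ?addr0 ?add0r ?V2.
Qed.

Lemma linV0 : linV 0 = 0.
Proof. by rewrite /linV big_nil. Qed.

Lemma linV_sg x : linV (sg x) = f x.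
Proof. exact: big_seq_fset1. Qed.

End Lin.

Lemma eq_linV (V : zmodType) (f g : S -> V) c :
  (forall x, coef c x -> f x = g x) -> linV f c = linV g c.
Proof. by move=> h; apply: eq_big_seq => x; apply: h. Qed.

Lemma linV_add (V : zmodType) (f g : S -> V) c :
  linV (fun x => f x + g x) c = linV f c + linV g c.
Proof. exact: big_split. Qed.

(** A predicate on simplices is a mod 2 cochain; this is its value on a chain. *)
Definition pair (phi : pred S) c : bool := linV (phi : S -> bool) c.

Lemma bool2 (b : bool) : b + b = 0. Proof. by case: b. Qed.

Lemma pairD phi c d : pair phi (c + d) = pair phi c (+) pair phi d.
Proof. exact: (linVD bool2). Qed.
Lemma pair0 phi : pair phi 0 = false. Proof. exact: linV0. Qed.
Lemma pair_sg phi x : pair phi (sg x) = phi x.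
Proof. exact: linV_sg. Qed.
Lemma eq_pair (phi psi : pred S) c :
  (forall x, coef c x -> phi x = psi x) -> pair phi c = pair psi c.
Proof. exact: eq_linV. Qed.
Lemma pair_add (phi psi : pred S) c :
  pair (fun x => phi x (+) psi x) c = pair phi c (+) pair psi c.
Proof. exact: linV_add. Qed.
Lemma pair_eq0 (phi : pred S) c :
  (forall x, coef c x -> phi x = false) -> pair phi c = false.
Proof. by move=> h; rewrite /pair /linV big1_seq // => x /h. Qed.

Lemma pair_odd (phi : pred S) c : pair phi c = odd (count phi (enum_fset c)).
Proof.
rewrite /pair /linV; elim: (enum_fset c) => [|x s IH]; first by rewrite big_nil.
by rewrite big_cons IH /= oddD; case: (phi x).
Qed.

End Chains.

Section LinC.
Variables (S T : choiceType).
Implicit Types (c d : chain S).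

Definition lin (f : S -> chain T) c : chain T := linV f c.

Lemma linD f c d : lin f (c + d) = lin f c + lin f d.
Proof. by apply: linVD => v; apply: addcc. Qed.
Lemma lin0 f : lin f 0 = 0. Proof. exact: linV0. Qed.
Lemma lin_sg f x : lin f (sg x) = f x. Proof. exact: linV_sg. Qed.
Lemma eq_lin f g c : (forall x, coef c x -> f x = g x) -> lin f c = lin g c.
Proof. exact: eq_linV. Qed.
Lemma lin_eq0 f c : (forall x, coef c x -> f x = 0) -> lin f c = 0.
Proof. by move=> h; rewrite /lin /linV big1_seq // => x /h. Qed.

Lemma coef_sum (I : Type) (r : seq I) (F : I -> chain T) y :
  coef (\sum_(i <- r) F i) y = \sum_(i <- r) (coef (F i) y : bool).
Proof.
elim: r => [|i r IH]; first by rewrite !big_nil coef0.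
by rewrite !big_cons coefD IH.
Qed.

Lemma coef_lin f c y : coef (lin f c) y = pair (fun x => coef (f x) y) c.
Proof. exact: coef_sum. Qed.

Lemma coef_linP f c y : coef (lin f c) y -> exists2 x, coef c x & coef (f x) y.
Proof.
rewrite coef_lin => h; apply: contrapT => hn; move: h; rewrite pair_eq0 // => x cx.
by apply/negbTE/negP => fxy; apply: hn; exists x.
Qed.

Lemma pair_lin f (phi : pred T) c : pair phi (lin f c) = pair (fun x => pair phi (f x)) c.
Proof.
rewrite /lin /linV [RHS]/pair /linV.
elim: (enum_fset c) => [|x s IH]; first by rewrite !big_nil pair0.
by rewrite !big_cons pairD IH.
Qed.

End LinC.

Lemma lin_lin (S T U : choiceType) (f : S -> chain T) (g : T -> chain U) c :
  lin g (lin f c) = lin (fun x => lin g (f x)) c.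
Proof.
rewrite {2}/lin /linV [RHS]/lin /linV.
elim: (enum_fset c) => [|x s IH]; first by rewrite !big_nil lin0.
by rewrite !big_cons linD IH.
Qed.

Lemma lin_id (S : choiceType) (c : chain S) : lin (@sg S) c = c.
Proof.
apply: chainP => x; rewrite coef_lin.
have -> : pair (fun y => coef (sg y) x) c = pair (pred1 x) c.
  by apply: eq_pair => y _; rewrite coef_sg /= eq_sym.
rewrite pair_odd -[count _ _]/(count_mem x (enum_fset c)).
by rewrite count_uniq_mem ?fset_uniq// /coef; case: (x \in _).
Qed.

(** Every chain is the sum of its simplices. This reduces identities between additive operators,
    such as boundaries and prisms, to single tuples. *)
Lemma lin_ext (S T : choiceType) (F F' : chain S -> chain T) :
    (forall c d, F (c + d) = F c + F d) -> (forall c d, F' (c + d) = F' c + F' d) ->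
    forall c, (forall x, coef c x -> F (sg x) = F' (sg x)) -> F c = F' c.
Proof.
move=> FD F'D c h.
have z (H : chain S -> chain T) : (forall c d, H (c + d) = H c + H d) ->
    H c = lin (fun x => H (sg x)) c.
  move=> HD; have H0 : H 0 = 0.
    by have := HD 0 0; rewrite addr0 => {1}->; rewrite addcc.
  rewrite -{1}(lin_id c) /lin /linV.
  by elim: (enum_fset c) => [|x s IH]; rewrite ?big_nil// !big_cons HD IH.
by rewrite (z F) // (z F') //; apply: eq_lin.
Qed.

(** * Tuples of points as ordered simplices *)

Section Tuples.
Variable P : choiceType.
Implicit Types (s u : seq P) (c d : chain (seq P)).

Definition consc x c : chain (seq P) := lin (fun s => sg (x :: s)) c.

Lemma conscD x c d : consc x (c + d) = consc x c + consc x d. Proof. exact: linD. Qed.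
Lemma consc0 x : consc x 0 = 0. Proof. exact: lin0. Qed.
Lemma consc_sg x s : consc x (sg s) = sg (x :: s). Proof. exact: lin_sg. Qed.

Lemma coef_consc x c u : coef (consc x c) u -> exists2 s, coef c s & u = x :: s.
Proof. by move=> /coef_linP[s cs]; rewrite coef_sg => /eqP->; exists s. Qed.

(** This is the augmented ordered complex: the boundary of a one-point tuple is the empty tuple, and
    repeated entries are allowed. A tuple of length [j+1] has dimension [j], and a chain of
    one-point tuples is a cycle when it has an even number of points. *)
Fixpoint bdt s : chain (seq P) :=
  if s is x :: s' then sg s' + consc x (bdt s') else 0.

Definition bd c := lin bdt c.

Lemma bdD c d : bd (c + d) = bd c + bd d. Proof. exact: linD. Qed.
Lemma bd0 : bd 0 = 0. Proof. exact: lin0. Qed.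
Lemma bd_sg s : bd (sg s) = bdt s. Proof. exact: lin_sg. Qed.

Lemma bd_consc x c : bd (consc x c) = c + consc x (bd c).
Proof.
apply: (lin_ext (F := fun c => bd (consc x c)) (F' := fun c => c + consc x (bd c))).
- by move=> ? ?; rewrite conscD bdD.
- by move=> ? ?; rewrite bdD conscD addrACA.
- by move=> s _; rewrite consc_sg !bd_sg.
Qed.

Lemma bdbd c : bd (bd c) = 0.
Proof.
rewrite {2}/bd /bd lin_lin lin_eq0 // => s _; elim: s => [|x s IH] /=; first exact: lin0.
rewrite -[lin bdt _]/(bd _) bdD bd_sg bd_consc -[bd (bdt s)]/(lin bdt _) IH.
by rewrite consc0 addr0 addcc.
Qed.

Lemma coef_bdt s u : coef (bdt s) u -> {subset u <= s} /\ size s = (size u).+1.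
Proof.
elim: s u => [|x s IH] u /=; first by rewrite coef0.
rewrite coefD coef_sg; case: eqP => [->|_] /=; last first.
  move=> /coef_consc[v /IH[vs sz] ->]; split; last by rewrite sz.
  by move=> y; rewrite !inE => /orP[->|/vs->]; rewrite ?orbT.
by move=> _; split=> // y ys; rewrite inE ys orbT.
Qed.

Lemma coef_bd c u : coef (bd c) u ->
  exists2 s, coef c s & {subset u <= s} /\ size s = (size u).+1.
Proof. by move=> /coef_linP[s cs /coef_bdt]; exists s. Qed.

(** [rem] deletes the first occurrence of an entry, which for a repeated entry need not be the given
    position; the two results are permutations of each other, and a symmetric cochain does not
    separate them. *)
Lemma pair_bdt_perm (phi : pred (seq P)) s :
    (forall u v, perm_eq u v -> phi u = phi v) ->
  pair phi (bdt s) = odd (count (fun x => phi (rem x s)) s).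
Proof.
elim: s phi => [|x s IH] phi hphi /=; first by rewrite pair0.
rewrite pairD pair_sg eqxx oddD oddb; congr (_ (+) _).
rewrite /consc pair_lin.
have -> : pair (fun s0 => pair phi (sg (x :: s0))) (bdt s)
        = pair (fun s0 => phi (x :: s0)) (bdt s).
  by apply: eq_pair => u _; rewrite pair_sg.
rewrite IH; last by move=> u v uv; apply: hphi; rewrite perm_cons.
congr odd; apply: eq_in_count => y ys /=; apply: hphi.
by case: eqP => // ->; rewrite perm_sym perm_to_rem.
Qed.

Definition sized n c := forall s, coef c s -> size s = n.

Lemma sizedD n c d : sized n c -> sized n d -> sized n (c + d).
Proof. by move=> hc hd s /coefD_or[/hc|/hd]. Qed.

Lemma sized_bd n c : sized n.+1 c -> sized n (bd c).
Proof. by move=> hc s /coef_bd[u /hc su [_ e]]; move: e; rewrite su => -[]. Qed.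

End Tuples.

(** * Induced maps and prism homotopies *)

Section Push.
Variables (P Q : choiceType).
Implicit Types (s : seq P) (c d : chain (seq P)) (f g : P -> Q).

Definition push f c : chain (seq Q) := lin (fun s => sg (map f s)) c.

Lemma pushD f c d : push f (c + d) = push f c + push f d. Proof. exact: linD. Qed.
Lemma push0 f : push f 0 = 0. Proof. exact: lin0. Qed.
Lemma push_sg f s : push f (sg s) = sg (map f s). Proof. exact: lin_sg. Qed.
Lemma coef_push f c u : coef (push f c) u -> exists2 s, coef c s & u = map f s.
Proof. by move=> /coef_linP[s cs]; rewrite coef_sg => /eqP ->; exists s. Qed.

Lemma eq_push f g c : (forall s, coef c s -> {in s, f =1 g}) -> push f c = push g c.
Proof. by move=> h; apply: eq_lin => s cs; congr sg; apply/eq_in_map; apply: h. Qed.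

Lemma push_consc f x c : push f (consc x c) = consc (f x) (push f c).
Proof.
apply: (lin_ext (F := fun c => push f (consc x c)) (F' := fun c => consc (f x) (push f c))).
- by move=> ? ?; rewrite conscD pushD.
- by move=> ? ?; rewrite pushD conscD.
- by move=> s _; rewrite consc_sg !push_sg consc_sg.
Qed.

Lemma push_bdt f s : push f (bdt s) = bdt (map f s).
Proof. by elim: s => [|x s IH] /=; rewrite ?push0// pushD push_sg push_consc IH. Qed.

Lemma push_bd f c : push f (bd c) = bd (push f c).
Proof.
rewrite /push /bd !lin_lin; apply: eq_lin => s _.
by rewrite lin_sg -[LHS]/(push f (bdt s)) push_bdt.
Qed.

Lemma sized_push n f c : sized n c -> sized n (push f c).
Proof. by move=> hc u /coef_push[s /hc <- ->]; rewrite size_map. Qed.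

(** The prism over a tuple is the sum of the tuples [f x0, ..., f xi, g xi, ..., g xk], the usual
    triangulation of a product with an interval. *)
Fixpoint prismt f g s : chain (seq Q) :=
  if s is x :: s' then sg (f x :: g x :: map g s') + consc (f x) (prismt f g s') else 0.

Definition prism f g c := lin (prismt f g) c.

Lemma prismD f g c d : prism f g (c + d) = prism f g c + prism f g d.
Proof. exact: linD. Qed.
Lemma prism0 f g : prism f g 0 = 0. Proof. exact: lin0. Qed.
Lemma prism_sg f g s : prism f g (sg s) = prismt f g s. Proof. exact: lin_sg. Qed.

Lemma prism_consc f g x c :
  prism f g (consc x c) = consc (f x) (consc (g x) (push g c)) + consc (f x) (prism f g c).
Proof.
apply: (lin_ext (F := fun c => prism f g (consc x c))
  (F' := fun c => consc (f x) (consc (g x) (push g c)) + consc (f x) (prism f g c))).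
- by move=> ? ?; rewrite conscD prismD.
- by move=> ? ?; rewrite pushD prismD !conscD addrACA.
- by move=> s _; rewrite consc_sg !push_sg !consc_sg !prism_sg.
Qed.

Lemma prismP f g c : bd (prism f g c) + prism f g (bd c) = push f c + push g c.
Proof.
apply: (lin_ext (F := fun c => bd (prism f g c) + prism f g (bd c))
  (F' := fun c => push f c + push g c)).
- by move=> ? ?; rewrite !(prismD, bdD) addrACA.
- by move=> ? ?; rewrite !pushD addrACA.
move=> s _; rewrite prism_sg bd_sg !push_sg; elim: s => [|x s IH] /=.
  by rewrite bd0 prism0 !addcc.
rewrite bdD bd_sg bd_consc /= prismD prism_sg prism_consc push_bdt !conscD consc_sg.
set a := sg (g x :: _); set b := sg (f x :: map g s).
set e := consc _ (consc _ _); set p := prismt f g s.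
have -> : consc (f x) (prism f g (bdt s)) =
  sg (f x :: map f s) + b + consc (f x) (bd p).
  rewrite -(addcK (consc (f x) (prism f g (bdt s))) (consc (f x) (bd p))).
  by rewrite -conscD [prism _ _ _ + _]addrC IH conscD !consc_sg.
set h := consc _ (bd p); set k := sg (f x :: _).
apply: chainP => y; rewrite !coefD.
by do 7! case: (coef _ y).
Qed.

Lemma coef_prismt f g s u : coef (prismt f g s) u ->
  {subset u <= map f s ++ map g s} /\ size u = (size s).+1.
Proof.
elim: s u => [|x s IH] u /=; first by rewrite coef0.
rewrite coefD coef_sg; case: eqP => [->|_] /=; last first.
  move=> /coef_consc[v /IH[vs sz] ->]; split; last by rewrite /= sz.
  move=> y; rewrite !inE => /orP[->//|/vs].
  by rewrite !mem_cat !inE => /orP[->|->]; rewrite ?orbT.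
move=> _; split; last by rewrite /= size_map.
move=> y; rewrite !inE mem_cat inE.
by move=> /or3P[->//|->|->]; rewrite ?orbT.
Qed.

Lemma coef_prism f g c u : coef (prism f g c) u ->
  exists2 s, coef c s & {subset u <= map f s ++ map g s} /\ size u = (size s).+1.
Proof. by move=> /coef_linP[s cs /coef_prismt]; exists s. Qed.

Lemma sized_prism n f g c : sized n c -> sized n.+1 (prism f g c).
Proof. by move=> hc u /coef_prism[s /hc <- []]. Qed.

End Push.

Lemma push_push (P Q U : choiceType) (f : P -> Q) (g : Q -> U) c :
  push g (push f c) = push (g \o f) c.
Proof. by rewrite /push lin_lin; apply: eq_lin => s _; rewrite lin_sg map_comp. Qed.

Lemma push_id (P : choiceType) (f : P -> P) (c : chain (seq P)) :
  (forall s, coef c s -> {in s, f =1 id}) -> push f c = c.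
Proof. by move=> h; rewrite (eq_push h) -[RHS]lin_id; apply: eq_lin => s _; rewrite map_id. Qed.

Lemma push_prismt (P Q U : choiceType) (f g : P -> Q) (h : Q -> U) s :
  push h (prismt f g s) = prismt (h \o f) (h \o g) s.
Proof. by elim: s => [|x s IH] /=; rewrite ?push0// pushD push_sg push_consc IH /= map_comp. Qed.

Lemma push_prism (P Q U : choiceType) (f g : P -> Q) (h : Q -> U) c :
  push h (prism f g c) = prism (h \o f) (h \o g) c.
Proof.
by rewrite /push /prism lin_lin; apply: eq_lin => s _; rewrite -[LHS]/(push h _) push_prismt.
Qed.

Lemma prismt_push (P Q U : choiceType) (f g : Q -> U) (h : P -> Q) s :
  prismt f g (map h s) = prismt (f \o h) (g \o h) s.
Proof. by elim: s => [|x s IH] //=; rewrite IH -map_comp. Qed.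

Lemma prism_push (P Q U : choiceType) (f g : Q -> U) (h : P -> Q) c :
  prism f g (push h c) = prism (f \o h) (g \o h) c.
Proof. by rewrite /push /prism lin_lin; apply: eq_lin => s _; rewrite lin_sg prismt_push. Qed.

Section Steps.
Variables (P Q : choiceType) (F : nat -> P -> Q).
Implicit Types c d : chain (seq P).

(** One prism per time step joins [F 0] to [F N]. Its tuples mix two consecutive times only, so they
    stay small when the steps are short. *)
Fixpoint steps N c : chain (seq Q) :=
  if N is N'.+1 then steps N' c + prism (F N') (F N) c else 0.

Lemma stepsD N c d : steps N (c + d) = steps N c + steps N d.
Proof. by elim: N => [|N IH] /=; rewrite ?addr0// IH prismD addrACA. Qed.

Lemma steps0 N : steps N 0 = 0.
Proof. by elim: N => //= N ->; rewrite prism0 addr0. Qed.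

Lemma stepsP N c : bd (steps N c) + steps N (bd c) = push (F 0%N) c + push (F N) c.
Proof.
elim: N => [|N IH] /=; first by rewrite bd0 addr0 addcc.
by rewrite bdD addrACA IH prismP addrA addcK.
Qed.

Lemma coef_steps N c u : coef (steps N c) u -> exists s i,
  [/\ coef c s, (i < N)%N, {subset u <= map (F i) s ++ map (F i.+1) s}
    & size u = (size s).+1].
Proof.
elim: N => [|N IH] /=; first by rewrite coef0.
move=> /coefD_or[/IH[s [i [cs iN us sz]]]|].
  by exists s, i; split=> //; apply: ltnW.
by move=> /coef_prism[s cs [us sz]]; exists s, N.
Qed.

Lemma sized_steps n N c : sized n c -> sized n.+1 (steps N c).
Proof. by move=> hc u /coef_steps[s [i [/hc <- _ _ ->]]]. Qed.

End Steps.

(** * Carriers and Fan's lemma *)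

Section FreeInvolution.
Variables (S : choiceType) (t : S -> S).
Hypothesis tK : involutive t.

(** The predicate is the same for [x] and [t x], and [choose] then returns the same point: this
    singles out one point in each orbit. *)
Definition rep x := choose (pred2 x (t x)) x.

Lemma rep_t x : rep (t x) = rep x.
Proof.
rewrite /rep tK (@eq_choose _ (pred2 (t x) x) (pred2 x (t x))).
  by apply: choose_id; rewrite /= eqxx ?orbT.
by move=> y /=; rewrite orbC.
Qed.

Lemma repP x : rep x = x \/ rep x = t x.
Proof.
have /orP[/eqP|/eqP] : pred2 x (t x) (rep x) by apply: chooseP; rewrite /= eqxx.
  by left.
by right.
Qed.

Definition tpush (c : chain S) := lin (fun s => sg (t s)) c.

Lemma coef_tpush c x : coef (tpush c) x = coef c (t x).
Proof.
rewrite /tpush coef_lin -[in RHS](lin_id c) coef_lin; apply: eq_pair => y _.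
by rewrite !coef_sg -(inj_eq (inv_inj tK)) tK eq_sym [RHS]eq_sym.
Qed.

(** In a free orbit exactly one simplex is its own representative; these simplices form the half
    [e]. Towers are obtained by repeating this on boundaries. *)
Lemma invariant_half (c : chain S) :
    (forall x, coef c x -> t x != x) -> tpush c = c ->
  exists2 e : chain S, c = e + tpush e & forall x, coef e x -> coef c x.
Proof.
move=> fr ct; exists (cfilter (fun x => rep x == x) c); last first.
  by move=> x; rewrite coef_filter => /andP[].
apply: chainP => x; rewrite coefD coef_tpush !coef_filter rep_t -coef_tpush ct.
case cx : (coef c x) => //=; have := fr _ cx.
by case: (repP x) => -> h; rewrite ?eqxx ?(negPf h) // eq_sym (negPf h).
Qed.

End FreeInvolution.

Section Carrier.
Variables (S Q : choiceType) (dS : S -> chain S) (Dom : S -> Prop) (sz : S -> nat).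
Variables (tS : S -> S) (tQ : Q -> Q) (Good : S -> chain (seq Q) -> Prop) (n : nat).
Hypothesis Dom_face : forall s u, Dom s -> coef (dS s) u -> Dom u /\ sz s = (sz u).+1.
Hypothesis ddS : forall s, Dom s -> lin dS (dS s) = 0.
Hypothesis tSK : involutive tS.
Hypothesis Dom_t : forall s, Dom s -> Dom (tS s).
Hypothesis sz_t : forall s, sz (tS s) = sz s.
Hypothesis dS_t : forall s, Dom s -> dS (tS s) = tpush tS (dS s).
Hypothesis free : forall s, Dom s -> (0 < sz s)%N -> tS s != s.
Hypothesis tQK : involutive tQ.
Hypothesis Good_t : forall s c, Dom s -> Good s c -> Good (tS s) (push tQ c).
Hypothesis base : forall s, Dom s -> sz s = 0%N -> Good s (sg [::]).
Hypothesis fill : forall s (th : S -> chain (seq Q)), Dom s -> (0 < sz s <= n)%N ->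
  (forall u, coef (dS s) u -> Good u (th u)) -> bd (lin th (dS s)) = 0 ->
  exists2 c, Good s c & bd c = lin th (dS s).

Definition carried (th : S -> chain (seq Q)) s :=
  [/\ Good s (th s), bd (th s) = lin th (dS s), th (tS s) = push tQ (th s)
    & sz s = 0%N -> th s = sg [::]].

Let pushQK c : push tQ (push tQ c) = c.
Proof. by rewrite push_push push_id // => s _ x _ /=; rewrite tQK. Qed.

(** The map is built by induction on size. In each orbit the boundary of one representative is
    filled, and the other simplex receives the image under [tQ]; freeness makes this consistent.
    Size counts vertices, and the empty simplex goes to the empty tuple, so the map preserves the
    augmentation. The carrier [Good] can restrict the support as well as the mesh of the values. *)
Lemma acyclic_carrier : exists th, forall s, Dom s -> (sz s <= n)%N -> carried th s.
Proof.
suff : forall k, (k <= n)%N ->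
    exists th, forall s, Dom s -> (sz s <= k)%N -> carried th s by apply.
elim=> [_|k IH kn].
  exists (fun=> sg [::]) => s Ds; rewrite leqn0 => /eqP s0.
  have d0 : dS s = 0.
    apply: chainP => u; rewrite coef0; apply/negbTE/negP => /(Dom_face Ds)[_].
    by rewrite s0.
  by split=> //; [exact: base|rewrite d0 lin0 bd_sg|rewrite push_sg].
have [th thP] := IH (ltnW kn).
have fc s : exists c, Dom s -> sz s = k.+1 -> Good s c /\ bd c = lin th (dS s).
  have [[Ds ss]|h] := pselect (Dom s /\ sz s = k.+1); last first.
    by exists 0 => Ds ss; case: h.
  have [] := @fill s th Ds; first by rewrite ss kn.
  - move=> u us; have [Du] := Dom_face Ds us; rewrite ss => -[su].
    by have [] := thP u Du; rewrite ?su.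
  - rewrite {1}/bd lin_lin; under eq_lin do over.
    rewrite (@eq_lin _ _ _ (fun u => lin th (dS u))); last first.
      move=> u us; have [Du] := Dom_face Ds us; rewrite ss => -[su].
      by have [] := thP u Du; rewrite ?su.
    by rewrite -lin_lin ddS // lin0.
  by move=> c Gc bc; exists c.
have [fl flP] := choice fc.
pose th' s := if sz s == k.+1 then
   (if rep tS s == s then fl s else push tQ (fl (tS s))) else th s.
have th'E s : Dom s -> (sz s <= k)%N -> th' s = th s.
  by move=> _ sk; rewrite /th'; case: eqP => // e; move: sk; rewrite e ltnn.
exists th' => s Ds; rewrite leq_eqVlt => /orP[/eqP ss|]; last first.
  rewrite ltnS => sk; have [h1 h2 h3 h4] := thP s Ds sk.
  have e1 : th' s = th s by apply: th'E.
  have e2 : th' (tS s) = th (tS s) by apply: th'E; [exact: (Dom_t Ds)|rewrite sz_t].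
  split; rewrite ?e1 ?e2 //.
  rewrite h2; apply: eq_lin => u us; have [Du su] := Dom_face Ds us.
  by rewrite th'E // -ltnS -su (leq_trans sk).
have lE : lin th' (dS s) = lin th (dS s).
  apply: eq_lin => u us; have [Du] := Dom_face Ds us; rewrite ss => -[su].
  by rewrite th'E // su.
have [Gs bs] := flP _ Ds ss.
have [Gt bt] := flP _ (Dom_t Ds) (etrans (sz_t s) ss).
have nt : tS s != s by apply: free => //; rewrite ss.
have th's : th' s = if rep tS s == s then fl s else push tQ (fl (tS s)).
  by rewrite /th' ss eqxx.
have th't : th' (tS s) = if rep tS s == s then push tQ (fl s) else fl (tS s).
  rewrite /th' sz_t ss eqxx rep_t // tSK.
  by case: (repP tS s) => ->; rewrite eqxx // ?(negPf nt) // eq_sym (negPf nt).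
split; last by rewrite ss.
- by rewrite th's; case: eqP => // _; have := Good_t (Dom_t Ds) Gt; rewrite tSK.
- rewrite lE th's; case: eqP => // _; rewrite -push_bd bt dS_t //.
  rewrite /tpush lin_lin /push lin_lin; apply: eq_lin => u us.
  rewrite lin_sg; have [Du] := Dom_face Ds us; rewrite ss => -[su].
  have uk : (sz u <= k)%N by rewrite su.
  have [_ _ -> _] := thP u Du uk.
  exact: pushQK.
- by rewrite th't th's; case: eqP => // _; rewrite pushQK.
Qed.

End Carrier.

(** * Alternating labels *)

Section Fan.

Fixpoint alt e (b : seq bool) := if b is x :: b' then (x == e) && alt (~~ e) b' else true.

(* The labels [2 i] and [2 i + 1] are the two antipodal vertices of the
   cross-polytope on the [i]-th axis. *)
Definition alpha e (l : seq nat) := alt e (map odd (sort leq l)).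

Definition flip x := if odd x then x.-1 else x.+1.

Definition nonantipodal (l : seq nat) :=
  forall x y, x \in l -> y \in l -> x./2 = y./2 -> x = y.

Lemma coef_bdt_subseq (T : choiceType) (s u : seq T) : coef (bdt s) u -> subseq u s.
Proof.
elim: s u => [|x s IH] u; rewrite [bdt _]/=; first by rewrite coef0.
move=> /coefD_or[|/coef_consc[v /IH vs ->]]; last by rewrite /= eqxx.
by rewrite coef_sg => /eqP->; apply: subseq_cons.
Qed.

(** In a sorted tuple that alternates from [e], only deleting the last entry leaves one alternating
    from [e]; in one that alternates from the other sign, only deleting the first entry does. In all
    other tuples such deletions come in pairs, at two neighbours of equal sign. This count is the
    core of Fan's lemma. *)
Lemma alpha_bdt e (l : seq nat) : pair (alpha e) (bdt l) = alpha e l (+) alpha (~~ e) l.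
Proof.
have aP e' u v : perm_eq u v -> alpha e' u = alpha e' v.
  by move=> /perm_sortP h; rewrite /alpha h //; [exact: leq_total|exact: leq_trans|exact: anti_leq].
(* Both sides depend on the labels up to order only, so the tuple may be sorted. *)
have -> : pair (alpha e) (bdt l) = pair (alpha e) (bdt (sort leq l)).
  rewrite !pair_bdt_perm //; try exact: aP.
  have ls : perm_eq l (sort leq l) by rewrite perm_sym perm_sort.
  rewrite (permP ls); congr odd; apply: eq_in_count => x xl.
  apply: aP; rewrite -(perm_cons x) -(permPl (perm_to_rem _)) ?(perm_mem ls) //.
  by rewrite (permPl ls) perm_to_rem.
have ss : sorted leq (sort leq l) by apply: sort_sorted; exact: leq_total.
rewrite /alpha; move: (sort leq l) ss => {}l ss.
rewrite (@eq_pair _ _ (fun u => alt e (map odd u))); last first.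
  move=> u /coef_bdt_subseq ul; congr (alt e (map odd _)).
  by apply: sorted_sort; [exact: leq_trans|apply: subseq_sorted ul ss; exact: leq_trans].
elim: l e {ss} => [|x l IH] e /=; first by rewrite pair0.
rewrite pairD pair_sg /consc pair_lin.
rewrite (@eq_pair _ _ (fun u => (odd x == e) && alt (~~ e) (map odd u))); last first.
  by move=> u _; rewrite pair_sg.
have [xe|xe] := eqVneq (odd x) e; last first.
  rewrite (@eq_pair _ _ (fun=> false)) // pair_eq0 //.
  by have -> : (odd x == ~~ e); [by case: (odd x) e xe => -[]|rewrite negbK addbF].
rewrite (@eq_pair _ _ (fun u => alt (~~ e) (map odd u))) ; last first.
  by move=> u _ /=; rewrite ?xe ?eqxx.
rewrite IH negbK ?xe ?eqxx /=; have -> : (e == ~~ e) = false by case: (e).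
by case: (alt e _); case: (alt (~~ e) _).
Qed.

(** Alternation forbids equal labels and, without antipodal pairs, forces the axes to increase
    strictly; there are only [n] axes. *)
Lemma alpha_top n e l : nonantipodal l -> (forall x, x \in l -> (x./2 < n)%N) ->
  (n < size l)%N -> alpha e l = false.
Proof.
move=> na ln sl; apply/negP; rewrite /alpha => h.
suff : (size l <= n)%N by rewrite leqNgt sl.
have ls : perm_eq l (sort leq l) by rewrite perm_sym perm_sort.
rewrite (perm_size ls).
have ss : sorted leq (sort leq l) by apply: sort_sorted; exact: leq_total.
have na' : nonantipodal (sort leq l) by move=> x y; rewrite !mem_sort; exact: na.
have ln' x : x \in sort leq l -> (x./2 < n)%N by rewrite mem_sort; exact: ln.
move: (sort leq l) h ss na' ln' => {ls sl ln na}l h ss na ln.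
have so : sorted ltn (map half l).
  elim: l e h ss na {ln} => //= x [|y l] IH e //= /andP[/eqP ox /andP[/eqP oy al]].
  move=> /andP[xy sl] na; apply/andP; split; last first.
    apply: (IH (~~ e)) => //; first by rewrite /= oy eqxx.
    by move=> a b ha hb; apply: na; rewrite inE ?ha ?hb orbT.
  rewrite ltn_neqAle half_leq // andbT; apply/eqP => hxy.
  have exy : x = y by apply: na => //; rewrite !inE eqxx ?orbT.
  by move: ox; rewrite exy oy; case: (e).
rewrite -(size_map half) -(size_iota 0 n); apply: uniq_leq_size.
  by apply: sorted_uniq so; [exact: ltn_trans|exact: ltnn].
by move=> _ /mapP[x xl ->]; rewrite mem_iota /= add0n; exact: ln.
Qed.

Lemma flipE (b : bool) k : flip (b + k.*2) = (~~ b + k.*2)%N.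
Proof. by rewrite /flip oddD odd_double addbF; case: b. Qed.

Lemma odd_flip x : odd (flip x) = ~~ odd x.
Proof. by rewrite -{1}[x]odd_double_half flipE oddD odd_double addbF oddb. Qed.

Lemma half_flip x : (flip x)./2 = x./2.
Proof. by rewrite -{1}[x]odd_double_half flipE half_bit_double. Qed.

Lemma alpha_flip e l : nonantipodal l -> alpha e (map flip l) = alpha (~~ e) l.
Proof.
move=> na; rewrite /alpha.
have -> : sort leq (map flip l) = map flip (sort leq l).
  have ss : sorted leq (sort leq l) by apply: sort_sorted; exact: leq_total.
  apply: (sorted_eq leq_trans anti_leq).
  - by apply: sort_sorted; exact: leq_total.
  - have na' : nonantipodal (sort leq l) by move=> x y; rewrite !mem_sort; exact: na.
    move: (sort leq l) ss na' => {na}; elim=> //= x [|y l'] IH //= /andP[xy sl] na.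
    have /= -> := IH sl; last by move=> a b ha hb; apply: na; rewrite inE ?ha ?hb orbT.
    rewrite andbT; have [hxy|hxy] := eqVneq x./2 y./2.
      by rewrite (na x y) // !inE eqxx ?orbT.
    rewrite leqNgt; apply/negP => /ltnW /half_leq; rewrite !half_flip => yx.
    by move: hxy; rewrite eqn_leq yx half_leq.
  - by rewrite perm_sort perm_map // perm_sym perm_sort.
elim: (sort leq l) e => //= x l' IH e; rewrite IH odd_flip; congr (_ && _).
by case: (odd x) (e) => -[].
Qed.

End Fan.

(** * Homology of a shell *)

Section Small.
Variables (R : realType) (P Q : choiceType).
Implicit Types (u : P -> P -> R).

Definition small (T : choiceType) (u : T -> T -> R) e (s : seq T) :=
  forall p q, p \in s -> q \in s -> u p q < e.

Definition allc (T : choiceType) (A : T -> Prop) (c : chain T) := forall s, coef c s -> A s.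

Lemma allcD (T : choiceType) (A : T -> Prop) c d : allc A c -> allc A d -> allc A (c + d).
Proof. by move=> hc hd s /coefD_or[/hc|/hd]. Qed.

Lemma allc_sg (T : choiceType) (A : T -> Prop) s : A s -> allc A (sg s).
Proof. by move=> h x; rewrite coef_sg => /eqP->. Qed.

Lemma allc0 (T : choiceType) (A : T -> Prop) : allc A 0.
Proof. by move=> x; rewrite coef0. Qed.

Lemma small_sub u e s s' : {subset s' <= s} -> small u e s -> small u e s'.
Proof. by move=> ss h p q /ss ps /ss qs; exact: h. Qed.

Lemma allc_bd (A : seq P -> Prop) c :
  (forall s s', {subset s' <= s} -> A s -> A s') -> allc A c -> allc A (bd c).
Proof. by move=> sub hc s /coef_bd[v /hc Av [vs _]]; exact: sub vs Av. Qed.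

(** Finitely many strict inequalities leave a common margin, which a later homotopy can spend. *)
Lemma small_gap u e (c : chain (seq P)) : allc (small u e) c ->
  exists2 eta : R, 0 < eta & allc (small u (e - eta)) c.
Proof.
move=> hc.
have gap (T : eqType) (f : T -> R) (l : seq T) : (forall x, x \in l -> f x < e) ->
    exists2 eta : R, 0 < eta & forall x, x \in l -> f x < e - eta.
  elim: l => [|x l IH] h; first by exists 1.
  have [|eta e0 he] := IH; first by move=> y yl; apply: h; rewrite inE yl orbT.
  have hx : f x < e by apply: h; rewrite inE eqxx.
  exists (Num.min eta ((e - f x) / 2)); first by rewrite lt_min e0 /= divr_gt0 // subr_gt0.
  have m1 := ge_min eta eta ((e - f x) / 2); have m2 := ge_min ((e - f x) / 2) eta ((e - f x) / 2).
  move: m1 m2; rewrite !lexx orbT => /= m1 m2.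
  move=> y; rewrite inE => /orP[/eqP->|/he]; lra.
have [|eta e0 he] := gap _ (fun x => u x.1 x.2)
    (flatten [seq [seq (p, q) | p <- s, q <- s] | s <- enum_fset c]).
  move=> x /flatten_mapP[s sc /allpairsP[[p q] /= [ps qs ->]]] /=.
  exact: (hc s).
exists eta => // s cs p q ps qs.
apply: (he (p, q)); apply/flatten_mapP; exists s => //.
by apply/allpairsP; exists (p, q).
Qed.

Lemma steps_small (u : Q -> Q -> R) (F : R -> P -> Q) e eta N (c : chain (seq P)) :
    (0 < N)%N -> N%:R^-1 < eta ->
    (forall s p q a b, coef c s -> p \in s -> q \in s -> 0 <= a <= 1 -> 0 <= b <= 1 ->
      `|a - b| < eta -> u (F a p) (F b q) < e) ->
  allc (fun t => small u e t /\ exists2 s, coef c s &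
      forall x, x \in t -> exists a p, [/\ 0 <= a <= 1, p \in s & x = F a p])
    (steps (fun i => F (i%:R / N%:R)) N c).
Proof.
move=> N0 Ne h t /coef_steps[s [i [cs iN ts _]]].
have N0' : 0 < N%:R :> R by rewrite ltr0n.
have iv k : (k <= N)%N -> 0 <= (k%:R / N%:R : R) <= 1.
  by move=> kN; rewrite divr_ge0 ?ler0n// ler_pdivrMr // mul1r ler_nat.
have d x : x \in t -> exists (k : nat) p,
    [/\ (k == i) || (k == i.+1), p \in s & x = F (k%:R / N%:R) p].
  move=> /ts; rewrite mem_cat => /orP[] /mapP[p ps ->].
    by exists i, p; rewrite eqxx.
  by exists i.+1, p; rewrite eqxx orbT.
split; last first.
  exists s => // x /d[k [p [ki ps ->]]]; exists (k%:R / N%:R), p; split=> //.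
  by apply: iv; case/orP: ki => /eqP-> //; apply: ltnW.
move=> x y /d[k [p [ki ps ->]]] /d[l [q [li qs ->]]].
have kN : (k <= N)%N by case/orP: ki => /eqP-> //; apply: ltnW.
have lN : (l <= N)%N by case/orP: li => /eqP-> //; apply: ltnW.
apply: (h s) => //; try exact: iv.
apply: le_lt_trans Ne; rewrite -mulrBl normrM normfV (ger0_norm (ltW N0')).
rewrite ler_piMl ?invr_ge0 ?(ltW N0') //.
have A : `|i.+1%:R - i%:R : R| = 1 by rewrite -natr1 addrAC subrr add0r normr1.
case/orP: ki => /eqP->; case/orP: li => /eqP->; rewrite ?subrr ?normr0 ?A ?ler01 //.
by rewrite distrC A.
Qed.

Lemma inv_nat_lt (eta : R) : 0 < eta -> exists2 N, (0 < N)%N & N%:R^-1 < eta.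
Proof.
move=> e0; exists (Num.truncn eta^-1).+1 => //.
rewrite invf_plt ?posrE ?ltr0n//; exact: truncnS_gt.
Qed.

(** The time interval is cut into steps shorter than [eta]; each tuple of the homotopy then involves
    points of one simplex of [c] at two times closer than [eta]. *)
Lemma homotopy_small (u : Q -> Q -> R) (F : R -> P -> Q) e eta (c : chain (seq P)) j :
    0 < eta -> sized j c -> bd c = 0 ->
    (forall s p q a b, coef c s -> p \in s -> q \in s -> 0 <= a <= 1 -> 0 <= b <= 1 ->
      `|a - b| < eta -> u (F a p) (F b q) < e) ->
  exists b, [/\ sized j.+1 b, bd b = push (F 0) c + push (F 1) c &
    allc (fun t => small u e t /\ exists2 s, coef c s &
      forall x, x \in t -> exists a p, [/\ 0 <= a <= 1, p \in s & x = F a p]) b].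
Proof.
move=> e0 sc bc h; have [N N0 Ne] := inv_nat_lt e0.
exists (steps (fun i => F (i%:R / N%:R)) N c); split; first exact: sized_steps.
  have := stepsP (fun i => F (i%:R / N%:R)) N c.
  by rewrite bc steps0 addr0 mul0r divff // pnatr_eq0 -lt0n.
exact: steps_small h.
Qed.

End Small.

Lemma sized0_chain (T : choiceType) (c : chain (seq T)) : sized 0 c -> c = 0 \/ c = sg [::].
Proof.
move=> sc; case h : (coef c [::]); [right|left]; apply: chainP => s.
  rewrite coef_sg; case: eqP => [->//|sn]; apply/negbTE/negP => /sc /size0nil.
  exact: sn.
by rewrite coef0; apply/negbTE/negP => cs; move: (sc _ cs) h => /size0nil <-; rewrite cs.
Qed.

(** * The region between two cubes as a sphere *)

Section Shell.
Variables (R : realType) (N : nat) (r rho e : R).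
Hypotheses (e0 : 0 < e) (er : e <= r) (rrho : r <= rho).
Implicit Types (p q : 'rV[R]_N) (c : chain (seq 'rV[R]_N)).

Definition vd p q : R := \big[Num.max/0]_i `|p 0 i - q 0 i|.

Lemma vd_lt x p q : 0 < x -> vd p q < x <-> forall i, `|p 0 i - q 0 i| < x.
Proof.
move=> x0; split=> [/bigmax_ltP[_ h] i|h]; first exact: h.
by apply/bigmax_ltP; split.
Qed.

(** Points of the first [n] coordinates with maximum norm between [r] and [rho]: up to homotopy, a
    sphere of dimension [n-1]. The ambient [N] is fixed so that the induction on [n] stays in one
    type. *)
Definition shell n p :=
  [/\ forall i : 'I_N, (n <= i)%N -> p 0 i = 0, forall i, `|p 0 i| <= rho
    & exists2 i : 'I_N, (i < n)%N & r <= `|p 0 i|].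

Definition inshell n c := allc (fun s => small vd e s /\ forall p, p \in s -> shell n p) c.

Definition bounded n j c := exists b, [/\ sized j.+1 b, inshell n b & bd b = c].

Lemma inshellD n c d : inshell n c -> inshell n d -> inshell n (c + d).
Proof. exact: allcD. Qed.

Lemma boundedD n j c d : bounded n j c -> bounded n j d -> bounded n j (c + d).
Proof.
move=> [b [s1 i1 b1]] [b' [s2 i2 b2]]; exists (b + b').
by split; [exact: sizedD|exact: inshellD|rewrite bdD b1 b2].
Qed.

Let r0 : 0 < r. Proof. exact: lt_le_trans e0 er. Qed.

Definition upd (k : 'I_N) v p : 'rV[R]_N := \row_i if i == k then v else p 0 i.

Lemma lineE a p q i : ((1 - a) *: p + a *: q) 0 i = (1 - a) * p 0 i + a * q 0 i.
Proof. by rewrite !mxE. Qed.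

(** The cycle avoids one polar cap. A homotopy raises the [k]-th coordinate, taken with the sign
    [sigma], to at least [r]; a second one moves all points straight to the pole of height [r]; a
    cone closes up. *)
Lemma half_space (k : 'I_N) (sigma : R) j c : sigma = 1 \/ sigma = -1 ->
    sized j c -> inshell k.+1 c -> bd c = 0 ->
    (forall s p, coef c s -> p \in s -> - r < sigma * p 0 k) -> bounded k.+1 j c.
Proof.
move=> sg1 sc ic bc hk.
have ss : sigma * sigma = 1 by case: sg1 => ->; rewrite ?mulr1 ?mulrNN ?mulr1.
have ns : `|sigma| = 1 by case: sg1 => ->; rewrite ?normrN normr1.
have pkE p : `|p 0 k| = `|sigma * p 0 k| by rewrite normrM ns mul1r.
have rho0 : 0 < rho by apply: lt_le_trans rrho.
have [eta eta0 he] : exists2 eta : R, 0 < eta & allc (small vd (e - eta)) c.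
  by apply: small_gap => s /ic[].
have small_pos s p q : coef c s -> p \in s -> q \in s -> forall i, `|p 0 i - q 0 i| < e - eta.
  move=> cs ps qs; apply/vd_lt; last exact: (he s).
  by apply: le_lt_trans (he s cs p q ps qs); exact: bigmax_ge_id.
(* The threshold runs from [- r], where it has no effect, to [r]. A point whose only large
   coordinate is the [k]-th one has it positive already, so no point falls into the hole. *)
pose F a p := upd k (sigma * Num.max (sigma * p 0 k) ((2 * a - 1) * r)) p.
have [||b1 [sb1 bb1 ib1]] := @homotopy_small R _ _ vd F e (eta / (2 * r)) c j _ sc bc.
- by rewrite divr_gt0 // mulr_gt0.
- move=> s p q a b cs ps qs _ _; rewrite ltr_pdivlMr ?mulr_gt0// => ab.
  apply/(vd_lt _ _ e0) => i; rewrite !mxE; have pq := small_pos s p q cs ps qs.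
  case: eqP => [ik|_]; last by have := pq i; lra.
  rewrite -mulrBr normrM ns mul1r; have := pq k.
  have -> : `|p 0 k - q 0 k| = `|sigma * p 0 k - sigma * q 0 k|.
    by rewrite -mulrBr normrM ns mul1r.
  move: (sigma * p 0 k) (sigma * q 0 k) => x y.
  have : `|(2 * a - 1) * r - (2 * b - 1) * r| < eta.
    have -> : (2 * a - 1) * r - (2 * b - 1) * r = (a - b) * (2 * r) by ring.
    by rewrite normrM (gtr0_norm (mulr_gt0 _ r0)).
  move: ((2 * a - 1) * r) ((2 * b - 1) * r) => x' y'.
  rewrite !ltr_norml => /andP[? ?] /andP[? ?].
  by apply/andP; split; rewrite /Num.max; case: ifPn; case: ifPn; rewrite -?leNgt => *; lra.
have shF a p : shell k.+1 p -> -r < sigma * p 0 k -> 0 <= a <= 1 -> shell k.+1 (F a p).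
  move=> [h1 h2 [i ik hi]] pk /andP[a0 a1]; split.
  - move=> l kl; rewrite mxE; case: eqP => [e1|_]; last exact: h1.
    by move: kl; rewrite e1 ltnn.
  - move=> l; rewrite mxE; case: eqP => [_|_]; last exact: h2.
    rewrite normrM ns mul1r; have := h2 k; rewrite pkE.
    have : `|(2 * a - 1) * r| <= rho.
      have ar : 0 <= a * r by rewrite mulr_ge0 // ltW.
      have ar1 : a * r <= r by rewrite ler_piMl // ltW.
      have -> : (2 * a - 1) * r = a * r + a * r - r by ring.
      by have := rrho; rewrite ler_norml => ?; apply/andP; split; lra.
    move: (sigma * p 0 k) ((2 * a - 1) * r) => x y.
    rewrite !ler_norml => /andP[? ?] /andP[? ?].
    by apply/andP; split; rewrite /Num.max; case: ifPn; rewrite -?leNgt => *; lra.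
  - have [ik'|ik'] := eqVneq i k; last by exists i => //; rewrite mxE (negPf ik').
    exists k => //; rewrite mxE eqxx normrM ns mul1r.
    have : r <= sigma * p 0 k.
      by move: hi; rewrite ik' pkE ler_normr => /orP[//|]; lra.
    move=> rp; rewrite ler_normr; apply/orP; left.
    by rewrite /Num.max; case: ifPn; rewrite -?leNgt => *; lra.
have F0 : push (F 0) c = c.
  apply: push_id => s cs p ps; apply/rowP => i; rewrite !mxE; case: eqP => // ->.
  have := hk s p cs ps; rewrite mulr0 sub0r mulN1r => pk.
  by rewrite max_l ?(ltW pk)// mulrA ss mul1r.
pose c1 := push (F 1) c.
have sc1 : sized j c1 by apply: sized_push.
have bc1 : bd c1 = 0 by rewrite -push_bd bc push0.
pose top : 'rV[R]_N := upd k (sigma * r) 0.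
have topk : top 0 k = sigma * r by rewrite mxE eqxx.
have topn i : i != k -> top 0 i = 0 by move=> h; rewrite !mxE (negPf h).
have ltk (l : 'I_N) : (k < l)%N -> l != k by apply: contraTneq => ->; rewrite ltnn.
pose G a p := (1 - a) *: p + a *: top.
have c1P s p : coef c1 s -> p \in s -> shell k.+1 p /\ r <= sigma * p 0 k.
  move=> /coef_push[s' cs' ->] /mapP[p' ps' ->]; have [_ /(_ _ ps') shp] := ic _ cs'.
  split; first by apply: shF => //; [exact: (hk s')|rewrite ler01 lexx].
  rewrite mxE eqxx mulrA ss mul1r; rewrite le_max; apply/orP; right.
  by have -> : (2 * 1 - 1) * r = r by ring.
have [eta' eta'0 he'] : exists2 eta : R, 0 < eta & allc (small vd (e - eta)) c1.
  apply: small_gap => _ /coef_push[s cs ->] _ _ /mapP[p ps ->] /mapP[q qs ->].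
  apply/(vd_lt _ _ e0) => i; have pq := small_pos s p q cs ps qs; rewrite !mxE.
  case: eqP => [ik|_]; last by have := pq i; lra.
  rewrite -mulrBr normrM ns mul1r; have := pq k.
  have -> : `|p 0 k - q 0 k| = `|sigma * p 0 k - sigma * q 0 k|.
    by rewrite -mulrBr normrM ns mul1r.
  move: (sigma * p 0 k) (sigma * q 0 k) ((2 * 1 - 1) * r) => x y z.
  rewrite !ltr_norml => /andP[? ?].
  by apply/andP; split; rewrite /Num.max; case: ifPn; case: ifPn; rewrite -?leNgt => *; lra.
have topE : forall i, `|top 0 i| <= rho.
  move=> i; rewrite !mxE; case: eqP => _; last by rewrite normr0 ltW.
  by rewrite normrM ns mul1r gtr0_norm.
have [||b2 [sb2 bb2 ib2]] := @homotopy_small R _ _ vd G e (eta' / (2 * rho)) c1 j _ sc1 bc1.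
- by rewrite divr_gt0 // mulr_gt0.
- move=> s p q a b cs ps qs /andP[va0 va1] /andP[vb0 vb1]; rewrite ltr_pdivlMr ?mulr_gt0// => ab.
  have pq : forall i, `|p 0 i - q 0 i| < e - eta'.
    apply/vd_lt; last exact: (he' s).
    by apply: le_lt_trans (he' s cs p q ps qs); exact: bigmax_ge_id.
  apply/(vd_lt _ _ e0) => i; have := pq i; rewrite /G !lineE => pqi.
  have -> : (1 - a) * p 0 i + a * top 0 i - ((1 - b) * q 0 i + b * top 0 i) =
     (1 - a) * (p 0 i - q 0 i) + (a - b) * (top 0 i - q 0 i) by ring.
  have [[_ /(_ i) qi _] _] := c1P s q cs qs; have ti := topE i.
  apply: le_lt_trans (ler_normD _ _) _; rewrite !normrM.
  have t1 : `|top 0 i - q 0 i| <= 2 * rho by apply: le_trans (ler_normB _ _) _; lra.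
  have t2 : `|1 - a| <= 1 by rewrite ger0_norm; lra.
  have t3 : `|a - b| * `|top 0 i - q 0 i| <= `|a - b| * (2 * rho) by rewrite ler_wpM2l.
  have t4 : `|1 - a| * `|p 0 i - q 0 i| <= 1 * `|p 0 i - q 0 i| by rewrite ler_wpM2r.
  lra.
have shG a p : shell k.+1 p -> r <= sigma * p 0 k -> 0 <= a <= 1 -> shell k.+1 (G a p).
  move=> [h1 h2 _] pk /andP[a0 a1]; split.
  - by move=> l kl; rewrite /G lineE h1 // topn ?ltk // !mulr0 addr0.
  - move=> l; rewrite /G lineE; apply: le_trans (ler_normD _ _) _.
    rewrite !normrM (ger0_norm a0) ger0_norm; last by lra.
    by have := h2 l; have := topE l; nra.
  - exists k => //; rewrite pkE ler_normr; apply/orP; left.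
    rewrite /G lineE topk.
    have -> : sigma * ((1 - a) * p 0 k + a * (sigma * r)) =
        (1 - a) * (sigma * p 0 k) + a * (sigma * sigma * r) by ring.
    by rewrite ss; move: (sigma * p 0 k) pk => x; nra.
have G0 : push (G 0) c1 = c1.
  by apply: push_id => s _ p _; rewrite /G subr0 scale1r scale0r addr0.
have G1 : push (G 1) c1 = bd (consc top (push (G 1) c1)).
  by rewrite bd_consc -push_bd bc1 push0 consc0 addr0.
have G1E p : G 1 p = top by rewrite /G subrr scale0r scale1r add0r.
exists (b1 + (b2 + consc top (push (G 1) c1))); split.
- apply: sizedD => //; apply: sizedD => //.
  by move=> s /coef_consc[v /(sized_push sc1) <- ->].
- apply: inshellD; [|apply: inshellD].
  + move=> t /ib1[st [s cs hs]]; split=> // x /hs[a [p [a01 ps ->]]].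
    by apply: shF => //; [have [_] := ic _ cs; apply|exact: (hk s)].
  + move=> t /ib2[st [s cs hs]]; split=> // x /hs[a [p [a01 ps ->]]].
    by have [h1 h2] := c1P s p cs ps; exact: shG.
  + move=> t /coef_consc[v /coef_push[s cs ->] ->].
    have h p : p \in top :: map (G 1) s -> p = top.
      by rewrite inE => /orP[/eqP//|/mapP[q _ ->]].
    split.
      by move=> p q /h-> /h->; apply/(vd_lt _ _ e0) => i; rewrite subrr normr0.
    move=> p /h->; split.
    * by move=> l kl; rewrite topn ?ltk.
    * exact: topE.
    * by exists k => //; rewrite topk normrM ns mul1r gtr0_norm.
- rewrite !bdD bb1 bb2 -G1 F0 G0 -/c1.
  by rewrite !addcK.
Qed.

Lemma shellS n p : shell n p -> shell n.+1 p.
Proof.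
move=> [h1 h2 [i i1 i2]]; split=> //; first by move=> l nl; apply: h1; exact: ltnW.
by exists i => //; exact: ltnW.
Qed.

Lemma inshellS n c : inshell n c -> inshell n.+1 c.
Proof. by move=> h s /h[? sh]; split=> // p /sh; exact: shellS. Qed.

(** Mayer-Vietoris: the boundary of the part of [c] that reaches above the equator lies in a thin
    slab, and its projection is a cycle of the equatorial shell. If that cycle bounds, both halves
    of [c] can be capped off, and each capped half avoids a polar cap. *)
Lemma suspension (k : 'I_N) j c (up := fun c => cfilter (has (fun p => 0 < p 0 k)) c) :
    sized j.+1 c -> inshell k.+1 c -> bd c = 0 ->
  [/\ sized j (push (upd k 0) (bd (up c))), inshell k (push (upd k 0) (bd (up c)))
    & bounded k j (push (upd k 0) (bd (up c))) -> bounded k.+1 j.+1 c].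
Proof.
move=> sc ic bc; set y := bd (up c).
pose dn := c + up c.
have sup : sized j.+1 (up c) by move=> s; rewrite coef_filter => /andP[/sc].
have iup : inshell k.+1 (up c) by move=> s; rewrite coef_filter => /andP[/ic].
have sdn : sized j.+1 dn by exact: sizedD.
have idn : inshell k.+1 dn by exact: inshellD.
have ydn : y = bd dn by rewrite bdD bc add0r.
have dnP s p : coef dn s -> p \in s -> p 0 k <= 0.
  rewrite /dn coefD coef_filter; case: (coef c s) => //=.
  by move=> /hasPn h /h; rewrite -leNgt.
have upP s p : coef (up c) s -> p \in s -> - e < p 0 k.
  rewrite coef_filter => /andP[/ic[sm _] /hasP[q qs q0]] ps.
  have : vd p q < e by exact: sm.
  by move/(vd_lt _ _ e0)/(_ k); rewrite ltr_norml => /andP[? _]; lra.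
(* As a boundary of both parts, [y] has its points above [- e] and not above [0]. *)
have yP s : coef y s -> [/\ size s = j, small vd e s &
    forall p, p \in s -> shell k.+1 p /\ - e < p 0 k <= 0].
  move=> ys; have sj : size s = j by apply: sized_bd ys.
  have [v cv [sv _]] := coef_bd ys; have [w cw [sw _]] : exists2 w, coef dn w &
      {subset s <= w} /\ size w = (size s).+1 by apply: coef_bd; rewrite -ydn.
  have [smv shv] := iup v cv; split=> //; first exact: small_sub smv.
  move=> p ps; split; first by apply: shv; exact: sv.
  by rewrite (upP v) ?sv // (dnP w) ?sw.
have pry p : shell k.+1 p -> - e < p 0 k <= 0 -> shell k (upd k 0 p).
  move=> [h1 h2 [i ik hi]] /andP[pk0 pk1]; split.
  - move=> l kl; rewrite mxE; case: eqP => // lk; apply: h1.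
    by rewrite ltn_neqAle kl andbT; apply/negP => /eqP /val_inj ?; apply: lk.
  - by move=> l; rewrite mxE; case: eqP => // _; rewrite normr0; apply: le_trans (h2 k).
  - exists i; last first.
      rewrite mxE; case: eqP => // ik'; move: hi; rewrite ik' ler0_norm // => hi.
      by have := er; lra.
    rewrite ltn_neqAle -ltnS ik andbT; apply/negP => /eqP /val_inj ik'.
    by move: hi; rewrite ik' ler0_norm // => hi; have := er; lra.
have sy : sized j (push (upd k 0) y) by apply: sized_push; exact: sized_bd.
have smpr s (u := map (upd k 0) s) : coef y s -> small vd e (s ++ u).
  move=> ys; have [_ sm sh] := yP s ys.
  have E p : p \in s ++ u -> exists2 q, q \in s & p = q \/ p = upd k 0 q.
    rewrite mem_cat => /orP[ps|/mapP[q qs ->]]; first by exists p => //; left.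
    by exists q => //; right.
  move=> p q /E[p' ps hp] /E[q' qs hq]; apply/(vd_lt _ _ e0) => i.
  have := sm _ _ ps qs; move/(vd_lt _ _ e0)/(_ i) => pq.
  have [_ /andP[p1 p2]] := sh _ ps; have [_ /andP[q1 q2]] := sh _ qs.
  have [ik|ik] := eqVneq i k.
    subst i; have P0 : - e < p 0 k <= 0 by case: hp => ->; rewrite ?mxE ?eqxx ?p1 //; lra.
    have Q0 : - e < q 0 k <= 0 by case: hq => ->; rewrite ?mxE ?eqxx ?q1 //; lra.
    by move: P0 Q0 => /andP[? ?] /andP[? ?]; rewrite ltr_norml; lra.
  by case: hp => ->; case: hq => ->; rewrite ?mxE ?(negPf ik).
have iy : inshell k (push (upd k 0) y).
  move=> _ /coef_push[s ys ->]; have [_ _ sh] := yP s ys; split.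
    by apply: small_sub (smpr s ys) => p ps; rewrite mem_cat ps orbT.
  by move=> _ /mapP[p /sh[h1 h2] ->]; exact: pry.
split=> // -[b [sb ib bb]].
pose pr := prism id (upd k 0) y.
have spr : sized j.+1 pr by apply: sized_prism; exact: sized_bd.
have prP s : coef pr s -> small vd e s /\ (forall p, p \in s -> shell k.+1 p /\ - e < p 0 k <= 0).
  move=> /coef_prism[u yu [su _]]; have [_ _ sh] := yP u yu; split.
    by apply: small_sub (smpr u yu) => p /su; rewrite map_id.
  move=> p /su; rewrite map_id mem_cat => /orP[/sh//|/mapP[q /sh[h1 h2] ->]].
  split; first by apply: shellS; exact: pry.
  by rewrite mxE eqxx; lra.
have ipr : inshell k.+1 pr by move=> s /prP[? h]; split=> // p /h[].
have bP s p : coef b s -> p \in s -> p 0 k = 0.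
  by move=> /ib[_ h] /h[h1 _ _]; exact: h1.
have bpr : bd pr = y + bd b.
  have := prismP id (upd k 0) y; rewrite bdbd prism0 addr0 => ->.
  by rewrite bb push_id.
have er' := er; have r0' := r0.
(* The cap is added to both halves and cancels in the sum. *)
have -> : c = (up c + (pr + b)) + (dn + (pr + b)).
  by apply: chainP => s; rewrite !coefD; do 4! case: (coef _ s).
apply: boundedD.
- apply: (@half_space k 1); first by left.
  + by do 2! apply: sizedD => //.
  + by do 2! apply: inshellD => //; exact: inshellS.
  + by rewrite !bdD bpr -/y addcK addcc.
  + move=> s p cs ps; rewrite mul1r; case/coefD_or: cs => [cs|/coefD_or[|] cs].
    * by have := upP s p cs ps; lra.
    * by have [_ /(_ p ps)[_ /andP[? _]]] := prP s cs; lra.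
    * by rewrite (bP s) //; lra.
- apply: (@half_space k (-1)); first by right.
  + by do 2! apply: sizedD => //.
  + by do 2! apply: inshellD => //; exact: inshellS.
  + by rewrite bdD -ydn bdD bpr addcK addcc.
  + move=> s p cs ps; rewrite mulN1r; case/coefD_or: cs => [cs|/coefD_or[|] cs].
    * by have := dnP s p cs ps; lra.
    * by have [_ /(_ p ps)[_ /andP[_ ?]]] := prP s cs; lra.
    * by rewrite (bP s) //; lra.
Qed.

(* The second part says that the top homology group has at most two elements. *)
Lemma shell_homology n : (n <= N)%N ->
  (forall j c, (j < n)%N -> sized j c -> inshell n c -> bd c = 0 -> bounded n j c) /\
  (forall c d, sized n c -> sized n d -> inshell n c -> inshell n d -> bd c = 0 ->
    bd d = 0 -> [\/ bounded n n c, bounded n n d | bounded n n (c + d)]).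
Proof.
have b0 m j : bounded m j 0 by exists 0; split; [|exact: allc0|exact: bd0] => s; rewrite coef0.
elim: n => [_|n IH nN].
  (* The shell in [R^0] is empty, and its augmented complex consists of [0] and the empty tuple. *)
  split=> // c d /sized0_chain[->|->]; first by move=> *; apply: Or31; exact: b0.
  move=> /sized0_chain[->|->]; first by move=> *; apply: Or32; exact: b0.
  by move=> *; apply: Or33; rewrite addcc; exact: b0.
have [IH1 IH2] := IH (ltnW nN).
pose k := Ordinal nN; have kn : k = n :> nat by [].
split.
  move=> [|j] c jn sc ic bc.
    case: (sized0_chain sc) => ->; first exact: b0.
    pose p : 'rV[R]_N := upd k r 0.
    exists (sg [:: p]); split; last by rewrite bd_sg /= consc0 addr0.
      by move=> s; rewrite coef_sg => /eqP->.
    apply: allc_sg; split.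
      move=> q q'; rewrite !inE => /eqP-> /eqP->.
      by apply/(vd_lt _ _ e0) => i; rewrite subrr normr0.
    move=> q; rewrite inE => /eqP->; split.
    - move=> l; rewrite -kn => nl; rewrite !mxE; case: eqP => // lk.
      by move: nl; rewrite lk ltnn.
    - move=> i; rewrite !mxE; case: eqP => _; first by rewrite gtr0_norm.
      by rewrite normr0; apply: le_trans rrho; exact: ltW.
    - by exists k => //; rewrite mxE eqxx gtr0_norm.
  rewrite -kn in ic *; have [s1 i1 h] := suspension sc ic bc.
  by apply: h; apply: IH1 => //; rewrite -push_bd bdbd push0.
move=> c d sc sd; rewrite -{1 2}kn => ic id bc bd'.
have [s1 i1 h1] := suspension sc ic bc.
have [s2 i2 h2] := suspension sd id bd'.
have bcd : bd (c + d) = 0 by rewrite bdD bc bd' addr0.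
have [_ _ h3] := suspension (sizedD sc sd) (inshellD ic id) bcd.
rewrite cfilterD bdD pushD in h3.
have z (x : chain (seq 'rV[R]_N)) : bd (push (upd k 0) (bd x)) = 0.
  by rewrite -push_bd bdbd push0.
by case: (IH2 _ _ s1 s2 i1 i2 (z _) (z _)) => [/h1|/h2|/h3] ?; [apply: Or31|apply: Or32|apply: Or33].
Qed.

End Shell.

(** * Towers, mod 2 degree and Borsuk-Ulam *)

Section Tower.
Variables (P : choiceType) (t : P -> P).

(* Smith-theoretic tower: the mod 2 class of [c n] caps with the powers of the
   class of the double cover down to an odd number of points. *)
Definition tower n (c : nat -> chain (seq P)) :=
  [/\ forall j, (j <= n)%N -> sized j.+1 (c j), bd (c 0%N) = sg [::]
    & forall j, (j < n)%N -> bd (c j.+1) = c j + push t (c j)].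

Lemma tower_leq n m c : (m <= n)%N -> tower n c -> tower m c.
Proof.
move=> mn [h1 h2 h3]; split=> // j jm; first by apply: h1; exact: leq_trans mn.
by apply: h3; exact: leq_trans mn.
Qed.

Lemma tower_cycle n c : involutive t -> tower n c -> bd (c n + push t (c n)) = 0.
Proof.
move=> tK [_ c0 cS]; rewrite bdD -push_bd; case: n cS => [|m] cS.
  by rewrite c0 push_sg addcc.
rewrite cS // pushD push_push [push _ (c m) + _]addrC.
by rewrite [push (_ \o _) _]push_id ?addcc // => s _ p _ /=; rewrite tK.
Qed.

End Tower.

(** The involution enters the equations of a tower only below the top level, so equivariance of [d]
    is asked only there. *)
Lemma tower_push (P Q : choiceType) (t : P -> P) (t' : Q -> Q) (d : P -> Q) n (c : nat -> chain (seq P)) :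
    (forall j s p, (j < n)%N -> coef (c j) s -> p \in s -> d (t p) = t' (d p)) ->
  tower t n c -> tower t' n (fun j => push d (c j)).
Proof.
move=> dt [h1 h2 h3]; split.
- by move=> j /h1; exact: sized_push.
- by rewrite -push_bd h2 push_sg.
- move=> j jn; rewrite -push_bd h3 // pushD; congr (_ + _).
  by rewrite !push_push; apply: eq_push => s cs p ps /=; apply: dt cs ps.
Qed.

Section Degree.
Variables (R : realType) (n : nat).
Implicit Types (p q : 'rV[R]_n.+1) (c d : chain (seq 'rV[R]_n.+1)).

(** The axis of largest absolute value together with the sign: the vertex of the cross-polytope
    closest in direction to [p]. *)
Definition lab p : nat :=
  let i := [arg max_(i > ord0) `|p 0 i|]%O in (0 < p 0 i)%R + (i : nat).*2.

Lemma labP p : exists2 i, lab p = ((0 < p 0 i)%R + (i : nat).*2)%N &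
  forall j, `|p 0 j| <= `|p 0 i|.
Proof. by rewrite /lab; case: arg_maxP => // i _ h; exists i => // j; exact: h. Qed.

Lemma lab_lt p : ((lab p)./2 < n.+1)%N.
Proof. by have [i -> _] := labP p; rewrite half_bit_double. Qed.

Lemma labN p : (exists j, p 0 j != 0) -> lab (- p) = flip (lab p).
Proof.
move=> [j pj]; rewrite /lab.
have -> : (fun i => `|(- p) 0 i|) = (fun i => `|p 0 i|).
  by apply/funext => i; rewrite mxE normrN.
case: arg_maxP => // i _ /(_ j isT) h; rewrite flipE mxE oppr_gt0 -leNgt le_eqVlt.
suff -> : (p 0 i == 0) = false by [].
by apply/negbTE; rewrite -normr_gt0; apply: lt_le_trans h; rewrite normr_gt0.
Qed.

Definition nonzero (r : R) (s : seq 'rV[R]_n.+1) :=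
  small (@vd R n.+1) r s /\ forall p, p \in s -> exists j, r <= `|p 0 j|.

(** Antipodal labels would put two points of the tuple at least [2 r] apart in one coordinate. *)
Lemma nonzero_nonantipodal r s : 0 < r -> nonzero r s -> nonantipodal (map lab s).
Proof.
move=> r0 [sm nz] _ _ /mapP[p ps ->] /mapP[q qs ->].
have [i -> hi] := labP p; have [k -> hk] := labP q; rewrite !half_bit_double => ik.
have {}ik := ord_inj ik; subst k; congr (_ + _)%N.
have [j rj] := nz p ps; have [l rl] := nz q qs.
have := sm p q ps qs; move/(vd_lt _ _ r0)/(_ i).
have {rj hi} := le_trans rj (hi j); have {rl hk} := le_trans rl (hk l).
move: (p 0 i) (q 0 i) => x y; rewrite !ler_normr ltr_norml.
move=> h1 h2 /andP[h3 h4].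
case: (ltP 0 x); case: (ltP 0 y) => // y0 x0; exfalso;
  by case/orP: h1 => ?; case/orP: h2 => ?; lra.
Qed.

(** On fine cycles of tuples of length [n+1] away from the origin this is the mod 2 degree around
    the origin, counted by alternating labels. *)
Definition deg e c := pair (fun s => alpha e (map lab s)) c.

Lemma degD e c d : deg e (c + d) = deg e c (+) deg e d. Proof. exact: pairD. Qed.

Lemma deg_bd e c : deg e (bd c) = deg e c (+) deg (~~ e) c.
Proof.
rewrite /deg /bd pair_lin -pair_add; apply: eq_pair => s _.
rewrite -alpha_bdt -push_bdt /push pair_lin; apply: eq_pair => u _.
by rewrite pair_sg.
Qed.

Lemma deg_top r e c : 0 < r -> sized n.+2 c -> allc (nonzero r) c -> deg e c = false.
Proof.
move=> r0 sc hc; apply: pair_eq0 => s cs; apply: (@alpha_top n.+1).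
- by apply: nonzero_nonantipodal r0 _; exact: hc.
- by move=> _ /mapP[p _ ->]; exact: lab_lt.
- by rewrite size_map sc.
Qed.

Lemma deg_bd0 r e c : 0 < r -> sized n.+2 c -> allc (nonzero r) c -> deg e (bd c) = false.
Proof. by move=> r0 sc hc; rewrite deg_bd !(deg_top _ r0). Qed.

Lemma deg_opp r e c : 0 < r -> allc (nonzero r) c -> deg e (push -%R c) = deg (~~ e) c.
Proof.
move=> r0 hc; rewrite /deg /push pair_lin; apply: eq_pair => s cs; rewrite pair_sg.
rewrite -(alpha_flip _ (nonzero_nonantipodal r0 (hc _ cs))) -!map_comp; congr alpha.
apply/eq_in_map => p ps /=; apply: labN; have [_ /(_ p ps)[j rj]] := hc _ cs.
by exists j; rewrite -normr_gt0; exact: lt_le_trans rj.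
Qed.

(** The antipode exchanges the two signs, so the degree of [T j] plus its antipode is the sum of the
    counts for both signs, which is the degree of the boundary of [T j]. The tower equation carries
    this down to the bottom. *)
Lemma deg_descent m r (T : nat -> chain (seq 'rV[R]_n.+1)) j : 0 < r ->
    (forall j, (j < m)%N -> bd (T j.+1) = T j + push -%R (T j)) ->
    (forall j, (j <= m)%N -> allc (nonzero r) (T j)) -> (j <= m)%N ->
  deg true (T j + push -%R (T j)) = deg true (bd (T 0%N)).
Proof.
move=> r0 cS nz.
have dS k : (k <= m)%N -> deg true (T k + push -%R (T k)) = deg true (bd (T k)).
  by move=> km; rewrite degD (deg_opp true r0 (nz k km)) deg_bd.
elim: j => [|j IH jm]; first by rewrite dS.
by rewrite dS // cS // IH // ltnW.
Qed.

(** Borsuk-Ulam: the bottom of the tower is an odd number of points, so the antipodal cycle at each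
    level has degree one. *)
Lemma deg_tower m r (T : nat -> chain (seq 'rV[R]_n.+1)) j : 0 < r ->
  tower -%R m T -> (forall j, (j <= m)%N -> allc (nonzero r) (T j)) -> (j <= m)%N ->
  deg true (T j + push -%R (T j)) = true.
Proof.
by move=> r0 [_ c0 cS] nz jm; rewrite (deg_descent r0 cS nz jm) c0 /deg pair_sg.
Qed.

Lemma deg_homotopy (P : choiceType) (F : R -> P -> 'rV[R]_n.+1) (r eta : R) e (c : chain (seq P)) :
    0 < r -> 0 < eta -> sized n.+1 c -> bd c = 0 ->
    (forall s (x : P) a, coef c s -> x \in s -> 0 <= a <= 1 -> exists j, r <= `|F a x 0 j|) ->
    (forall s (x y : P) a b, coef c s -> x \in s -> y \in s -> 0 <= a <= 1 -> 0 <= b <= 1 ->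
      `|a - b| < eta -> vd (F a x) (F b y) < r) ->
  deg e (push (F 0) c) = deg e (push (F 1) c).
Proof.
move=> r0 eta0 sc bc nz h.
have [b [sb bb ib]] := homotopy_small eta0 sc bc h.
have : deg e (bd b) = false; last first.
  by rewrite bb degD; case: (deg e (push (F 0) c)); case: (deg e (push (F 1) c)).
apply: (@deg_bd0 r) => // t /ib[st [s cs hs]]; split=> // x /hs[a [p [a01 ps ->]]].
exact: nz cs ps a01.
Qed.

Section ShellDegree.
Variables (r rho e : R).
Hypotheses (e0 : 0 < e) (er : e <= r) (rrho : r <= rho).
Let r0 : 0 < r. Proof. exact: lt_le_trans e0 er. Qed.

Lemma inshell_nonzero c : inshell r rho e n.+1 c -> allc (nonzero r) c.
Proof.
move=> h s /h[sm sh]; split; last by move=> p /sh[_ _ [j _ rj]]; exists j.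
by move=> p q ps qs; apply: lt_le_trans er; exact: sm.
Qed.

Lemma inshell_opp c : inshell r rho e n.+1 c -> inshell r rho e n.+1 (push -%R c).
Proof.
move=> h _ /coef_push[s /h[sm sh] ->]; split.
  move=> _ _ /mapP[p ps ->] /mapP[q qs ->]; apply/(vd_lt _ _ e0) => i.
  rewrite !mxE -opprD normrN; apply/vd_lt: i => //; exact: sm.
move=> _ /mapP[p /sh[h1 h2 [i i1 i2]] ->]; split.
- by move=> l /h1 pl; rewrite mxE pl oppr0.
- by move=> l; rewrite mxE normrN.
- by exists i => //; rewrite mxE normrN.
Qed.

(** The homology of the shell vanishes below the top dimension, so each antipodal cycle can be
    filled to give the next level. *)
Lemma shell_tower : exists2 c : nat -> chain (seq 'rV[R]_n.+1), tower -%R n c & forall j, inshell r rho e n.+1 (c j).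
Proof.
have [H _] := shell_homology e0 er rrho (leqnn n.+1).
suff : forall m, (m <= n)%N -> exists2 c : nat -> chain (seq 'rV[R]_n.+1), tower -%R m c & forall j, inshell r rho e n.+1 (c j).
  exact.
elim=> [_|m IH mn].
  have [|||b [sb ib bb]] := H 0%N (sg [::]) isT.
  - by move=> s; rewrite coef_sg => /eqP->.
  - by apply: allc_sg; split.
  - by rewrite bd_sg.
  exists (fun=> b) => //; split=> // j; rewrite leqn0 => /eqP->; exact: sb.
have [c [h1 h2 h3] hi] := IH (ltnW mn).
have [|||b [sb ib bb]] := H m.+1 (c m + push -%R (c m)) mn.
- by apply: sizedD; [|apply: sized_push]; exact: h1.
- by apply: inshellD => //; exact: inshell_opp.
- exact: tower_cycle (@opprK _) (And3 h1 h2 h3).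
exists (fun j => if j == m.+1 then b else c j); last by move=> j; case: eqP.
split=> //.
- move=> j; rewrite leq_eqVlt => /orP[/eqP->|jm]; first by rewrite eqxx.
  by rewrite (ltn_eqF jm); exact: h1.
- move=> j jm; rewrite (ltn_eqF jm) eqSS; have [->//|jm'] := eqVneq j m.
  by apply: h3; rewrite ltn_neqAle jm' -ltnS.
Qed.

(** The antipodal cycle of a tower has degree one and so does not bound; as the top homology has at
    most two elements, the degree detects it. *)
Lemma deg0_bounded c : sized n.+1 c -> inshell r rho e n.+1 c -> bd c = 0 ->
  deg true c = false -> bounded r rho e n.+1 n.+1 c.
Proof.
move=> sc ic bc dc; have [T tT iT] := shell_tower.
have [H _] := tT.
have [_ H2] := shell_homology e0 er rrho (leqnn n.+1).
pose s := T n + push -%R (T n).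
have ds : deg true s = true.
  by apply: (deg_tower r0 tT) => // j _; exact: inshell_nonzero.
have ss : sized n.+1 s by apply: sizedD; [|apply: sized_push]; exact: H.
have is' : inshell r rho e n.+1 s by apply: inshellD => //; exact: inshell_opp.
have bs : bd s = 0 by exact: tower_cycle (@opprK _) tT.
case: (H2 c s sc ss ic is' bc bs) => // -[b [sb ib bb]].
  by have := deg_bd0 true r0 sb (inshell_nonzero ib); rewrite bb ds.
by have := deg_bd0 true r0 sb (inshell_nonzero ib); rewrite bb degD ds dc.
Qed.

End ShellDegree.
End Degree.

(** * Fine charts of a manifold *)

Section CompactUniform.
Variables (R : realType).

(** All moduli below come from this. With [u] a distance in the source and [v] one in the target it
    is uniform continuity; with the two exchanged it is uniform injectivity. *)
Lemma compact_uniform (Y : topologicalType) (A : set Y) (u v : Y -> R) :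
    compact A -> {within A, continuous u} -> {within A, continuous v} ->
    (forall y, A y -> 0 <= u y) -> (forall y, A y -> u y = 0 -> v y <= 0) ->
  forall e : R, 0 < e -> exists2 d : R, 0 < d & forall y, A y -> u y < d -> v y < e.
Proof.
move=> /compact_near_coveringP/near_covering_withinP cov.
move=> /subspace_continuousP uc /subspace_continuousP vc u0 uv e e0.
suff [d d0 hd] : exists2 d : R, 0 < d & A `<=` (fun y => u y < d -> v y < e) by exists d.
have : \forall d \near (0 : R)^'+, A `<=` (fun y => u y < d -> v y < e).
  apply: (cov R (0 : R)^'+ (fun d y => u y < d -> v y < e)) => x Ax.
  (* Where [u] vanishes, [v] is small nearby; elsewhere [u] stays above half its value, and a small
     [d] makes the premise false. *)
  have [ux|ux] := eqVneq (u x) 0.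
    have vx : v x < e by apply: le_lt_trans e0; exact: uv.
    exists ([set y | A y -> v y < e], setT); last by move=> [y d] /= [h _] /h.
    split; last exact: filterT.
    exact: (cvgr_lt _ (vc x Ax) _ vx).
  have ux0 : 0 < u x by rewrite lt_neqAle eq_sym ux u0.
  have ux2 : u x / 2 < u x by lra.
  exists ([set y | A y -> u x / 2 < u y], [set d | d < u x / 2]).
    split; first exact: (cvgr_gt _ (uc x Ax) _ ux2).
    by apply: nbhs_right_lt; rewrite divr_gt0.
  by move=> [y d] /= [h1 h2] /h1 h3 h4; lra.
move=> h; near (0 : R)^'+ => d; exists d; first by near: d; exact: nbhs_right_gt.
by near: d; exact: h.
Unshelve. all: by end_near. Qed.

Lemma continuous_bigmax (Y : topologicalType) (I : Type) (l : seq I) (f : I -> Y -> R) y :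
    (forall i, continuous_at y (f i)) ->
  continuous_at y (fun y => \big[Num.max/0]_(i <- l) f i y).
Proof.
move=> fc; elim: l => [|i l IH].
  by under eq_fun do rewrite big_nil; exact: cvg_cst.
under eq_fun do rewrite big_cons.
exact: (continuous_max (fc i) IH).
Qed.

Lemma continuous_glue (Y : topologicalType) (U K : set Y) (f h : Y -> R) :
    open U -> closed K -> K `<=` U -> (forall y, U y -> f y = h y) ->
    (forall y, U y -> continuous_at y h) -> (forall y, ~ K y -> f y = 0) -> continuous f.
Proof.
move=> oU cK KU fh hc f0 y; have [Uy|nU] := pselect (U y).
  have e : \forall z \near y, h z = f z.
    by near=> z; rewrite fh //; near: z; exact: open_nbhs_nbhs.
  by rewrite /continuous_at (fh _ Uy); exact: cvg_trans (near_eq_cvg e) (hc y Uy).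
have nK : ~ K y by move=> /KU.
have e : \forall z \near y, 0 = f z.
  near=> z; rewrite f0 //; near: z; apply: open_nbhs_nbhs; split=> //.
  exact: closed_openC.
by rewrite /continuous_at (f0 _ nK); exact: cvg_trans (near_eq_cvg e) (cvg_cst _).
Unshelve. all: by end_near. Qed.

Lemma finite_cover (Y : topologicalType) (A : set Y) (O : Y -> set Y) :
    compact A -> (forall x, A x -> nbhs x (O x)) ->
  exists2 F : {fset Y}, (forall i, i \in F -> A i) &
    forall y, A y -> exists2 i, i \in F & O i y.
Proof.
move=> /compact_near_coveringP cov nO.
(* The filter of large finite subsets of [A]; near covering produces one of them that covers. *)
pose G := filter_from [set F : {fset Y} | forall i, i \in F -> A i]
  (fun F => [set F' : {fset Y} | (F `<=` F')%fset /\ forall i, i \in F' -> A i]).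
have FG : Filter G.
  apply: filter_from_filter; first by exists fset0 => i; rewrite inE.
  move=> F1 F2 h1 h2; exists (F1 `|` F2)%fset.
    by move=> i; rewrite in_fsetU => /orP[/h1|/h2].
  by move=> F' [+ hF']; rewrite fsubUset => /andP[? ?]; split.
have [|F0 hF0 h] := cov {fset Y} G (fun F y => exists2 i, i \in F & O i y) FG.
  move=> x Ax; exists (O x, [set F' : {fset Y} | x \in F']); last first.
    by move=> [y F'] /= [Oy xF']; exists x.
  split; first exact: nO.
  exists [fset x]%fset; first by move=> i; rewrite inE => /eqP->.
  by move=> F' [+ _]; rewrite fsub1set.
by exists F0 => // y Ay; apply: h.
Qed.

End CompactUniform.

(** * Charts cut off to global functions *)

Section Chart.
Variables (R : realType) (N : nat) (M : topologicalType).

Record chart := Chart {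
  bump : M -> R;
  coord : M -> 'rV[R]_N;
  invc : 'rV[R]_N -> M }.

Definition unit_cube : set 'rV[R]_N := [set q | forall j, `|q 0 j| <= 1].

(** [coord] is thought of as [bump] times a local coordinate. The second clause then says that
    [bump] is one wherever the local coordinate lies in the unit cube, and there [invc] inverts
    [coord]. *)
Definition good_chart (x : M) (c : chart) :=
  [/\ (continuous (bump c) /\ forall j, continuous (fun y => coord c y 0 j)),
      (forall y, 0 < bump c y -> (forall j, `|coord c y 0 j| <= bump c y) -> bump c y = 1),
      (forall y, bump c y = 1 -> unit_cube (coord c y) /\ invc c (coord c y) = y),
      {within unit_cube, continuous (invc c)} /\
        (forall q, unit_cube q -> coord c (invc c q) = q)
    & bump c x = 1 /\ coord c x = 0].

Lemma cube_compact (a : 'rV[R]_N) (r : R) : compact [set q : 'rV[R]_N | forall j, `|q 0 j - a 0 j| <= r].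
Proof.
have -> : [set q : 'rV[R]_N | forall j, `|q 0 j - a 0 j| <= r] =
   [set q : 'rV[R]_N | forall j, `[a 0 j - r, a 0 j + r]%classic (q 0 j)].
  apply/seteqP; split=> q /= h j; have := h j.
    by rewrite in_itv /= ler_distl.
  by rewrite in_itv /= ler_distl.
by apply: (@rV_compact R N (fun j => `[a 0 j - r, a 0 j + r]%classic)) => j; exact: segment_compact.
Qed.

Lemma affine_continuous (a : 'rV[R]_N) (s : R) : continuous (fun q : 'rV[R]_N => a + s *: q).
Proof.
move=> q; apply: continuousD; first exact: cst_continuous.
by apply: continuousZl_tmp; exact: cvg_id.
Qed.

Lemma exists_chart x : manifold R N M -> exists c, good_chart x c.
Proof.
move=> [hM _ /(_ x)[U [phi [psi [[oU Ux] oV phic psic phiK]]]]].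
have phiK' y : U y -> psi (phi y) = y by move=> Uy; apply: phiK; rewrite inE.
have psiK p : (phi @` U) p -> phi (psi p) = p.
  by move=> [y Uy <-]; rewrite phiK'.
have {}phic y : U y -> continuous_at y phi.
  by move=> Uy; move: phic; rewrite continuous_open_subspace // => /(_ y); rewrite inE; apply.
(* After rescaling by [s], the cube of size [2] still lies in the image of the chart, and the
   cut-off takes place between the sizes [1] and [2]. *)
have [s s0 hs] : exists2 s : R, 0 < s & forall q : 'rV[R]_N, (forall j, `|q 0 j - phi x 0 j| <= 2 * s) -> (phi @` U) q.
  have : nbhs (phi x) (phi @` U) by apply: open_nbhs_nbhs; split=> //; exists x.
  move=> /nbhs_ballP[e /= e0 he]; exists (e / 4); first by rewrite divr_gt0.
  move=> q hq; apply: he; rewrite -ball_normE /= /ball_ /= -[ltLHS]/(`|phi x - q|).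
  rewrite /Num.Def.normr /= mx_normrE; apply/bigmax_ltP; split=> // -[i j] _ /=.
  by rewrite !mxE (ord1 i) distrC; apply: le_lt_trans (hq j) _; lra.
pose fi y := s^-1 *: (phi y - phi x).
pose nf y : R := \big[Num.max/0]_j `|fi y 0 j|.
pose bu y : R := if y \in U then Num.max 0 (Num.min 1 (2 - nf y)) else 0.
pose co y : 'rV[R]_N := if y \in U then bu y *: fi y else 0.
pose iv (q : 'rV[R]_N) := psi (phi x + s *: q).
have fiE y j : fi y 0 j = s^-1 * (phi y 0 j - phi x 0 j) by rewrite /fi !mxE.
have nfP y (a : R) : 0 <= a -> nf y <= a <-> forall j, `|fi y 0 j| <= a.
  move=> a0; split=> [/bigmax_leP[_ h] j|h]; first exact: h.
  by apply/bigmax_leP; split.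
pose K := psi @` [set q : 'rV[R]_N | forall j, `|q 0 j - phi x 0 j| <= 2 * s].
have cK : closed K.
  apply: compact_closed => //; apply: continuous_compact; last exact: cube_compact.
  by apply: continuous_subspaceW psic => q; exact: hs.
have KU : K `<=` U by move=> _ [q /hs[y Uy <-] <-]; rewrite phiK'.
have phij y j : U y -> continuous_at y (fun y => phi y 0 j).
  by move=> /phic h; exact: (@continuous_comp _ _ _ phi (fun q : 'rV[R]_N => q 0 j) y h (@coord_continuous _ _ _ _ _ _)).
have fij y j : U y -> continuous_at y (fun y => fi y 0 j).
  move=> Uy; under eq_fun do rewrite fiE.
  apply: (@cvgM _ _ _ _ (fun=> s^-1) (fun y => phi y 0 j - phi x 0 j)); first exact: cvg_cst.
  by apply: (@cvgB _ _ _ _ _ (fun y => phi y 0 j)); [exact: phij|exact: cvg_cst].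
pose h y := Num.max 0 (Num.min 1 (2 - nf y)).
have hc y : U y -> continuous_at y h.
  move=> Uy; apply: (@continuous_max _ _ (fun=> 0 : R^o) (fun y => Num.min 1 (2 - nf y) : R^o) y).
    exact: cvg_cst.
  apply: (@continuous_min _ _ (fun=> 1 : R^o) (fun y => 2 - nf y : R^o) y); first exact: cvg_cst.
  apply: (@cvgB _ R^o _ _ _ (fun=> 2)); first exact: cvg_cst.
  apply: continuous_bigmax => j.
  exact: (@continuous_comp _ _ _ _ (fun t : R => `|t|) y (fij y j Uy) (@norm_continuous _ _ _)).
have buU y : U y -> bu y = h y by move=> Uy; rewrite /bu mem_set.
have n2 : (0 : R) <= 2 by [].
have bu0 y : ~ K y -> bu y = 0.
  rewrite /bu => nK; case: ifPn => // /set_mem Uy; apply/eqP; rewrite eq_le le_max lexx andbT.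
  rewrite ge_max lexx /= ge_min; apply/orP; right; rewrite subr_le0 leNgt; apply/negP => /ltW.
  move=> /(nfP y 2 n2) hn; apply: nK; exists (phi y); last exact: phiK'.
  move=> j; have := hn j; rewrite fiE normrM gtr0_norm ?invr_gt0// mulrC.
  by rewrite ler_pdivrMr // mulrC.
have bu1 y : U y -> nf y <= 1 -> bu y = 1.
  move=> Uy ny; rewrite buU // /h min_l; last by lra.
  by rewrite max_r.
have inv_bu y : bu y = 1 -> U y /\ nf y <= 1.
  rewrite /bu; case: ifPn => [/set_mem Uy|_ e]; last by have := oner_neq0 R; rewrite -e eqxx.
  move=> e; split=> //; rewrite leNgt; apply/negP => n1.
  move: e; rewrite min_r; last by lra.
  by rewrite /Num.max; case: ifPn => _; lra.
have coE y j : co y 0 j = bu y * fi y 0 j.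
  rewrite /co; case: ifPn => Uy; first by rewrite mxE.
  by rewrite mxE /bu (negPf Uy) mul0r.
have ivP q : unit_cube q -> [/\ U (iv q), fi (iv q) = q & nf (iv q) <= 1].
  move=> cq; have pq : (phi @` U) (phi x + s *: q).
    apply: hs => j; rewrite !mxE addrAC subrr add0r normrM gtr0_norm //.
    by have := cq j; nra.
  have e : fi (iv q) = q.
    rewrite /fi psiK // addrAC subrr add0r scalerA mulVf ?scale1r //.
    by rewrite gt_eqF.
  split=> //; last by apply/nfP => // j; rewrite e; exact: cq.
  by rewrite /iv; case: pq => y Uy <-; rewrite phiK'.
exists (Chart bu co iv); split=> /=.
- split; first exact: (continuous_glue oU cK KU buU hc bu0).
  move=> j; under eq_fun do rewrite coE.
  apply: (@continuous_glue _ _ U K _ (fun y => h y * fi y 0 j)) => //.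
  + by move=> y Uy; rewrite buU.
  + by move=> y Uy; apply: (@cvgM _ _ _ _ h); [exact: hc|exact: fij].
  + by move=> y nK; rewrite bu0 ?mul0r.
- move=> y b0 hb; have Uy : U y.
    by apply: contrapT => nU; move: b0; rewrite /bu memNset // ltxx.
  apply: bu1 => //; apply/nfP => // j; have := hb j.
  by rewrite coE normrM gtr0_norm // -[leRHS]mulr1 ler_pM2l.
- move=> y by1; have [Uy ny] := inv_bu y by1.
  have coy : co y = fi y by apply/rowP => j; rewrite coE by1 mul1r.
  split; first by move=> j; rewrite coy; move/nfP: ny; apply.
  rewrite coy /iv /fi scalerA divff ?scale1r; last by rewrite gt_eqF.
  by rewrite addrC subrK phiK'.
- split; last first.
    move=> q /[dup] cq /ivP[Uy fe ne]; apply/rowP => j.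
    by rewrite coE fe bu1 ?mul1r.
  apply: continuous_in_subspaceT => q /set_mem cq.
  have hp : continuous_at (phi x + s *: q) psi.
    move: psic; rewrite continuous_open_subspace // => /(_ (phi x + s *: q)); rewrite inE; apply.
    apply: hs => j; rewrite !mxE addrAC subrr add0r normrM gtr0_norm //.
    by have := cq j; nra.
  rewrite -[continuous_at _ _]/(continuous_at q (psi \o (fun q => phi x + s *: q))).
  by apply: continuous_comp => //; exact: affine_continuous.
- have fx : fi x = 0 by rewrite /fi subrr scaler0.
  have nx : nf x <= 1 by apply/nfP => // j; rewrite fx mxE normr0.
  by rewrite bu1 //; split=> //; apply/rowP => j; rewrite coE fx !mxE mulr0.
Qed.

End Chart.

Section VectorDistance.
Variables (R : realType) (N : nat).
Implicit Types p q : 'rV[R]_N.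

Lemma vd_ge0 p q : 0 <= vd p q. Proof. exact: bigmax_ge_id. Qed.
Lemma vdC p q : vd p q = vd q p.
Proof. by rewrite /vd; apply: eq_bigr => i _; rewrite distrC. Qed.
Lemma vd_le x p q : 0 <= x -> vd p q <= x <-> forall i, `|p 0 i - q 0 i| <= x.
Proof.
move=> x0; split=> [/bigmax_leP[_ h] i|h]; first exact: h.
by apply/bigmax_leP; split.
Qed.
Lemma vdxx p : vd p p = 0.
Proof.
by apply/eqP; rewrite eq_le vd_ge0 andbT; apply/vd_le => // i; rewrite subrr normr0.
Qed.
Lemma vd_coord p q i : `|p 0 i - q 0 i| <= vd p q.
Proof. by move: i; apply/vd_le => //; exact: vd_ge0. Qed.
Lemma vd_tri p q q' : vd p q' <= vd p q + vd q q'.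
Proof.
apply/vd_le => [|i]; first by rewrite addr_ge0 // vd_ge0.
have -> : p 0 i - q' 0 i = (p 0 i - q 0 i) + (q 0 i - q' 0 i) by ring.
by apply: le_trans (ler_normD _ _) _; apply: lerD; exact: vd_coord.
Qed.
Lemma vd_eq0 p q : vd p q = 0 -> p = q.
Proof.
move=> e; apply/rowP => i; apply/eqP; rewrite -subr_eq0 -normr_le0 -e; exact: vd_coord.
Qed.
Lemma exists_large (r : R) p q : 0 < r -> r <= vd p q -> exists j, r <= `|p 0 j - q 0 j|.
Proof.
move=> r0 h; apply: contrapT => hn; have : vd p q < r.
  by apply/(vd_lt _ _ r0) => j; rewrite ltNge; apply/negP => hj; apply: hn; exists j.
by rewrite ltNge h.
Qed.
End VectorDistance.

Lemma exists_min3 (R : realFieldType) (a b c : R) : 0 < a -> 0 < b -> 0 < c ->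
  exists d, [/\ 0 < d, d <= a, d <= b & d <= c].
Proof.
move=> a0 b0 c0; exists (Num.min (Num.min a b) c).
by rewrite !lt_min a0 b0 c0 !ge_min !lexx !orbT.
Qed.

Lemma within_fst (X Y Z : topologicalType) (A : set X) (B : set Y) (f : X -> Z) :
  {within A, continuous f} -> {within A `*` B, continuous (fun p => f p.1)}.
Proof.
move=> /subspace_continuousP fc; apply/subspace_continuousP => p [Ap Bp] O /(fc _ Ap) h.
by exists ([set x | A x -> O (f x)], setT); [split=> //; exact: filterT|move=> q /= [h1 _] [/h1]].
Qed.

Lemma within_snd (X Y Z : topologicalType) (A : set X) (B : set Y) (f : Y -> Z) :
  {within B, continuous f} -> {within A `*` B, continuous (fun p => f p.2)}.
Proof.
move=> /subspace_continuousP fc; apply/subspace_continuousP => p [Ap Bp] O /(fc _ Bp) h.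
by exists (setT, [set x | B x -> O (f x)]); [split=> //; exact: filterT|move=> q /= [_ h1] [_ /h1]].
Qed.

Lemma cont_fst (X Y Z : topologicalType) (f : X -> Z) (p : X * Y) :
  continuous_at p.1 f -> continuous_at p (fun p => f p.1).
Proof.
by move=> fc O /fc h; exists (f @^-1` O, setT); [split=> //; exact: filterT|move=> q []].
Qed.

Lemma cont_snd (X Y Z : topologicalType) (f : Y -> Z) (p : X * Y) :
  continuous_at p.2 f -> continuous_at p (fun p => f p.2).
Proof.
by move=> fc O /fc h; exists (setT, f @^-1` O); [split=> //; exact: filterT|move=> q []].
Qed.

Lemma within_pair (X Y Z W : topologicalType) (A : set X) (f : X -> Y) (g : X -> Z) (h : Y * Z -> W) :
  {within A, continuous f} -> {within A, continuous g} -> continuous h ->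
  {within A, continuous (fun x => h (f x, g x))}.
Proof.
move=> fc gc hc x; apply: (continuous_comp (cvg_pair (fc x) (gc x))); exact: hc.
Qed.

(** * A finite atlas with a pseudometric *)

Section Atlas.
Variables (R : realType) (N : nat) (M : topologicalType).

(** [dist] will be the maximum of the differences of finitely many bumps and coordinates. It is a
    pseudometric on [M] and separates points when one of them is in [K0]. The constants [1 / 2] and
    [1 / 8] leave room around a point of [K0] inside the unit cube of its chart. *)
Record atlas (K0 : set M) := Atlas {
  ix : Type;
  gc : ix -> M -> 'rV[R]_N;
  gi : ix -> 'rV[R]_N -> M;
  dist : M -> M -> R;
  dist_ge0 : forall x y, 0 <= dist x y;
  distxx : forall x, dist x x = 0;
  distC : forall x y, dist x y = dist y x;
  dist_tri : forall x y z, dist x z <= dist x y + dist y z;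
  dist_cont : continuous (fun p : M * M => dist p.1 p.2);
  dist_chart : forall x, K0 x -> exists i, (forall j, `|gc i x 0 j| < 1 / 2) /\
    forall y, dist x y < 1 / 8 -> unit_cube (gc i y) /\ gi i (gc i y) = y;
  dist_ge : forall i y z, vd (gc i y) (gc i z) <= dist y z;
  dist_inv : forall e, 0 < e -> exists2 d, 0 < d & forall i q q',
    unit_cube q -> unit_cube q' -> vd q q' < d -> dist (gi i q) (gi i q') < e;
  gc_gi : forall i q, unit_cube q -> gc i (gi i q) = q }.

Arguments gc {K0} _ _ _.
Arguments gi {K0} _ _ _.
Arguments dist_ge {K0} _ _ _ _.
Arguments gc_gi {K0} _ _ _ _.

Lemma dist_sep K0 (T : atlas K0) x y : K0 x -> dist T x y = 0 -> x = y.
Proof.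
move=> /(dist_chart T)[i [_ h]] d0.
have [_ <-] : unit_cube (gc T i x) /\ gi T i (gc T i x) = x by apply: h; rewrite distxx.
have [_ <-] : unit_cube (gc T i y) /\ gi T i (gc T i y) = y by apply: h; rewrite d0.
congr gi; apply: vd_eq0; apply/eqP; rewrite eq_le vd_ge0 andbT.
by have := dist_ge T i x y; rewrite d0.
Qed.

Lemma exists_atlas K0 : manifold R N M -> compact K0 -> exists T : atlas K0, True.
Proof.
move=> mM cK.
have [ch chP] := choice (fun x => exists_chart x mM).
pose O x := [set y | 7 / 8 < bump (ch x) y] `&` [set y | vd (coord (ch x) y) 0 < 1 / 2].
have oO x : open (O x).
  have [[bc cc] _ _ _ _] := chP x; apply: openI.
    apply: (@open_comp _ _ (bump (ch x)) [set t | 7 / 8 < t]); last exact: open_gt.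
    by move=> y _; exact: bc.
  apply: (@open_comp _ _ (fun y => vd (coord (ch x) y) 0) [set t | t < 1 / 2]); last exact: open_lt.
  move=> y _; apply: continuous_bigmax => j; apply: cvg_norm; apply: cvgB; first exact: cc.
  exact: cvg_cst.
have [|F _ KF] := finite_cover (O := O) cK.
  move=> x _; apply: open_nbhs_nbhs; split; first exact: oO.
  have [_ _ _ _ [b1 c0]] := chP x.
  by split; rewrite /= ?b1 ?c0 ?vdxx; lra.
pose C (i : F) := ch (val i).
pose di (i : F) y z : R := Num.max `|bump (C i) y - bump (C i) z| (vd (coord (C i) y) (coord (C i) z)).
pose D y z : R := \big[Num.max/0]_(i : F) di i y z.
have DP y z a : 0 <= a -> D y z <= a <-> forall i : F, `|bump (C i) y - bump (C i) z| <= a /\ vd (coord (C i) y) (coord (C i) z) <= a.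
  move=> a0; split=> [/bigmax_leP[_ h] i|h].
    by have := h i isT; rewrite /di ge_max => /andP[].
  by apply/bigmax_leP; split=> // i _; rewrite /di ge_max; apply/andP; exact: h.
have D0 y z : 0 <= D y z by exact: bigmax_ge_id.
have Di y z (i : F) : `|bump (C i) y - bump (C i) z| <= D y z /\ vd (coord (C i) y) (coord (C i) z) <= D y z.
  by move: i; apply/DP.
have gP (i : F) : good_chart (val i) (C i) by exact: chP.
have Dc : continuous (fun p : M * M => D p.1 p.2).
  move=> p; apply: continuous_bigmax => i.
  have [[bc cc] _ _ _ _] := gP i.
  apply: (@continuous_max _ _ (fun p : M * M => `|bump (C i) p.1 - bump (C i) p.2| : R^o)
     (fun p : M * M => vd (coord (C i) p.1) (coord (C i) p.2) : R^o) p).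
    apply: cvg_norm; apply: cvgB.
      by apply: (cont_fst (f := bump (C i))); exact: bc.
    by apply: (cont_snd (f := bump (C i))); exact: bc.
  apply: continuous_bigmax => j; apply: cvg_norm; apply: cvgB.
    by apply: (cont_fst (f := fun y => coord (C i) y 0 j)); exact: cc.
  by apply: (cont_snd (f := fun y => coord (C i) y 0 j)); exact: cc.
unshelve eexists; last by [].
refine (@Atlas K0 F (fun i => coord (C i)) (fun i => invc (C i)) D D0 _ _ _ Dc _ _ _ _).
- by move=> x; apply/eqP; rewrite eq_le D0 andbT; apply/DP => // i; rewrite subrr normr0 vdxx.
- by move=> x y; rewrite /D; apply: eq_bigr => i _; rewrite /di distrC vdC.
- move=> x y z; apply/DP; first by rewrite addr_ge0.
  move=> i; have [h1 h2] := Di x y i; have [h3 h4] := Di y z i; split.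
    have -> : bump (C i) x - bump (C i) z =
      (bump (C i) x - bump (C i) y) + (bump (C i) y - bump (C i) z) by ring.
    by apply: le_trans (ler_normD _ _) _; exact: lerD.
  by apply: le_trans (vd_tri _ (coord (C i) y) _) _; exact: lerD.
(* Within distance [1 / 8] the bump stays above [7 / 8 - 1 / 8 = 3 / 4] and the coordinates below
   [1 / 2 + 1 / 8], so the cube criterion of [good_chart] applies. *)
- move=> x /KF[i0 i0F [b0 c0]]; exists [` i0F]%fset; set i : F := [` i0F]%fset.
  have cx j : `|coord (C i) x 0 j| < 1 / 2.
    have hf : (0 : R) < 1 / 2 by lra.
    by move: c0 => /(vd_lt _ _ hf)/(_ j); rewrite mxE subr0.
  have [_ h2 h3 [_ h4] _] := gP i; split=> // y xy; apply: h3.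
  have [h5 h6] := Di x y i; have h7 : bump (C i) y > 3 / 4.
    have b0' : 7 / 8 < bump (C i) x := b0.
    by have := le_lt_trans h5 xy; rewrite ltr_norml => /andP[_ ?]; lra.
  apply: h2; first by lra.
  move=> j; have h8' := cx j; have := le_trans (vd_coord _ _ j) h6.
  move=> h9; have : `|coord (C i) y 0 j| <= `|coord (C i) x 0 j| + `|coord (C i) x 0 j - coord (C i) y 0 j|.
    by rewrite distrC; have := ler_normD (coord (C i) x 0 j) (coord (C i) y 0 j - coord (C i) x 0 j); rewrite addrC subrK addrC.
  by lra.
- by move=> i y z; have [] := Di y z i.
- move=> e e0.
  have dex (i : F) : exists d, 0 < d /\ forall q q', unit_cube q -> unit_cube q' ->
      vd q q' < d -> D (invc (C i) q) (invc (C i) q') < e.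
    have [_ _ _ [ic _] _] := gP i.
    have cU : compact (@unit_cube R N).
      have -> : @unit_cube R N = [set q : 'rV[R]_N | forall j, `|q 0 j - (0 : 'rV[R]_N) 0 j| <= 1].
        by apply/seteqP; split=> q /= h j; have := h j; rewrite mxE subr0.
      exact: cube_compact.
    have [d d0 hd] := @compact_uniform R _ (@unit_cube R N `*` @unit_cube R N)
       (fun q : 'rV[R]_N * 'rV[R]_N => vd q.1 q.2) (fun q => D (invc (C i) q.1) (invc (C i) q.2))
       (compact_setX cU cU)
       ltac:(apply: continuous_subspaceT => q; apply: continuous_bigmax => j; apply: cvg_norm; apply: cvgB;
         [apply: (cont_fst (f := fun q : 'rV[R]_N => q 0 j)); exact: coord_continuous
         |apply: (cont_snd (f := fun q : 'rV[R]_N => q 0 j)); exact: coord_continuous])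
       (within_pair (within_fst ic) (within_snd ic) Dc)
       ltac:(by move=> q _; exact: vd_ge0)
       ltac:(by move=> q _ /vd_eq0 ->; apply/DP => // k; rewrite subrr normr0 vdxx) e e0.
    by exists d; split=> // q q' cq cq'; apply: (hd (q, q')).
  have [d dP] := choice dex.
  exists (\big[Num.min/1]_(i : F) d i).
    by apply/bigmin_gtP; split=> // i _; have [] := dP i.
  move=> i q q' cq cq' h; have [_] := dP i; apply=> //.
  by apply: lt_le_trans h _; exact: bigmin_le.
- by move=> i q cq; have [_ _ _ [_ h] _] := gP i; exact: h.
Qed.

End Atlas.

Arguments unit_cube {R N} _.
Arguments gc {R N M K0} _ _ _.
Arguments gi {R N M K0} _ _ _.
Arguments dist_ge {R N M K0} _ _ _ _.
Arguments gc_gi {R N M K0} _ _ _ _.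
Arguments dist_inv {R N M K0} _ [e] _.
Arguments dist_chart {R N M K0} _ [x] _.

(** * Contracting a tower off the diagonal *)
Lemma lerp_close (F : realFieldType) (u v w a r : F) : 0 <= a -> a <= 1 -> `|u - v| < r -> `|u - w| < r ->
  `|u - (v + a * (u - v))| < r /\ `|u - (w + a * (u - v))| < 2 * r.
Proof.
move=> a0 a1 h1 h2.
have -> : u - (v + a * (u - v)) = (1 - a) * (u - v) by ring.
have -> : u - (w + a * (u - v)) = (u - w) - a * (u - v) by ring.
have t1 : `|(1 - a) * (u - v)| <= 1 * `|u - v| by rewrite normrM ler_wpM2r // ger0_norm; lra.
have t2 : `|a * (u - v)| <= 1 * `|u - v| by rewrite normrM ler_wpM2r // ger0_norm; lra.
by split; [|apply: le_lt_trans (ler_normB _ _) _]; lra.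
Qed.

Lemma lerp_dist (F : realFieldType) (u v w a b : F) : 0 <= a -> a <= 1 -> `|u - w| <= 1 ->
  `|v + a * (u - v) - (w + b * (u - w))| <= `|v - w| + `|a - b|.
Proof.
move=> a0 a1 h.
have -> : v + a * (u - v) - (w + b * (u - w)) = (1 - a) * (v - w) + (a - b) * (u - w) by ring.
apply: le_trans (ler_normD _ _) _; rewrite !normrM lerD //.
  by rewrite ler_piMl // ger0_norm; lra.
by rewrite ler_piMr.
Qed.

Lemma translate_dist (F : realFieldType) (u v w v' w' a b : F) : 0 <= a -> a <= 1 -> `|u - w| <= 1 ->
  `|v' + a * (u - v) - (w' + b * (u - w))| <= `|v' - w'| + (`|v - w| + `|a - b|).
Proof.
move=> a0 a1 h.
have -> : v' + a * (u - v) - (w' + b * (u - w)) = (v' - w') + (- a * (v - w) + (a - b) * (u - w)) by ring.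
apply: le_trans (ler_normD _ _) _; rewrite lerD2l.
apply: le_trans (ler_normD _ _) _; rewrite !normrM normrN lerD //.
  by rewrite ler_piMl // ger0_norm.
by rewrite ler_piMr.
Qed.

(** * Filling cycles near the diagonal *)

Section Fill.
Variables (R : realType) (n : nat) (M : topologicalType) (K0 : set M) (T : atlas R n.+1 K0).
Implicit Types (q : M * M) (c z : chain (seq (M * M))).
Local Notation D := (dist T).

Definition pd (p q : M * M) : R := Num.max (D p.1 q.1) (D p.2 q.2).

Lemma pd_lt a p q : pd p q < a <-> D p.1 q.1 < a /\ D p.2 q.2 < a.
Proof. by rewrite /pd gt_max; split=> [/andP[]|[? ?]]//; apply/andP. Qed.

Definition near_diag x rho q := D x q.1 < rho /\ D x q.2 < rho.

(** Three sizes are tracked: [rho] bounds the distance to the centre, [r] bounds the distance to the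
    diagonal from below, and [e] bounds the mesh. *)
Definition tight x rho r e c :=
  allc (fun s => small pd e s /\ forall q, q \in s -> near_diag x rho q /\ r <= D q.1 q.2) c.

Definition dif i q := gc T i q.1 - gc T i q.2.

Definition chart_at i x := (forall j, `|gc T i x 0 j| < 1 / 2) /\
  forall y, D x y < 1 / 8 -> unit_cube (gc T i y) /\ gi T i (gc T i y) = y.

(** In a chart both points of a pair are translated by the same vector until the first is the centre
    [x]. The difference does not change, so the pair stays off the diagonal, and it remains to fill
    the cycle of differences in a shell, where the only obstruction is the degree. The quantifiers
    record dependence: [rho1] on [rho2], then [r2] also on [r1], then [e1] also on [e2]. *)
Lemma fill (rho2 : R) : 0 < rho2 -> exists rho1, [/\ 0 < rho1, rho1 <= rho2, rho1 <= 1 / 16 &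
  forall r1, 0 < r1 -> exists r2, [/\ 0 < r2, r2 <= r1 &
  forall e2, 0 < e2 -> exists e1, [/\ 0 < e1, e1 <= e2 &
  forall x i j z, K0 x -> chart_at i x -> sized j z -> tight x rho1 r1 e1 z -> bd z = 0 ->
    (j < n.+1)%N \/ j = n.+1 /\ deg true (push (dif i) z) = false ->
  exists b, [/\ sized j.+1 b, tight x rho2 r2 e2 b & bd b = z]]]].
Proof.
move=> rho20; have [d1 d10 hd1] := dist_inv T rho20.
have [rho1 [rho10 rho12 rho116 rho1d]] :
    exists d, [/\ 0 < d, d <= rho2, d <= 1 / 16 & d <= d1 / 4].
  by apply: exists_min3; rewrite ?divr_gt0.
exists rho1; split=> // r1 r10.
have [dr dr0 hdr] := dist_inv T r10.
have [r2 [r20 r21 r2d r2rho]] := exists_min3 r10 dr0 rho10.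
exists r2; split=> // e2 e20.
have [de de0 hde] := dist_inv T e20.
have [es [es0 esr esd _]] := exists_min3 r20 de0 de0.
have [e1 [e10 e12 e1s _]] := exists_min3 e20 (divr_gt0 es0 (ltr0n R 4)) e20.
exists e1; split=> // x i j z Kx [xi ci] sz tz bz hj.
set xi_ := gc T i x; have xE : gi T i xi_ = x by have [] := ci x; rewrite ?distxx //; lra.
have ball y : D x y < rho1 -> [/\ unit_cube (gc T i y), gi T i (gc T i y) = y &
    forall k, `|xi_ 0 k - gc T i y 0 k| < rho1].
  move=> xy; have [h1 h2] : unit_cube (gc T i y) /\ gi T i (gc T i y) = y by apply: ci; lra.
  split=> // k; apply: le_lt_trans xy; apply: le_trans (dist_ge T i x y); exact: vd_coord.
have zq s q : coef z s -> q \in s ->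
  [/\ (forall k, `|xi_ 0 k - gc T i q.1 0 k| < rho1), (forall k, `|xi_ 0 k - gc T i q.2 0 k| < rho1),
    gi T i (gc T i q.1) = q.1, gi T i (gc T i q.2) = q.2 &
    exists k, r2 <= `|dif i q 0 k|].
  move=> zs qs; have [_ /(_ q qs)[[n1 n2] rq]] := tz s zs.
  have [c1 g1 h1] := ball _ n1; have [c2 g2 h2] := ball _ n2; split=> //.
  have [k hk] : exists k, r2 <= `|gc T i q.1 0 k - gc T i q.2 0 k|.
    apply: exists_large => //; apply: le_trans r2d _; rewrite leNgt; apply/negP => h.
    by have := hdr i _ _ c1 c2 h; rewrite g1 g2 ltNge rq.
  by exists k; rewrite !mxE.
have zsm s p q : coef z s -> p \in s -> q \in s -> forall k,
    `|gc T i p.1 0 k - gc T i q.1 0 k| < e1 /\ `|gc T i p.2 0 k - gc T i q.2 0 k| < e1.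
  move=> zs ps qs k; have [/(_ p q ps qs)/pd_lt[h1 h2] _] := tz s zs.
  by split; [apply: le_lt_trans h1|apply: le_lt_trans h2];
    apply: le_trans (dist_ge T i _ _); exact: vd_coord.
(* The pair with first point [x] and difference [w]. *)
pose E w : M * M := (gi T i xi_, gi T i (xi_ - w)).
pose F a q : M * M := (gi T i (gc T i q.1 + a *: (xi_ - gc T i q.1)),
                       gi T i (gc T i q.2 + a *: (xi_ - gc T i q.1))).
have F0 : push (F 0) z = z.
  apply: push_id => s zs q qs; have [_ _ g1 g2 _] := zq s q zs qs.
  by rewrite /F !scale0r !addr0 g1 g2 -surjective_pairing.
have F1 : push (F 1) z = push E (push (dif i) z).
  rewrite push_push; apply: eq_push => s zs q qs /=.
  rewrite /F /E /dif !scale1r; congr (gi T i _, gi T i _); apply/rowP => k; rewrite !mxE; ring.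
have ha2 : forall k, `|xi_ 0 k| < 1 / 2 by [].
have coordF s q a k : coef z s -> q \in s -> 0 <= a <= 1 ->
  `|xi_ 0 k - (gc T i q.1 + a *: (xi_ - gc T i q.1)) 0 k| < rho1 /\
  `|xi_ 0 k - (gc T i q.2 + a *: (xi_ - gc T i q.1)) 0 k| < 2 * rho1.
  move=> zs qs /andP[a0 a1]; have [/(_ k) h1 /(_ k) h2 _ _ _] := zq s q zs qs.
  by rewrite !mxE; apply: (lerp_close a0 a1 h1 h2).
have rho1lt : rho1 < 2 * rho1 by lra.
have cubeW (w : 'rV[R]_n.+1) : (forall k, `|xi_ 0 k - w 0 k| < 2 * rho1) -> unit_cube w.
  move=> h k; have := ha2 k; have := h k; rewrite !ltr_norml ler_norml; lra.
have nearW (w : 'rV[R]_n.+1) : (forall k, `|xi_ 0 k - w 0 k| <= 2 * rho1) -> D x (gi T i w) < rho2.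
  move=> h; rewrite -xE; apply: hd1.
  - by move=> k; apply: ltW; have := ha2 k; lra.
  - move=> k; have := ha2 k; have := h k; rewrite !ltr_norml !ler_norml; lra.
  - by apply/(vd_lt _ _ d10) => k; apply: le_lt_trans (h k) _; lra.
have [||b1 [sb1 bb1 ib1]] := @homotopy_small R _ _ pd F e2 (de / 4) z j _ sz bz.
- by rewrite divr_gt0.
- move=> s p q a b zs ps qs a01 b01 ab.
  have cp k := coordF s p a k zs ps a01; have cq k := coordF s q b k zs qs b01.
  have [_ _ _ _ _] := zq s q zs qs.
  have hq k : `|xi_ 0 k - gc T i q.1 0 k| < rho1 by have [h _ _ _ _] := zq s q zs qs.
  have q1 k : `|xi_ 0 k - gc T i q.1 0 k| <= 1 by have := hq k; lra.
  have pq := zsm s p q zs ps qs.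
  move: a01 b01 => /andP[va0 va1] /andP[vb0 vb1].
  apply/pd_lt; split=> /=; apply: hde.
  + by apply: cubeW => k; have [h _] := cp k; exact: lt_trans h rho1lt.
  + by apply: cubeW => k; have [h _] := cq k; exact: lt_trans h rho1lt.
  + apply/(vd_lt _ _ de0) => k; rewrite !mxE.
    have [h1 _] := pq k; apply: le_lt_trans (lerp_dist _ b va0 va1 (q1 k)) _; lra.
  + by apply: cubeW => k; have [] := cp k.
  + by apply: cubeW => k; have [] := cq k.
  + apply/(vd_lt _ _ de0) => k; rewrite !mxE.
    have [h1 h3] := pq k; apply: le_lt_trans (translate_dist _ _ _ b va0 va1 (q1 k)) _; lra.
have r2rho' : r2 <= 2 * rho1 by lra.
have sd : sized j (push (dif i) z) by exact: sized_push.
have bd0 : bd (push (dif i) z) = 0 by rewrite -push_bd bz push0.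
have id : inshell r2 (2 * rho1) es n.+1 (push (dif i) z).
  move=> _ /coef_push[s zs ->]; split.
    move=> _ _ /mapP[p ps ->] /mapP[q qs ->]; apply/(vd_lt _ _ es0) => k; rewrite !mxE.
    have [] := zsm s p q zs ps qs k.
    by rewrite !ltr_norml; lra.
  move=> _ /mapP[q qs ->]; have [h1 h2 _ _ [k hk]] := zq s q zs qs; split.
  - by move=> l; rewrite leqNgt ltn_ord.
  - by move=> l; rewrite !mxE; have := h1 l; have := h2 l; rewrite !ltr_norml ler_norml; lra.
  - by exists k.
have [b2 [sb2 ib2 bb2]] : bounded r2 (2 * rho1) es n.+1 j (push (dif i) z).
  case: hj => [jn|[jn dz]].
    by have [+ _] := shell_homology es0 esr r2rho' (leqnn n.+1); apply.
  by subst j; apply: deg0_bounded.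
have xc : unit_cube xi_ by move=> k; apply: ltW; have := ha2 k; lra.
exists (b1 + push E b2); split.
- by apply: sizedD => //; exact: sized_push.
- apply: allcD.
    move=> t /ib1[st [s zs hs]]; split=> // _ /hs[a [q [a01 qs ->]]] /=.
    have cF k := coordF s q a k zs qs a01; split; first split.
    + by apply: nearW => k; have [h _] := cF k; exact: ltW (lt_trans h rho1lt).
    + by apply: nearW => k; have [_ h] := cF k; exact: ltW.
    + have [_ _ _ _ [k hk]] := zq s q zs qs; apply: le_trans hk _.
      apply: le_trans (dist_ge T i _ _); rewrite !gc_gi; last 2 first.
      * by apply: cubeW => l; have [] := cF l.
      * by apply: cubeW => l; have [h _] := cF l; exact: lt_trans h rho1lt.
      apply: le_trans (vd_coord _ _ k); rewrite !mxE.
      by rewrite le_eqVlt; apply/orP; left; apply/eqP; congr (`|_|); ring.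
  move=> _ /coef_push[s /ib2[ss hs] ->]; split.
    move=> _ _ /mapP[w ws ->] /mapP[v vs ->]; apply/pd_lt; rewrite /E /= distxx; split=> //.
    have cw u : u \in s -> unit_cube (xi_ - u).
      move=> /hs[_ hu _] k; have := ha2 k; have := hu k; rewrite !mxE.
      by rewrite !ler_norml !ltr_norml; lra.
    apply: hde; [exact: cw|exact: cw|].
    apply: lt_le_trans esd; apply/(vd_lt _ _ es0) => k; rewrite !mxE.
    have := ss w v ws vs; move/(vd_lt _ _ es0)/(_ k).
    by rewrite !ltr_norml; lra.
  move=> _ /mapP[w /hs[_ hw [k _ hk]] ->]; rewrite /E /= ; split; first (split; first by rewrite /= xE distxx).
    by apply: nearW => l; rewrite !mxE opprB addrC subrK; exact: hw.
  apply: le_trans hk _; apply: le_trans (dist_ge T i _ _); rewrite !gc_gi //; last first.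
    move=> l; have := ha2 l; have := hw l; rewrite !mxE.
    by rewrite !ler_norml !ltr_norml; lra.
  by apply: le_trans (vd_coord _ _ k); rewrite !mxE opprB addrC subrK.
- by rewrite bdD bb1 -push_bd bb2 F0 F1 addcK.
Qed.

(** The inverse charts are uniformly continuous, so points that are [r] apart in [M] cannot have
    arbitrarily close coordinates. *)
Lemma tight_nonzero (r : R) : 0 < r -> exists2 d, 0 < d & forall x i rho e b,
    chart_at i x -> rho <= 1 / 8 -> e <= d -> tight x rho r e b ->
  allc (nonzero (2 * d)) (push (dif i) b).
Proof.
move=> r0; have [dr dr0 hdr] := dist_inv T r0.
exists (dr / 2) => [|x i rho e b [xi ci] rho8 ed tb]; first by rewrite divr_gt0.
have -> : 2 * (dr / 2) = dr by field.
move=> _ /coef_push[s /tb[ss hs] ->]; split.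
  move=> _ _ /mapP[p ps ->] /mapP[q qs ->]; apply/(vd_lt _ _ dr0) => k; rewrite !mxE.
  have /pd_lt[h1 h2] := ss p q ps qs.
  have := le_lt_trans (le_trans (vd_coord _ _ k) (dist_ge T i _ _)) h1.
  have := le_lt_trans (le_trans (vd_coord _ _ k) (dist_ge T i _ _)) h2.
  by rewrite !ltr_norml; lra.
move=> _ /mapP[q /hs[[n1 n2] rq] ->].
have [c1 g1] := ci _ (lt_le_trans n1 rho8); have [c2 g2] := ci _ (lt_le_trans n2 rho8).
have [k hk] : exists k, dr <= `|gc T i q.1 0 k - gc T i q.2 0 k|.
  apply: exists_large => //; rewrite leNgt; apply/negP => h.
  by have := hdr i _ _ c1 c2 h; rewrite g1 g2 ltNge rq.
by exists k; rewrite !mxE.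
Qed.

End Fill.

Arguments dif {R n M K0} T i q.
Arguments chart_at {R n M K0} T i x.
Arguments pd {R n M K0} T p q.
Arguments tight {R n M K0} T x rho r e c.
Arguments near_diag {R n M K0} T x rho q.

Lemma pair_additive (S : choiceType) (f : chain S -> bool) c :
  (forall c d, f (c + d) = f c (+) f d) -> pair (fun s => f (sg s)) c = f c.
Proof.
move=> fD; have f0 : f 0 = false by have := fD 0 0; rewrite addr0; case: (f 0).
rewrite -[in RHS](lin_id c) /pair /linV /lin /linV.
by elim: (enum_fset c) => [|x s IH]; rewrite ?big_nil// !big_cons fD IH.
Qed.

Section Levels.
Variables (R : realType) (n : nat) (M : topologicalType) (K0 : set M) (T : atlas R n.+1 K0).
Local Notation D := (dist T).

Definition fillable (rho1 r1 e1 rho2 r2 e2 : R) := forall x i j z, K0 x -> chart_at T i x ->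
  sized j z -> tight T x rho1 r1 e1 z -> bd z = 0 ->
  (j < n.+1)%N \/ j = n.+1 /\ deg true (push (dif T i) z) = false ->
  exists b, [/\ sized j.+1 b, tight T x rho2 r2 e2 b & bd b = z].

Lemma exists_levels L (rtop : R) : 0 < rtop -> exists rho : nat -> R,
  [/\ rho L = rtop, (forall k, (k <= L)%N -> 0 < rho k), (forall k, (k < L)%N -> rho k <= rho k.+1 /\ 2 * rho k <= 1 / 8) &
  forall r0, 0 < r0 -> exists r : nat -> R,
  [/\ r 0%N = r0, (forall k, (k <= L)%N -> 0 < r k), (forall k, (k < L)%N -> r k.+1 <= r k) &
  forall etop, 0 < etop -> exists e : nat -> R,
  [/\ e L = etop, (forall k, (k <= L)%N -> 0 < e k), (forall k, (k < L)%N -> e k <= e k.+1) &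
  forall k, (k < L)%N -> fillable (2 * rho k) (r k) (e k) (rho k.+1 / 2) (r k.+1) (e k.+1)]]].
Proof.
elim: L rtop => [|L IH] rtop rt0.
  exists (fun=> rtop); split=> // r0 r00; exists (fun=> r0); split=> // etop et0.
  by exists (fun=> etop).
have [rho1 [rho10 rho12 rho116 F1]] := fill T (divr_gt0 rt0 (ltr0n R 2)).
have [rho [rhoL rho0 rhoS IH1]] := IH (rho1 / 2) (divr_gt0 rho10 (ltr0n R 2)).
have upd_lt (f : nat -> R) a k : (k <= L)%N -> (if k == L.+1 then a else f k) = f k.
  by move=> kL; rewrite ltn_eqF.
have top (P : nat -> R -> Prop) (f : nat -> R) a : (forall k, (k <= L)%N -> P k (f k)) -> P L.+1 a ->
    forall k, (k <= L.+1)%N -> P k (if k == L.+1 then a else f k).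
  move=> hf ha k; rewrite leq_eqVlt => /orP[/eqP->|kL]; first by rewrite eqxx.
  by rewrite upd_lt //; exact: hf.
exists (fun k => if k == L.+1 then rtop else rho k); split.
- by rewrite eqxx.
- exact: (top (fun _ a => 0 < a)).
- move=> k kL /=; rewrite (upd_lt _ _ k) // ?eqSS; have [->|kL'] := eqVneq k L.
    by rewrite rhoL; split; lra.
  by apply: rhoS; rewrite ltn_neqAle kL' -ltnS.
move=> r0 r00; have [r [rr0 rpos rS IH2]] := IH1 r0 r00.
have [r2 [r20 r21 F2]] := F1 (r L) (rpos L (leqnn L)).
exists (fun k => if k == L.+1 then r2 else r k); split=> //.
- exact: (top (fun _ a => 0 < a)).
- move=> k kL /=; rewrite (upd_lt _ _ k) // ?eqSS; have [->//|kL'] := eqVneq k L.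
  by apply: rS; rewrite ltn_neqAle kL' -ltnS.
move=> etop et0; have [e1 [e10 e12 F3]] := F2 etop et0.
have [e [eL epos eS IH3]] := IH2 e1 e10.
exists (fun k => if k == L.+1 then etop else e k); split=> //.
- by rewrite eqxx.
- exact: (top (fun _ a => 0 < a)).
- move=> k kL /=; rewrite (upd_lt _ _ k) // ?eqSS; have [->|kL'] := eqVneq k L; first by rewrite eL.
  by apply: eS; rewrite ltn_neqAle kL' -ltnS.
- move=> k kL /=; rewrite !(upd_lt _ _ k) // ?eqSS; have [->|kL'] := eqVneq k L; last first.
    by apply: IH3; rewrite ltn_neqAle kL' -ltnS.
  rewrite rhoL eL; have -> : 2 * (rho1 / 2) = rho1 by field.
  by move=> x i j z Kx ci sz tz bz hj; exact: (F3 x i j z).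
Qed.

End Levels.

Definition swap (X : Type) (q : X * X) := (q.2, q.1).
Lemma swapK (X : Type) : involutive (@swap X). Proof. by case. Qed.

(** * The obstruction cocycle of pushing pairs off the diagonal *)

Section Obstruction.
Variables (R : realType) (n : nat) (M : topologicalType) (K0 : set M) (T : atlas R n.+1 K0).
Local Notation D := (dist T).
Variables (rho r ep : nat -> R) (R0 es dtop : R) (ic : M -> ix T).
Let L := n.+2.
Hypothesis rho_pos : forall k, (k <= L)%N -> 0 < rho k.
Hypothesis rhoS : forall k, (k < L)%N -> rho k <= rho k.+1.
Hypothesis rho_half : 2 * rho n.+1 <= 1 / 8.
Hypothesis rho_top : rho L <= 1 / 8.
Hypothesis rS : forall k, (k < L)%N -> r k.+1 <= r k.
Hypothesis r0E : r 0%N = R0.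
Hypothesis epS : forall k, (k < L)%N -> ep k <= ep k.+1.
Hypothesis hfill : forall k, (k < L)%N ->
  fillable T (2 * rho k) (r k) (ep k) (rho k.+1 / 2) (r k.+1) (ep k.+1).
Hypothesis R0_small : R0 <= rho 0%N / 4.
Hypothesis es_pos : 0 < es.
Hypothesis es_small : es <= rho 0%N / 8.
Hypothesis es_ep : es <= ep 0%N.
Hypothesis icP : forall x, K0 x -> chart_at T (ic x) x.
Hypothesis dtop_pos : 0 < dtop.
Hypothesis ep_top : ep L <= dtop.
Hypothesis htop : forall x i rh e b, chart_at T i x -> rh <= 1 / 8 -> e <= dtop ->
  tight T x rh (r L) e b -> allc (nonzero (2 * dtop)) (push (dif T i) b).

Local Notation NP := ((M * M) * bool)%type.
(** The label makes the swap free even on the diagonal, where the contraction ends. *)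
Definition tn (p : NP) : NP := (swap p.1, ~~ p.2).
Lemma tnK : involutive tn. Proof. by move=> [[x y] b]; rewrite /tn /= negbK. Qed.

Definition dom (s : seq NP) := (forall p, p \in s -> K0 p.1.1 /\ K0 p.1.2) /\
  small (fun p q : NP => pd T p.1 q.1) es s.
Definition far (s : seq NP) := forall p, p \in s -> R0 <= D p.1.1 p.1.2.
(** A tuple separated by [R0] is left as it is. Any other one becomes a chain of the same length,
    off the diagonal and near every point of the tuple, with the constants of the level given by the
    length. *)
Definition admissible (s : seq NP) (c : chain (seq (M * M))) :=
  [/\ sized (size s) c, (far s -> c = sg (map fst s))
    & ~ far s -> allc (fun u => small (pd T) (ep (size s)) u /\ forall q, q \in u ->
      r (size s) <= D q.1 q.2 /\ forall p, p \in s ->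
        near_diag T p.1.1 (rho (size s)) q /\ near_diag T p.1.2 (rho (size s)) q) c].

Let rho_mono k l : (k <= l)%N -> (l <= L)%N -> rho k <= rho l.
Proof.
elim: l => [|l IH]; first by rewrite leqn0 => /eqP->.
rewrite leq_eqVlt => /orP[/eqP->//|]; rewrite ltnS => kl lL.
by apply: le_trans (IH kl (ltnW lL)) _; exact: rhoS.
Qed.
Let ep_mono k l : (k <= l)%N -> (l <= L)%N -> ep k <= ep l.
Proof.
elim: l => [|l IH]; first by rewrite leqn0 => /eqP->.
rewrite leq_eqVlt => /orP[/eqP->//|]; rewrite ltnS => kl lL.
by apply: le_trans (IH kl (ltnW lL)) _; exact: epS.
Qed.
Let r_mono k l : (k <= l)%N -> (l <= L)%N -> r l <= r k.
Proof.
elim: l => [|l IH]; first by rewrite leqn0 => /eqP->.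
rewrite leq_eqVlt => /orP[/eqP->//|]; rewrite ltnS => kl lL.
by apply: le_trans (IH kl (ltnW lL)); exact: rS.
Qed.

Lemma dom_sub s u : {subset u <= s} -> dom s -> dom u.
Proof. by move=> us [h1 h2]; split; [move=> p /us; exact: h1|exact: small_sub h2]. Qed.

Lemma far_sub s u : {subset u <= s} -> far s -> far u.
Proof. by move=> us h p /us; exact: h. Qed.

Lemma dom_tn s : dom s -> dom (map tn s).
Proof.
move=> [h1 h2]; split; first by move=> _ /mapP[p /h1[? ?] ->].
move=> _ _ /mapP[p ps ->] /mapP[q qs ->]; have /pd_lt[? ?] := h2 p q ps qs.
exact/pd_lt.
Qed.

Lemma far_tn s : far (map tn s) <-> far s.
Proof.
split=> h p ps; last by case/mapP: ps => q qs -> /=; rewrite distC; exact: h.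
by have := h (tn p) (map_f tn ps); rewrite /= distC.
Qed.

(** One pair of the tuple is within [R0] of the diagonal and the mesh is at most [es], so the points
    of all pairs lie in one small ball. *)
Lemma near_close s p0 p q : dom s -> p0 \in s -> D p0.1.1 p0.1.2 < R0 -> p \in s -> q \in s ->
  [/\ D p.1.1 q.1.1 < rho 0%N / 2, D p.1.1 q.1.2 < rho 0%N / 2,
      D p.1.2 q.1.1 < rho 0%N / 2 & D p.1.2 q.1.2 < rho 0%N / 2].
Proof.
move=> [_ sm] p0s p00 ps qs.
have /pd_lt[a1 a2] := sm p q ps qs; have /pd_lt[b1 b2] := sm p p0 ps p0s.
have /pd_lt[c1 c2] := sm p0 q p0s qs; have := rho_pos (leq0n L) => rp.
have [d1 d2] := (dist_tri T p.1.1 p0.1.1 q.1.2, dist_tri T p0.1.1 p0.1.2 q.1.2).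
have [d3 d4] := (dist_tri T p.1.2 p0.1.2 q.1.1, dist_tri T p0.1.2 p0.1.1 q.1.1).
by have := distC T p0.1.2 p0.1.1; have := R0_small; have := es_small; split; lra.
Qed.

Lemma not_far s : ~ far s -> exists2 p, p \in s & D p.1.1 p.1.2 < R0.
Proof.
move=> h; apply: contrapT => h'; apply: h => p ps; rewrite leNgt; apply/negP => hp.
by apply: h'; exists p.
Qed.

(** Unchanged faces and filled faces both satisfy the bounds of level [k] around any centre close to
    [s], so [fill] can be applied to their sum. *)
Lemma faces_tight s k th x : dom s -> size s = k.+1 -> (k <= n.+1)%N -> K0 x ->
    (forall p, p \in s -> D x p.1.1 < rho 0%N / 2 /\ D x p.1.2 < rho 0%N / 2) ->
    (forall u, coef (bdt s) u -> admissible u (th u)) ->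
  sized k (lin th (bdt s)) /\ tight T x (2 * rho k) (r k) (ep k) (lin th (bdt s)).
Proof.
move=> ds sk kn Kx xs hth; split.
  move=> w /coef_linP[u us uw]; have [su _ _] := hth u us.
  by rewrite (su w uw); have [_] := coef_bdt us; rewrite sk => -[].
move=> w /coef_linP[u us uw]; have [us' su] := coef_bdt us.
have {}su : size u = k by move: su; rewrite sk => -[].
have [_ hf hn] := hth u us.
have kL : (k <= L)%N by apply: leq_trans kn _.
have rk : 0 < rho k by exact: rho_pos.
have r0k := rho_mono (leq0n k) kL.
have [fu|nfu] := pselect (far u).
  move: uw; rewrite hf // coef_sg => /eqP->; split.
    move=> _ _ /mapP[p pu ->] /mapP[q qu ->]; have [_ sm] := ds.
    apply: lt_le_trans (sm p q (us' p pu) (us' q qu)) _; apply: le_trans es_ep _.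
    exact: ep_mono.
  move=> _ /mapP[p pu ->]; have [h1 h2] := xs p (us' p pu); split; first by split; lra.
  by apply: le_trans (fu p pu); rewrite -r0E; exact: r_mono.
have [h1 h2] := hn nfu w uw; rewrite su in h1 h2; split=> // q qw.
have [p pu _] := not_far nfu; have [rq /(_ p pu)[[n1 n2] _]] := h2 q qw.
split=> //; have [x1 _] := xs p (us' p pu).
have := dist_tri T x p.1.1 q.1; have := dist_tri T x p.1.1 q.2.
by move=> ? ?; split; lra.
Qed.

(** Up to length [n+1] the cycles to be filled have length at most [n], where [fill] imposes no
    condition on the degree. *)
Lemma exists_theta : exists th : seq NP -> chain (seq (M * M)), forall s, dom s ->
  (size s <= n.+1)%N -> carried (@bdt _) size (map tn) (@swap M) admissible th s.
Proof.
apply: acyclic_carrier.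
- by move=> s u ds /coef_bdt[us su]; split=> //; exact: dom_sub ds.
- by move=> s _; rewrite -[lin _ _]/(bd (bdt s)) -bd_sg bdbd.
- by move=> s; rewrite -map_comp map_id_in // => p _ /=; rewrite tnK.
- exact: dom_tn.
- by move=> s; rewrite size_map.
- by move=> s _; rewrite -push_bdt.
- move=> [|[q b] s] // _ _; apply/eqP => -[_ + _]; by case: b.
- exact: swapK.
- move=> s c ds [sc hf hn]; split.
  + by rewrite size_map; exact: sized_push.
  + move=> /far_tn/hf->; rewrite push_sg; congr sg.
    by rewrite -[LHS]map_comp -[RHS]map_comp.
  + move=> nf; have nf' : ~ far s by move=> /far_tn.
    rewrite size_map => _ /coef_push[u /(hn nf')[h1 h2] ->]; split.
      move=> _ _ /mapP[p pu ->] /mapP[q qu ->]; have /pd_lt[? ?] := h1 p q pu qu.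
      exact/pd_lt.
    move=> _ /mapP[q /h2[h3 h4] ->]; rewrite distC; split=> // _ /mapP[p /h4[[? ?] [? ?]] ->].
    by [].
- move=> s _ /size0nil->; split.
  + by move=> u; rewrite coef_sg => /eqP->.
  + by [].
  + by move=> nf; case: nf.
- move=> s th ds /andP[s0 sn] hth bz.
  have [fs|nfs] := pselect (far s).
    exists (sg (map fst s)); first split.
    + by move=> u; rewrite coef_sg => /eqP->; rewrite size_map.
    + by [].
    + by [].
    rewrite bd_sg -push_bdt /push; apply: eq_lin => u us; have [_ -> //] := hth u us.
    by apply: far_sub fs; have [] := coef_bdt us.
  case sk : (size s) s0 sn => [//|k] _ kn.
  have [p0 p0s p00] := not_far nfs; have [/(_ p0 p0s)[Kx _] _] := ds.
  have cl p q := @near_close s p0 p q ds p0s p00.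
  have [|sz tz] := faces_tight ds sk (ltnW kn) Kx _ hth.
    by move=> p ps; have [] := cl p0 p p0s ps.
  have kL' : (k < L)%N by apply: leq_trans kn _.
  have [|b [sb tb bb]] := hfill kL' Kx (icP Kx) sz tz bz; first by left.
  exists b => //; split; rewrite ?sk // => _ u /tb[h1 h2]; split=> // q /h2[[n1 n2] rq].
  split=> // p ps; have [d1 _ d3 _] := cl p p0 ps p0s.
  have kL : (k.+1 <= L)%N by apply: leq_trans kn _.
  have := rho_mono (leq0n k.+1) kL => r0k.
  have [t1 t2] := (dist_tri T p.1.1 p0.1.1 q.1, dist_tri T p.1.1 p0.1.1 q.2).
  have [t3 t4] := (dist_tri T p.1.2 p0.1.1 q.1, dist_tri T p.1.2 p0.1.1 q.2).
  by split; split; lra.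
Qed.

Lemma tight_weaken x rh rh' r1 r2 e1 e2 b : rh <= rh' -> r2 <= r1 -> e1 <= e2 ->
  tight T x rh r1 e1 b -> tight T x rh' r2 e2 b.
Proof.
move=> h1 h2 h3 tb s /tb[ss hs]; split.
  by move=> p q ps qs; apply: lt_le_trans h3; exact: ss.
move=> q /hs[[n1 n2] rq]; split; last exact: le_trans rq.
by split; apply: lt_le_trans h1.
Qed.

(** A filling found in the chart of [x] also bounds the differences read in the chart of [y];
    vanishing of the degree is therefore independent of the chart. *)
Lemma compare x y z : K0 x -> K0 y -> D y x < rho 0%N / 2 -> sized n.+1 z -> bd z = 0 ->
    tight T x (2 * rho n.+1) (r n.+1) (ep n.+1) z ->
  deg true (push (dif T (ic x)) z) = false -> deg true (push (dif T (ic y)) z) = false.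
Proof.
move=> Kx Ky xy sz bz tz dz.
have [|b [sb tb <-]] := hfill (ltnSn n.+1) Kx (icP Kx) sz tz bz; first by right.
have r0L := rho_mono (leq0n L) (leqnn L).
rewrite push_bd; apply: (@deg_bd0 _ _ (2 * dtop)); first by rewrite mulr_gt0.
  exact: sized_push.
apply: (htop (icP Ky) rho_top ep_top) => s /tb[h1 h2]; split=> // q /h2[[n1 n2] rq].
have t1 := dist_tri T y x q.1; have t2 := dist_tri T y x q.2.
by split=> //; split; lra.
Qed.

Variable th : seq NP -> chain (seq (M * M)).
Hypothesis hth : forall s, dom s -> (size s <= n.+1)%N ->
  carried (@bdt _) size (map tn) (@swap M) admissible th s.

Lemma bd_th c : allc (fun s => dom s /\ (size s <= n.+1)%N) c -> bd (lin th c) = lin th (bd c).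
Proof.
move=> hc; rewrite /bd !lin_lin; apply: eq_lin => s cs; have [ds sn] := hc s cs.
by have [_ + _ _] := hth ds sn.
Qed.

Lemma th_tn c : allc (fun s => dom s /\ (size s <= n.+1)%N) c ->
  lin th (push tn c) = push (@swap M) (lin th c).
Proof.
move=> hc; rewrite /push !lin_lin; apply: eq_lin => s cs; rewrite lin_sg.
by have [ds sn] := hc s cs; have [_ _ + _] := hth ds sn.
Qed.

Lemma face_dom s u : dom s -> (size s <= n.+2)%N -> coef (bdt s) u -> dom u /\ (size u <= n.+1)%N.
Proof.
move=> ds sn /coef_bdt[us su]; split; first exact: dom_sub ds.
by move: sn; rewrite su.
Qed.

Lemma bd_th_bdt s : dom s -> (size s <= n.+2)%N -> bd (lin th (bdt s)) = 0.
Proof.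
move=> ds sn; rewrite bd_th; last by move=> u; exact: face_dom.
by rewrite -bd_sg bdbd lin0.
Qed.

Lemma th_far s : dom s -> (size s <= n.+2)%N -> far s -> lin th (bdt s) = bdt (map fst s).
Proof.
move=> ds sn fs; rewrite -push_bdt /push; apply: eq_lin => u us.
have fu : far u by apply: far_sub fs; have [] := coef_bdt us.
by have [du su] := face_dom ds sn us; have [[_ /(_ fu) -> _] _ _ _] := hth du su.
Qed.

Definition degx x s := deg true (push (dif T (ic x)) (lin th (bdt s))).
(** The obstruction to pushing a tuple of length [n+2]: the degree of the differences along its
    pushed boundary, read in the chart of its first point. Far tuples need no push and get the value
    zero. *)
Definition mu (s : seq NP) := if s is p :: _ then ~~ `[< far s >] && degx p.1.1 s else false.

Let tight_faces s x : dom s -> size s = n.+2 -> K0 x ->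
    (forall p, p \in s -> D x p.1.1 < rho 0%N / 2 /\ D x p.1.2 < rho 0%N / 2) ->
  sized n.+1 (lin th (bdt s)) /\ tight T x (2 * rho n.+1) (r n.+1) (ep n.+1) (lin th (bdt s)).
Proof.
move=> ds sn Kx xs; apply: faces_tight => // u us.
by have [du su] := face_dom ds (eq_leq sn) us; have [] := hth du su.
Qed.

(** By [compare], the chart of any centre nearby gives the same value. For a far tuple the pushed
    boundary is its own boundary, which bounds off the diagonal, so the degree is zero there too. *)
Lemma mu_eq s x : dom s -> size s = n.+2 -> K0 x ->
    (forall p, p \in s -> D x p.1.1 < rho 0%N / 2 /\ D x p.1.2 < rho 0%N / 2) ->
  mu s = degx x s.
Proof.
move=> ds sn Kx xs; case es' : s => [|p s']; first by move: sn; rewrite es'.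
have muE : mu (p :: s') = ~~ `[< far (p :: s') >] && degx p.1.1 (p :: s') by [].
rewrite -es' in muE *; rewrite muE; case: asboolP => [fs|nf] /=.
  rewrite /degx th_far // ?sn // push_bdt -bd_sg; apply/esym; apply: (@deg_bd0 _ _ (2 * dtop)).
  - by rewrite mulr_gt0.
  - by move=> u; rewrite coef_sg => /eqP->; rewrite !size_map.
  rewrite -push_sg; apply: (htop (icP Kx) (rh := rho 0%N / 2) (e := es)).
  - have := rho_mono (leq0n L) (leqnn L); have := rho_pos (leq0n L); have := rho_top; lra.
  - apply: le_trans es_ep _; apply: le_trans ep_top; exact: ep_mono.
  apply: allc_sg; split.
    by move=> _ _ /mapP[a pa ->] /mapP[b pb ->]; have [_] := ds; apply.
  move=> _ /mapP[a pa ->]; have [? ?] := xs a pa; split=> //.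
  by apply: le_trans (fs a pa); rewrite -r0E; exact: r_mono.
have ps : p \in s by rewrite es' inE eqxx.
have [p0 p0s p00] := not_far nf.
have [[Kp _] [Dxp _]] := (ds.1 p ps, xs p ps).
have [sz tx] := tight_faces ds sn Kx xs.
have [_ tp] : sized n.+1 (lin th (bdt s)) /\
    tight T p.1.1 (2 * rho n.+1) (r n.+1) (ep n.+1) (lin th (bdt s)).
  by apply: tight_faces => // q qs; have [] := near_close ds p0s p00 ps qs.
have bz := bd_th_bdt ds (eq_leq sn).
have Dpx : D p.1.1 x < rho 0%N / 2 by rewrite distC.
have h1 := compare Kx Kp Dpx sz bz tx; have h2 := compare Kp Kx Dxp sz bz tp.
rewrite /degx; apply/idP/idP => h; apply: contraT => /negbTE h'.
  by rewrite (h1 h') in h.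
by rewrite (h2 h') in h.
Qed.

(** If [w] is not far, a single chart serves all its faces, and the sum is the degree of the image
    of a double boundary. *)
Lemma mu_cocycle w : dom w -> size w = n.+3 -> pair mu (bdt w) = false.
Proof.
move=> dw sw; have [fw|nfw] := pselect (far w).
  apply: pair_eq0 => s /coef_bdt[sub _]; case es' : s => [//|p s'] /=.
  by rewrite -es'; case: asboolP => // nf; case: nf; apply: far_sub fw.
have [p0 p0w p00] := not_far nfw; have [Kx _] := dw.1 p0 p0w.
rewrite (@eq_pair _ _ (degx p0.1.1)); last first.
  move=> s /coef_bdt[sub]; rewrite sw => -[ss]; apply: mu_eq => //; first exact: dom_sub dw.
  by move=> p /sub pw; have [] := near_close dw p0w p00 p0w pw.
pose f c := deg true (push (dif T (ic p0.1.1)) (lin th (bd c))).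
rewrite (@eq_pair _ _ (fun s => f (sg s))); last by move=> s _; rewrite /f bd_sg.
rewrite pair_additive /f; last by move=> a b; rewrite bdD linD pushD degD.
by rewrite -bd_sg bdbd lin0 push0 /deg pair0.
Qed.

(** Exchanging the two points changes the sign of the differences, and on a cycle the counts from
    the two signs agree. *)
Lemma mu_tn s : dom s -> size s = n.+2 -> mu (map tn s) = mu s.
Proof.
move=> ds sn; case es' : s => [//|p s']; rewrite -es'.
have [fs|nf] := pselect (far s).
  rewrite /mu es' /=; case: asboolP => [_|[]]; last by apply/(far_tn (p :: s')); rewrite -es'.
  by case: asboolP => // -[]; rewrite -es'.
have [p0 p0s p00] := not_far nf; have [Kx _] := ds.1 p0 p0s.
have cl q (qs : q \in s) := near_close ds p0s p00 p0s qs.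
have [sz tz] : sized n.+1 (lin th (bdt s)) /\
    tight T p0.1.1 (2 * rho n.+1) (r n.+1) (ep n.+1) (lin th (bdt s)).
  by apply: tight_faces => // q /cl[].
rewrite (@mu_eq s p0.1.1) //; last by move=> q /cl[].
rewrite (@mu_eq (map tn s) p0.1.1) ?size_map //; [|exact: dom_tn|]; last first.
  by move=> _ /mapP[q /cl[? ? _ _] ->].
rewrite /degx -push_bdt th_tn; last by move=> u; apply: face_dom => //; rewrite sn.
set z := lin th (bdt s) in sz tz *; have bz : bd z = 0 by apply: bd_th_bdt; rewrite ?sn.
have -> : push (dif T (ic p0.1.1)) (push (@swap M) z) = push -%R (push (dif T (ic p0.1.1)) z).
  by rewrite !push_push; apply: eq_push => u _ q _ /=; rewrite /dif opprB.
rewrite (@deg_opp _ _ (2 * dtop)) ?mulr_gt0 //=; last first.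
  apply: (htop (icP Kx) rho_half); last apply: tight_weaken tz => //.
    by apply: le_trans ep_top; exact: ep_mono.
  exact: r_mono.
have := deg_bd true (push (dif T (ic p0.1.1)) z); rewrite -push_bd bz push0 {1}/deg pair0 /=.
by case: (deg true _); case: (deg false _).
Qed.

Variables (c : nat -> chain (seq NP)) (F : nat -> NP -> NP) (K : nat) (x0 : M).
Hypothesis tc : tower tn n.+1 c.
Hypothesis Kx0 : K0 x0.
Hypothesis F_tn : forall k p, F k (tn p) = tn (F k p).
Hypothesis F0 : forall p, F 0%N p = p.
Hypothesis FK : forall p, F K p = ((x0, x0), p.2).
Hypothesis dom_steps : forall j, (j <= n.+1)%N -> allc dom (steps F K (c j)).
Hypothesis far_c : allc far (c n.+1).
Hypothesis R0_pos : 0 < R0.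

Lemma steps_tn d : steps F K (push tn d) = push tn (steps F K d).
Proof.
have E k : tn \o F k = F k \o tn by apply/funext => p; exact: esym (F_tn k p).
by elim: (K) => [|k IH] /=; [rewrite push0|rewrite pushD IH push_prism prism_push !E].
Qed.

(** [mu] is paired with the homotopy contracting the top chain. The cocycle condition and invariance
    make the values at the two ends equal; but it is zero at the start, where all tuples are far,
    and one at the constant pair, where Borsuk-Ulam applies in a single chart. *)
Lemma no_contracted_tower : False.
Proof.
have [sc c0 cS] := tc; pose c' j := push (F K) (c j).
have sE j : (j <= n.+1)%N -> sized j.+2 (steps F K (c j)) by move=> jn; exact: sized_steps (sc j jn).
have := stepsP F K (c n.+1); rewrite cS // stepsD steps_tn => /(congr1 (pair mu)).
rewrite !pairD.
have -> : pair mu (bd (steps F K (c n.+1))) = false.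
  rewrite /bd pair_lin; apply: pair_eq0 => w hw; apply: mu_cocycle; first exact: dom_steps hw.
  exact: sE hw.
have -> : pair mu (push tn (steps F K (c n))) = pair mu (steps F K (c n)).
  rewrite /push pair_lin; apply: eq_pair => s hs; rewrite pair_sg; apply: mu_tn.
    exact: dom_steps hs.
  exact: sE hs.
have -> : pair mu (push (F 0%N) (c n.+1)) = false.
  rewrite push_id; last by move=> s _ p _; exact: F0.
  apply: pair_eq0 => -[//|p s] hs; rewrite /mu; case: asboolP => // -[]; exact: far_c.
(* What is left of the homotopy formula says that [mu] vanishes on the contracted chain. *)
rewrite addbb /= -/(c' n.+1).
have c'P j s p : coef (c' j) s -> p \in s -> p.1 = (x0, x0).
  by move=> /coef_push[u _ ->] /mapP[q _ ->]; rewrite FK.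
have dom' j s : coef (c' j) s -> dom s.
  move=> cs; split; first by move=> p ps; rewrite (c'P j s p).
  by move=> p q ps qs; apply/pd_lt; rewrite (c'P j s p) // (c'P j s q) //= distxx.
have rho2 : 0 < rho 0%N / 2 by rewrite divr_gt0 // rho_pos.
have sc' j : (j <= n.+1)%N -> sized j.+1 (c' j) by move=> jn; exact: sized_push (sc j jn).
rewrite (@eq_pair _ _ (degx x0)); last first.
  move=> s cs; apply: mu_eq => //; [exact: dom' cs|exact: sc' cs|].
  by move=> p ps; rewrite (c'P _ _ _ cs ps) /= distxx.
pose f d := deg true (push (dif T (ic x0)) (lin th (bd d))).
rewrite (@eq_pair _ _ (fun s => f (sg s))); last by move=> s _; rewrite /f bd_sg.
rewrite pair_additive /f; last by move=> a b; rewrite bdD linD pushD degD.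
have c'S j : (j < n.+1)%N -> bd (c' j.+1) = c' j + push tn (c' j).
  move=> jn; rewrite /c' -push_bd cS // pushD !push_push; congr (_ + _).
  by apply: eq_push => s _ p _ /=; rewrite F_tn.
pose y j := push (dif T (ic x0)) (lin th (c' j)).
have sth j : (j < n.+1)%N -> allc (fun s => dom s /\ (size s <= n.+1)%N) (c' j).
  by move=> jn s cs; split; [exact: dom' cs|rewrite (sc' j (ltnW jn) s cs)].
have yopp j : (j < n.+1)%N -> push (dif T (ic x0)) (lin th (push tn (c' j))) = push -%R (y j).
  by move=> jn; rewrite th_tn; [rewrite !push_push|exact: sth]; apply: eq_push => u _ q _ /=; rewrite /dif opprB.
have adm j s : (j < n.+1)%N -> coef (c' j) s -> admissible s (th s) /\ size s = j.+1.
  move=> jn cs; have sj := sc' j (ltnW jn) s cs.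
  by have [//|] := hth (dom' j s cs); rewrite sj.
(* The differences of the pushed constant tower form a tower of nonzero vectors under the
   antipode. *)
have ty : tower -%R n y.
  split.
  - move=> j jn; apply: sized_push => w /coef_linP[s cs]; have [[+ _ _] ss] := adm j s jn cs.
    by rewrite ss; apply.
  - rewrite /y -push_bd bd_th; last exact: sth.
    rewrite /c' -push_bd c0 push_sg lin_sg.
    have d0 : dom [::] by split=> // p q; rewrite in_nil.
    by have [_ _ _ ->//] := hth d0 isT; rewrite push_sg.
  - move=> j jn; have jn1 : (j < n.+1)%N by exact: ltnW.
    by rewrite /y -push_bd bd_th ?c'S //; [rewrite linD pushD yopp|exact: sth].
rewrite c'S // linD pushD yopp // -/(y n) (@deg_tower _ _ n (2 * dtop)) ?mulr_gt0 // => j jn.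
apply: (htop (icP Kx0) rho_top ep_top) => w /coef_linP[s cs ws].
have [[_ _ hn] ss] := adm j s jn cs.
have ps : exists p, p \in s by case: (s) ss => // p s'; exists p; rewrite inE eqxx.
have [p ps'] := ps; have pE := c'P j s p cs ps'.
have nf : ~ far s by move=> /(_ p ps'); rewrite pE /= distxx leNgt R0_pos.
have [h1 h2] := hn nf w ws; rewrite ss in h1 h2; have jL : (j.+1 <= L)%N by apply: leq_trans jn _.
split.
  by move=> a b aw bw; apply: lt_le_trans (h1 a b aw bw) _; exact: ep_mono.
move=> q /h2[rq /(_ p ps')]; rewrite pE /= => -[[n1 n2] _]; split.
  by split; [apply: lt_le_trans n1 _|apply: lt_le_trans n2 _]; exact: rho_mono.
by apply: le_trans rq; exact: r_mono.
Qed.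

End Obstruction.

(** * No fine tower off the diagonal of a contractible manifold *)

Section NoTower.
Variables (R : realType) (M : topologicalType) (n : nat).

(** The track of [C] under the contraction is compact and is put into [K0]; the constants are chosen
    there, from the radii down to the mesh [e]. [K] is carried along so that the caller can measure
    distances on a compact set of its own. *)
Lemma no_tower : manifold R n.+1 M -> contractible R M ->
  forall C : set (M * M), compact C -> (forall q, C q -> q.1 <> q.2) ->
  forall K : set M, compact K ->
  exists (K0 : set M) (T : atlas R n.+1 K0), K `<=` K0 /\
  exists2 e, 0 < e & forall c, tower (@swap M) n.+1 c ->
    (forall j, (j <= n.+1)%N -> allc (fun s => small (pd T) e s /\ forall q, q \in s -> C q) (c j)) ->
  False.
Proof.
move=> mM [x0 [H [Hc H0 H1]]] C cC offC K cK.
pose Kc : set M := fst @` C `|` snd @` C.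
have cKc : compact Kc.
  apply: compactU; apply: continuous_compact => //; apply: continuous_subspaceT => q.
    exact: cvg_fst.
  exact: cvg_snd.
pose I01 : set R := `[0, 1]%classic.
have cI : compact I01 by exact: segment_compact.
have HcK : {within Kc `*` I01, continuous H}.
  by apply: continuous_subspaceW Hc => -[x a] [_ h].
pose K0 : set M := (Kc `|` H @` (Kc `*` I01)) `|` ([set x0] `|` K).
have cK0 : compact K0.
  apply: compactU; apply: compactU => //; last exact: compact_set1.
  by apply: continuous_compact => //; exact: compact_setX.
have [T _] := exists_atlas mM cK0; exists K0, T; split; first by move=> x Kx; right; right.
have Kx0 : K0 x0 by right; left.
have KcK0 x : Kc x -> K0 x by move=> h; left; left.
have [i0 _] := dist_chart T Kx0.
have [ic icP] : exists ic, forall x, K0 x -> chart_at T (ic x) x.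
  have h x : exists i, K0 x -> chart_at T i x.
    by have [/(dist_chart T)[i hi]|nK] := pselect (K0 x); [exists i|exists i0].
  by have [ic h'] := choice h; exists ic.
have p8 : (0 : R) < 1 / 8 by lra.
have [rho [rhoL rho0 rhoS Hr]] := exists_levels T n.+2 p8.
have [R1 R10 hR1] : exists2 R1 : R, 0 < R1 & forall q, C q -> R1 <= dist T q.1 q.2.
  have [||||d d0 hd] := @compact_uniform R _ C (fun q => dist T q.1 q.2) (fun=> 1) cC _ _ _ _ 1 ltr01.
  - by apply: continuous_subspaceT; exact: dist_cont.
  - by move=> q; exact: cvg_cst.
  - by move=> q _; exact: dist_ge0.
  - move=> q Cq /(dist_sep (KcK0 _ (or_introl (ex_intro2 _ _ q Cq erefl)))).
    by move/(offC q Cq).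
  by exists d => // q Cq; rewrite leNgt; apply/negP => /(hd q Cq); rewrite ltxx.
have rho0' := rho0 0%N (leq0n _).
have [R0 [R0_pos R0R1 R0rho _]] := exists_min3 R10 (divr_gt0 rho0' (ltr0n R 4)) R10.
have [r [r0E r_pos rS Hep]] := Hr R0 R0_pos.
have [dtop dtop0 htop] := tight_nonzero T (r_pos _ (leqnn _)).
have [ep [epL ep_pos epS hfill]] := Hep dtop dtop0.
have ep0' := ep_pos 0%N (leq0n _).
have [es [es0 esep esrho _]] := exists_min3 ep0' (divr_gt0 rho0' (ltr0n R 8)) ep0'.
pose A := (Kc `*` Kc) `*` (I01 `*` I01).
pose HA (p : (M * M) * (R * R)) := dist T (H (p.1.1, p.2.1)) (H (p.1.2, p.2.2)).
have [d d0 hd] : exists2 d : R, 0 < d & forall x y a b, Kc x -> Kc y -> I01 a -> I01 b ->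
    dist T x y + `|a - b| < d -> dist T (H (x, a)) (H (y, b)) < es.
  have cA : compact A by apply: compact_setX; exact: compact_setX.
  have cu : {within A, continuous (fun p : (M * M) * (R * R) => dist T p.1.1 p.1.2 + `|p.2.1 - p.2.2|)}.
    apply: continuous_subspaceT => p; apply: cvgD.
      exact: (cont_fst (f := fun q : M * M => dist T q.1 q.2) (@dist_cont _ _ _ _ T _)).
    apply: (cont_snd (f := fun q : R * R => `|q.1 - q.2|)).
    by apply: cvg_norm; apply: cvgB; [exact: cvg_fst|exact: cvg_snd].
  have cv : {within A, continuous HA}.
    have pr (f : (M * M) * (R * R) -> M * R) : continuous f -> (forall p, A p -> (Kc `*` I01) (f p)) ->
        {within A, continuous (H \o f)}.
      move=> fc fA; apply/subspace_continuousP => p Ap O.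
      move: HcK => /subspace_continuousP/(_ (f p) (fA p Ap) O) h /h hO.
      exact: (@filterS _ (nbhs p) _ _ _ (fun q h2 Aq => h2 (fA q Aq)) (fc p _ hO)).
    apply: (within_pair (f := H \o (fun p => (p.1.1, p.2.1))) (g := H \o (fun p => (p.1.2, p.2.2)))
        (h := fun q : M * M => dist T q.1 q.2)); last exact: dist_cont.
      apply: pr; last by move=> p [[? ?] [? ?]].
      move=> p; exact: (cvg_pair (cont_fst (f := fst) cvg_fst) (cont_snd (f := fst) cvg_fst)).
    apply: pr; last by move=> p [[? ?] [? ?]].
    move=> p; exact: (cvg_pair (cont_fst (f := snd) cvg_snd) (cont_snd (f := snd) cvg_snd)).
  have [||d d0 hd] := compact_uniform cA cu cv _ _ es0.
  - by move=> p _; rewrite addr_ge0 // dist_ge0.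
  - move=> p [[Kp _] _] h; have h1 := dist_ge0 T p.1.1 p.1.2; have h2 := normr_ge0 (p.2.1 - p.2.2).
    have e1 : dist T p.1.1 p.1.2 = 0 by lra.
    have e2 : `|p.2.1 - p.2.2| = 0 by lra.
    rewrite /HA (dist_sep (KcK0 _ Kp) e1); move/eqP: e2; rewrite normr_eq0 subr_eq0 => /eqP->.
    by rewrite distxx.
  exists d => // x y a b Kx Ky Ia Ib; exact: (hd ((x, y), (a, b))).
have d20 : 0 < d / 2 by rewrite divr_gt0.
have [e [e0 ed ees _]] := exists_min3 d20 es0 es0.
exists e => // c tc hc.
(* Off the diagonal the swap is free, and being the representative of the orbit is an equivariant
   label. *)
pose sgn (q : M * M) := rep (@swap M) q == q.
pose lift (q : M * M) := (q, sgn q).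
have lift_swap q : C q -> lift (swap q) = tn (lift q).
  move=> /offC qq; rewrite /lift /tn /=; congr (_, _); rewrite /sgn rep_t; last exact: swapK.
  have nq : swap q == q = false by apply/eqP => /(congr1 fst)/esym.
  by case: (repP (@swap M) q) => ->; rewrite eqxx ?nq // eq_sym nq.
have [Nn N0 Ne] := inv_nat_lt d20.
pose F a (p : (M * M) * bool) := ((H (p.1.1, a), H (p.1.2, a)), p.2).
have cl j : (j <= n.+1)%N -> forall s p, coef (push lift (c j)) s -> p \in s -> C p.1.
  by move=> jn s p /coef_push[u /(hc j jn)[_ h] ->] /mapP[q /h Cq ->].
have KcC q : C q -> Kc q.1 /\ Kc q.2 by move=> Cq; split; [left|right]; exists q.
have smc j : (j <= n.+1)%N -> forall s p q, coef (push lift (c j)) s -> p \in s -> q \in s ->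
    pd T p.1 q.1 < e.
  move=> jn s p q /coef_push[u /(hc j jn)[h _] ->] /mapP[p' pu ->] /mapP[q' qu ->]; exact: h.
have rhoS' k (kL : (k < n.+2)%N) : rho k <= rho k.+1 := (rhoS k kL).1.
have rho_half : 2 * rho n.+1 <= 1 / 8 := (rhoS n.+1 (ltnSn _)).2.
have rho_top : rho n.+2 <= 1 / 8 by rewrite rhoL.
have ep_top : ep n.+2 <= dtop by rewrite epL.
have [th hth] := exists_theta rho0 rhoS' rS r0E epS hfill R0rho esrho esep icP.
apply: (no_contracted_tower rho0 rhoS' rho_half rho_top rS r0E epS hfill R0rho es0 esrho esep icP
  dtop0 ep_top htop hth (c := fun j => push lift (c j)) (F := fun k => F (k%:R / Nn%:R)) (K := Nn)
  (x0 := x0)) => //.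
- apply: tower_push tc => j s q jn cs qs; apply: lift_swap.
  by have [_] := hc j (ltnW jn) s cs; apply.
- by move=> [[x y] b]; rewrite /F /= mul0r !H0.
- by move=> [[x y] b]; rewrite /F /= divff ?H1 // pnatr_eq0 -lt0n.
- move=> j jn t ht.
  have [st [s cs hs]] : small (fun p q : (M * M) * bool => pd T p.1 q.1) es t /\
     exists2 s, coef (push lift (c j)) s & forall x, x \in t -> exists a p,
       [/\ 0 <= a <= 1, p \in s & x = F a p].
    apply: (steps_small N0 Ne) ht => s p q a b cs ps qs a01 b01 ab.
    have [Kp1 Kp2] := KcC _ (cl j jn s p cs ps); have [Kq1 Kq2] := KcC _ (cl j jn s q cs qs).
    have /pd_lt[h1 h2] := smc j jn s p q cs ps qs.
    by apply/pd_lt; split; apply: hd; rewrite /I01 /= ?in_itv //; lra.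
  split=> // x /hs[a [p [a01 ps ->]]]; have [Kp1 Kp2] := KcC _ (cl j jn s p cs ps).
  by split; left; right; [exists (p.1.1, a)|exists (p.1.2, a)] => //; split=> //;
    rewrite /I01 /= in_itv.
- move=> s cs p ps; apply: le_trans R0R1 _; apply: hR1; exact: cl cs ps.
Qed.

End NoTower.

(** * Degree of an odd map at its zeros *)

Section Sperner.
Variables (P L : choiceType) (lab : P -> L).

Definition full (c : chain (seq P)) := pair (fun s => uniq (map lab s)) c.
Definition missing i (c : chain (seq P)) :=
  pair (fun s => uniq (map lab s) && (i \notin map lab s)) c.

(** If all labels differ, only the deletion of [i] qualifies. Otherwise a qualifying deletion
    removes one of two equal labels, and removing the other one qualifies too. *)
Lemma sperner_bdt i (l : seq L) : (uniq l -> i \in l) ->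
  pair (fun u => uniq u && (i \notin u)) (bdt l) = uniq l.
Proof.
move=> hi; rewrite pair_bdt_perm; last by move=> u v uv; rewrite (perm_uniq uv) (perm_mem uv).
case ul : (uniq l).
  rewrite (@eq_in_count _ _ (pred1 i)); last first.
    move=> x xl /=; rewrite rem_uniq //= mem_rem_uniq // inE hi // andbT negbK.
    by rewrite eq_sym.
  by rewrite count_uniq_mem // hi.
case h : (has (fun x => uniq (rem x l) && (i \notin rem x l)) l); last first.
  by rewrite (_ : count _ _ = 0%N) //; apply/eqP; rewrite -leqn0 leqNgt -has_count h.
have /hasP[x xl /andP[ux ix]] := h.
have p := perm_to_rem xl.
have xr : x \in rem x l by apply: contraFT ul => nx; rewrite (perm_uniq p) /= nx.
rewrite (@eq_in_count _ _ (pred1 x)); last first.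
  move=> y yl /=; apply/idP/eqP => [/andP[uy _]|-> //]; last by rewrite ux.
  apply: contraTeq uy => yx.
  have : (1 < count_mem x (rem y l))%N.
    have q := perm_to_rem yl; have := permP q (pred1 x); rewrite /= (negPf yx) add0n => <-.
    by rewrite (permP p) /= eqxx add1n ltnS -has_count has_pred1.
  by apply: contraTN => u; rewrite count_uniq_mem // -leqNgt; case: (_ \in _).
by rewrite (permP p) /= eqxx count_uniq_mem // xr.
Qed.

(** Consequently the parity of the fully labelled tuples depends on the boundary alone. *)
Lemma missing_bd i (c : chain (seq P)) :
    (forall s, coef c s -> uniq (map lab s) -> i \in map lab s) ->
  missing i (bd c) = full c.
Proof.
move=> hi; rewrite /missing /full /bd pair_lin; apply: eq_pair => s cs.
rewrite -(sperner_bdt (hi s cs)) -push_bdt /push pair_lin; apply: eq_pair => u _.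
by rewrite pair_sg.
Qed.

End Sperner.

(** * The degree at one isolated zero *)

Section LocalDegree.
Variables (R : realType) (n : nat).
Local Notation PS := 'rV[R]_n.+2.
Local Notation N2 := (n.+2%:R : R).
Implicit Types (x y z : PS) (q : 'rV[R]_n.+1).

Definition std : set PS := [set x | (forall i, 0 <= x 0 i) /\ \sum_i x 0 i = 1].

Definition wid (i : 'I_n.+1) : 'I_n.+2 := widen_ord (leqnSn _) i.
Definition kap x : 'rV[R]_n.+1 := \row_i x 0 (wid i).
(** Coordinates centred at [z] on the hyperplane of constant coordinate sum; the last coordinate
    absorbs the displacement. *)
Definition unk z q : PS := \row_i
  (if insub (i : nat) is Some j then z 0 i + q 0 (j : 'I_n.+1) else z 0 i - \sum_k q 0 k).

Lemma unk_wid z q j : unk z q 0 (wid j) = z 0 (wid j) + q 0 j.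
Proof. by rewrite mxE /= (valK j). Qed.

Lemma unk_max z q : unk z q 0 ord_max = z 0 ord_max - \sum_k q 0 k.
Proof. by rewrite mxE insubF //= ltnn. Qed.

Lemma ord2P (A : 'I_n.+2 -> Prop) : (forall j, A (wid j)) -> A ord_max -> forall i, A i.
Proof.
move=> h1 h2 i; have [il|il] := ltnP i n.+1.
  by have -> : i = wid (Ordinal il) by exact: val_inj.
by have -> : i = ord_max by apply: val_inj; apply/eqP; rewrite eqn_leq il -ltnS ltn_ord.
Qed.

Lemma sum_unk z q : \sum_i unk z q 0 i = \sum_i z 0 i.
Proof.
rewrite big_ord_recr [RHS]big_ord_recr /= unk_max (eq_bigr (fun j => z 0 (wid j) + q 0 j)); last first.
  by move=> j _; exact: unk_wid.
by rewrite big_split /=; ring.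
Qed.

Lemma kap_unk z q : kap (unk z q) = kap z + q.
Proof. by apply/rowP => j; rewrite [LHS]mxE unk_wid [RHS]mxE [kap z 0 j]mxE. Qed.

Lemma kapB x y j : (kap x - kap y) 0 j = x 0 (wid j) - y 0 (wid j).
Proof. by rewrite !mxE. Qed.

Lemma unk_kap z x : \sum_i x 0 i = \sum_i z 0 i -> unk z (kap x - kap z) = x.
Proof.
move=> e; apply/rowP; apply: ord2P => [j|].
  by rewrite unk_wid kapB addrC subrK.
rewrite big_ord_recr [RHS]big_ord_recr /= in e; rewrite unk_max.
rewrite (eq_bigr (fun k => x 0 (wid k) - z 0 (wid k))); last by move=> k _; exact: kapB.
rewrite sumrB.
move: (\sum_(i < n.+1) x 0 (wid i)) (\sum_(i < n.+1) z 0 (wid i)) e => a b e.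
by apply: (@addrI _ a); rewrite e; ring.
Qed.

Lemma vd_unk z q q' : vd (unk z q) (unk z q') <= N2 * vd q q'.
Proof.
have v0 := vd_ge0 q q'; have N0 : 0 <= N2 * vd q q' by rewrite mulr_ge0.
have N1 : vd q q' <= N2 * vd q q' by rewrite ler_peMl // ler1n.
apply/vd_le => //; apply: ord2P => [j|].
  rewrite !unk_wid opprD addrACA subrr add0r; apply: le_trans N1; exact: vd_coord.
rewrite !unk_max (_ : _ - _ = \sum_k q' 0 k - \sum_k q 0 k); last by ring.
rewrite -sumrB.
apply: le_trans (ler_norm_sum _ _ _) _.
apply: (@le_trans _ _ (\sum_(k < n.+1) vd q q')).
  by apply: ler_sum => k _; rewrite distrC; exact: vd_coord.
by rewrite sumr_const card_ord -[leLHS]mulr_natl ler_wpM2r // ler_nat.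
Qed.

Lemma vd_kap x y : vd (kap x) (kap y) <= vd x y.
Proof. by apply/vd_le => [|j]; rewrite ?vd_ge0 // !mxE; exact: vd_coord. Qed.

Lemma vd_le_kap x y : \sum_i x 0 i = \sum_i y 0 i -> vd x y <= N2 * vd (kap x) (kap y).
Proof.
move=> e; have := vd_unk y (kap x - kap y) (kap y - kap y).
rewrite (unk_kap e) (unk_kap (erefl (\sum_i y 0 i))) => h; apply: le_trans h _; rewrite ler_wpM2l //.
apply/vd_le => [|i]; rewrite ?vd_ge0 // subrr kapB [X in _ - X]mxE subr0.
by have := vd_coord (kap x) (kap y) i; rewrite !mxE.
Qed.

(** A Sperner labelling in which all labels come together only around [z]: a coordinate where [x] is
    largest relative to [z]. *)
Definition ell z x : 'I_n.+2 := [arg max_(i > ord0) (x 0 i / z 0 i)]%O.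

Lemma uniq_full (l : seq 'I_n.+2) i : size l = n.+2 -> uniq l -> i \in l.
Proof.
move=> sl ul; apply: contraT => il.
have u : uniq (i :: l) by rewrite /= il.
by have := max_card (mem (i :: l)); rewrite (card_uniqP u) /= sl card_ord ltnn.
Qed.

(** Away from [z] there is a coordinate [i] that is smaller than [z i] at every point of the tuple.
    A point labelled [i] would have all its coordinates below those of [z], although both have sum
    one. *)
Lemma not_full z rho e s : std z -> (forall i, 0 < z 0 i) -> 0 < rho -> e <= rho / (2 * N2) ->
    size s = n.+2 -> small (@vd R n.+2) e s -> (forall x, x \in s -> std x) ->
    (forall x, x \in s -> rho / 2 <= vd (kap x) (kap z)) ->
  uniq (map (ell z) s) = false.
Proof.
move=> [_ z1] zp rho0 er ss sm st far; apply/negP => us.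
case: s ss us sm st far => // x s ss us sm st far.
have xs : x \in x :: s by rewrite inE eqxx.
have N20 : 0 < N2 by rewrite ltr0n.
(* An excess of [rho / 2] in one coordinate is made up by the [n+1] others, so one of them is short
   by at least this amount. *)
pose c := rho / (2 * N2); have c0 : 0 < c by rewrite divr_gt0 // mulr_gt0.
have cE : N2 * c = rho / 2 by rewrite /c; field; rewrite gt_eqF.
have c2 : c <= rho / 2 by rewrite -cE ler_peMl ?(ltW c0) // ler1n.
have [i hi] : exists i, c <= z 0 i - x 0 i.
  apply: contrapT => hn; have {}hn i : z 0 i - x 0 i < c.
    by rewrite ltNge; apply/negP => h; apply: hn; exists i.
  have [j hj] : exists j, rho / 2 <= `|kap x 0 j - kap z 0 j|.
    by apply: exists_large; rewrite ?divr_gt0 //; exact: far.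
  rewrite !mxE -/(wid j) in hj.
  have s0 : \sum_i (z 0 i - x 0 i) = 0.
    by rewrite sumrB z1; have [_ ->] := st x xs; rewrite subrr.
  have hx : rho / 2 <= x 0 (wid j) - z 0 (wid j).
    by move: hj; rewrite ler_normr => /orP[//|]; have := hn (wid j); lra.
  move: s0; rewrite (bigD1 (wid j)) //=.
  have : \sum_(k < n.+2 | k != wid j) (z 0 k - x 0 k) < rho / 2.
    apply: (@le_lt_trans _ _ (\sum_(k < n.+2 | k != wid j) c)).
      by apply: ler_sum => k _; exact: ltW.
    rewrite sumr_const cardC1 card_ord -[ltLHS]mulr_natl -cE ltr_pM2r //.
    by rewrite ltr_nat.
  by lra.
have h : ell z x \in map (ell z) (x :: s) by rewrite inE eqxx.
have : i \in map (ell z) (x :: s) by apply: uniq_full; rewrite // size_map.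
move=> /mapP[y ys iE]; have [y0 y1] := st y ys.
have yi : y 0 i < z 0 i.
  have := sm y x ys xs; move/(le_lt_trans (vd_coord y x i)); rewrite ltr_norml.
  by move=> /andP[_ ?]; rewrite -/c in er; lra.
have hy k : y 0 k / z 0 k <= y 0 i / z 0 i.
  by rewrite iE /ell; case: arg_maxP => // l _ hl; exact: hl.
have : \sum_k y 0 k < \sum_k z 0 k.
  apply: (@le_lt_trans _ _ (\sum_k (y 0 i / z 0 i) * z 0 k)).
    by apply: ler_sum => k _; rewrite -ler_pdivrMr.
  by rewrite -mulr_sumr z1 mulr1 ltr_pdivrMr // mul1r.
by rewrite y1 z1 ltxx.
Qed.

Lemma std_closed : closed std.
Proof.
have -> : std = \bigcap_(i in [set: 'I_n.+2]) [set x : PS | 0 <= x 0 i] `&` [set x : PS | \sum_i x 0 i = 1].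
  by apply/seteqP; split=> x [h0 h1]; split=> // i; [move=> _; exact: h0|exact: (h0 i)].
apply: closedI.
  apply: closed_bigI => i _; apply: (@closed_comp _ _ (fun x : PS => x 0 i) [set t | 0 <= t]).
    by move=> x _; exact: coord_continuous.
  exact: closed_ge.
apply: (@closed_comp _ _ (fun x : PS => \sum_i x 0 i) [set t | t = 1]); last exact: closed_eq.
move=> x _; apply: (@cvg_big _ _ +%R 0) => [||i _]; [exact: add_continuous|exact: nbhs_filter|exact: coord_continuous].
Qed.

Lemma std_ball_compact (z : PS) r : compact (std `&` [set x | vd x z <= r]).
Proof.
have [r0|r0] := leP 0 r; last first.
  rewrite (_ : _ `&` _ = set0); first exact: compact0.
  by apply/seteqP; split=> // x [_ /=]; have := vd_ge0 x z; lra.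
have -> : std `&` [set x | vd x z <= r] = [set x : PS | forall j, `|x 0 j - z 0 j| <= r] `&` std.
  by apply/seteqP; split=> x [h1 h2]; split=> //; apply/vd_le.
apply: compact_closedI; [exact: cube_compact|exact: std_closed].
Qed.

Lemma vd_std x y : std x -> std y -> vd x y <= 1.
Proof.
move=> [x0 x1] [y0 y1]; apply/vd_le => // i.
have hx : x 0 i <= 1 by rewrite -x1 (bigD1 i) //= lerDl sumr_ge0.
have hy : y 0 i <= 1 by rewrite -y1 (bigD1 i) //= lerDl sumr_ge0.
by rewrite ler_norml; have := x0 i; have := y0 i; lra.
Qed.

Lemma std_compact : compact std.
Proof.
have [[z sz]|h] := pselect (exists z, std z).
  rewrite (_ : std = std `&` [set x | vd x z <= 1]); first exact: std_ball_compact.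
  by apply/seteqP; split=> x; [move=> sx; split=> //; exact: vd_std|case].
rewrite (_ : std = set0); first exact: compact0.
by apply/seteqP; split=> // x sx; apply: h; exists x.
Qed.

Lemma within_vd (M : nat) (A : set 'rV[R]_M) (N : nat) (g : 'rV[R]_M -> 'rV[R]_N) : {within A, continuous g} ->
  {within A `*` A, continuous (fun p => vd (g p.1) (g p.2))}.
Proof.
move=> gc; pose h (q : 'rV[R]_N * 'rV[R]_N) := vd q.1 q.2.
have hc : continuous h.
  move=> q; apply: continuous_bigmax => j.
  apply: (@continuous_comp _ _ _ (fun q : 'rV[R]_N * 'rV[R]_N => q.1 0 j - q.2 0 j) (fun t : R => `|t|)).
    apply: (@cvgB _ _ _ (nbhs q)).
      by apply: (cont_fst (f := fun q : 'rV[R]_N => q 0 j)); exact: coord_continuous.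
    by apply: (cont_snd (f := fun q : 'rV[R]_N => q 0 j)); exact: coord_continuous.
  exact: norm_continuous.
exact: (@within_pair _ _ _ _ (A `*` A) _ _ h (within_fst gc) (within_snd gc) hc).
Qed.

Lemma vd_sub (N : nat) (u v u' v' : 'rV[R]_N) : vd (u - v) (u' - v') <= vd u u' + vd v v'.
Proof.
apply/vd_le => [|i]; first by rewrite addr_ge0 ?vd_ge0.
rewrite !mxE (_ : _ - _ - _ = (u 0 i - u' 0 i) - (v 0 i - v' 0 i)); last by ring.
by apply: le_trans (ler_normB _ _) _; apply: lerD; exact: vd_coord.
Qed.

Section AtZero.
Variables (d : PS -> 'rV[R]_n.+1) (z : PS) (rho : R).
Hypotheses (dc : {within std, continuous d}) (stz : std z) (dz : d z = 0) (rho0 : 0 < rho).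
Hypothesis zrho : forall i, 2 * N2 * rho <= z 0 i.
Hypothesis dinj : forall x y, std x -> std y -> vd x z <= N2 * rho -> vd y z <= N2 * rho ->
  d x = d y -> x = y.

Lemma d_uniform e : 0 < e -> exists2 a, 0 < a & forall x y, std x -> std y -> vd x y < a ->
  vd (d x) (d y) < e.
Proof.
move=> e0.
have idc : {within std, continuous (@idfun PS)} by apply: continuous_subspaceT => x; exact: cvg_id.
have [||a a0 ha] := compact_uniform (compact_setX std_compact std_compact) (within_vd idc)
  (within_vd dc) _ _ e0.
- by move=> p _; exact: vd_ge0.
- by move=> p _ /vd_eq0 /= ->; rewrite vdxx.
by exists a => // x y sx sy; exact: (ha (x, y)).
Qed.

(** Injectivity near the zero becomes uniform by compactness. *)
Lemma d_expansive : exists2 r, 0 < r & forall x y, std x -> std y -> vd x z <= N2 * rho ->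
  vd y z <= N2 * rho -> rho / 2 <= vd x y -> r <= vd (d x) (d y).
Proof.
have r2 : 0 < rho / 2 by rewrite divr_gt0.
have cB := @std_ball_compact z (N2 * rho).
have sub : std `&` [set x | vd x z <= N2 * rho] `<=` std by move=> x [].
have dB := continuous_subspaceW sub dc.
have iB : {within std `&` [set x | vd x z <= N2 * rho], continuous (@idfun PS)}.
  by apply: continuous_subspaceT => x; exact: cvg_id.
have [||r r0 hr] := compact_uniform (compact_setX cB cB) (within_vd dB) (within_vd iB) _ _ r2.
- by move=> p _; exact: vd_ge0.
- by move=> p [[s1 b1] [s2 b2]] /vd_eq0 /(dinj s1 s2 b1 b2) ->; rewrite vdxx.
exists r => // x y sx sy bx by' h; rewrite leNgt; apply/negP => lt.
by have := hr (x, y) (conj (conj sx bx) (conj sy by')) lt; rewrite /= ltNge h.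
Qed.

Let N20 : 0 < N2. Proof. by rewrite ltr0n. Qed.

Let unk0 : unk z 0 = z.
Proof. by rewrite -[RHS](unk_kap (erefl (\sum_i z 0 i))) subrr. Qed.

Lemma unk_ball q : (forall i, `|q 0 i| <= rho) -> std (unk z q) /\ vd (unk z q) z <= N2 * rho.
Proof.
move=> hq; have v : vd (unk z q) z <= N2 * rho.
  rewrite -{2}unk0; apply: le_trans (vd_unk _ _ _) _; rewrite ler_wpM2l //.
  by apply/vd_le => [|i]; rewrite ?(ltW rho0) // mxE subr0.
split=> //; split; last by rewrite sum_unk; case: stz.
move=> i; have := vd_coord (unk z q) z i; have := zrho i.
rewrite ler_norml; have : 0 <= N2 * rho by rewrite mulr_ge0 // ltW.
move: (N2 * rho) v (mulrA 2 N2 rho) => t v <- ? ? /andP[? _]; lra.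
Qed.

(* [d] is homotopic, on the boundary of a box around its isolated zero [z], to
   the odd map [q |-> d (z + q / 2) - d (z - q / 2)], through maps
   [q |-> d (z + (1 - a / 2) q) - d (z - a / 2 q)] that vanish nowhere as [d] is
   injective near [z]. *)
Lemma local_degree : exists2 e, 0 < e & forall C, sized n.+2 C ->
    allc (fun s : seq PS => small (@vd R n.+2) e s /\
      forall x, x \in s -> std x /\ vd (kap x) (kap z) <= rho) C ->
    allc (fun s : seq PS => forall x, x \in s -> rho / 2 <= vd (kap x) (kap z)) (bd C) ->
    full (ell z) C ->
  deg true (push d (bd C)) = true.
Proof.
have [r r0 hr] := d_expansive.
have r20 : 0 < r / 2 by rewrite divr_gt0.
have [a a0 ha] := d_uniform r20.
have N40 : 0 < 4 * N2 by rewrite mulr_gt0.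
have [e [e0 e1 e2 e3]] : exists e, [/\ 0 < e, e <= a / (4 * N2),
    e <= rho / (2 * N2) / N2 & e <= rho / 2].
  by apply: exists_min3; rewrite ?divr_gt0 // mulr_gt0.
pose eta := a / (4 * N2) / rho.
have eta0 : 0 < eta by rewrite /eta !divr_gt0.
pose D q := d (unk z q).
pose F (t : R) q := D ((1 - t / 2) *: q) - D (- (t / 2) *: q).
have ball t q : `|t| <= 1 -> (forall i, `|q 0 i| <= rho) -> forall i, `|(t *: q) 0 i| <= rho.
  move=> t1 hq i; rewrite mxE normrM -[leRHS]mul1r; apply: ler_pM => //; exact: hq.
have t1 (t : R) : 0 <= t <= 1 -> `|1 - t / 2| <= 1 /\ `|- (t / 2)| <= 1.
  by move=> /andP[h0 h1]; split; rewrite ?normrN ler_norml; apply/andP; split; lra.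
have Dfar t q : 0 <= t <= 1 -> (forall i, `|q 0 i| <= rho) -> (exists j, rho / 2 <= `|q 0 j|) ->
    exists j, r <= `|F t q 0 j|.
  move=> ht hq [j hj]; have [h1 h2] := t1 t ht.
  have [s1 b1] := unk_ball (ball _ _ h1 hq); have [s2 b2] := unk_ball (ball _ _ h2 hq).
  have [|k] := exists_large r0 (hr _ _ s1 s2 b1 b2 _).
    apply: le_trans (vd_kap _ _); apply: le_trans (vd_coord _ _ j).
    rewrite !kap_unk !mxE (_ : _ - _ = q 0 j) //; ring.
  by exists k; rewrite /F [in X in _ <= X]mxE [X in _ + X]mxE.
have Dnear t t' q q' : 0 <= t <= 1 -> 0 <= t' <= 1 -> (forall i, `|q 0 i| <= rho) ->
    (forall i, `|q' 0 i| <= rho) -> vd q q' < e -> `|t - t'| < eta -> vd (F t q) (F t' q') < r.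
  move=> ht ht' hq hq' vq tt'.
  have key (u u' : R) : `|u| <= 1 -> `|u - u'| < eta -> `|u'| <= 1 -> vd (D (u *: q)) (D (u' *: q')) < r / 2.
    move=> u1 uu u'1; apply: ha; [exact: (unk_ball (ball _ _ u1 hq)).1|exact: (unk_ball (ball _ _ u'1 hq')).1|].
    apply: le_lt_trans (vd_unk _ _ _) _.
    have -> : a = N2 * (a / (4 * N2) * 4) by field; rewrite gt_eqF.
    rewrite ltr_pM2l //; have a4 : 0 < a / (4 * N2) by rewrite divr_gt0.
    apply: (@le_lt_trans _ _ (a / (4 * N2) + a / (4 * N2))); last first.
      by move: (a / (4 * N2)) a4 => t4 t40; lra.
    apply/vd_le => [|i]; first by rewrite addr_ge0 ?(ltW a4).
    rewrite !mxE (_ : _ - _ = u * (q 0 i - q' 0 i) + (u - u') * q' 0 i); last by ring.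
    apply: le_trans (ler_normD _ _) _; rewrite !normrM; apply: lerD.
      rewrite -[leRHS]mul1r; apply: ler_pM => //; apply: le_trans e1; apply: le_trans (ltW vq).
      exact: vd_coord.
    have -> : a / (4 * N2) = eta * rho by rewrite /eta divfK // gt_eqF.
    by apply: ler_pM => //; exact: ltW.
  have [h1 h2] := t1 t ht; have [h1' h2'] := t1 t' ht'.
  apply: le_lt_trans (vd_sub _ _ _ _) _; rewrite (splitr r); apply: ltrD; apply: key => //.
    rewrite (_ : _ - _ = - ((t - t') / 2)); last by ring.
    by rewrite normrN normrM [ `|2^-1|]ger0_norm //; have := normr_ge0 (t - t'); lra.
  rewrite (_ : _ - _ = - ((t - t') / 2)); last by ring.
  by rewrite normrN normrM [ `|2^-1|]ger0_norm //; have := normr_ge0 (t - t'); lra.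
have r2rho : rho / 2 <= rho by lra.
have inF t c : 0 <= t <= 1 -> inshell (rho / 2) rho e n.+1 c -> allc (nonzero r) (push (F t) c).
  move=> ht hc u /coef_push[s cs ->]; have [sm sh] := hc s cs; split.
    move=> _ _ /mapP[x xs ->] /mapP[y ys ->]; have [_ hx _] := sh x xs; have [_ hy _] := sh y ys.
    by apply: Dnear => //; [exact: sm|rewrite subrr normr0].
  move=> _ /mapP[x xs ->]; have [_ hx [j _ hj]] := sh x xs; apply: Dfar => //; by exists j.
have t00 : 0 <= (0 : R) <= 1 by apply/andP; split; lra.
have t01 : 0 <= (1 : R) <= 1 by apply/andP; split; lra.
have F0 q : F 0 q = D q.
  by rewrite /F mul0r subr0 scale1r oppr0 scale0r /D unk0 dz subr0.
exists e => // C sC inC farC fC.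
have bdC : allc (fun s : seq PS => small (@vd R n.+2) e s /\
      forall x, x \in s -> std x /\ vd (kap x) (kap z) <= rho) (bd C).
  apply: allc_bd inC => s s' ss [sm h]; split=> [|x xs]; [exact: small_sub sm|exact/h/ss].
pose k x := kap x - kap z.
pose y := push k (bd C).
have uk x : std x -> unk z (k x) = x.
  by move=> [_ sx]; apply: unk_kap; rewrite sx; case: stz.
have sy : sized n.+1 y by apply/sized_push/sized_bd.
have bdy : bd y = 0 by rewrite /y -push_bd bdbd push0.
have iny : inshell (rho / 2) rho e n.+1 y.
  move=> u /coef_push[s cs ->]; have [sm sh] := bdC s cs; split.
    move=> _ _ /mapP[p ps ->] /mapP[q qs ->]; apply: le_lt_trans (sm p q ps qs).
    by apply: le_trans (vd_kap p q); apply/vd_le => [|i]; rewrite ?vd_ge0 // (_ : _ - _ = kap p 0 i - kap q 0 i);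
      [exact: vd_coord|rewrite !mxE; ring].
  move=> _ /mapP[p ps ->]; split=> [i|i|].
  - by move=> h; have := ltn_ord i; rewrite ltnNge h.
  - have [_ /(vd_le _ _ (ltW rho0)) h] := sh p ps; have := h i; by rewrite !mxE.
  - have r2 : 0 < rho / 2 by rewrite divr_gt0.
    have [j hj] := exists_large r2 (farC s cs p ps); exists j; first exact: ltn_ord.
    by move: hj; rewrite !mxE.
have [T tT inT] := shell_tower n e0 e3 r2rho.
(* The antipodal cycle of the shell around the zero: the odd map [F 1] has degree one on it, and the
   homotopy [F] carries this to [D]. *)
pose s := T n + push -%R (T n).
have sT : sized n.+1 s.
  by case: tT => st _ _; apply: sizedD; [exact: st|apply: sized_push; exact: st].
have inS : inshell (rho / 2) rho e n.+1 s by apply: inshellD; [exact: inT|exact: (inshell_opp e0 (inT n))].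
have bds : bd s = 0 by apply: tower_cycle tT => q; rewrite opprK.
have r2 : 0 < rho / 2 by rewrite divr_gt0.
have degs : deg true s.
  by apply: (deg_tower r2 tT) => // j _; exact: (inshell_nonzero e3).
have degDs : deg true (push D s).
  have -> : push D s = push (F 0) s by apply: eq_push => u _ q _; rewrite F0.
  rewrite (@deg_homotopy R n _ F r eta true s r0 eta0 sT bds); first last.
  - move=> u x x' t t' cu xu x'u ht ht' tt; have [sm sh] := inS u cu.
    have [_ hx _] := sh x xu; have [_ hx' _] := sh x' x'u; exact: Dnear (sm _ _ xu x'u) tt.
  - move=> u x t cu xu ht; have [sm sh] := inS u cu; have [_ hx [j _ hj]] := sh x xu.
    by apply: Dfar => //; exists j.
  have F1N q : F 1 (- q) = - F 1 q.
    have h : 1 - 1 / 2 = 1 / 2 :> R by lra.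
    by rewrite /F h opprB !scaleNr scalerN opprK.
  have tF : tower -%R n (fun j => push (F 1) (T j)) by apply: tower_push tT => j u p _ _ _; exact: F1N.
  rewrite /s pushD push_push (_ : push (F 1 \o -%R) (T n) = push -%R (push (F 1) (T n))); last first.
    by rewrite push_push; apply: eq_push => u _ p _ /=; exact: F1N.
  by apply: (deg_tower r0 tF) => // j _; apply: inF => //; exact: inT.
have degDb b : sized n.+2 b -> inshell (rho / 2) rho e n.+1 b -> deg true (push D (bd b)) = false.
  move=> sb ib; have e' : push D b = push (F 0) b by apply: eq_push => u _ q _; rewrite F0.
  by rewrite push_bd e' (deg_bd0 true r0) //; [exact: sized_push|exact: inF].
have eDy : push d (bd C) = push D y.
  rewrite /y push_push; apply: eq_push => u cu x xu /=; rewrite /D uk //.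
  by case: (bdC u cu) => _ /(_ x xu)[].
have [[b [sb ib eb]]|[b [sb ib eb]]|[b [sb ib eb]]] :=
  (shell_homology e0 e3 r2rho (leqnn n.+1)).2 _ _ sy sT iny inS bdy bds.
(* If [y] were the boundary of some [b] in the shell, then [C] and [b] together would form a cycle,
   which has an even number of full tuples; those of [b] are not full, against the hypothesis on
   [C]. *)
- suff : full (ell z) (C + push (unk z) b) = false.
    rewrite /full pairD -!/(full _ _) fC addTb => /negbFE; rewrite /full pair_eq0 //.
    move=> u /coef_push[v cv ->]; have [sm sh] := ib v cv.
    have e4 : N2 * e <= rho / (2 * N2) by rewrite -ler_pdivlMl // mulrC.
    apply: (not_full stz _ rho0 e4).
    + by move=> i; apply: lt_le_trans (zrho i); rewrite !mulr_gt0.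
    + by rewrite size_map sb.
    + move=> _ _ /mapP[p pv ->] /mapP[q qv ->]; apply: le_lt_trans (vd_unk _ _ _) _.
      by rewrite ltr_pM2l //; exact: sm.
    + by move=> _ /mapP[p pv ->]; have [_ h _] := sh p pv; exact: (unk_ball h).1.
    + move=> _ /mapP[p pv ->]; have [_ _ [j _ hj]] := sh p pv.
      apply: le_trans (vd_coord _ _ j); rewrite kap_unk mxE addrAC subrr add0r //.
  have sz : sized n.+2 (C + push (unk z) b) by apply: sizedD => //; exact: sized_push.
  rewrite -(missing_bd (i := ord0)); last first.
    by move=> u cu uu; apply: uniq_full => //; rewrite size_map sz.
  rewrite bdD -push_bd eb /y push_push push_id => [|u cu x xu /=].
    by rewrite addcc /missing pair0.
  by have [_ h] := bdC u cu; rewrite uk //; exact: (h x xu).1.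
- by move: degs; rewrite -eb (deg_bd0 true r2 sb (inshell_nonzero e3 ib)).
(* In the remaining case [y] is homologous to the antipodal cycle and shares its degree. *)
have := degDb b sb ib; rewrite eb pushD degD degDs eDy addbT => /negbFE //.
Qed.

End AtZero.

End LocalDegree.

(** An exchange of quantifiers: finitely many requirements that persist when the radius shrinks
    share one radius. *)
Lemma uniform_radius (R : realFieldType) (T : eqType) (Q : T -> R -> Prop) (l : seq T) :
    (forall x a b, 0 < a -> a <= b -> Q x b -> Q x a) ->
    (forall x, x \in l -> exists2 a, 0 < a & Q x a) ->
  exists2 a, 0 < a & forall x, x \in l -> Q x a.
Proof.
move=> mono; elim: l => [|y l IH] h; first by exists 1.
have [a a0 ha] := IH (fun x xl => h x (mem_behead (s := y :: l) xl)).
have [b b0 hb] := h y (mem_head _ _).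
exists (Num.min a b); first by rewrite lt_min a0.
have m0 : 0 < Num.min a b by rewrite lt_min a0.
move=> x; rewrite inE => /orP[/eqP->|xl].
  by apply: mono hb => //; rewrite ge_min lexx orbT.
by apply: mono (ha x xl) => //; rewrite ge_min lexx.
Qed.

Lemma pair_filter (T : choiceType) (g h : pred T) (c : chain T) :
  pair g (cfilter h c) = pair (fun s => h s && g s) c.
Proof.
rewrite !pair_odd; congr odd; rewrite -!size_filter; apply/perm_size/uniq_perm.
- exact/filter_uniq/fset_uniq.
- exact/filter_uniq/fset_uniq.
move=> x; rewrite !mem_filter; have := coef_filter h c x; rewrite /coef => ->.
by case: (g x); case: (h x); case: (x \in _).
Qed.

(** * Summing the local degrees *)

Section GlobalDegree.
Variables (R : realType) (n : nat) (d : 'rV[R]_n.+2 -> 'rV[R]_n.+1) (Z : seq 'rV[R]_n.+2).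
Local Notation PS := 'rV[R]_n.+2.
Local Notation N2 := (n.+2%:R : R).
Hypotheses (dc : {within @std R n, continuous d}) (uZ : uniq Z).
Hypothesis ZP : forall z, (z \in Z) <-> (@std R n z /\ d z = 0).
Hypothesis Zint : forall z, z \in Z -> forall i, 0 < z 0 i.
Hypothesis Zinj : forall z, z \in Z -> exists2 e, 0 < e & forall x y,
  @std R n x -> @std R n y -> vd x z < e -> vd y z < e -> d x = d y -> x = y.

Let N20 : 0 < N2. Proof. by rewrite ltr0n. Qed.

Lemma common_radius : exists2 rho, 0 < rho & forall z, z \in Z ->
  [/\ forall i, 2 * N2 * rho <= z 0 i,
    forall x y, @std R n x -> @std R n y -> vd x z <= N2 * rho -> vd y z <= N2 * rho ->
      d x = d y -> x = y
  & forall z', z' \in Z -> z' != z -> 2 * rho <= vd (kap z) (kap z')].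
Proof.
apply: uniform_radius => [z a b a0 ab [h1 h2 h3]|z zZ].
  have N2ab : N2 * a <= N2 * b by rewrite ler_pM2l.
  split=> [i|x y sx sy bx by'|z' z'Z ne].
  - by apply: le_trans (h1 i); rewrite -!mulrA ler_pM2l // ler_pM2l.
  - by apply: h2 => //; apply: le_trans N2ab.
  - by apply: le_trans (h3 z' z'Z ne); lra.
have [sz dz] := (ZP z).1 zZ.
have [a a0 ha] : exists2 a, 0 < a & forall i : 'I_n.+2, i \in enum 'I_n.+2 -> a <= z 0 i.
  apply: uniform_radius => [i a b _ ab|i _]; first exact: le_trans.
  by exists (z 0 i) => //; exact: Zint.
have [b b0 hb] := Zinj zZ.
have [c c0 hc] : exists2 c, 0 < c & forall z', z' \in Z -> z' != z -> c <= vd (kap z) (kap z').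
  apply: uniform_radius => [z' x y _ xy h /h|z' z'Z]; first exact: le_trans.
  have [->|ne] := eqVneq z' z; first by exists 1.
  exists (vd (kap z) (kap z')) => //; rewrite lt_neqAle vd_ge0 andbT eq_sym.
  apply: contra ne => /eqP /vd_eq0 e; apply/eqP.
  have [sz' _] := (ZP z').1 z'Z.
  have es : \sum_i z 0 i = \sum_i z' 0 i by case: sz => _ ->; case: sz' => _ ->.
  by rewrite -(unk_kap es) e subrr -[LHS](unk_kap (erefl (\sum_i z' 0 i))) subrr.
have [r [r0 r1 r2 r3]] := exists_min3 (divr_gt0 a0 (mulr_gt0 (ltr0Sn R 1) N20))
  (divr_gt0 b0 (mulr_gt0 (ltr0Sn R 1) N20)) (divr_gt0 c0 (ltr0Sn R 1)).
exists r => //; split=> [i|x y sx sy hx hy|z' z'Z ne].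
- apply: le_trans (ha i (mem_enum _ i)).
  by rewrite mulrC -ler_pdivlMr // mulr_gt0.
- have : N2 * r < b.
    apply: (@le_lt_trans _ _ (b / 2)); last by lra.
    by rewrite mulrC -ler_pdivlMr // -mulrA -invfM.
  by move=> hr; apply: hb => //; [exact: le_lt_trans hx hr|exact: le_lt_trans hy hr].
- by rewrite mulrC -ler_pdivlMr //; apply: le_trans r3 _; rewrite ler_pM2r ?invr_gt0 //; exact: hc.
Qed.

(* Each zero contributes the parity of the number of fully labelled simplices
   around it. *)
Lemma global_degree : exists2 e, 0 < e & forall C, sized n.+2 C ->
    allc (fun s : seq PS => small (@vd R n.+2) e s /\ forall x, x \in s -> @std R n x) C ->
    allc (fun s : seq PS => exists i, forall x, x \in s -> x 0 i = 0) (bd C) ->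
    (forall z : PS, (forall i, 0 < z 0 i) -> full (ell z) C) ->
  deg true (push d (bd C)) = odd (size Z).
Proof.
have [rho rho0 hrho] := common_radius.
have [e1 e10 he1] : exists2 e, 0 < e & forall z, z \in Z -> forall C, sized n.+2 C ->
    allc (fun s : seq PS => small (@vd R n.+2) e s /\
      forall x, x \in s -> @std R n x /\ vd (kap x) (kap z) <= rho) C ->
    allc (fun s : seq PS => forall x, x \in s -> rho / 2 <= vd (kap x) (kap z)) (bd C) ->
    full (ell z) C ->
    deg true (push d (bd C)) = true.
  apply: uniform_radius => [z a b _ ab h C sC hC|z zZ].
    apply: h => // s /hC[sm ?]; split=> // p q ps qs; exact: lt_le_trans (sm p q ps qs) ab.
  have [h1 h2 h3] := hrho z zZ; have [sz dz] := (ZP z).1 zZ.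
  exact: (local_degree dc sz dz rho0 h1 h2).
pose near (z x : PS) := vd (kap x) (kap z) < rho / 2.
pose far := [set x : PS | @std R n x /\ forall z, z \in Z -> rho / 2 <= vd (kap x) (kap z)].
have r2 : 0 < rho / 2 by rewrite divr_gt0.
have [r r0 hr] : exists2 r, 0 < r & forall x, far x -> r <= vd (d x) 0.
  have cfar : compact far.
    have -> : far = @std R n `&` \bigcap_(z in [set` Z]) [set x | rho / 2 <= vd (kap x) (kap z)].
      by apply/seteqP; split=> x [h1 h2].
    apply: compact_closedI; first exact: std_compact.
    apply: closed_bigI => z _; apply: (@closed_comp _ _ (fun x : PS => vd (kap x) (kap z)) [set t | rho / 2 <= t]).
      move=> x _; apply: continuous_bigmax => j.
      apply: (@continuous_comp _ _ _ (fun x : PS => kap x 0 j - kap z 0 j) (fun t : R => `|t|)).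
        apply: (@cvgB _ _ _ (nbhs x)); last exact: cvg_cst.
        by rewrite /kap; under eq_fun do rewrite mxE; rewrite mxE; exact: coord_continuous.
      exact: norm_continuous.
    exact: closed_ge.
  have sub : far `<=` @std R n by move=> x [].
  have dF := continuous_subspaceW sub dc.
  have c1 : {within far, continuous (fun x : PS => vd (d x) 0)}.
    move=> x; apply: continuous_bigmax => j.
    apply: (@continuous_comp _ _ _ (fun x : subspace far => d x 0 j - (0 : 'rV[R]_n.+1) 0 j) (fun t : R => `|t|)).
      apply: (@cvgB _ _ _ (nbhs x)); last exact: cvg_cst.
      apply: (@continuous_comp _ _ _ (d : subspace far -> _) (fun q : 'rV[R]_n.+1 => q 0 j)); first exact: dF.
      exact: coord_continuous.
    exact: norm_continuous.
  have c2 : {within far, continuous (fun x : PS => 1 : R)} by move=> x; exact: cvg_cst.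
  have h2 : 0 < 1 / 2 :> R by lra.
  have [||r r0 h] := compact_uniform cfar c1 c2 _ _ h2.
  - by move=> x _; exact: vd_ge0.
  - move=> x [sx hx] /vd_eq0 dx; have xZ : x \in Z by apply/ZP.
    by have := hx x xZ; rewrite vdxx; lra.
  by exists r => // x fx; rewrite leNgt; apply/negP => /(h x fx); lra.
have [a a0 ha] := d_uniform dc r0.
have N20' : 0 < rho / (2 * N2) by rewrite divr_gt0 // mulr_gt0.
have [e [e0 ee1 ea er]] := exists_min3 e10 a0 N20'.
have er2 : e <= rho / 2.
  by apply: le_trans er _; rewrite invfM mulrA ler_piMr ?(ltW r2) // invf_le1 // ler1n.
exists e => // C sC hC bC fC.
pose hs (z : PS) (s : seq PS) := has (near z) s.
pose g (s : seq PS) := deg true (push d (bdt s)).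
have gE c : deg true (push d (bd c)) = pair g c.
  by rewrite /deg /push /bd !pair_lin; apply: eq_pair => s _; rewrite /g /deg /push pair_lin.
have kapd (x y : PS) : vd x y < e -> vd (kap x) (kap y) < e by apply: le_lt_trans; exact: vd_kap.
have each z : z \in Z -> pair g (cfilter (hs z) C).
  move=> zZ; have [h1 h2 h3] := hrho z zZ; rewrite -gE.
  have nearP s x : coef C s -> hs z s -> x \in s -> vd (kap x) (kap z) <= rho.
    move=> cs /hasP[y ys hy] xs; have [sm _] := hC s cs.
    have := vd_tri (kap x) (kap y) (kap z); have := kapd _ _ (sm x y xs ys).
    by rewrite /near in hy; lra.
  apply: (he1 z zZ).
  - by move=> s; rewrite coef_filter => /andP[/sC].
  - move=> s; rewrite coef_filter => /andP[cs hz]; have [sm st] := hC s cs; split.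
      by move=> p q ps qs; apply: lt_le_trans (sm p q ps qs) ee1.
    by move=> x xs; split; [exact: st|exact: nearP hz xs].
  (* A boundary face of the part near [z] that came near [z] itself would be a boundary face of [C],
     since every tuple of [C] having it as a face belongs to that part. But on boundary faces of [C]
     a coordinate vanishes, which keeps them away from [z]. *)
  - move=> u cu x xu; rewrite leNgt; apply/negP => nx.
    have hu : hs z u by apply/hasP; exists x.
    have : coef (bd C) u.
      have -> : C = cfilter (hs z) C + cfilter (predC (hs z)) C.
        by apply: chainP => s; rewrite coefD !coef_filter /=; case: (coef C s) (hs z s) => [] [].
      rewrite bdD coefD cu; case E : (coef (bd (cfilter _ _)) u) => //.
      move/coef_bd: E => [s]; rewrite coef_filter /= => /andP[_ ns] [us _].
      by case/negP: ns; apply/hasP; exists x => //; exact: us.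
    move=> /bC[i hi]; have := hi x xu; have := h1 i.
    have [v vu v2] : exists2 v, coef C v & {subset u <= v}.
      by move/coef_bd: cu => [v]; rewrite coef_filter => /andP[cv _] [uv _]; exists v.
    have [_ stv] := hC v vu; have sx := stv x (v2 x xu).
    have [sz dz] := (ZP z).1 zZ.
    have es : \sum_i x 0 i = \sum_i z 0 i by case: sx => _ ->; case: sz => _ ->.
    have := vd_le_kap es; have := vd_coord x z i; rewrite ler_norml.
    have : N2 * vd (kap x) (kap z) < N2 * rho.
      by rewrite ltr_pM2l //; apply: lt_le_trans nx _; lra.
    have : 0 < N2 * rho by rewrite mulr_gt0.
    by rewrite -mulrA; move: (N2 * rho) (N2 * vd _ _) => b c ? ? /andP[? ?] ? ?; lra.
  - suff <- : full (ell z) C = full (ell z) (cfilter (hs z) C) by exact: fC (Zint zZ).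
    rewrite /full pair_filter; apply: eq_pair => s cs.
    case hz : (hs z s) => //=.
    have [sm st] := hC s cs; have [sz dz] := (ZP z).1 zZ.
    apply: (not_full sz (Zint zZ) rho0 er (sC s cs) sm st) => x xs.
    by rewrite leNgt; apply: contraFN hz => nx; apply/hasP; exists x.
(* A tuple near no zero has a fine image away from the origin, so its boundary has degree zero. The
   rest is summed over the zeros, whose neighbourhoods share no tuple. *)
suff H l : uniq l -> {subset l <= Z} -> pair g (cfilter (fun s => has (hs^~ s) l) C) = odd (size l).
  rewrite gE -(H Z uZ (fun _ h => h)) pair_filter; apply: eq_pair => s cs.
  case hz : (has _ _) => //=; have [sm st] := hC s cs.
  rewrite /g -bd_sg push_bd (deg_bd0 true r0) //.
    by apply: sized_push => u; rewrite coef_sg => /eqP->; exact: sC.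
  move=> u /coef_push[v]; rewrite coef_sg => /eqP-> ->; split.
    move=> _ _ /mapP[x xs ->] /mapP[y ys ->]; apply: ha; [exact: st|exact: st|].
    exact: lt_le_trans (sm x y xs ys) ea.
  move=> _ /mapP[x xs ->]; have [|j hj] := exists_large r0 (hr x _).
    split=> [|z zZ]; first exact: st.
    rewrite leNgt; apply: contraFN hz => nz; apply/hasP; exists z => //; apply/hasP; by exists x.
  by exists j; move: hj; rewrite mxE subr0.
elim: l => [|z l IH] /=.
  by move=> _ _; rewrite pair_eq0 // => s; rewrite coef_filter andbF.
move=> /andP[zl ul] sub; have zZ := sub z (mem_head _ _).
have subl : {subset l <= Z} by move=> x xl; apply: sub; rewrite inE xl orbT.
have ez : pair g (cfilter (hs z) C) = true := each z zZ.
rewrite -addTb -ez -(IH ul subl) -pairD; congr pair; apply: chainP => s.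
rewrite coefD !coef_filter; case cs : (coef C s) => //=.
case hz : (hs z s) => //=; case hl : (has _ l) => //=.
have [z' z'l /hasP[y ys hy]] := hasP hl; have /hasP[x xs hx] := hz.
have [sm _] := hC s cs; have [_ _ h3] := hrho z zZ.
have ne : z' != z by apply: contraNneq zl => <-.
have := h3 z' (subl z' z'l) ne; have := vd_tri (kap z) (kap x) (kap z').
have := vd_tri (kap x) (kap y) (kap z'); have := kapd _ _ (sm x y xs ys).
by move: hx hy; rewrite /near (vdC (kap x) (kap z)); lra.
Qed.

End GlobalDegree.

(** * The tower of an obstructor complex *)

Section Facets.
Variable T : choiceType.
Implicit Types X Y Z : {fset T}.

Definition bdf X : chain {fset T} := [fset X `\ w | w in X]%fset.

Lemma coef_bdf X Y : coef (bdf X) Y = (Y `<=` X)%fset && (#|` X| == #|` Y|.+1).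
Proof.
apply/imfsetP/andP => [[w /= wX ->]|[YX /eqP e]].
  by split; [exact: fsubD1set|rewrite [in X in X == _](cardfsD1 w) wX].
have : #|` X `\` Y|%fset = 1%N by rewrite cardfsDS // e subSnn.
move/eqP/cardfs1P => [w ew]; have : w \in (X `\` Y)%fset by rewrite ew inE.
rewrite inE => /andP[wY wX]; exists w => //; apply/fsetP => u.
rewrite !inE; move/fsetP: ew => /(_ u); rewrite !inE => h.
case uY : (u \in Y) => //=; move: h; rewrite uY /= => h.
  by rewrite (fsubsetP YX _ uY) andbT; apply/esym/negP => /eqP uw; rewrite -uw uY in wY.
by rewrite -h; case: (u \in X).
Qed.

Lemma bdfP X Y : coef (bdf X) Y -> exists2 w, w \in X & Y = (X `\ w)%fset.
Proof. by move=> /imfsetP[w /= wX ->]; exists w. Qed.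

Lemma pair_pred1 (c : chain {fset T}) X : pair (pred1 X) c = coef c X.
Proof. by rewrite pair_odd count_uniq_mem ?fset_uniq // oddb. Qed.

(** Exactly two sets lie strictly between [X] and a subset with two elements fewer. *)
Lemma bdf_bdf X : lin bdf (bdf X) = 0.
Proof.
apply: chainP => Y; rewrite coef0 coef_lin.
case h : ((Y `<=` X)%fset && (#|` X| == #|` Y|.+2)); last first.
  apply: pair_eq0 => Z /[!coef_bdf] /andP[ZX /eqP e].
  by apply: (contraFF _ h) => /andP[YZ /eqP e']; rewrite (fsubset_trans YZ ZX) e e' /=.
case/andP: h => YX /eqP e.
have cD : #|` X `\` Y|%fset = 2%N by rewrite cardfsDS // e subSn // subSnn.
have [u uD] : exists u, u \in (X `\` Y)%fset by apply/fset0Pn; rewrite -cardfs_gt0 cD.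
have : #|` X `\` Y `\ u|%fset = 1%N by move: cD; rewrite (cardfsD1 u) uD => -[].
move/eqP/cardfs1P => [w /fsetP ew].
have := ew w; rewrite !inE eqxx => /and3P[wu wY wX].
move: uD; rewrite inE => /andP[uY uX].
rewrite (_ : pair _ _ = pair (fun Z => (Z == u |` Y) (+) (Z == w |` Y))%fset (bdf X)).
  rewrite pair_add !pair_pred1 !coef_bdf !cardfsU1 uY wY !fsubUset !fsub1set uX wX YX /= !add1n e.
  by rewrite eqxx.
apply: eq_pair => Z; rewrite !coef_bdf => /andP[ZX /eqP eZ].
have key v : v \notin Y -> (Y `<=` Z)%fset -> v \in Z -> Z = (v |` Y)%fset.
  move=> vY YZ vZ; apply/esym/eqP; rewrite eqEfcard fsubUset fsub1set vZ YZ cardfsU1 vY.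
  by rewrite -ltnS -eZ e /= add1n ltnS.
apply/andP/idP => [[YZ _]|].
  have : (X `\` Z `<=` X `\` Y)%fset by apply: fsetDS.
  have [uZ|uZ] := boolP (u \in Z).
    rewrite (key u uY YZ uZ) eqxx /= => _; apply/negP => /eqP/fsetP/(_ w).
    by rewrite !inE eqxx (negPf wu) (negPf wY).
  have [wZ|wZ _] := boolP (w \in Z).
    rewrite (key w wY YZ wZ) eqxx addbT => _; apply/negP => /eqP/fsetP/(_ w).
    by rewrite !inE eqxx (negPf wu) (negPf wY).
  have : ([fset u; w] `<=` X `\` Z)%fset.
    by apply/fsubsetP => v; rewrite !inE => /orP[]/eqP->; rewrite ?uX ?wX ?uZ ?wZ.
  move/fsubset_leq_card; rewrite cardfs2 cardfsDS // eZ subSnn.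
  by rewrite eq_sym wu.
have g v : v \notin Y -> Z == (v |` Y)%fset -> (Y `<=` Z)%fset /\ #|` Z| == #|` Y|.+1.
  by move=> vY /eqP->; rewrite cardfsU1 vY fsubsetUr.
by move=> h; have [/(g u uY) [-> ->] //|nu] := boolP (Z == u |` Y)%fset; move: h; rewrite (negPf nu) /= => /(g w wY)[-> ->].
Qed.

End Facets.

Arguments bdf {T} X.

Lemma odd_sum (I : Type) (l : seq I) (N : I -> nat) :
  odd (\sum_(i <- l) N i) = odd (count (fun i => odd (N i)) l).
Proof. by elim: l => [|x l IH]; rewrite ?big_nil // big_cons /= !oddD IH oddb. Qed.

(** * The deleted join and the cycle of an obstructor complex *)

Section DeletedJoin.
Variables (V : choiceType) (K : complex V) (m : nat).
Local Notation VB := (V * bool)%type.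
Implicit Types (X Y : {fset VB}) (s t : {fset V}).

Definition opp_vertex (w : VB) : VB := (w.1, ~~ w.2).
Definition opp X : {fset VB} := [fset opp_vertex w | w in X]%fset.
Definition part b X : {fset V} := [fset w.1 | w in [fset w in X | w.2 == b]]%fset.
Definition join s t : {fset VB} :=
  ([fset (v, true) | v in s] `|` [fset (v, false) | v in t])%fset.
Definition parts X : {fset {fset V}} := [fset part true X; part false X]%fset.
(* the deleted join of [K], a subcomplex of the join of two copies of [K] *)
Definition deleted X : Prop :=
  (forall b, part b X != fset0 -> faces K (part b X)) /\ [disjoint part true X & part false X]%fset.

Lemma opp_vertexK : involutive opp_vertex.
Proof. by case=> v b; rewrite /opp_vertex negbK. Qed.

Lemma in_opp X w : (w \in opp X) = (opp_vertex w \in X).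
Proof.
apply/imfsetP/idP => [[u /= uX ->]|h]; first by rewrite opp_vertexK.
by exists (opp_vertex w); rewrite ?opp_vertexK.
Qed.

Lemma in_part b X v : (v \in part b X) = ((v, b) \in X).
Proof.
apply/imfsetP/idP => [[[u b'] /=]|h].
  by rewrite !inE /= => /andP[uX /eqP <-] ->.
by exists (v, b) => //=; rewrite !inE h eqxx.
Qed.

Lemma in_join s t v b : ((v, b) \in join s t) = if b then v \in s else v \in t.
Proof.
rewrite in_fsetU; apply/orP/idP => [[]/imfsetP[u /= us [-> ->]] //|].
by case: b => h; [left|right]; apply/imfsetP; exists v.
Qed.

Lemma oppK : involutive opp.
Proof. by move=> X; apply/fsetP => w; rewrite !in_opp opp_vertexK. Qed.

Lemma part_opp b X : part b (opp X) = part (~~ b) X.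
Proof. by apply/fsetP => v; rewrite !in_part in_opp. Qed.

Lemma parts_opp X : parts (opp X) = parts X.
Proof. by rewrite /parts !part_opp /= fsetUC. Qed.

Lemma part_join s t b : part b (join s t) = if b then s else t.
Proof. by apply/fsetP => v; rewrite in_part in_join; case: b. Qed.

Lemma part_inj X Y : (forall b, part b X = part b Y) -> X = Y.
Proof. by move=> h; apply/fsetP => -[v b]; rewrite -!in_part h. Qed.

Lemma card_join s t : #|` join s t| = (#|` s| + #|` t|)%N.
Proof.
rewrite cardfsU (_ : _ `&` _ = fset0)%fset; last first.
  by apply/fsetP => -[v b]; rewrite !inE; apply/negP => /andP[/imfsetP[u _ [_ ->]] /imfsetP[? _ []]].
rewrite cardfs0 subn0; congr (_ + _)%N; apply: card_imfset => x y [] //.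
Qed.

Lemma join_parts X : join (part true X) (part false X) = X.
Proof. by apply: part_inj => b; rewrite part_join; case: b. Qed.

Lemma card_parts X : #|` X| = (#|` part true X| + #|` part false X|)%N.
Proof. by rewrite -card_join join_parts. Qed.

Lemma card_opp X : #|` opp X| = #|` X|.
Proof. by rewrite !card_parts !part_opp addnC. Qed.

Lemma opp_free X : deleted X -> (0 < #|` X|)%N -> opp X != X.
Proof.
move=> [_ /fdisjointP dj]; rewrite cardfs_gt0 => /fset0Pn[[v b] vX].
apply/negP => /eqP e; have : (v, ~~ b) \in X by rewrite -e in_opp /opp_vertex negbK.
by case: b vX => /= h1 h2; [have := dj v|have := dj v]; rewrite !in_part h1 h2 => /(_ isT).
Qed.

Lemma part_sub b X Y : (Y `<=` X)%fset -> (part b Y `<=` part b X)%fset.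
Proof. by move=> /fsubsetP h; apply/fsubsetP => v; rewrite !in_part => /h. Qed.

Lemma deleted_sub X Y : (Y `<=` X)%fset -> deleted X -> deleted Y.
Proof.
move=> YX [h1 h2]; split=> [b n0|].
  have sb := part_sub b YX; apply: (face_sub (h1 b _) n0 sb).
  by apply: contra n0 => /eqP e; rewrite e fsubset0 in sb.
apply/fdisjointP => v /(fsubsetP (part_sub true YX)) /(fdisjointP h2).
by apply: contra; exact: (fsubsetP (part_sub false YX)).
Qed.

Lemma deleted_opp X : deleted X -> deleted (opp X).
Proof.
move=> [h1 h2]; split=> [b|]; first by rewrite part_opp; exact: h1.
by rewrite !part_opp fdisjoint_sym.
Qed.

Lemma bdf_opp X : bdf (opp X) = tpush opp (bdf X).
Proof.
apply: chainP => Y; rewrite (coef_tpush oppK) !coef_bdf !card_opp; congr (_ && _).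
apply/fsubsetP/fsubsetP => h w; first by rewrite in_opp => /h; rewrite in_opp opp_vertexK.
by move=> wY; rewrite in_opp; apply: h; rewrite in_opp opp_vertexK.
Qed.

Section Sigma.
Variable Sigma : {fset {fset {fset V}}}.
Hypotheses (cellS : is_cell_chain K m Sigma) (cycS : is_cell_cycle Sigma).
Hypothesis evenS : forall s, faces K s -> #|` s| = m.+1 ->
  ~~ odd #|` fset_set [set v : V | [fset s; [fset v]] \in Sigma]|.

Lemma fset2_eq (T : choiceType) (a b c d : T) : [fset a; b]%fset = [fset c; d]%fset ->
  (a = c /\ b = d) \/ (a = d /\ b = c).
Proof.
move=> /fsetP e; have := e a; have := e b; have := e c; have := e d.
rewrite !inE !eqxx /= !orbT => /orP[]/eqP dE /orP[]/eqP cE /esym/orP[]/eqP bE /esym/orP[]/eqP aE;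
  by [left; split; congruence|right; split; congruence].
Qed.

Lemma parts_Sigma X : parts X \in Sigma ->
  [/\ deleted X, #|` X| = m.+2, part true X != fset0 & part false X != fset0].
Proof.
move=> /cellS[s [t [e [fs ft dj] c]]].
have [[e1 e2]|[e1 e2]] := fset2_eq e.
  split; rewrite ?card_parts ?e1 ?e2; [|by rewrite c addn2|exact: face_neq0 fs|exact: face_neq0 ft].
  by split; rewrite ?e1 ?e2 // => -[]; rewrite ?e1 ?e2.
split; rewrite ?card_parts ?e1 ?e2; [|by rewrite addnC c addn2|exact: face_neq0 ft|exact: face_neq0 fs].
by split; [move=> []; rewrite ?e1 ?e2|rewrite e1 e2 fdisjoint_sym].
Qed.

Lemma parts_eq X Y : parts X = parts Y -> X = Y \/ X = opp Y.
Proof.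
move=> /fset2_eq[[e1 e2]|[e1 e2]]; [left|right]; apply: part_inj => -[]; rewrite ?part_opp //.
Qed.

(** All vertices involved occur in a cell of [Sigma], so finiteness is clear. This lifts [Sigma] to
    the deleted join, with two joins over each cell. *)
Lemma cells_chain : exists z : chain {fset VB}, forall X, coef z X = (parts X \in Sigma).
Proof.
pose f (P : {fset {fset V}}) : {fset VB} :=
  ([fset (v, true) | v in \bigcup_(s <- P) s] `|` [fset (v, false) | v in \bigcup_(s <- P) s])%fset.
pose W : {fset VB} := (\bigcup_(P <- Sigma) f P)%fset.
exists [fset X in fpowerset W | parts X \in Sigma]%fset => X.
rewrite /coef !inE fpowersetE; case h : (parts X \in Sigma); rewrite ?andbF // andbT.
apply/fsubsetP => -[v b] vX; apply/bigfcupP; exists (parts X); first by rewrite h.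
have hv : v \in (\bigcup_(s <- parts X) s)%fset.
  apply/bigfcupP; exists (part b X); last by rewrite in_part.
  by rewrite /parts !inE; case: (b); rewrite eqxx ?orbT.
by rewrite in_fsetU; apply/orP; case: b vX => _; [left|right]; apply/imfsetP; exists v.
Qed.

Variable z : chain {fset VB}.
Hypothesis zP : forall X, coef z X = (parts X \in Sigma).

Lemma z_opp : tpush opp z = z.
Proof. by apply: chainP => X; rewrite (coef_tpush oppK) !zP parts_opp. Qed.

Let cofaces Y := cfilter (fun X => coef (bdf X) Y) z.

(** The coefficient of [Y] is the parity of its cofaces in [z], which may be counted under any
    injective naming [h]. *)
Lemma bd_z_bij (U : choiceType) (A : {fset U}) (h : {fset VB} -> U) Y :
    {in enum_fset (cofaces Y) &, injective h} ->
    (forall P, P \in A <-> exists2 X, coef (cofaces Y) X & P = h X) ->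
  coef (lin bdf z) Y = odd #|` A|.
Proof.
move=> hi hA; rewrite coef_lin.
rewrite (_ : pair _ z = pair predT (cofaces Y)).
  rewrite pair_odd count_predT -(size_map h); congr odd; apply/perm_size/uniq_perm.
  - by rewrite map_inj_in_uniq // fset_uniq.
  - exact: fset_uniq.
  move=> P; apply/mapP/idP => [[X XY ->]|/hA[X XY ->]]; last by exists X.
  by apply/hA; exists X.
by rewrite /cofaces pair_filter; apply: eq_pair => X _; rewrite andbT.
Qed.

(** When both parts are nonempty, cofaces in the join correspond to cofaces in the deleted product,
    whose number is even by [cycS]. *)
Lemma bd_cells_both Y : (forall b, part b Y != fset0) -> coef (lin bdf z) Y = false.
Proof.
move=> n0; rewrite (@bd_z_bij _ [fset P in Sigma | `[< cell_facet P (parts Y) >]]%fset (@parts)).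
- exact/negbTE/cycS.
- move=> X X'; rewrite -![_ \in enum_fset _]/(coef _ _) !coef_filter => /andP[zX]; rewrite coef_bdf => /andP[YX _].
  move=> /andP[zX']; rewrite coef_bdf => /andP[YX' _] /parts_eq[//|e].
  have [v vY] := fset0Pn _ (n0 true); case/negP: (n0 true); apply/eqP.
  have [[_ /fdisjointP dj] _ _ _] := parts_Sigma (etrans (esym (zP X)) zX).
  have := dj v (fsubsetP (part_sub true YX) _ vY).
  rewrite e part_opp /= => /negP[]; exact: (fsubsetP (part_sub true YX')).
move=> P; rewrite !inE; split=> [/andP[PS /asboolP[s [t [v [PE vs s0 YE]]]]]|].
  have [s' [t' [PE' [fs ft dj] c]]] := cellS PS.
  have dj' : [disjoint s & t]%fset.
    by move: PE; rewrite PE' => /fset2_eq[[<- <-]//|[<- <-]]; rewrite fdisjoint_sym.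
  have [[e1 e2]|[e1 e2]] := fset2_eq YE.
    exists (join s t); last by rewrite /parts !part_join.
    rewrite coef_filter zP /parts !part_join -PE PS /=; apply/imfsetP; exists (v, true); rewrite ?in_join //.
    apply: part_inj => b; apply/fsetP => u; rewrite [RHS]in_part in_fsetD1 in_join xpair_eqE.
    by case: b; rewrite /= ?andbT ?andbF /= ?e1 ?e2 ?in_fsetD1.
  exists (join t s); last by rewrite /parts !part_join fsetUC.
  rewrite coef_filter zP /parts !part_join fsetUC -PE PS /=; apply/imfsetP; exists (v, false); rewrite ?in_join //.
  apply: part_inj => b; apply/fsetP => u; rewrite [RHS]in_part in_fsetD1 in_join xpair_eqE.
  by case: b; rewrite /= ?andbT ?andbF /= ?e1 ?e2 ?in_fsetD1.
move=> [X]; rewrite coef_filter zP => /andP[XS /bdfP[[v b] vX YE]] PE; rewrite PE XS /=.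
apply/asboolP; have pY b' : part b' Y = if b' == b then (part b' X `\ v)%fset else part b' X.
  apply/fsetP => u; rewrite in_part YE in_fsetD1 xpair_eqE.
  by have [->|_] := eqVneq b' b; rewrite ?in_fsetD1 !in_part ?andbT ?andbF.
case: b vX pY YE => vX pY YE; [exists (part true X), (part false X), v|exists (part false X), (part true X), v].
  have := pY true; have := pY false; rewrite /= => pf pt.
  by split; rewrite ?in_part // -?pt ?n0 // /parts pt pf.
have := pY true; have := pY false; rewrite /= => pf pt.
by split; rewrite ?in_part // -?pf ?n0 // /parts ?pt ?pf fsetUC.
Qed.

(** Here the part that disappeared was a single vertex and the other part is an [m]-simplex; the
    number of such vertices is even by [evenS]. Such faces do not exist in the deleted product,
    which is why the third condition on obstructor complexes is needed. *)
Lemma bd_cells_left Y : part true Y != fset0 -> part false Y = fset0 -> coef (lin bdf z) Y = false.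
Proof.
move=> n0 e0; have [hf|hf] := boolP (`[< faces K (part true Y) >] && (#|` Y| == m.+1)); last first.
  rewrite coef_lin; apply: pair_eq0 => X; rewrite zP => XS; apply: contraNF hf; rewrite coef_bdf => /andP[YX /eqP c].
  have [dX cX _ _] := parts_Sigma XS; have [fY _] := deleted_sub YX dX.
  by move: c; rewrite cX => -[<-]; rewrite eqxx andbT; apply/asboolP/fY.
case/andP: hf => /asboolP fY /eqP cY.
have cY' : #|` part true Y| = m.+1 by rewrite -cY card_parts e0 cardfs0 addn0.
have fin : finite_set [set v : V | [fset part true Y; [fset v]]%fset \in Sigma].
  pose B : {fset V} := (\bigcup_(P <- Sigma) \bigcup_(s <- P) s)%fset.
  apply: (@sub_finite_set _ _ [set` B]); last exact: finite_fset.
  move=> v /= h; apply/bigfcupP; exists [fset part true Y; [fset v]]%fset; rewrite ?h //.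
  by apply/bigfcupP; exists [fset v]%fset; rewrite !inE ?eqxx ?orbT.
pose A := [fset [fset v]%fset | v in fset_set [set v : V | [fset part true Y; [fset v]]%fset \in Sigma]]%fset.
rewrite (@bd_z_bij _ A (part false)).
- by rewrite card_imfset; [exact/negbTE/evenS|move=> u v /fset1_inj].
- move=> X X'; rewrite -![_ \in enum_fset _]/(coef _ _) !coef_filter => /andP[zX YX] /andP[zX' YX'] e.
  have pt W : coef z W -> coef (bdf W) Y -> part true W = part true Y.
    rewrite zP => /parts_Sigma[dW cW _ n2]; rewrite coef_bdf => /andP[YW /eqP c].
    have [[v b] vW YE] : exists2 w, w \in W & Y = (W `\ w)%fset by apply/bdfP; rewrite coef_bdf YW c eqxx.
    have bf : b = false.
      case: b vW YE => // vW YE; case/negP: n2; apply/eqP; rewrite -e0.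
      by apply/fsetP => u; rewrite !in_part YE !inE xpair_eqE andbF.
    by apply/fsetP => u; rewrite !in_part YE !inE xpair_eqE bf andbF.
  by apply: part_inj => -[] //; rewrite (pt X) ?(pt X').
move=> P; split=> [/imfsetP[v /=]|[X]].
  rewrite in_fset_set // inE /= => h ->; exists (join (part true Y) [fset v]%fset); last by rewrite part_join.
  rewrite coef_filter zP /parts !part_join h /=; apply/imfsetP; exists (v, false) => /=.
    by rewrite in_join inE.
  apply: part_inj => -[]; apply/fsetP => u; rewrite [RHS]in_part in_fsetD1 in_join xpair_eqE ?andbF ?andbT //.
  by move/fsetP: e0 => /(_ u) ->; rewrite !inE; case: eqP.
rewrite coef_filter zP => /andP[XS /bdfP[[v b] vX YE]] ->.
have [dX cX _ n2] := parts_Sigma XS.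
have bf : b = false.
  case: b vX YE => // vX YE; case/negP: n2; apply/eqP; rewrite -e0.
  by apply/fsetP => u; rewrite !in_part YE !inE xpair_eqE andbF.
rewrite bf in vX YE; have pt : part true X = part true Y.
  by apply/fsetP => u; rewrite !in_part YE !inE xpair_eqE andbF.
have pf : part false X = [fset v]%fset.
  apply/fsetP => u; rewrite in_part inE; move/fsetP: e0 => /(_ u).
  by rewrite in_part YE !inE xpair_eqE andbT; case: eqP => [->|_] //=.
apply/imfsetP; exists v => //=; rewrite in_fset_set // inE /= -pf -pt; exact: XS.
Qed.

Lemma bd_cells : lin bdf z = 0.
Proof.
apply: chainP => Y; rewrite coef0.
have inv W : coef (lin bdf z) W = coef (lin bdf z) (opp W).
  rewrite !coef_lin -{2}z_opp pair_lin; apply: eq_pair => X _.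
  rewrite (@pair_sg {fset VB}) bdf_opp (coef_tpush oppK) oppK //.
have [e1|n1] := eqVneq (part true Y) fset0; have [e2|n2] := eqVneq (part false Y) fset0.
- rewrite coef_lin; apply: pair_eq0 => X; rewrite zP => /parts_Sigma[_ cX _ _].
  by rewrite coef_bdf cX (card_parts Y) e1 e2 cardfs0 andbF.
- by rewrite inv; apply: bd_cells_left; rewrite part_opp.
- exact: bd_cells_left.
- by apply: bd_cells_both => -[].
Qed.

(** The invariant cycle [z] is split as [e] plus its opposite; the boundary of [e] is invariant
    because [z] is a cycle, and it is split in turn, down to dimension zero. As [e] contains one
    join over each cell, sums over [Sigma] become pairings with the top chain. Oddness of the bottom
    chain is not asserted here: it comes later from the degree. *)
Lemma deleted_join_tower : exists c : nat -> chain {fset VB},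
  [/\ forall j X, coef (c j) X -> deleted X /\ #|` X| = j.+1,
    forall j, (j <= m)%N -> lin bdf (c j.+1) = c j + tpush opp (c j),
    forall X, coef (c m.+1) X -> parts X \in Sigma
  & forall N : {fset {fset V}} -> nat,
      odd (\sum_(P <- Sigma) N P) = pair (fun X => odd (N (parts X))) (c m.+1)].
Proof.
have oppK' := oppK.
have [e ze es] := @invariant_half _ opp oppK z (fun X zX =>
  let: And4 dX cX _ _ := parts_Sigma (etrans (esym (zP X)) zX) in
  opp_free dX (etrans (congr1 (leq 1) cX) isT)) z_opp.
have step (k : nat) : (k <= m.+1)%N -> exists c : nat -> chain {fset VB},
  [/\ c m.+1 = e, forall j X, (m.+1 - k <= j <= m.+1)%N -> coef (c j) X -> deleted X /\ #|` X| = j.+1,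
    lin bdf (c (m.+1 - k)%N + tpush opp (c (m.+1 - k)%N)) = 0 &
    forall j, (m.+1 - k <= j)%N -> (j <= m)%N -> lin bdf (c j.+1) = c j + tpush opp (c j)].
  elim: k => [|k IH] km.
    exists (fun=> e); rewrite subn0 -ze; split=> [//|j X /andP[h1 h2] eX||j h1 h2]; last 2 first.
    - exact: bd_cells.
    - by have := leq_trans h1 h2; rewrite ltnn.
    have -> : j = m.+1 by apply/eqP; rewrite eqn_leq h1 h2.
    have [dX cX _ _] := parts_Sigma (etrans (esym (zP X)) (es X eX)); by [].
  have [c [c1 c2 c3 c4]] := IH (ltnW km).
  pose j0 := (m.+1 - k.+1)%N; have j0E : (m.+1 - k)%N = j0.+1 by rewrite /j0 subnSK.
  rewrite j0E in c2 c3 c4; pose y := lin bdf (c j0.+1).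
  have yX X : coef y X -> deleted X /\ #|` X| = j0.+1.
    move=> /coef_linP[Y cY]; rewrite coef_bdf => /andP[XY /eqP cc].
    have [|dY cY'] := c2 j0.+1 Y _ cY; first by rewrite leqnn -j0E leq_subr.
    by split; [exact: deleted_sub dY|move: cc; rewrite cY' => -[]].
  have yt : tpush opp y = y.
    have -> : tpush opp y = lin bdf (tpush opp (c j0.+1)).
      rewrite /y /tpush !lin_lin; apply: eq_lin => X _; rewrite lin_sg bdf_opp //.
    by apply/esym/addc_eq0; rewrite -linD.
  have [X yX'|e' ye es'] := @invariant_half _ opp oppK y _ yt.
    by have [dX cX] := yX X yX'; apply: opp_free => //; rewrite cX.
  exists (fun j => if j == j0 then e' else c j); rewrite -/j0 eqxx; split=> [|j X|| j].
  - by rewrite ifF // gtn_eqF // /j0 ltn_subrL.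
  - move=> /andP[h1 h2]; case: eqP => [->|jn] cX; first exact/yX/es'.
    by apply: c2 => //; rewrite h2 andbT ltn_neqAle h1 andbT eq_sym; apply/eqP.
  - by rewrite -ye /y lin_lin lin_eq0 // => X _; exact: bdf_bdf.
  - move=> h1 h2; have -> : (j.+1 == j0) = false by rewrite gtn_eqF.
    have [->|jn] := eqVneq j j0; first by rewrite -ye.
    by apply: c4 => //; rewrite ltn_neqAle eq_sym jn.
have [c [c1 c2 _ c4]] := step m.+1 (leqnn _); rewrite subnn in c2 c4.
exists (fun j => if (j <= m.+1)%N then c j else 0); split.
- by move=> j X; case: leqP => [jm|_ /[!coef0]//]; exact: c2.
- by move=> j jm; rewrite ltnS jm (leqW jm); exact: c4.
- by move=> X; rewrite leqnn c1 => /es; rewrite zP.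
move=> N; rewrite leqnn c1 odd_sum.
have -> : pair (fun X => odd (N (parts X))) e = odd (count (fun P => odd (N P)) (map parts (enum_fset e))).
  by rewrite pair_odd count_map.
congr odd; apply/permP/uniq_perm; first exact: fset_uniq.
  rewrite map_inj_in_uniq ?fset_uniq // => X Y eX eY /parts_eq[//|XY].
  have zX := es X eX; move: (zX); rewrite ze coefD (coef_tpush oppK) XY oppK.
  by rewrite -{1}XY [coef e X]eX [coef e Y]eY.
move=> P; apply/idP/mapP => [PS|[X eX ->]]; last by have := es X eX; rewrite zP.
have [s [t [PE [fs ft dj] c0]]] := cellS PS.
have pj : parts (join s t) = P by rewrite /parts !part_join PE.
have := zP (join s t); rewrite pj PS ze coefD (coef_tpush oppK).
case h : (coef e (join s t)); first by exists (join s t).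
by move=> /= h'; exists (opp (join s t)); rewrite ?parts_opp.
Qed.

End Sigma.

End DeletedJoin.

(** * Points of the deleted join and equivariant subdivision *)

Section Points.
Variables (R : realType) (V : choiceType) (K : complex V) (vs : seq (V * bool)).
Hypotheses (vsP : forall w, w \in vs) (vsU : uniq vs).
Local Notation VB := (V * bool)%type.
Local Notation N := (size vs).
Local Notation PT := 'rV[R]_N.
Implicit Types (p q : PT) (X Y : {fset VB}) (w : VB) (g : VB -> R).

(** The list [vs] enumerates the vertices, which places the join in a finite-dimensional row space,
    where the shell and degree results apply. *)
Definition idx w : 'I_N := Ordinal (etrans (index_mem w vs) (vsP w)).
Definition crd p w := p 0 (idx w).
Definition mk g : PT := \row_i g (tnth (in_tuple vs) i).

Lemma crd_mk g w : crd (mk g) w = g w.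
Proof. by rewrite /crd mxE (tnth_nth w) /= nth_index. Qed.

Lemma idx_tnth i : idx (tnth (in_tuple vs) i) = i.
Proof.
have w : VB by exact: (tnth (in_tuple vs) i).
by apply: val_inj; rewrite /= (tnth_nth w) /= index_uniq.
Qed.

Lemma mk_crd p : mk (crd p) = p.
Proof. by apply/rowP => i; rewrite mxE /crd idx_tnth. Qed.

Lemma crd_inj p q : crd p =1 crd q -> p = q.
Proof. by move=> h; rewrite -(mk_crd p) -(mk_crd q); apply/rowP => i; rewrite !mxE h. Qed.

Lemma crd_ord (Q : 'I_N -> Prop) : (forall w, Q (idx w)) -> forall i, Q i.
Proof. by move=> h i; rewrite -(idx_tnth i). Qed.

Lemma vd_crd_lt e p q : 0 < e -> vd p q < e <-> forall w, `|crd p w - crd q w| < e.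
Proof.
by move=> e0; rewrite (vd_lt _ _ e0); split=> h; [move=> w; exact: h|apply: crd_ord].
Qed.

Lemma vd_crd p q w : `|crd p w - crd q w| <= vd p q.
Proof. exact: vd_coord. Qed.

Definition face X p :=
  [/\ forall w, 0 <= crd p w, forall w, w \notin X -> crd p w = 0 & \sum_(w <- X) crd p w = 1].

Lemma crdE (a b : R) p q w : crd (a *: p + b *: q) w = a * crd p w + b * crd q w.
Proof. by rewrite /crd !mxE. Qed.

Lemma face_convex X a p q : 0 <= a <= 1 -> face X p -> face X q -> face X ((1 - a) *: p + a *: q).
Proof.
move=> /andP[a0 a1] [p0 pX p1] [q0 qX q1]; have a1' : 0 <= 1 - a by rewrite subr_ge0.
split=> [w|w wX|]; rewrite ?crdE.
- by rewrite addr_ge0 // mulr_ge0.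
- by rewrite pX // qX // !mulr0 addr0.
under eq_bigr do rewrite crdE.
by rewrite big_split /= -!mulr_sumr p1 q1 !mulr1 subrK.
Qed.

Lemma face_sub X Y p : (Y `<=` X)%fset -> face Y p -> face X p.
Proof.
move=> YX [p0 pY p1]; split=> // [w|]; first by move=> wX; apply: pY; apply: contra wX; exact: (fsubsetP YX).
by rewrite -p1; apply/esym/big_fsetID1 || rewrite -(big_fset_incl _ YX) // => w _ /pY.
Qed.

Lemma face_le1 X p w : face X p -> crd p w <= 1.
Proof.
move=> [p0 pX p1]; have [wX|/pX->] := boolP (w \in X); last exact: ler01.
by rewrite -p1 (big_fsetD1 w) //= lerDl sumr_ge0.
Qed.

Definition vtx w : PT := mk (fun u => (u == w)%:R).

Lemma face_vtx X w : w \in X -> face X (vtx w).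
Proof.
move=> wX; split=> [u|u uX|]; rewrite ?crd_mk ?ler0n //.
  by case: eqP => // e; rewrite -e (negPf uX) in wX.
rewrite (big_fsetD1 w) //= crd_mk eqxx big1_fset ?addr0 // => u; rewrite !inE => /andP[uw _] _.
by rewrite crd_mk (negPf uw).
Qed.

Definition opp_point p : PT := mk (fun w => crd p (opp_vertex w)).

Lemma crd_opp p w : crd (opp_point p) w = crd p (opp_vertex w).
Proof. exact: crd_mk. Qed.

Lemma opp_pointK : involutive opp_point.
Proof. by move=> p; apply: crd_inj => w; rewrite !crd_opp opp_vertexK. Qed.

Lemma face_opp X p : face X p -> face (opp X) (opp_point p).
Proof.
move=> [p0 pX p1]; split=> [w|w wX|]; rewrite ?crd_opp //.
  by apply: pX; rewrite -in_opp.
rewrite -p1 /opp big_imfset /=; last by move=> x y _ _; exact: (can_inj (@opp_vertexK V)).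
by apply: eq_bigr => w _; rewrite crd_opp opp_vertexK.
Qed.

Lemma vd_opp p q e : 0 < e -> vd p q < e -> vd (opp_point p) (opp_point q) < e.
Proof. by move=> e0 /(vd_crd_lt _ _ e0) h; apply/(vd_crd_lt _ _ e0) => w; rewrite !crd_opp. Qed.

Section Subdivision.
Variables (delta : R) (n : nat).
Hypothesis delta0 : 0 < delta.

Definition subdivides X (c : chain (seq PT)) :=
  sized #|` X| c /\ allc (fun s : seq PT => small (@vd R N) delta s /\ forall p, p \in s -> face X p) c.

(** Simplices are convex: the image of the boundary is moved to one vertex by a fine homotopy and
    closed up by a cone. *)
Lemma subdivision : exists th, forall X, deleted K X -> (#|` X| <= n)%N ->
  carried bdf (fun X => #|` X|) (@opp V) opp_point subdivides th X.
Proof.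
apply: acyclic_carrier.
- move=> X Y dX; rewrite coef_bdf => /andP[YX /eqP ->]; split=> //; exact: deleted_sub dX.
- by move=> X _; exact: bdf_bdf.
- exact: oppK.
- by move=> X; exact: deleted_opp.
- by move=> X; exact: card_opp.
- by move=> X _; exact: bdf_opp.
- by move=> X; exact: opp_free.
- exact: opp_pointK.
- move=> X c _ [sc hc]; split; first by rewrite card_opp; exact: sized_push.
  move=> _ /coef_push[s cs ->]; have [sm sf] := hc s cs; split.
    by move=> _ _ /mapP[p ps ->] /mapP[q qs ->]; apply: vd_opp => //; exact: sm.
  by move=> _ /mapP[p ps ->]; exact/face_opp/sf.
- move=> X _ /= X0; split; first by move=> s; rewrite coef_sg => /eqP ->.
  by apply: allc_sg; split=> // p.
move=> X th dX /andP[X0 _] hth; set z := lin th _ => bz.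
move: X0; rewrite cardfs_gt0 => /fset0Pn[w0 wX].
have hz s : coef z s -> [/\ (size s).+1 = #|` X|, small (@vd R N) delta s & forall p, p \in s -> face X p].
  move=> /coef_linP[Y cY cs]; have [sY hY] := hth Y cY; have [sm sf] := hY s cs.
  move: cY; rewrite coef_bdf => /andP[YX /eqP ->]; split=> //; first by rewrite (sY s cs).
  by move=> p /sf; exact: face_sub.
have [eta eta0 small_z] : exists2 eta : R, 0 < eta & allc (small (@vd R N) (delta - eta)) z.
  by apply: small_gap => s /hz[].
pose F (a : R) p := (1 - a) *: p + a *: vtx w0.
have sz : sized (#|` X|).-1 z by move=> s /hz[<-].
have X1 : (#|` X|).-1.+1 = #|` X| by rewrite prednK // cardfs_gt0; apply/fset0Pn; exists w0.
have [|b [sb bb hb]] := @homotopy_small R PT PT (@vd R N) F delta eta z _ eta0 sz bz.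
- move=> s p q a b cs ps qs /andP[a0 a1] /andP[b0 b1] ab; apply/(vd_crd_lt _ _ delta0) => w.
  have [_ _ sf] := hz s cs; have := small_z s cs p q ps qs; have := vd_crd p q w.
  rewrite /F !crdE; have [q0 _ _] := sf q qs; have q1 := face_le1 w (sf q qs).
  have [v0 _ _] := face_vtx wX; have v1 := face_le1 w (face_vtx wX).
  move: (crd p w) (crd q w) (crd _ w) (v0 w) v1 (q0 w) q1 => x y v v0' v1' y0 y1 h1 h2.
  rewrite (_ : _ - _ = (1 - a) * (x - y) + (a - b) * (v - y)); last by ring.
  apply: le_lt_trans (ler_normD _ _) _; rewrite !normrM.
  have ha : `|1 - a| * `|x - y| <= `|x - y| by rewrite ler_piMl // ger0_norm ?subr_ge0 // gerBl.
  have hb : `|a - b| * `|v - y| <= `|a - b|.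
    by rewrite ler_piMr // ler_norml; apply/andP; split; lra.
  by move: (`|1 - a| * _) (`|a - b| * _) ha hb => A B; lra.
exists (b + consc (vtx w0) (push (F 1) z)).
  split; first apply: sizedD; first by rewrite -X1.
    by move=> s /coef_consc[u /coef_push[v cv ->] ->]; rewrite /= size_map; case: (hz v cv).
  have F1 p : F 1 p = vtx w0 by rewrite /F subrr scale0r add0r scale1r.
  apply: allcD => [s cs|s /coef_consc[u /coef_push[v cv ->] ->]].
    have [sm [u cu hu]] := hb s cs; split=> // p ps; have [a [q [ha qu ->]]] := hu p ps.
    by have [_ _ sf] := hz u cu; apply: face_convex => //; [exact: sf|exact: face_vtx].
  have e p : p \in vtx w0 :: map (F 1) v -> p = vtx w0.
    by rewrite inE => /orP[/eqP//|/mapP[x _ ->]].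
  split=> [p q /e-> /e->|p /e->]; first by rewrite vdxx.
  exact: face_vtx.
rewrite bdD bb bd_consc -push_bd bz push0 consc0 addr0 addcK.
by rewrite (_ : push (F 0) z = z) // push_id // => s _ p _; rewrite /F subr0 scale1r scale0r addr0.
Qed.

(** Induction on dimension: among the boundary tuples that miss a label [w], only those of the facet
    opposite to [w] can be fully labelled. *)
Lemma sperner th (X0 : {fset VB}) (L : PT -> VB) :
    (forall X, deleted K X -> (#|` X| <= n)%N ->
      carried bdf (fun X => #|` X|) (@opp V) opp_point subdivides th X) ->
    deleted K X0 -> (#|` X0| <= n)%N ->
    (forall X p, (X `<=` X0)%fset -> face X p -> L p \in X) ->
  full L (th X0).
Proof.
move=> hth d0 n0 hL.
suff H j X : (#|` X| < j)%N -> (X `<=` X0)%fset -> full L (th X) by exact: (H _ X0 (ltnSn _)).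
elim: j X => // j IH X; rewrite ltnS => Xj XX.
have dX := deleted_sub XX d0; have nX := leq_trans (fsubset_leq_card XX) n0.
have [[sX gX] bX _ baseX] := hth X dX nX.
have [X0'|/fset0Pn[w wX]] := eqVneq X fset0.
  by rewrite baseX ?X0' ?cardfs0 // /full pair_sg.
have labels Y s : (Y `<=` X)%fset -> coef (th Y) s -> size s = #|` Y| /\ forall x, x \in map L s -> x \in Y.
  move=> YX cs; have YX0 := fsubset_trans YX XX.
  have [[sY gY] _ _ _] := hth Y (deleted_sub YX dX) (leq_trans (fsubset_leq_card YX) nX).
  split; first exact: sY.
  by move=> _ /mapP[p ps ->]; apply: hL => //; have [_ h] := gY s cs; exact: h.
have allw Y s u : (Y `<=` X)%fset -> coef (th Y) s -> uniq (map L s) -> u \in Y -> u \in map L s.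
  move=> YX cs us uY; have [ss sl] := labels Y s YX cs.
  by have [|_ ->] := uniq_min_size us sl; first by rewrite size_map ss.
rewrite -(missing_bd (i := w)) => [|s cs us]; last exact: (allw X).
rewrite bX /missing pair_lin (_ : pair _ _ = pair (pred1 (X `\ w)%fset) (bdf X)).
  rewrite pair_pred1 coef_bdf fsubD1set /=.
  by rewrite (cardfsD1 w X) wX.
apply: eq_pair => Y cY; have [u uX YE] := bdfP cY.
have YX : (Y `<=` X)%fset by rewrite YE fsubD1set.
have [Yw|Yw] := eqVneq Y (X `\ w)%fset; rewrite /= ?Yw ?eqxx ?(negPf Yw).
  have : full L (th (X `\ w)%fset).
    apply: IH; last exact: fsubset_trans (fsubD1set _ _) XX.
    by apply: leq_trans Xj; rewrite (cardfsD1 w X) wX.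
  move=> f; apply: etrans f; apply: eq_pair => s cs.
  have [_ sl] := labels _ s (fsubD1set X w) cs.
  by case: (uniq _) => //=; apply/negP => /sl; rewrite !inE eqxx.
apply: pair_eq0 => s cs; apply/negP => /andP[us]; apply/negP; rewrite negbK.
apply: (allw Y) => //; rewrite YE !inE wX andbT; apply: contra Yw => /eqP ->.
by rewrite YE.
Qed.

End Subdivision.

End Points.

(** * Continuity in the pointwise topology and on subspaces *)

Section ContinuityTools.
Variable R : realType.

Lemma cvg_ptws (V : choiceType) (Y : Type) (F : set_system Y) (FF : Filter F) (x : Y -> {ptws V -> R})
    (y : {ptws V -> R}) : (forall v, (fun i => x i v) @ F --> y v) -> x @ F --> y.
Proof.
move=> h; apply/cvg_sup => v A [B [[C oC CB] By BA]].
rewrite -CB in By; have nC : nbhs (y v) C by apply: open_nbhs_nbhs.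
apply: (@filterS _ F FF ((fun i => x i v) @^-1` C)); last exact: (h v C nC).
by move=> i Ci; apply: BA; rewrite -CB.
Qed.

Lemma cvg_row (N : nat) (Y : Type) (F : set_system Y) (FF : Filter F) (x : Y -> 'rV[R]_N) (y : 'rV[R]_N) :
  (forall i, (fun t => x t 0 i) @ F --> y 0 i) -> x @ F --> y.
Proof.
move=> h; apply/cvg_ballP => e e0.
have : \forall t \near F, forall i, `|y 0 i - x t 0 i| < e.
  apply: filter_forall => i; have /cvgrPdist_lt hi := h i; exact: hi.
by apply: filterS => t ht; split=> // i j; rewrite (ord1 i); exact: ht.
Qed.

Lemma within_comp (X Y Z : topologicalType) (A : set X) (B : set Y) (f : Y -> Z) (u : X -> Y) :
    {within B, continuous f} -> {within A, continuous u} -> (forall x, A x -> B (u x)) ->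
  {within A, continuous (f \o u)}.
Proof.
move=> /subspace_continuousP fc /subspace_continuousP uc AB; apply/subspace_continuousP => x Ax O.
move=> /(fc _ (AB x Ax)) h; have := uc x Ax _ h; rewrite /= /nbhs /= /within /=.
by rewrite !near_simpl; apply: filter_app; near=> y => hy Ay; exact: (hy Ay (AB y Ay)).
Unshelve. all: by end_near. Qed.

Lemma within_row (X : topologicalType) (A : set X) (N : nat) (f : X -> 'rV[R]_N) :
  (forall i, {within A, continuous (fun x => f x 0 i)}) -> {within A, continuous f}.
Proof.
move=> h; apply/subspace_continuousP => x Ax; apply: cvg_row => i.
by have /subspace_continuousP hi := h i; exact: hi.
Qed.

Lemma withinM (X : topologicalType) (A : set X) (f g : X -> R) :
  {within A, continuous f} -> {within A, continuous g} -> {within A, continuous (fun x => f x * g x)}.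
Proof. by move=> fc gc x; apply: (@continuousM _ (subspace A) f g x); [exact: fc|exact: gc]. Qed.

Lemma withinB (X : topologicalType) (A : set X) (f g : X -> R) :
  {within A, continuous f} -> {within A, continuous g} -> {within A, continuous (fun x => f x - g x)}.
Proof. by move=> fc gc x; apply: (@continuousB _ _ (subspace A) f g x); [exact: fc|exact: gc]. Qed.

Lemma withinV (X : topologicalType) (A : set X) (f : X -> R) : (forall x, A x -> f x != 0) ->
  {within A, continuous f} -> {within A, continuous (fun x => (f x)^-1)}.
Proof.
move=> f0 /subspace_continuousP fc; apply/subspace_continuousP => x Ax.
by apply: cvgV; [exact: f0|exact: fc].
Qed.

End ContinuityTools.

(** * The odd map of a general position map *)

Section Degree1.
Variables (R : realType) (V : choiceType) (K : complex V) (vs : seq (V * bool)) (m : nat).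
Hypotheses (vsP : forall w, w \in vs) (vsU : uniq vs).
Variable f : {ptws V -> R} -> 'rV[R]_m.
Hypothesis fgp : general_position K f.
Local Notation VB := (V * bool)%type.
Local Notation N := (size vs).
Local Notation PT := 'rV[R]_N.
Local Notation crd := (@crd R V vs vsP).
Local Notation mk := (@mk R V vs).
Local Notation face := (@face R V vs vsP).
Local Notation opp_point := (@opp_point R V vs vsP).
Implicit Types (p q : PT) (X Y : {fset VB}) (w : VB) (b : bool).

Definition mass b p := \sum_(w <- vs | w.2 == b) crd p w.
Definition bary b p : {ptws V -> R} := fun v => crd p (v, b) / mass b p.
(** It vanishes unless both sides have mass above a quarter, so it dies out before [bary] becomes
    undefined. *)
Definition mult p := Num.max 0 (Num.min (mass true p) (mass false p) - 4^-1).
(* The odd map whose zeros are the pairs of points of [K] with disjoint supports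
   and the same image under [f]. *)
Definition diff p : 'rV[R]_m.+1 := \row_i
  if unlift ord_max i is Some j then mult p * (f (bary true p) 0 j - f (bary false p) 0 j)
  else mass true p - mass false p.

Lemma diff_lift p j : diff p 0 (lift ord_max j) = mult p * (f (bary true p) 0 j - f (bary false p) 0 j).
Proof. by rewrite mxE liftK. Qed.

Lemma diff_max p : diff p 0 ord_max = mass true p - mass false p.
Proof. by rewrite mxE unlift_none. Qed.

Lemma crd_continuous w : continuous (fun p : PT => crd p w).
Proof. by move=> p; exact: coord_continuous. Qed.

Lemma mass_continuous b : continuous (fun p : PT => mass b p).
Proof.
move=> p; apply: (@cvg_big _ _ +%R 0) => [||w _]; [exact: add_continuous|exact: nbhs_filter|exact: crd_continuous].
Qed.

Lemma mass_part X b p : face X p -> \sum_(v <- part b X) crd p (v, b) = mass b p.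
Proof.
move=> [_ pX _]; rewrite /mass (bigID (fun w => w \in X)) /= [X in _ + X]big1 ?addr0; last first.
  by move=> w /andP[_ /pX].
rewrite -[RHS]big_filter -[LHS](big_map (fun v => (v, b)) xpredT (crd p)); apply: perm_big; apply: uniq_perm.
- by rewrite map_inj_uniq ?fset_uniq // => u v [].
- exact: filter_uniq.
move=> [v b']; rewrite mem_filter vsP andbT /=; apply/mapP/andP => [[u /= uX [-> ->]]|[/eqP -> vX]].
  by rewrite eqxx -in_part.
by exists v => //; rewrite in_part.
Qed.

Lemma mass_face X p : face X p -> mass true p + mass false p = 1.
Proof.
move=> [_ pX <-]; transitivity (\sum_(w <- vs | w \in X) crd p w); last first.
  rewrite -big_filter; apply: perm_big; apply: uniq_perm; [exact: filter_uniq|exact: fset_uniq|].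
  by move=> w; rewrite mem_filter vsP andbT.
rewrite [RHS]big_mkcond /= (eq_bigr (fun w => crd p w)) => [|w _]; last first.
  by case: ifPn => // /pX.
rewrite [RHS](bigID (fun w : VB => w.2 == true)) /=; congr (_ + _); apply: eq_bigl => -[v []] //.
Qed.

Lemma mass_ge0 X b p : face X p -> 0 <= mass b p.
Proof. by move=> [p0 _ _]; apply: sumr_ge0. Qed.

Lemma bary_simplex X b p : face X p -> mass b p != 0 -> simplex R (part b X) (bary b p).
Proof.
move=> fp s0; have [p0 pX _] := fp; split=> [v|v vX|].
- by rewrite /bary mulr_ge0 // invr_ge0 (mass_ge0 b fp).
- by rewrite /bary pX ?mul0r // -in_part.
by rewrite -mulr_suml (mass_part b fp) divff.
Qed.

Lemma simplex_neq0 (s : {fset V}) x : simplex R s x -> s != fset0.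
Proof.
move=> [_ _ x1]; apply/eqP => e; move: x1; rewrite e big_seq_fset0 || rewrite e big_nil.
by move/eqP; rewrite eq_sym oner_eq0.
Qed.

Lemma part_face X b p : deleted K X -> face X p -> mass b p != 0 -> faces K (part b X).
Proof. by move=> [h _] fp s0; apply: h; exact: simplex_neq0 (bary_simplex fp s0). Qed.

Lemma mass_opp b p : mass b (opp_point p) = mass (~~ b) p.
Proof.
have e : perm_eq vs (map (@opp_vertex V) vs).
  apply: uniq_perm => // [|w]; first by rewrite map_inj_uniq //; exact: (can_inj (@opp_vertexK V)).
  by rewrite vsP; apply/esym/mapP; exists (opp_vertex w); rewrite ?opp_vertexK.
rewrite /mass [RHS](perm_big _ e) big_map; apply: eq_big => [[v b']|w _] /=; last by rewrite crd_opp.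
by case: b b' => [] [].
Qed.

Lemma bary_opp b p : bary b (opp_point p) = bary (~~ b) p.
Proof. by apply/funext => v; rewrite /bary mass_opp crd_opp. Qed.

Lemma diff_opp p : diff (opp_point p) = - diff p.
Proof.
apply/rowP => i; rewrite [RHS]mxE; have [j ->|->] := unliftP ord_max i.
  by rewrite !diff_lift /mult !mass_opp !bary_opp minC -mulrN opprB.
by rewrite !diff_max !mass_opp opprB.
Qed.

Lemma row_eq (q q' : 'rV[R]_m.+1) : (forall j, q 0 (lift ord_max j) = q' 0 (lift ord_max j)) ->
  q 0 ord_max = q' 0 ord_max -> q = q'.
Proof. by move=> h1 h2; apply/rowP => i; have [j ->|->] := unliftP ord_max i. Qed.

Lemma mult_half p : mass true p = 2^-1 -> mass false p = 2^-1 -> mult p = 4^-1.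
Proof. by move=> h1 h2; rewrite /mult h1 h2 minxx max_r; lra. Qed.

(** The last coordinate vanishes only if both masses are one half, and there [mult] equals a quarter
    and can be cancelled. *)
Lemma diff_zero X p : face X p -> diff p = 0 <->
  [/\ mass true p = 2^-1, mass false p = 2^-1 & f (bary true p) = f (bary false p)].
Proof.
move=> fp; have s1 := mass_face fp; split=> [e|[h1 h2 e]].
  have := diff_max p; rewrite e mxE => h.
  have h1 : mass true p = 2^-1 by lra. have h2 : mass false p = 2^-1 by lra.
  split=> //; apply/rowP => j; have := diff_lift p j; rewrite e mxE mult_half // => /esym/eqP.
  by rewrite mulf_eq0 invr_eq0 (gt_eqF (ltr0Sn R 3)) /= subr_eq0 => /eqP.
apply: row_eq => [j|]; first by rewrite diff_lift e subrr mulr0 mxE.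
by rewrite diff_max h1 h2 subrr mxE.
Qed.

Lemma face_closed X : closed (face X).
Proof.
have -> : face X = \bigcap_(w in [set: VB]) [set p : PT | 0 <= crd p w] `&`
    \bigcap_(w in [set w | w \notin X]) [set p : PT | crd p w = 0] `&`
    [set p : PT | \sum_(w <- X) crd p w = 1].
  apply/seteqP; split=> p; first by move=> [h1 h2 h3]; split=> //; split=> w /=; [move=> _; exact: h1|exact: h2].
  by move=> [[h1 h2] h3]; split=> // w; exact: (h1 w).
apply: closedI; first apply: closedI.
- apply: closed_bigI => w _; apply: (@closed_comp _ _ (fun p : PT => crd p w) [set t | 0 <= t]).
    by move=> p _; exact: crd_continuous.
  exact: closed_ge.
- apply: closed_bigI => w _; apply: (@closed_comp _ _ (fun p : PT => crd p w) [set t | t = 0]).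
    by move=> p _; exact: crd_continuous.
  exact: closed_eq.
apply: (@closed_comp _ _ (fun p : PT => \sum_(w <- X) crd p w) [set t | t = 1]); last exact: closed_eq.
move=> p _; apply: (@cvg_big _ _ +%R 0) => [||w _]; [exact: add_continuous|exact: nbhs_filter|exact: crd_continuous].
Qed.

Lemma face_compact X : compact (face X).
Proof.
have -> : face X = [set p : PT | forall j, `|p 0 j - (0 : PT) 0 j| <= 1] `&` face X.
  apply/seteqP; split=> [p fp|p []//]; split=> // j.
  rewrite -(idx_tnth vsP vsU j); move: (tnth _ j) => w.
  have [p0 _ _] := fp; rewrite mxE subr0 ger0_norm; [exact: face_le1 fp|exact: p0].
apply: compact_closedI; [exact: cube_compact|exact: face_closed].
Qed.

Lemma bary_within X b A : A `<=` face X -> (forall p, A p -> mass b p != 0) ->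
  {within A, continuous (bary b)}.
Proof.
move=> AX s0; apply/subspace_continuousP => p Ap; apply: cvg_ptws => v.
have : {within A, continuous (fun p => crd p (v, b) / mass b p)}.
  apply: withinM; first by apply: continuous_subspaceT; exact: crd_continuous.
  by apply: withinV => //; apply: continuous_subspaceT; exact: mass_continuous.
by move=> /subspace_continuousP h; exact: h.
Qed.

Lemma f_bary_within X b A : deleted K X -> A `<=` face X -> (forall p, A p -> mass b p != 0) ->
  forall j, {within A, continuous (fun p => f (bary b p) 0 j)}.
Proof.
move=> dX AX s0 j; have [fc _ _] := fgp.
have bc : forall p, A p -> realization R K (bary b p).
  by move=> p Ap; exists (part b X); [exact: part_face (AX p Ap) (s0 p Ap)|exact: bary_simplex (AX p Ap) (s0 p Ap)].
have := within_comp fc (bary_within AX s0) bc => /subspace_continuousP h; apply/subspace_continuousP => p Ap.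
apply: (@cvg_comp _ _ _ (f \o bary b) (fun q : 'rV[R]_m => q 0 j) _ _ _ (h p Ap)); exact: coord_continuous.
Qed.

(** Two closed pieces are glued: on one both masses are at least a quarter and all terms are
    continuous, on the other [mult] vanishes. *)
Lemma diff_continuous X : deleted K X -> {within face X, continuous diff}.
Proof.
move=> dX; apply: within_row => i; have [j ->|->] := unliftP ord_max i; last first.
  under eq_fun do rewrite diff_max.
  by apply: withinB; apply: continuous_subspaceT; exact: mass_continuous.
under eq_fun do rewrite diff_lift.
pose mn p := Num.min (mass true p) (mass false p).
have mnc : continuous mn by move=> p; apply: continuous_min; exact: mass_continuous.
pose A := face X `&` [set p | 4^-1 <= mn p]; pose B := face X `&` [set p | mn p <= 4^-1].
have -> : face X = A `|` B.
  apply/seteqP; split=> p; last by case=> [][].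
  by move=> fp; have [h|/ltW h] := leP 4^-1 (mn p); [left|right].
apply: withinU_continuous.
- apply: closedI; first exact: face_closed.
  by apply: (@closed_comp _ _ mn [set t | 4^-1 <= t]); [move=> p _; exact: mnc|exact: closed_ge].
- apply: closedI; first exact: face_closed.
  by apply: (@closed_comp _ _ mn [set t | t <= 4^-1]); [move=> p _; exact: mnc|exact: closed_le].
- have AX : A `<=` face X by move=> p [].
  have s0 b p : A p -> mass b p != 0.
    by move=> [_ /=]; rewrite /mn le_min => /andP[h1 h2]; rewrite gt_eqF //; case: b; lra.
  apply: withinM.
    apply: continuous_subspaceT => p.
    have c1 : continuous_at p (fun=> 0 : R) by exact: cst_continuous.
    have c2 : continuous_at p (fun p => mn p - 4^-1).
      by apply: (@cvgB _ _ _ (nbhs p)); [exact: mnc|exact: cvg_cst].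
    exact: (continuous_max c1 c2).
  by apply: withinB; apply: f_bary_within AX _ _ => //; exact: s0.
have e : {in B, (fun=> 0) =1 (fun p => mult p * (f (bary true p) 0 j - f (bary false p) 0 j))}.
  move=> p /set_mem[_ /= h]; rewrite /mult max_l ?mul0r // subr_le0; exact: h.
by apply: (subspace_eq_continuous e) => p; exact: cvg_cst.
Qed.

End Degree1.

Lemma nbhs_vd (R : realType) (N : nat) (z : 'rV[R]_N) (A : set 'rV[R]_N) : nbhs z A ->
  exists2 e, 0 < e & forall x, vd x z < e -> A x.
Proof.
move=> /nbhs_ballP[e /= e0 he]; exists e => // x; rewrite vdC => /(vd_lt _ _ e0) h; apply: he.
by split=> // i j; rewrite (ord1 i); exact: h.
Qed.

(** * Zeros of the odd map on a top simplex *)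

Section TopFace.
Variables (R : realType) (V : choiceType) (K : complex V) (vs : seq (V * bool)) (m : nat).
Hypotheses (vsP : forall w, w \in vs) (vsU : uniq vs).
Variable f : {ptws V -> R} -> 'rV[R]_m.
Hypothesis fgp : general_position K f.
Local Notation VB := (V * bool)%type.
Local Notation N := (size vs).
Local Notation PT := 'rV[R]_N.
Local Notation crd := (@crd R V vs vsP).
Local Notation mk := (@mk R V vs).
Local Notation face := (@face R V vs vsP).
Local Notation opp_point := (@opp_point R V vs vsP).
Local Notation mass := (@mass R V vs vsP).
Local Notation bary := (@bary R V vs vsP).
Local Notation mult := (@mult R V vs vsP).
Local Notation diff := (@diff R V vs m vsP f).
Implicit Types (p q : PT) (X Y : {fset VB}) (w : VB) (b : bool).

Lemma sum_parts X (g : VB -> R) :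
  \sum_(w <- X) g w = \sum_(v <- part true X) g (v, true) + \sum_(v <- part false X) g (v, false).
Proof.
have key b : \sum_(w <- X | w.2 == b) g w = \sum_(v <- part b X) g (v, b).
  rewrite -[LHS]big_filter -[RHS](big_map (fun v => (v, b)) xpredT g); apply: perm_big; apply: uniq_perm.
  - by rewrite filter_uniq // fset_uniq.
  - by rewrite map_inj_uniq ?fset_uniq // => u v [].
  move=> [v b']; rewrite mem_filter /=; apply/andP/mapP => [[/eqP -> vX]|[u /= uX [-> ->]]].
    by exists v => //; rewrite in_part.
  by rewrite eqxx -in_part.
rewrite -(key true) -(key false) (bigID (fun w : VB => w.2 == true)) /=; congr (_ + _).
by apply: eq_bigl => -[v []].
Qed.

Lemma disjoint_parts X p : deleted K X -> face X p -> mass true p = 2^-1 -> mass false p = 2^-1 ->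
  disjoint_faces K (part true X) (part false X).
Proof.
have n2 : 2^-1 != 0 :> R by rewrite invr_eq0 (gt_eqF (ltr0Sn R 1)).
move=> dX fp h1 h2; split; last by case: dX.
  by apply: (part_face vsU dX fp); rewrite h1.
by apply: (part_face vsU dX fp); rewrite h2.
Qed.

Lemma bary_half X b p : face X p -> mass b p = 2^-1 -> simplex R (part b X) (bary b p).
Proof. by move=> fp h; apply: bary_simplex => //; rewrite h invr_eq0 (gt_eqF (ltr0Sn R 1)). Qed.

(** A zero gives a common value of two disjoint simplices whose dimensions add up to less than [m],
    which general position excludes. *)
Lemma no_zero X p : deleted K X -> (#|` X| < m + 2)%N -> face X p -> diff p <> 0.
Proof.
move=> dX cX fp /(diff_zero vsU f fp)[h1 h2 e].
have [_ gp2 _] := fgp; have dj := disjoint_parts dX fp h1 h2.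
have : set0 (f (bary true p)).
  rewrite -(gp2 _ _ dj); last by rewrite -card_parts.
  split; first by exists (bary true p) => //; exact: bary_half.
  by rewrite e; exists (bary false p) => //; exact: bary_half.
by [].
Qed.

Lemma mass_continuous_at b p : mass b p != 0 -> continuous_at p (bary b).
Proof.
move=> s0; apply: (@cvg_ptws _ _ _ (nbhs p) (nbhs_filter p)) => v.
have c1 : (fun q : PT => crd q (v, b)) @ p --> crd p (v, b) by exact: coord_continuous.
have c2 : (fun q : PT => (mass b q)^-1) @ p --> (mass b p)^-1.
  exact: (@cvgV R PT (nbhs p) (nbhs_filter p) (mass b) (mass b p) s0 (@mass_continuous R V vs vsP b p)).
exact: (@cvgM R PT (nbhs p) (nbhs_filter p) _ _ _ _ c1 c2).
Qed.

Section Chart.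
Variables (X : {fset VB}) (w0 : VB).
Hypotheses (dX : deleted K X) (cX : #|` X| = m.+2).
Local Notation xs := (enum_fset X).
Local Notation PS := 'rV[R]_m.+2.

(** With [cht] this identifies a top simplex with the standard simplex, where the global degree
    count applies; [w0] is only the default value of [nth]. *)
Definition ins (x : PS) : PT := mk (fun w => if w \in X then x 0 (inord (index w xs)) else 0).
Definition cht p : PS := \row_i crd p (nth w0 xs i).

Let sxs : size xs = m.+2. Proof. exact: cX. Qed.

Lemma nth_in (i : 'I_m.+2) : nth w0 xs i \in X.
Proof. by rewrite -[_ \in X]/(_ \in xs) mem_nth // sxs. Qed.

Lemma ins_nth (x : PS) (i : 'I_m.+2) : crd (ins x) (nth w0 xs i) = x 0 i.
Proof. by rewrite crd_mk nth_in index_uniq ?fset_uniq ?sxs // inord_val. Qed.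

Lemma chtK (x : PS) : cht (ins x) = x.
Proof. by apply/rowP => i; rewrite mxE ins_nth. Qed.

Lemma nth_index_ord w : w \in X -> exists i : 'I_m.+2, w = nth w0 xs i.
Proof.
move=> wX; have h : (index w xs < m.+2)%N by rewrite -sxs index_mem.
by exists (Ordinal h); rewrite /= nth_index.
Qed.

Lemma insK p : face X p -> ins (cht p) = p.
Proof.
move=> [_ pX _]; apply: (crd_inj vsU) => w; have [wX|wX] := boolP (w \in X).
  by have [i ->] := nth_index_ord wX; rewrite ins_nth mxE.
by rewrite crd_mk (negPf wX) pX.
Qed.

Lemma sum_nth (g : VB -> R) : \sum_(w <- X) g w = \sum_(i < m.+2) g (nth w0 xs i).
Proof. by rewrite (big_nth w0) sxs big_mkord. Qed.

Lemma face_ins (x : PS) : std x -> face X (ins x).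
Proof.
move=> [x0 x1]; split=> [w|w wX|]; rewrite ?crd_mk ?(negPf wX) //.
  by case: ifP.
by rewrite sum_nth -x1; apply: eq_bigr => i _; rewrite ins_nth.
Qed.

Lemma std_cht p : face X p -> std (cht p).
Proof.
move=> [p0 _ p1]; split=> [i|]; first by rewrite mxE.
by rewrite -p1 sum_nth; apply: eq_bigr => i _; rewrite mxE.
Qed.

Lemma vd_cht p q : vd (cht p) (cht q) <= vd p q.
Proof. by apply/vd_le => [|i]; rewrite ?vd_ge0 // !mxE; exact: vd_crd. Qed.

Lemma ins_continuous : continuous ins.
Proof.
move=> x; apply: (@cvg_row _ _ _ (nbhs x) (nbhs_filter x)) => i.
have e y : ins y 0 i = if tnth (in_tuple vs) i \in X then y 0 (inord (index (tnth (in_tuple vs) i) xs)) else 0.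
  by rewrite mxE.
under eq_fun do rewrite e; rewrite e; case: ifP => _; first exact: coord_continuous.
exact: cst_continuous.
Qed.

Lemma diff_ins_continuous : {within @std R m, continuous (diff \o ins)}.
Proof.
apply: (within_comp (diff_continuous vsU fgp dX)); last exact: face_ins.
by apply: continuous_subspaceT; exact: ins_continuous.
Qed.

(** Triple points are excluded, so a common value determines its two preimages, and these determine
    the point of the join as both masses are one half. *)
Lemma zero_inj p q : face X p -> face X q -> diff p = 0 -> diff q = 0 ->
  f (bary true p) = f (bary true q) -> p = q.
Proof.
move=> fp fq /(diff_zero vsU f fp)[p1 p2 pe] /(diff_zero vsU f fq)[q1 q2 qe] e.
have [_ _ gp3] := fgp; have dj := disjoint_parts dX fp p1 p2.
have [|_ gi _] := gp3 _ _ dj; first by rewrite -card_parts cX addn2.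
have [b1 b2] := gi (bary true q) (bary true p) (bary false q) (bary false p) (bary_half fq q1)
  (bary_half fp p1) (bary_half fq q2) (bary_half fp p2) qe e (etrans (esym pe) (etrans e qe)).
have n2 : 2^-1 != 0 :> R by rewrite invr_eq0 (gt_eqF (ltr0Sn R 1)).
apply: (crd_inj vsU) => -[v b].
have {}b1 := congr1 (fun g => g v) b1; have {}b2 := congr1 (fun g => g v) b2.
apply: (@mulIf _ (2^-1)^-1); rewrite ?invr_neq0 //.
by case: b; [move: b1; rewrite /bary p1 q1|move: b2; rewrite /bary p2 q2].
Qed.

Lemma zero_exists y : (f @` simplex R (part true X) `&` f @` simplex R (part false X)) y ->
  exists p, [/\ face X p, diff p = 0 & f (bary true p) = y].
Proof.
move=> [[a [a0 aX a1] fa] [b [b0 bX b1] fb]].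
pose p := mk (fun w => (if w.2 then a w.1 else b w.1) / 2).
have fp : face X p.
  split=> [[v c]|[v c] vX|]; rewrite ?crd_mk.
  - by rewrite /= divr_ge0 //; case: c.
  - by rewrite /=; case: c vX => vX; rewrite ?aX ?bX ?mul0r // in_part.
  rewrite sum_parts; under eq_bigr do rewrite crd_mk; under [X in _ + X]eq_bigr do rewrite crd_mk.
  by rewrite /= -!mulr_suml a1 b1; lra.
have h1 : mass true p = 2^-1.
  rewrite -(mass_part vsU true fp); under eq_bigr do rewrite crd_mk.
  by rewrite /= -mulr_suml a1 mul1r.
have h2 : mass false p = 2^-1.
  rewrite -(mass_part vsU false fp); under eq_bigr do rewrite crd_mk.
  by rewrite /= -mulr_suml b1 mul1r.
have e1 : bary true p = a by apply/funext => v; rewrite /bary h1 crd_mk /= invrK divfK.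
have e2 : bary false p = b by apply/funext => v; rewrite /bary h2 crd_mk /= invrK divfK.
exists p; split; rewrite ?e1 //; apply/(diff_zero vsU f fp); split=> //.
by rewrite e1 e2 fa fb.
Qed.

(** A zero with a vanishing coordinate would lie on a proper face, where there are no zeros. *)
Lemma zero_interior p w : face X p -> diff p = 0 -> w \in X -> 0 < crd p w.
Proof.
move=> fp dp wX; have [p0 pX p1] := fp; rewrite lt_neqAle p0 andbT; apply/negP => /eqP e.
apply: (@no_zero (X `\ w)%fset p _ _ _ dp).
- exact: deleted_sub (fsubD1set _ _) dX.
- by move: cX; rewrite (cardfsD1 w) wX add1n => -[->]; rewrite addn2.
split=> // [u|]; last by rewrite -p1 (big_fsetD1 w wX) /= -e add0r.
by rewrite !inE negb_and negbK => /orP[/eqP->|/pX].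
Qed.

(** Near the zero [mult] is positive, so equal values of [diff] force equal masses and equal
    differences of the values of [f]; transversality, stated as local injectivity, does the rest. *)
Lemma zero_isolated p : face X p -> diff p = 0 -> exists2 e, 0 < e & forall x y : PS,
  std x -> std y -> vd x (cht p) < e -> vd y (cht p) < e -> (diff \o ins) x = (diff \o ins) y -> x = y.
Proof.
move=> fp dp; have [p1 p2 pe] := (diff_zero vsU f fp).1 dp.
have [_ _ gp3] := fgp; have dj := disjoint_parts dX fp p1 p2.
have [|_ _ gi] := gp3 _ _ dj; first by rewrite -card_parts cX addn2.
have [U [W [nU nW inj]]] := gi _ _ (bary_half fp p1) (bary_half fp p2) pe.
have n2 : 2^-1 != 0 :> R by rewrite invr_eq0 (gt_eqF (ltr0Sn R 1)).
have ic : ins x @[x --> cht p] --> p by rewrite -[X in _ --> X](insK fp); exact: ins_continuous.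
have cb b A : mass b p = 2^-1 -> nbhs (bary b p) A -> nbhs (cht p) [set x | A (bary b (ins x))].
  move=> h nA; have s0 : mass b p != 0 by rewrite h.
  exact: (ic [set q | A (bary b q)] (mass_continuous_at s0 nA)).
have cm b : mass b p = 2^-1 -> nbhs (cht p) [set x | 4^-1 < mass b (ins x)].
  move=> h; apply: (ic [set q | 4^-1 < mass b q]).
  apply: (@mass_continuous R V vs vsP b p [set t | 4^-1 < t]).
  by apply: open_nbhs_nbhs; split; [exact: open_gt|rewrite /= h; lra].
have [e e0 he] := nbhs_vd (filterI (filterI (cb true _ p1 nU) (cb false _ p2 nW)) (filterI (cm true p1) (cm false p2))).
exists e => // x y sx sy /he[[xU xW] [xm1 xm2]] /he[[yU yW] [ym1 ym2]] exy.
have fx := face_ins sx; have fy := face_ins sy.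
rewrite /= in exy xU xW xm1 xm2 yU yW ym1 ym2; rewrite -(chtK x) -(chtK y); congr cht.
move: (ins x) (ins y) fx fy xU xW xm1 xm2 yU yW ym1 ym2 exy => p' q' fx fy xU xW /= xm1 xm2 yU yW ym1 ym2 exy.
have sX := mass_face vsU fx; have sY := mass_face vsU fy.
have := diff_max vsP f p'; rewrite exy diff_max => eD.
have m1 : mass true p' = mass true q' by lra.
have m2 : mass false p' = mass false q' by lra.
have pos q : 4^-1 < mass true q -> 4^-1 < mass false q -> mult q != 0.
  by move=> h1 h2; rewrite /mult gt_eqF // lt_max subr_gt0 lt_min h1 h2 orbT.
have mE : mult p' = mult q' by rewrite /mult m1 m2.
have nz q : 4^-1 < mass true q -> 4^-1 < mass false q -> forall b, mass b q != 0.
  by move=> h1 h2 b; rewrite gt_eqF //; case: b; lra.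
have sb q b : face X q -> 4^-1 < mass true q -> 4^-1 < mass false q -> simplex R (part b X) (bary b q).
  by move=> fq h1 h2; apply: bary_simplex => //; exact: nz.
have [b1 b2] : bary true p' = bary true q' /\ bary false p' = bary false q'.
  have : (bary true p', bary false p') = (bary true q', bary false q').
    apply: inj; rewrite ?inE /=.
    - by split; (split; [assumption|exact: (sb _ _ fx xm1 xm2)]).
    - by split; (split; [assumption|exact: (sb _ _ fy ym1 ym2)]).
    apply/rowP => j; have := diff_lift vsP f p' j; rewrite exy diff_lift mE !mxE => h.
    by apply/esym; apply: (mulfI (pos q' ym1 ym2)).
  by case.
apply: (crd_inj vsU) => -[v b].
have {}b1 := congr1 (fun g => g v) b1; have {}b2 := congr1 (fun g => g v) b2.
apply: (@mulIf _ (mass b q')^-1); first by rewrite invr_neq0 // nz.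
by case: b; [move: b1; rewrite /bary m1|move: b2; rewrite /bary m2].
Qed.

End Chart.

End TopFace.

Lemma bounded_away (R : realType) (N M : nat) (A : set 'rV[R]_N) (d : 'rV[R]_N -> 'rV[R]_M) :
    compact A -> {within A, continuous d} -> (forall x, A x -> d x <> 0) ->
  exists2 r, 0 < r & forall x, A x -> r <= vd (d x) 0.
Proof.
move=> cA dc d0.
have c1 : {within A, continuous (fun x => vd (d x) 0)}.
  move=> x; apply: continuous_bigmax => j.
  apply: (@continuous_comp _ _ _ (fun x : subspace A => d x 0 j - (0 : 'rV[R]_M) 0 j) (fun t : R => `|t|)).
    apply: (@cvgB _ _ _ (nbhs x)); last exact: cvg_cst.
    apply: (@continuous_comp _ _ _ (d : subspace A -> _) (fun q : 'rV[R]_M => q 0 j)); first exact: dc.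
    exact: coord_continuous.
  exact: norm_continuous.
have c2 : {within A, continuous (fun x : 'rV[R]_N => 1 : R)} by move=> x; exact: cvg_cst.
have h2 : 0 < 1 / 2 :> R by lra.
have [||r r0 h] := compact_uniform cA c1 c2 _ _ h2.
- by move=> x _; exact: vd_ge0.
- by move=> x Ax /vd_eq0 /(d0 x Ax).
by exists r => // x Ax; rewrite leNgt; apply/negP => /(h x Ax); lra.
Qed.

Lemma uniform_modulus (R : realType) (N M : nat) (A : set 'rV[R]_N) (d : 'rV[R]_N -> 'rV[R]_M) e :
    compact A -> {within A, continuous d} -> 0 < e ->
  exists2 a, 0 < a & forall x y, A x -> A y -> vd x y < a -> vd (d x) (d y) < e.
Proof.
move=> cA dc e0.
have idc : {within A, continuous (@idfun 'rV[R]_N)} by apply: continuous_subspaceT => x; exact: cvg_id.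
have [||a a0 ha] := compact_uniform (compact_setX cA cA) (within_vd idc) (within_vd dc) _ _ e0.
- by move=> p _; exact: vd_ge0.
- by move=> p _ /vd_eq0 /= ->; rewrite vdxx.
by exists a => // x y sx sy; exact: (ha (x, y)).
Qed.

(** * The tower of fine tuples *)

Section JoinTower.
Variables (R : realType) (V : choiceType) (K : complex V) (vs : seq (V * bool)) (m : nat).
Hypotheses (vsP : forall w, w \in vs) (vsU : uniq vs).
Local Notation VB := (V * bool)%type.
Local Notation N := (size vs).
Local Notation PT := 'rV[R]_N.
Local Notation crd := (@crd R V vs vsP).
Local Notation face := (@face R V vs vsP).
Local Notation opp_point := (@opp_point R V vs vsP).
Local Notation bary := (@bary R V vs vsP).
Implicit Types (p q : PT) (X Y : {fset VB}) (w : VB) (b : bool).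

Definition subdivision_map delta th := forall X, deleted K X -> (#|` X| <= m.+2)%N ->
  carried bdf (fun X => #|` X|) (@opp V) opp_point (@subdivides R V vs vsP delta) th X.

(** Zeros of [diff] on the join correspond to common values of [f] on its two parts, and
    [global_degree] counts them along the boundary of the subdivided simplex. *)
Lemma top_degree (f : {ptws V -> R} -> 'rV[R]_m) X : general_position K f ->
    deleted K X -> #|` X| = m.+2 -> part true X != fset0 -> part false X != fset0 ->
  exists2 e, 0 < e & forall delta th, 0 < delta -> delta <= e -> subdivision_map delta th ->
    deg true (push (diff vsP f) (bd (th X))) =
    odd #|` fset_set (\bigcap_(s in [set` parts X]) f @` simplex R s)|.
Proof.
move=> fgp dX cX n1 n2; have [w0 w0X] : exists w, w \in X by apply/fset0Pn; rewrite -cardfs_gt0 cX.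
set S := \bigcap_(s in _) _.
have SE : S = f @` simplex R (part true X) `&` f @` simplex R (part false X).
  apply/seteqP; split=> y.
    by move=> h; split; apply: h; rewrite /= /parts !inE eqxx ?orbT.
  by move=> [h1 h2] s; rewrite /= /parts !inE => /orP[]/eqP->.
have dj : disjoint_faces K (part true X) (part false X) by case: dX => h ?; split=> //; exact: h.
have finS : finite_set S.
  by have [_ _ gp3] := fgp; have [|h _ _] := gp3 _ _ dj; rewrite -?card_parts ?cX ?addn2 // SE.
have hpt y : exists p, S y -> [/\ face X p, diff vsP f p = 0 & f (bary true p) = y].
  have [Sy|nS] := pselect (S y); last by exists 0.
  have Sy' := Sy; rewrite SE in Sy'; have [p hp] := zero_exists vsP vsU Sy'; by exists p.
have [pt ptP] := choice hpt.
pose D := diff vsP f \o @ins R V vs m X.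
pose ch := @cht R V vs m vsP X w0.
pose Z := [seq ch (pt y) | y <- enum_fset (fset_set S)].
have inS y : (y \in enum_fset (fset_set S)) -> S y by rewrite -[_ \in _]/(y \in fset_set S) in_fset_set // inE.
have ptf y : S y -> face X (pt y) by move=> /ptP[].
have chK y : S y -> @ins R V vs m X (ch (pt y)) = pt y by move=> /ptf h; exact: (insK vsU w0 cX h).
have uZ : uniq Z.
  rewrite map_inj_in_uniq ?fset_uniq // => y y' /inS Sy /inS Sy' e.
  have : pt y = pt y' by rewrite -(chK y Sy) -(chK y' Sy') e.
  by have [_ _ e1] := ptP y Sy; have [_ _ e2] := ptP y' Sy' => e3; rewrite -[LHS]e1 -[RHS]e2 e3.
have ZP z : z \in Z <-> std z /\ D z = 0.
  split=> [/mapP[y /inS Sy ->]|[sz Dz]].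
    by split; [exact: (std_cht w0 cX (ptf y Sy))|rewrite /D /= chK //; case: (ptP y Sy)].
  have fz := face_ins vsP w0 cX sz; have [h1 h2 h3] := (diff_zero vsU f fz).1 Dz.
  pose y := f (bary true (@ins R V vs m X z)).
  have Sy : S y.
    rewrite SE; split; first by exists (bary true (@ins R V vs m X z)) => //; exact: (bary_half vsU fz h1).
    by rewrite /y h3; exists (bary false (@ins R V vs m X z)) => //; exact: (bary_half vsU fz h2).
  apply/mapP; exists y; first by rewrite -[_ \in _]/(y \in fset_set S) in_fset_set // inE.
  have [p1 p2 p3] := ptP y Sy.
  by rewrite (zero_inj vsU fgp dX cX p1 fz p2 Dz p3) /ch chtK.
have Zint z : z \in Z -> forall i, 0 < z 0 i.
  move=> /mapP[y /inS Sy ->] i; rewrite mxE; have [p1 p2 _] := ptP y Sy.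
  by apply: (zero_interior vsU fgp dX cX p1 p2); exact: nth_in.
have Zinj z : z \in Z -> exists2 e, 0 < e & forall x y,
    std x -> std y -> vd x z < e -> vd y z < e -> D x = D y -> x = y.
  by move=> /mapP[y /inS Sy ->]; have [p1 p2 _] := ptP y Sy; exact: (zero_isolated vsU fgp w0 dX cX p1 p2).
have Dc : {within @std R m, continuous D} by exact: (diff_ins_continuous vsU fgp w0 dX cX).
have [e e0 he] := global_degree Dc uZ ZP Zint Zinj.
exists e => // delta th d0 de hth.
have [[sX gX] bX _ _] := hth X dX (eq_leq cX).
have fX s p : coef (th X) s -> p \in s -> face X p by move=> cs ps; have [_ h] := gX s cs; exact: h.
have szZ : size Z = #|` fset_set S| by rewrite size_map.
rewrite -szZ -(he (push ch (th X))).
- rewrite -push_bd push_push; congr deg; apply: eq_push => s cs p ps /=; rewrite /D /= (insK vsU w0 cX) //.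
  by move: cs => /coef_bd[u cu [su _]]; apply: fX cu _; exact: su.
- by apply: sized_push => s cs; rewrite (sX s cs) cX.
- move=> _ /coef_push[s cs ->]; have [sm _] := gX s cs; split.
    move=> _ _ /mapP[p ps ->] /mapP[q qs ->]; apply: le_lt_trans (vd_cht m vsP X w0 p q) _.
    exact: lt_le_trans (sm p q ps qs) de.
  by move=> _ /mapP[p ps ->]; exact: (std_cht w0 cX (fX s p cs ps)).
- move=> u; rewrite -push_bd bX => /coef_push[s /coef_linP[Y /bdfP[w wX YE] cs] ->].
  have YX : (Y `<=` X)%fset by rewrite YE fsubD1set.
  have [[_ gY] _ _ _] := hth Y (deleted_sub YX dX) (leq_trans (fsubset_leq_card YX) (eq_leq cX)).
  have [i iE] := nth_index_ord w0 cX wX; exists i => _ /mapP[p ps ->]; rewrite mxE -iE.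
  have [_ h] := gY s cs; have [_ -> //] := h p ps; by rewrite YE !inE eqxx.
(* The label is a vertex of positive weight, which is Sperner's condition. *)
move=> z zi; pose L p := nth w0 (enum_fset X) (ell z (ch p)).
have fL : full L (th X).
  apply: (sperner hth dX (eq_leq cX)) => Y p YX fp.
  have fp' := face_sub YX fp; have [s0 s1] := std_cht w0 cX fp'.
  have pos : 0 < ch p 0 (ell z (ch p)).
    rewrite lt_neqAle s0 andbT; apply/negP => /eqP e1.
    have : \sum_i ch p 0 i = 0.
      apply: big1 => i _; apply/eqP; rewrite eq_le s0 andbT.
      have : ch p 0 i / z 0 i <= ch p 0 (ell z (ch p)) / z 0 (ell z (ch p)).
        by rewrite /ell; case: arg_maxP => // k _ hk; exact: hk.
      by rewrite -e1 mul0r ler_pdivrMr // mul0r.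
    by rewrite s1 => /eqP; rewrite oner_eq0.
  have [_ pY _] := fp; apply: contraT => /pY; rewrite /L => e1.
  by move: pos; rewrite mxE e1 ltxx.
rewrite /full /push pair_lin; apply: etrans fL; apply: eq_pair => s cs; rewrite pair_sg -map_comp.
have -> : map L s = map (fun i : 'I_m.+2 => nth w0 (enum_fset X) i) (map (ell z \o ch) s) by rewrite -map_comp.
rewrite [RHS]map_inj_uniq // => i j /eqP; rewrite nth_uniq ?fset_uniq // ?cX ?ltn_ord //.
by move=> /eqP/val_inj.
Qed.

(** The combinatorial tower is subdivided. If its bottom were even, the degree of [diff] would
    descend along the tower from the top boundary to zero; but on the top boundary it is the
    intersection number, which is odd. *)
Lemma small_join_tower : obstructor_complex R K m -> forall delta, 0 < delta -> exists T,
  tower opp_point m.+1 T /\ forall j, allc (fun s : seq PT => small (@vd R N) delta s /\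
    exists2 X, deleted K X & forall p, p \in s -> face X p) (T j).
Proof.
move=> [fK dimK [Sigma [[cS yS] [f fgp oddf] ev]]] delta delta0.
have [z zP] := cells_chain Sigma.
have [c [c1 c2 c3 c4]] := deleted_join_tower cS yS ev zP.
pose al := enum_fset (fpowerset (seq_fset tt vs)).
have alP X : X \in al.
  by rewrite -[_ \in _]/(X \in fpowerset _) fpowersetE; apply/fsubsetP => w _; rewrite seq_fsetE.
have [r r0 hr] : exists2 r, 0 < r & forall X, X \in al -> deleted K X -> (#|` X| < m + 2)%N ->
    forall p, face X p -> r <= vd (diff vsP f p) 0.
  apply: uniform_radius => [X a b _ ab h dX cX p fp|X _]; first exact: le_trans (h dX cX p fp).
  have [[dX cX]|h] := pselect (deleted K X /\ (#|` X| < m + 2)%N); last by exists 1 => // dX cX; case: h.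
  have [r r0 hr] := bounded_away (@face_compact R V vs vsP vsU X) (diff_continuous vsU fgp dX) (fun p => @no_zero R V K vs m vsP vsU f fgp X p dX cX).
  by exists r.
have [a a0 ha] : exists2 a, 0 < a & forall X, X \in al -> deleted K X -> forall p q, face X p -> face X q ->
    vd p q < a -> vd (diff vsP f p) (diff vsP f q) < r.
  apply: uniform_radius => [X a b _ ab h dX p q fp fq pq|X _]; first exact: h (lt_le_trans pq ab).
  have [dX|h] := pselect (deleted K X); last by exists 1.
  have [a a0 ha] := uniform_modulus (@face_compact R V vs vsP vsU X) (diff_continuous vsU fgp dX) r0.
  by exists a.
have [e e0 he] : exists2 e, 0 < e & forall X, X \in al -> coef (c m.+1) X -> forall delta th, 0 < delta ->
    delta <= e -> subdivision_map delta th -> deg true (push (diff vsP f) (bd (th X))) =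
    odd #|` fset_set (\bigcap_(s in [set` parts X]) f @` simplex R s)|.
  apply: uniform_radius => [X x y _ xy h cX d th d0 dx|X _]; first by apply: h => //; exact: le_trans xy.
  case cX : (coef (c m.+1) X); last by exists 1.
  have [dX sX n1 n2] := parts_Sigma cS (c3 X cX).
  by have [e e0 he] := top_degree fgp dX sX n1 n2; exists e.
have [d [d0 d1 d2 d3]] := exists_min3 delta0 a0 e0.
have [th hth] := subdivision K vsP vsU m.+2 d0.
pose T j := if (j <= m.+1)%N then lin th (c j) else 0.
have cs j X : (j <= m.+1)%N -> coef (c j) X -> (deleted K X) * (#|` X| <= m.+2)%N * (#|` X| = j.+1).
  by move=> jm cX; have [dX sX] := c1 j X cX; split=> //; split=> //; rewrite sX.
have bdT X : deleted K X -> (#|` X| <= m.+2)%N -> bd (th X) = lin th (bdf X) by move=> dX sX; case: (hth X dX sX).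
have bdlin j : (j <= m.+1)%N -> bd (lin th (c j)) = lin th (lin bdf (c j)).
  move=> jm; rewrite /bd !lin_lin; apply: eq_lin => X cX; have [[dX sX] _] := cs j X jm cX; exact: bdT.
have tht j : (j <= m.+1)%N -> lin th (tpush (@opp V) (c j)) = push opp_point (lin th (c j)).
  move=> jm; rewrite /tpush /push !lin_lin; apply: eq_lin => X cX; have [[dX sX] _] := cs j X jm cX.
  by rewrite lin_sg; case: (hth X dX sX).
have goodT j : allc (fun s : seq PT => small (@vd R N) d s /\
    exists2 X, deleted K X /\ #|` X| = j.+1 & forall p, p \in s -> face X p) (T j).
  rewrite /T; case: leqP => // jm s /coef_linP[X cX cs']; have [[dX sX] eX] := cs j X jm cX.
  have [[_ gX] _ _ _] := hth X dX sX; have [sm fs] := gX s cs'; split=> //; by exists X.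
have sT j : (j <= m.+1)%N -> sized j.+1 (T j).
  rewrite /T => jm; rewrite jm => s /coef_linP[X cX cs']; have [[dX sX] eX] := cs j X jm cX.
  by have [[h _] _ _ _] := hth X dX sX; rewrite (h s cs').
have stepT j : (j < m.+1)%N -> bd (T j.+1) = T j + push opp_point (T j).
  move=> jm; rewrite /T jm (ltnW jm) bdlin // c2 // linD tht //; exact: ltnW.
exists T; split; last first.
  move=> j s cs'; have [sm [X [dX _] fX]] := goodT j s cs'; split; last by exists X.
  by move=> p q ps qs; exact: lt_le_trans (sm p q ps qs) d1.
split=> //.
have sz0 : sized 0 (bd (T 0%N)) by apply: sized_bd; exact: sT.
have [b0|//] := sized0_chain sz0; exfalso.
have nzT j : (j <= m)%N -> allc (nonzero r) (push (diff vsP f) (T j)).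
  move=> jm _ /coef_push[s cs' ->]; have [sm [X [dX sX] fX]] := goodT j s cs'; split.
    move=> _ _ /mapP[p ps ->] /mapP[q qs ->].
    apply: (ha X (alP X) dX); [exact: fX|exact: fX|exact: lt_le_trans (sm p q ps qs) d2].
  have cX : (#|` X| < m + 2)%N by rewrite sX addn2 !ltnS.
  move=> _ /mapP[p ps ->]; have [j' hj] := exists_large r0 (hr X (alP X) dX cX p (fX p ps)).
  by exists j'; move: hj; rewrite [X in _ - X]mxE subr0.
have dpush c' : push (diff vsP f) (push opp_point c') = push -%R (push (diff vsP f) c').
  by rewrite !push_push; apply: eq_push => s _ p _ /=; exact: diff_opp.
have bdpush j : (j < m.+1)%N -> push (diff vsP f) (bd (T j.+1)) =
    push (diff vsP f) (T j) + push -%R (push (diff vsP f) (T j)).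
  by move=> jm; rewrite stepT // pushD dpush.
have stepd j : (j < m)%N -> bd (push (diff vsP f) (T j.+1)) =
    push (diff vsP f) (T j) + push -%R (push (diff vsP f) (T j)).
  by move=> jm; rewrite -push_bd bdpush // ltnW.
have := @deg_descent R m m r (fun j => push (diff vsP f) (T j)) m r0 stepd nzT (leqnn m).
rewrite -bdpush // -push_bd b0 push0 => h.
have degE c' : deg true (push (diff vsP f) c') = pair (fun s => alpha true (map (@lab R m) (map (diff vsP f) s))) c'.
  by rewrite /deg /push pair_lin; apply: eq_pair => s _; rewrite pair_sg.
have : deg true (push (diff vsP f) (bd (T m.+1))) = true.
  transitivity (odd (intersection_number f Sigma)); last exact: oddf.
  rewrite /intersection_number c4; apply: (etrans (degE _)); rewrite /T leqnn bdlin //.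
  have -> : lin th (lin bdf (c m.+1)) = lin (fun X => bd (th X)) (c m.+1).
    by rewrite lin_lin; apply: eq_lin => X cX; have [[dX sX] _] := cs m.+1 X (leqnn _) cX; rewrite bdT.
  rewrite pair_lin; apply: eq_pair => X cX.
  exact: etrans (esym (degE _)) (he X (alP X) cX d th d0 d3 hth).
by move=> e1; have := etrans (esym e1) (etrans h (pair0 _)).
Qed.

End JoinTower.

Lemma finite_vertices (V : choiceType) (K : complex V) : finite_set (faces K) ->
  exists vs : seq (V * bool), (forall w, w \in vs) /\ uniq vs.
Proof.
move=> fK; have fV : finite_set [set: V].
  have : finite_set ((fun v : V => [fset v]%fset) @^-1` faces K).
    by apply: finite_preimage => // u v _ _ /fset1_inj.
  by apply: sub_finite_set => v _; exact: face_vertex.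
exists (undup [seq (v, b) | v <- enum_fset (fset_set [set: V]), b <- [:: true; false]]).
split; last exact: undup_uniq.
move=> [v b]; rewrite mem_undup; apply/allpairsP; exists (v, b); split=> //; last by case: (b).
by rewrite -[_ \in _]/(v \in fset_set [set: V]) in_fset_set // inE.
Qed.

(** * From the cone to the group *)

Section WordBall.
Variables (R : realType) (G : groupType) (S : seq G).
Implicit Types x y : G.

(** The identity is included so that balls increase with the radius. *)
Definition gens : seq G := 1%g :: S ++ map (fun x => x^-1)%g S.

Fixpoint ball n : seq G :=
  if n is n'.+1 then [seq (x * y)%g | x <- ball n', y <- gens] else [:: 1%g].

Lemma gensE x : (x \in gens) = [|| x == 1%g, x \in S | (x^-1)%g \in S].
Proof.
rewrite inE mem_cat; congr [|| _, _ | _]; apply/mapP/idP => [[y yS ->]|h]; first by rewrite invgK.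
by exists (x^-1)%g; rewrite ?invgK.
Qed.

Lemma gensV x : x \in gens -> (x^-1)%g \in gens.
Proof. by rewrite !gensE invgK invg_eq1 => /or3P[]->; rewrite ?orbT. Qed.

Lemma ballSP n x : reflect (exists u v, [/\ u \in ball n, v \in gens & x = (u * v)%g]) (x \in ball n.+1).
Proof.
apply: (iffP allpairsP) => [[[u v] /= [h1 h2 h3]]|[u [v [h1 h2 h3]]]]; first by exists u, v.
by exists (u, v).
Qed.

Lemma ballS n x : x \in ball n -> x \in ball n.+1.
Proof. by move=> xn; apply/ballSP; exists x, 1%g; rewrite mulg1 gensE eqxx. Qed.

Lemma ball_leq n k x : (n <= k)%N -> x \in ball n -> x \in ball k.
Proof. by move=> /subnK <- h; elim: (k - n)%N => // i /ballS. Qed.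

Lemma ball1 n : 1%g \in ball n.
Proof. by apply: (@ball_leq 0) => //; rewrite inE. Qed.

Lemma ball_gens x : x \in gens -> x \in ball 1.
Proof. by move=> h; apply/ballSP; exists 1%g, x; rewrite mul1g inE eqxx. Qed.

Lemma ballM n k x y : x \in ball n -> y \in ball k -> (x * y)%g \in ball (n + k).
Proof.
move=> xn; elim: k y => [|k IH] y; first by rewrite inE => /eqP ->; rewrite mulg1 addn0.
by move=> /ballSP[u [v [uk vg ->]]]; rewrite addnS mulgA; apply/ballSP; exists (x * u)%g, v; rewrite IH.
Qed.

Lemma ballV n x : x \in ball n -> (x^-1)%g \in ball n.
Proof.
elim: n x => [|n IH] x; first by rewrite !inE => /eqP ->; rewrite invg1.
move=> /ballSP[u [v [un vg ->]]]; rewrite invgM -add1n; apply: ballM; last exact: IH.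
exact/ball_gens/gensV.
Qed.

Lemma cayley_gens x y : cayley S x y -> (x^-1 * y)%g \in gens.
Proof. by rewrite /cayley gensE => /orP[] h; rewrite ?h ?orbT // invgM invgK h !orbT. Qed.

Lemma path_ball x p : path (cayley S) x p -> (x^-1 * last x p)%g \in ball (size p).
Proof.
elim: p x => [|y p IH] x /=; first by rewrite mulVg inE.
move=> /andP[/cayley_gens xy /IH h].
by have := ballM (ball_gens xy) h; rewrite add1n -mulgA mulVKg.
Qed.

Lemma ball_path n x g : g \in ball n ->
  exists p, [/\ path (cayley S) x p, last x p = (x * g)%g & (size p <= n)%N].
Proof.
elim: n g => [|n IH] g; first by rewrite inE => /eqP ->; exists [::]; rewrite mulg1.
move=> /ballSP[u [v [un vg ->]]]; have [p [pp lp sp]] := IH u un.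
have [v1|v1] := eqVneq v 1%g; first by exists p; rewrite v1 mulg1 ltnW.
exists (rcons p (x * (u * v))%g); rewrite rcons_path pp last_rcons size_rcons lp; split=> //=.
rewrite /cayley; move: vg; rewrite gensE (negPf v1) /= => h.
have -> : ((x * u)^-1 * (x * (u * v)) = v)%g by rewrite (mulgA x) mulKg.
have -> : ((x * (u * v))^-1 * (x * u) = v^-1)%g by rewrite (mulgA x) invgM mulgVK.
exact: h.
Qed.

Lemma ball_dist n x y : (x^-1 * y)%g \in ball n -> (word_dist R S x y <= n%:R%:E)%E.
Proof.
move=> /(ball_path x)[p [pp lp sp]]; apply: (@le_trans _ _ (size p)%:R%:E); last first.
  by rewrite lee_fin ler_nat.
by apply: ereal_inf_lbound; exists p => //; split=> //; rewrite lp mulVKg.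
Qed.

Lemma dist_ball n x y : (word_dist R S x y <= n%:R%:E)%E -> (x^-1 * y)%g \in ball n.
Proof.
move=> h; apply: contraT => nb; move: h; rewrite leNgt => /negP[].
apply: (@lt_le_trans _ _ n.+1%:R%:E); first by rewrite lte_fin ltr_nat.
apply: le_ereal_inf_tmp => _ [p [pp lp] <-]; rewrite lee_fin ler_nat ltnNge.
by apply: contra nb => sp; rewrite -lp; apply: ball_leq sp _; exact: path_ball.
Qed.

(** The elements lying in some ball form a subgroup containing [S]. *)
Lemma generates_ball : generates S -> forall g, exists n, g \in ball n.
Proof.
move=> gS.
pose P : pred G := fun g => `[< exists n, g \in ball n >].
have P1 : 1%g \in P by apply/asboolP; exists 0%N; exact: ball1.
have PM : mulg_closed P.
  by move=> x y /asboolP[n xn] /asboolP[k yk]; apply/asboolP; exists (n + k)%N; exact: ballM.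
have PV : invg_closed P by move=> x /asboolP[n xn]; apply/asboolP; exists n; exact: ballV.
pose HM := isMulClosed.Build G P PM. pose H1 := isMul1Closed.Build G P P1. pose HV := isInvClosed.Build G P PV.
pose H : groupClosed G := HB.pack P HM H1 HV.
move=> g; apply/asboolP; apply: (gS H) => x xS; apply/asboolP; exists 1%N.
by apply: ball_gens; rewrite gensE xS orbT.
Qed.

End WordBall.

Lemma cvg_set_type (T : topologicalType) (A : set T) (Y : Type) (F : set_system Y) (FF : Filter F)
    (x : Y -> set_type A) (y : set_type A) :
  (fun i => \val (x i)) @ F --> (\val y : T) -> x @ F --> y.
Proof.
move=> h O [B [[C oC CB] By BO]]; rewrite -CB in By.
have nC : nbhs (\val y : T) C by apply: open_nbhs_nbhs.
apply: (@filterS _ F FF ((fun i => \val (x i)) @^-1` C)); last exact: (h C nC).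
by move=> i Ci; apply: BO; rewrite -CB.
Qed.

Lemma val_continuous (T : topologicalType) (A : set T) : continuous (fun x : set_type A => \val x : T).
Proof. exact: initial_continuous. Qed.

Lemma eval_ptws (R : realType) (V : choiceType) (v : V) : continuous (fun x : {ptws V -> R} => x v).
Proof. exact: (@proj_continuous V (fun=> R) v). Qed.

(** * The open cone and its radius *)

Section Cone.
Variables (R : realType) (V : choiceType) (K : complex V).
Local Notation OC := (open_cone R K).

Lemma cone_pi_eq (p q : cylinder R K) : cone_rel p q -> cone_pi p = cone_pi q.
Proof.
move=> h; have e : \pi_({eq_quot (cone_equiv R K)})%qT p = \pi_({eq_quot (cone_equiv R K)})%qT q :> {eq_quot (cone_equiv R K)}%qT.
  by apply/eqmodP.
exact: e.
Qed.

Lemma cone_pi_rel (p q : cylinder R K) : cone_pi p = cone_pi q -> cone_rel p q.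
Proof.
move=> h; have e : \pi_({eq_quot (cone_equiv R K)})%qT p = \pi_({eq_quot (cone_equiv R K)})%qT q :> {eq_quot (cone_equiv R K)}%qT by exact: h.
by move/eqmodP: e.
Qed.

Lemma cone_pi_continuous : continuous (@cone_pi R V K).
Proof. exact: pi_continuous. Qed.

Lemma cone_pi_surj (z : OC) : exists c, cone_pi c = z.
Proof. by exists (repr z); rewrite /cone_pi reprK. Qed.

(** The representative does not matter, since only points of height zero are identified. *)
Definition radius (z : OC) : R := \val (repr z).2.

Lemma radius_pi c : radius (cone_pi c) = \val c.2.
Proof.
have : cone_pi (repr (cone_pi c)) = cone_pi c by rewrite /cone_pi reprK.
by move=> /cone_pi_rel /orP[/eqP e|/andP[/eqP e1 /eqP e2]]; rewrite /radius ?e // e1 e2.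
Qed.

Lemma radius_continuous : continuous radius.
Proof.
have -> : radius = (fun c : cylinder R K => \val c.2 : R) \o repr by [].
apply: repr_comp_continuous.
  move=> c; apply: (@continuous_comp _ _ _ snd (fun t : set_type `[0 : R, +oo[ => \val t : R)).
    exact: cvg_snd.
  exact: val_continuous.
move=> a b /eqP h; apply/eqP.
by move/cone_pi_rel: (h : cone_pi a = cone_pi b) => /orP[/eqP->//|/andP[/eqP-> /eqP->]].
Qed.

End Cone.

Section SimplexTopology.
Variables (R : realType) (W : choiceType).

Lemma sum_eval_continuous (l : seq W) : continuous (fun p : {ptws W -> R} => \sum_(w <- l) p w).
Proof.
elim: l => [|w l IH] p.
  rewrite (_ : (fun p : {ptws W -> R} => _) = (fun=> 0)); first exact: cst_continuous.
  by apply/funext => q; rewrite big_nil.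
rewrite (_ : (fun p : {ptws W -> R} => _) = (fun q : {ptws W -> R} => q w + \sum_(u <- l) q u)).
  exact: (@cvgD _ _ _ (nbhs p) (nbhs_filter p) _ _ _ _ (@eval_ptws R W w p) (IH p)).
by apply/funext => q; rewrite big_cons.
Qed.

Lemma simplex_compact (t : {fset W}) : compact (simplex R t).
Proof.
have -> : simplex R t = [set x : {ptws W -> R} | forall w, `[(0 : R), 1]%classic (x w)] `&` simplex R t.
  apply/seteqP; split=> [x [x0 xt x1]|x [] //]; split=> // w; rewrite /= in_itv /= x0 /=.
  have [wt|/xt-> //] := boolP (w \in t).
  by rewrite -x1 (big_fsetD1 w) //= lerDl sumr_ge0.
apply: compact_closedI; first by apply: (@tychonoff W (fun=> R) (fun=> `[(0 : R), 1]%classic)) => w; exact: segment_compact.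
have -> : simplex R t = \bigcap_(w in [set: W]) [set x : {ptws W -> R} | 0 <= x w] `&`
    \bigcap_(w in [set w | w \notin t]) [set x : {ptws W -> R} | x w = 0] `&`
    [set x : {ptws W -> R} | \sum_(w <- t) x w = 1].
  apply/seteqP; split=> x; first by move=> [h1 h2 h3]; split=> [|//]; split=> w /=; [move=> _; exact: h1|exact: h2].
  by move=> [[h1 h2] h3]; split=> // w; exact: (h1 w).
apply: closedI; first apply: closedI.
- apply: closed_bigI => w _; apply: (@closed_comp _ _ (fun p : {ptws W -> R} => p w) [set t | 0 <= t]).
    by move=> p _; exact: eval_ptws.
  exact: closed_ge.
- apply: closed_bigI => w _; apply: (@closed_comp _ _ (fun p : {ptws W -> R} => p w) [set t | t = 0]).
    by move=> p _; exact: eval_ptws.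
  exact: closed_eq.
apply: (@closed_comp _ _ (fun p : {ptws W -> R} => \sum_(w <- t) p w) [set t | t = 1]); last exact: closed_eq.
by move=> p _; exact: sum_eval_continuous.
Qed.

Lemma compact_max (Y : topologicalType) (A : set Y) (f : Y -> R) : compact A ->
  {within A, continuous f} -> exists M, forall x, A x -> f x <= M.
Proof.
move=> cA fc; have [M [Mr hM]] := @compact_bounded R R^o _ (continuous_compact fc cA).
exists (M + 1) => x Ax; apply: le_trans (ler_norm _) _; apply: (hM (M + 1)); first by rewrite ltrDl.
by exists x.
Qed.

End SimplexTopology.

(** * Vertices near a point of the triangulated cone *)

Section Triangulated.
Variables (R : realType) (V W : choiceType) (K : complex V) (T : complex W).
Variable tri : set_type (realization R T) -> open_cone R K.
Hypothesis triP : cone_triangulation tri.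
Variable inv : open_cone R K -> set_type (realization R T).
Hypotheses (invc : continuous inv) (triK : cancel tri inv) (invK : cancel inv tri) (tric : continuous tri).
Local Notation OC := (open_cone R K).

(** Membership of [z] in the open star of [w]. *)
Definition pos (z : OC) (w : W) := 0 < (\val (inv z) : {ptws W -> R}) w.

Lemma pos_face z : exists2 t, faces T t & simplex R t (\val (inv z)) /\ forall w, pos z w -> w \in t.
Proof.
have : realization R T (\val (inv z)) by apply: set_mem; exact: valP.
move=> [t tT st]; exists t => //; split=> // w; apply: contraTT => wt.
by case: st => _ /(_ w wt) e _; rewrite /pos e ltxx.
Qed.

Lemma pos_exists z : exists w, pos z w.
Proof.
have [t _ [[x0 xt x1] _]] := pos_face z; apply: contrapT => h.
suff : \sum_(w <- t) (\val (inv z) : {ptws W -> R}) w = 0 by rewrite x1 => /eqP; rewrite oner_eq0.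
apply: big1_seq => w _; apply/eqP; rewrite eq_le x0 andbT leNgt; apply/negP => hw.
by apply: h; exists w.
Qed.

Lemma pos_open w : open [set z | pos z w].
Proof.
apply: (@open_comp _ _ (fun z => (\val (inv z) : {ptws W -> R}) w) [set t | 0 < t]); last exact: open_gt.
move=> z _; apply: (@continuous_comp _ _ _ inv (fun x => (\val x : {ptws W -> R}) w)); first exact: invc.
apply: (@continuous_comp _ _ _ (fun x : set_type (realization R T) => \val x : {ptws W -> R}) (fun x => x w)).
  exact: val_continuous.
exact: eval_ptws.
Qed.

Lemma pos_adjacent z w w' : pos z w -> pos z w' -> w = w' \/ edge_rel T w w'.
Proof.
have [t tT [_ ht]] := pos_face z => /ht wt /ht w't.
have [->|ww] := eqVneq w w'; [by left|right].
have h : faces T [fset w; w']%fset.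
  apply: (Defs.face_sub tT); first by apply/fset0Pn; exists w; rewrite !inE eqxx.
  by rewrite fsubUset !fsub1set wt w't.
by rewrite /edge_rel ww; exact: mem_set h.
Qed.

(** The carrier of [z] contains [a] and [w], that of [z'] contains [w] and [b]; within a simplex
    vertices are equal or adjacent. *)
Lemma pos_dist z z' a b w : pos z a -> pos z w -> pos z' w -> pos z' b ->
  (path_dist R (edge_rel T) a b <= 2%:E)%E.
Proof.
move=> za zw zw' zb.
have [p [pp lp sp]] : exists p, [/\ path (edge_rel T) a p, last a p = b & (size p <= 2)%N].
  have [->|e1] := pos_adjacent za zw; have [<-|e2] := pos_adjacent zw' zb.
  - by exists [::].
  - by exists [:: b]; rewrite /= e2.
  - by exists [:: w]; rewrite /= e1.
  - by exists [:: w; b]; rewrite /= e1 e2.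
apply: (@le_trans _ _ (size p)%:R%:E); first by apply: ereal_inf_lbound; exists p.
by rewrite lee_fin (ler_nat R _ 2).
Qed.

Lemma vertex_point_simplex w (t : {fset W}) : w \in t -> simplex R t (vertex_point R w).
Proof.
move=> wt; split=> [u|u ut|]; rewrite /vertex_point ?ler0n //.
  by case: eqP => // e; rewrite -e (negPf ut) in wt.
rewrite (big_fsetD1 w) //= eqxx big1_fset ?addr0 // => u; rewrite !inE => /andP[uw _] _.
by rewrite (negPf uw).
Qed.

(** A subcone is a subcomplex, so with a point it contains the vertices of its carrier. *)
Lemma pos_cone_vertex (s : {fset V}) z w : faces K s -> subcone R K s z -> pos z w -> cone_vertices tri s w.
Proof.
move=> fs sz zw; have [_ _ /(_ s fs)[L [LT Lsub] Le]] := triP.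
have : (tri @^-1` subcone R K s) (inv z) by rewrite /= invK.
rewrite Le => -[t Lt st]; have wt : w \in t.
  by apply: contraTT zw => wt; case: st => _ /(_ w wt) e _; rewrite /pos e ltxx.
have Lw : L [fset w]%fset by apply: Lsub Lt _ _; rewrite ?fsub1set //; apply/fset0Pn; exists w; rewrite inE.
have rw : vertex_point R w \in realization R T.
  by apply/mem_set; exists [fset w]%fset; [exact: LT|apply: vertex_point_simplex; rewrite inE].
exists (Sub (vertex_point R w) rw); first by rewrite SubK.
have : [set x | exists2 t, L t & simplex R t (\val x)] (Sub (vertex_point R w) rw : set_type (realization R T)).
  by exists [fset w]%fset => //; rewrite SubK; apply: vertex_point_simplex; rewrite inE.
by rewrite -Le.
Qed.

(** By local finiteness the star of [w] consists of finitely many compact simplices. *)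
Lemma radius_bound w : exists M, forall z, pos z w -> radius z <= M.
Proof.
have [lf _ _] := triP; have fin := lf w.
have [[z0 z0w]|nz] := pselect (exists z, pos z w); last by exists 0 => z zw; case: nz; exists z.
(* [insubd] extends the radius by a default value to all functions on vertices, so that compactness
   of simplices can be used in the ambient space. *)
pose f (x : {ptws W -> R}) : R := radius (tri (insubd (inv z0) x)).
have [M hM] : exists M, forall t, [set s | faces T s /\ w \in s] t -> forall x, simplex R t x -> f x <= M.
  have H (l : seq {fset W}) : (forall t, t \in l -> faces T t) ->
      exists M, forall t, t \in l -> forall x, simplex R t x -> f x <= M.
    elim: l => [|t l IH] hl; first by exists 0.
    have [|M hM] := IH; first by move=> u ul; apply: hl; rewrite inE ul orbT.
    have fc : {within simplex R t, continuous f}.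
      apply/subspace_continuousP => x sx.
      have rt y : simplex R t y -> y \in realization R T by move=> sy; apply/mem_set; exists t => //; apply: hl; exact: mem_head.
      have c1 : (insubd (inv z0) y : set_type (realization R T)) @[y --> within (simplex R t) (nbhs x)] -->
          (insubd (inv z0) x : set_type (realization R T)).
        apply: cvg_set_type; rewrite val_insubd rt //.
        apply: (@cvg_trans _ (y @[y --> within (simplex R t) (nbhs x)])); last exact: cvg_within.
        by apply: near_eq_cvg; rewrite near_withinE; near=> y => sy; rewrite val_insubd rt.
      have c2 : continuous_at (insubd (inv z0) x : set_type (realization R T)) (fun y => radius (tri y)).
        by apply: continuous_comp; [exact: tric|exact: radius_continuous].
      exact: (cvg_comp _ _ c1 c2).
    have [M' hM'] := compact_max (@simplex_compact R W t) fc.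
    exists (Num.max M M') => u; rewrite inE => /orP[/eqP->|ul] x sx; rewrite le_max; first by rewrite hM' ?orbT.
    by rewrite (hM u).
  have [M hM] := H (enum_fset (fset_set [set s | faces T s /\ w \in s]))
    (fun t => ltac:(by rewrite -[_ \in _]/(t \in fset_set _) in_fset_set // inE => -[])).
  exists M => t ht; apply: hM; by rewrite -[_ \in _]/(t \in fset_set _) in_fset_set // inE.
exists M => z zw; have [t tT [st ht]] := pos_face z.
by have := hM t (conj tT (ht w zw)) _ st; rewrite /f valKd invK.
Unshelve. all: by end_near. Qed.

Section Join.
Variable vs : seq (V * bool).
Hypotheses (vsP : forall w, w \in vs) (vsU : uniq vs).
Local Notation PT := 'rV[R]_(size vs).
Local Notation face := (@face R V vs vsP).
Local Notation mass := (@mass R V vs vsP).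
Local Notation bary := (@bary R V vs vsP).
Variables (k0 : set_type (realization R K)) (r0 : set_type `[0 : R, +oo[) (R0 : R).
Hypotheses (r00 : \val r0 = 0) (R00 : 0 <= R0).
Implicit Types (p q : PT) (X : {fset V * bool}).

(** Zero up to mass [1 / 4] and [R0] from mass [1 / 2] on. The two masses add up to one, so one side
    is always at full radius. *)
Definition height b p : R := R0 * Num.max 0 (Num.min 1 (4 * mass b p - 1)).
(* The cut-off makes the map locally constant near the points where [bary b] is
   undefined. *)
Definition cone_point b p : open_cone R K :=
  cone_pi (insubd k0 (bary b p : {ptws V -> R}), insubd r0 (height b p)).

Lemma height_in b p : height b p \in `[0 : R, +oo[%classic.
Proof. by apply/mem_set; rewrite /= in_itv /= andbT mulr_ge0 // le_max lexx. Qed.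

Lemma cone_point_apex b p : mass b p <= 4^-1 -> cone_point b p = cone_pi (k0, r0).
Proof.
move=> h; apply: cone_pi_eq; apply/orP; right; rewrite val_insubd height_in /= r00 eqxx andbT.
rewrite /height max_l ?mulr0 // ge_min; apply/orP; right; lra.
Qed.

Lemma radius_cone_point b p : 2^-1 <= mass b p -> radius (cone_point b p) = R0.
Proof.
move=> h; rewrite /cone_point radius_pi val_insubd height_in /height.
rewrite (@min_l _ R 1) ?max_r ?mulr1 //; lra.
Qed.

Lemma bary_realization X b p : deleted K X -> face X p -> mass b p != 0 -> bary b p \in realization R K.
Proof.
move=> dX fp s0; apply/mem_set; exists (part b X); first exact: (part_face vsU dX fp s0).
exact: bary_simplex.
Qed.

Lemma cone_point_subcone X b p : deleted K X -> face X p -> mass b p != 0 ->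
  subcone R K (part b X) (cone_point b p).
Proof.
move=> dX fp s0; eexists; last reflexivity.
by rewrite /= val_insubd (bary_realization dX fp s0); exact: bary_simplex.
Qed.

(** Below mass [1 / 4] the map is locally constant; from there on the mass is nonzero nearby and
    [bary] is continuous. *)
Lemma cone_point_open X b p (O : set OC) : deleted K X -> face X p -> open O -> O (cone_point b p) ->
  exists2 e, 0 < e & forall q, face X q -> vd q p < e -> O (cone_point b q).
Proof.
move=> dX fp oO Op; have mc := @mass_continuous R V vs vsP b p.
have [lt4|ge4] := ltP (mass b p) 4^-1.
  have : nbhs p [set q | mass b q < 4^-1].
    by apply: (mc [set t | t < 4^-1]); apply: open_nbhs_nbhs; split; [exact: open_lt|].
  move=> /nbhs_vd[e e0 he]; exists e => // q fq /he /ltW h.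
  by rewrite cone_point_apex // -(cone_point_apex (ltW lt4)).
have s0 : mass b p != 0 by rewrite gt_eqF //; lra.
pose F := within (face X) (nbhs p).
have FF : Filter F by exact: within_filter.
have nz : \forall q \near F, face X q /\ mass b q != 0.
  rewrite near_withinE; have : nbhs p [set q | 0 < mass b q].
    by apply: (mc [set t | 0 < t]); apply: open_nbhs_nbhs; split; [exact: open_gt|rewrite /=; lra].
  by apply: filterS => q h fq; split=> //; rewrite gt_eqF.
have c1 : insubd k0 (bary b q : {ptws V -> R}) @[q --> F] --> (insubd k0 (bary b p : {ptws V -> R}) : set_type (realization R K)).
  apply: cvg_set_type; rewrite val_insubd (bary_realization dX fp s0).
  apply: (@cvg_trans _ ((fun q => bary b q) @ F)); last first.
    by apply: cvg_trans (mass_continuous_at s0); apply: cvg_app; exact: cvg_within.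
  apply: near_eq_cvg; near=> q; rewrite val_insubd (@bary_realization X) //; near: q.
    by apply: filterS nz => q [].
  by apply: filterS nz => q [].
have hc : height b q @[q --> nbhs p] --> height b p.
  have h1 : continuous_at p (fun q => 4 * mass b q - 1).
    apply: (@cvgB _ _ _ (nbhs p)); last exact: cvg_cst.
    by apply: (@cvgM _ _ (nbhs p) _ (fun=> 4)); [exact: cvg_cst|exact: mc].
  have h2 : continuous_at p (fun=> 1 : R) by exact: cst_continuous.
  have h3 : continuous_at p (fun=> 0 : R) by exact: cst_continuous.
  have h4 := continuous_max h3 (continuous_min h2 h1).
  by apply: (@cvgM _ _ (nbhs p) _ (fun=> R0)); [exact: cvg_cst|exact: h4].
have c2 : insubd r0 (height b q) @[q --> F] --> (insubd r0 (height b p) : set_type `[0 : R, +oo[).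
  apply: cvg_set_type; rewrite val_insubd height_in.
  under eq_fun do rewrite val_insubd height_in.
  by apply: cvg_trans hc; apply: cvg_app; exact: cvg_within.
have [[A B] /= [nA nB] AB] : nbhs ((insubd k0 (bary b p : {ptws V -> R}), insubd r0 (height b p)) : cylinder R K)
    ((@cone_pi R V K) @^-1` O) by apply: cone_pi_continuous; apply: open_nbhs_nbhs.
have : F (fun q => O (cone_point b q)).
  have h1 : F (fun q => A (insubd k0 (bary b q : {ptws V -> R}))) := c1 A nA.
  have h2 : F (fun q => B (insubd r0 (height b q))) := c2 B nB.
  by apply: (@filterS _ F FF _ _ _ (@filterI _ F FF _ _ h1 h2)) => q [Aq Bq]; apply: AB; split.
rewrite /F /within /= => /nbhs_vd[e e0 he].
by exists e => // q fq /he; apply.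
Unshelve. all: by end_near. Qed.

(** A Lebesgue number for the cover of a compact face by the preimages of open stars. *)
Lemma cone_point_lebesgue X b : deleted K X ->
  exists2 e, 0 < e & forall p q, face X p -> face X q -> vd p q < e ->
    exists w, pos (cone_point b p) w /\ pos (cone_point b q) w.
Proof.
move=> dX.
have H p : exists ew : R * W, face X p -> 0 < ew.1 /\ forall q, face X q -> vd q p < ew.1 -> pos (cone_point b q) ew.2.
  have [fp|nf] := pselect (face X p); last by exists (1, (projT1 (cid (pos_exists (cone_pi (k0, r0)))))).
  have [w wp] := pos_exists (cone_point b p).
  by have [e e0 he] := cone_point_open dX fp (@pos_open w) wp; exists (e, w).
have [f fP] := choice H.
pose O p := [set q | vd q p < (f p).1 / 2].
have nO p : face X p -> nbhs p (O p).
  move=> /fP[e0 _]; have e2 : 0 < (f p).1 / 2 by rewrite divr_gt0.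
  apply/nbhs_ballP; exists ((f p).1 / 2) => //= q pq; rewrite /O /= vdC; apply/(vd_lt _ _ e2) => i.
  by case: pq => _; exact.
have [L LX Lc] := finite_cover (@face_compact R V vs vsP vsU X) nO.
have [e e0 he] : exists2 e, 0 < e & forall p, p \in enum_fset L -> e <= (f p).1 / 2.
  apply: uniform_radius => [p a c _ ac|p pL]; first exact: le_trans.
  by have [e0 _] := fP p (LX p pL); exists ((f p).1 / 2) => //; rewrite divr_gt0.
exists e => // p q fp fq pq; have [c cL cp] := Lc p fp; have [c0 hc] := fP c (LX c cL).
exists (f c).2; split; apply: hc => //; first by apply: lt_trans cp _; lra.
have := vd_tri q p c; have := he c cL; rewrite /O /= in cp; rewrite vdC in pq; lra.
Qed.

End Join.

End Triangulated.

Lemma finite_union (U W : eqType) (Q : U -> set W -> Prop) (l : seq U) :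
    (forall x A B, A `<=` B -> Q x A -> Q x B) ->
    (forall x, x \in l -> exists2 A, finite_set A & Q x A) ->
  exists2 A, finite_set A & forall x, x \in l -> Q x A.
Proof.
move=> mono; elim: l => [|y l IH] h; first by exists set0.
have [|A fA hA] := IH; first by move=> x xl; apply: h; rewrite inE xl orbT.
have [B fB hB] := h y (mem_head _ _).
exists (A `|` B); first by rewrite finite_setU.
move=> x; rewrite inE => /orP[/eqP->|xl]; first by apply: mono hB; right.
by apply: mono (hA x xl); left.
Qed.

Lemma seq_bound (R : realDomainType) (U : eqType) (Q : U -> R -> Prop) (l : seq U) :
    (forall x a b, a <= b -> Q x a -> Q x b) -> (forall x, x \in l -> exists a, Q x a) ->
  exists a, forall x, x \in l -> Q x a.
Proof.
move=> mono; elim: l => [|y l IH] h; first by exists 0.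
have [|a ha] := IH; first by move=> x xl; apply: h; rewrite inE xl orbT.
have [b hb] := h y (mem_head _ _).
exists (Num.max a b) => x; rewrite inE => /orP[/eqP->|xl]; first by apply: mono hb; rewrite le_max lexx orbT.
by apply: mono (ha x xl); rewrite le_max lexx.
Qed.

(** * The tower of pairs of group elements *)

Section FarTower.
Variables (R : realType) (G : groupType) (S : seq G) (V : choiceType) (K : complex V) (m : nat).
Variables (W : choiceType) (T : complex W) (tri : set_type (realization R T) -> open_cone R K) (h : W -> G).
Hypotheses (gS : generates S) (obs : obstructor_complex R K m) (triP : cone_triangulation tri).
Hypotheses (hprop : proper_map h) (hlip : lipschitz_map (path_dist R (edge_rel T)) (word_dist R S) h).
Hypothesis hexp : expanding S tri h.
Local Notation ball := (ball S).

Lemma seq_ball (F : seq G) : exists D, forall g, g \in F -> g \in ball D.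
Proof.
elim: F => [|g F [D hD]]; first by exists 0%N.
have [n gn] := generates_ball gS g; exists (maxn D n) => x; rewrite inE => /orP[/eqP->|/hD].
  by apply: ball_leq gn; rewrite leq_maxr.
by apply: ball_leq; rewrite leq_maxl.
Qed.

Lemma far_finite D (E : set W) : finite_set E ->
  finite_set [set w | exists2 w', E w' & ((h w)^-1 * h w')%g \in ball D].
Proof.
move=> fE; apply: (@sub_finite_set _ _ (h @^-1` [set (h p.1 * p.2)%g | p in E `*` [set` ball D]])).
  move=> w [w' Ew' hw]; exists (w', ((h w)^-1 * h w')^-1)%g; first by split=> //=; exact: ballV.
  by rewrite /= invgM invgK mulgA mulgV mul1g.
by apply: hprop; apply: finite_image; apply: finite_setX => //; exact: finite_seq.
Qed.

(** A point of the join is sent to two points of the cone, at least one of them at radius [R0], then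
    to nearby vertices and into the group. The bound [B] depends on the Lipschitz constant alone,
    while [R0] is adapted to [F]. *)
Lemma far_tower : exists B : seq G, forall F : seq G, exists c : nat -> chain (seq (G * G)),
  tower (@swap G) m.+1 c /\ forall j, allc (fun s : seq (G * G) =>
    (forall p q, p \in s -> q \in s -> (p.1^-1 * q.1)%g \in B /\ (p.2^-1 * q.2)%g \in B) /\
    forall p, p \in s -> (p.1^-1 * p.2)%g \notin F) (c j).
Proof.
have [L L0 hL] := hlip; have [fK dK _] := obs.
have [vs [vsP vsU]] := finite_vertices fK.
have [lf [tric [inv [invc triK invK]]] _] := triP.
(* Close points have vertices at distance at most two, hence images at most [2 L] apart. *)
pose n2 := Num.bound (L * 2); exists (ball n2) => F.
have [D FD] := seq_ball F.
have [v0 _] : exists v : V, True.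
  have [T1 [tT1 gT1]] := small_join_tower vsP vsU obs (ltr01 : 0 < 1 :> R).
  have [_ b0 _] := tT1; have : coef (bd (T1 0%N)) [::] by rewrite b0 coef_sg.
  move=> /coef_bd[s cs [_ ss]]; have [_ [X _ fX]] := gT1 _ _ cs.
  case: s ss cs fX => // p [|//] _ cs fX; have [_ _ p1] := fX p (mem_head _ _).
  have [X0|/fset0Pn[w _]] := eqVneq X fset0; last by exists w.1.
  by move: p1; rewrite X0 big_seq_fset0 => /eqP; rewrite eq_sym oner_eq0.
have k0P : vertex_point R v0 \in realization R K.
  apply/mem_set; exists [fset v0]%fset; first exact: face_vertex.
  by apply: vertex_point_simplex; rewrite inE.
pose k0 : set_type (realization R K) := Sub (vertex_point R v0) k0P.
have r0P : 0 \in (`[0 : R, +oo[%classic) by apply/mem_set; rewrite /= in_itv /= lexx.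
pose r0 : set_type `[0 : R, +oo[ := Sub (0 : R) r0P.
have r00 : \val r0 = 0 :> R by rewrite SubK.
pose al := enum_fset (fpowerset (seq_fset tt vs)).
have alP (X : {fset V * bool}) : X \in al.
  by rewrite -[_ \in _]/(X \in fpowerset _) fpowersetE; apply/fsubsetP => w _; rewrite seq_fsetE.
pose apex : open_cone R K := cone_pi (k0, r0).
pose ps := pos inv.
have fF0 : finite_set [set w | ps apex w].
  have [t _ [_ ht]] := pos_face inv apex.
  by apply: sub_finite_set (finite_fset t) => w /ht.
(* Off the finite set [E], vertices over disjoint simplices have images more than [D] apart, by
   expansion. *)
have [E fE hE] : exists2 E : set W, finite_set E & forall X, X \in al ->
    disjoint_faces K (part true X) (part false X) -> forall w w', ~ E w -> ~ E w' ->
    cone_vertices tri (part true X) w -> cone_vertices tri (part false X) w' ->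
    ((h w)^-1 * h w')%g \notin ball D.
  apply: finite_union => [X A B AB H dj w w' nw nw'|X _]; first by apply: H => // /AB.
  have [dj|nj] := pselect (disjoint_faces K (part true X) (part false X)); last by exists set0.
  have [C1 [C2 [f1 f2 _ _ hd]]] := hexp dj (ltr0Sn R D).
  exists (C1 `|` C2); first by rewrite finite_setU.
  move=> _ w w' nw nw' cw cw'; apply/negP => /(ball_dist R) hb; move: hd; apply/negP; rewrite -leNgt.
  apply: (@le_trans _ _ (word_dist R S (h w) (h w'))).
    apply: ereal_inf_lbound; exists (h w, h w') => //; split.
      by exists w => //; split=> // ?; apply: nw; left.
    by exists w' => //; split=> // ?; apply: nw'; right.
  by apply: le_trans hb _; rewrite lee_fin ler_nat.
pose E0 := E `|` [set w | ps apex w].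
have fE0 : finite_set E0 by rewrite finite_setU.
(* [E1] adds every vertex whose image is within [D] of the image of [E0], that is, of [E] or of a
   vertex at the apex. *)
pose E1 := E0 `|` [set w | exists2 w', E0 w' & ((h w)^-1 * h w')%g \in ball D].
have fE1 : finite_set E1 by rewrite finite_setU; split=> //; exact: far_finite.
have [M hM] : exists M : R, forall w, w \in enum_fset (fset_set E1) -> forall z, ps z w -> radius z <= M.
  apply: seq_bound => [w a b ab H z /H/le_trans|w _]; first exact.
  have [M hM] := radius_bound triP invK tric w; exists M => z; exact: hM.
(* The open stars of vertices in [E1] stay within radius [M], so a point at radius [R0] has no
   vertex in [E1]. *)
pose R0 := Num.max 0 M + 1.
have R00 : 0 <= R0 by rewrite addr_ge0 // le_max lexx.
pose J := cone_point vsP k0 r0 R0.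
have highJ b p w : 2^-1 <= mass vsP b p -> ps (J b p) w -> ~ E1 w.
  move=> hb pw Ew; have : w \in fset_set E1 by rewrite in_fset_set // inE.
  move=> /hM/(_ _ pw); rewrite radius_cone_point // /R0 => h1.
  have h2 : M <= Num.max 0 M by rewrite le_max lexx orbT.
  by move: h1 h2; lra.
have [vert vertP] := choice (fun z => pos_exists inv z : exists w, ps z w).
have [e e0 he] : exists2 e, 0 < e & forall X, X \in al -> deleted K X -> forall b p q, face vsP X p -> face vsP X q ->
    vd p q < e -> exists w, ps (J b p) w /\ ps (J b q) w.
  apply: uniform_radius => [X a b _ ab H dX c p q fp fq pq|X _]; first by apply: H => //; exact: lt_le_trans pq ab.
  have [dX|nX] := pselect (deleted K X); last by exists 1.
  have [e1 e10 h1] := cone_point_lebesgue invc vsP vsU k0 r00 R00 true dX.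
  have [e2 e20 h2] := cone_point_lebesgue invc vsP vsU k0 r00 R00 false dX.
  exists (Num.min e1 e2); first by rewrite lt_min e10.
  by move=> _ [] p q fp fq; rewrite lt_min => /andP[pq1 pq2]; [exact: h1|exact: h2].
have [T1 [tT1 gT1]] := small_join_tower vsP vsU obs e0.
pose kap (p : 'rV[R]_(size vs)) : G * G := (h (vert (J true p)), h (vert (J false p))).
exists (fun j => push kap (T1 j)); split.
  apply: tower_push tT1 => j s p _ _ _; rewrite /kap /swap /J /cone_point /height.
  by rewrite !(mass_opp vsP vsU) !(bary_opp vsP vsU).
move=> j _ /coef_push[s cs ->]; have [sm [X dX fX]] := gT1 j s cs; split.
  have near b p q : p \in s -> q \in s -> ((h (vert (J b p)))^-1 * h (vert (J b q)))%g \in ball n2.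
    move=> psn qs; have [w [w1 w2]] := he X (alP X) dX b p q (fX p psn) (fX q qs) (sm p q psn qs).
    apply: (@dist_ball R); apply: le_trans (hL _ _) _.
    apply: (@le_trans _ _ (L%:E * 2%:E)%E).
      by rewrite lee_pmul2l // ?lte_fin //; exact: (pos_dist (vertP _) w1 w2 (vertP _)).
    by rewrite -EFinM lee_fin ltW // archi_boundP // mulr_ge0 // ltW.
  by move=> _ _ /mapP[p psn ->] /mapP[q qs ->]; split; exact: near.
move=> _ /mapP[p psn ->]; apply/negP => /FD /=; apply/negP.
have fp := fX p psn; have s1 := mass_face vsU fp.
pose w := vert (J true p); pose w' := vert (J false p); rewrite -/w -/w'.
have ballC x y : (x^-1 * y)%g \in ball D -> (y^-1 * x)%g \in ball D by move=> /ballV; rewrite invgM invgK.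
have out u u' : E0 u' -> ~ E1 u -> ((h u)^-1 * h u')%g \notin ball D.
  by move=> Eu' nu; apply/negP => hb; apply: nu; right; exists u'.
have out' u u' : E0 u -> ~ E1 u' -> ((h u)^-1 * h u')%g \notin ball D.
  by move=> Eu nu; apply/negP => /ballC; apply/negP; exact: out.
have m0 b : 0 <= mass vsP b p by exact: mass_ge0 fp.
(* If one mass is at most a quarter, that side sits at the apex and the other one at full radius,
   outside [E1]. *)
have [tl|tl] := leP (mass vsP true p) 4^-1.
  apply: out'; first by right; have := vertP (J true p); rewrite {1}(cone_point_apex k0 r00 R00 tl : J true p = apex).
  by apply: (highJ false p); [lra|exact: vertP].
have [fl|fl] := leP (mass vsP false p) 4^-1.
  apply: out; first by right; have := vertP (J false p); rewrite {1}(cone_point_apex k0 r00 R00 fl : J false p = apex).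
  by apply: (highJ true p); [lra|exact: vertP].
have t0 : mass vsP true p != 0 by rewrite gt_eqF //; lra.
have f0 : mass vsP false p != 0 by rewrite gt_eqF //; lra.
have ft := part_face vsU dX fp t0; have ff := part_face vsU dX fp f0.
have dj : disjoint_faces K (part true X) (part false X) by split=> //; case: dX.
have cw : cone_vertices tri (part true X) w.
  exact: (pos_cone_vertex triP invK ft (cone_point_subcone vsU k0 r0 R0 dX fp t0) (vertP _)).
have cw' : cone_vertices tri (part false X) w'.
  exact: (pos_cone_vertex triP invK ff (cone_point_subcone vsU k0 r0 R0 dX fp f0) (vertP _)).
(* A vertex in [E] belongs to a side that is not at full radius, so the other side is, and its
   vertex avoids [E1]. If neither vertex is in [E], expansion applies. *)
have [Ew|nEw] := pselect (E w).
  have [h1|h1] := leP 2^-1 (mass vsP true p).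
    by case: (highJ true p w h1 (vertP _)); left; left.
  by apply: out'; [left|apply: (highJ false p); [lra|exact: vertP]].
have [Ew'|nEw'] := pselect (E w'); last exact: (hE X (alP X) dj).
have [h1|h1] := leP 2^-1 (mass vsP false p).
  by case: (highJ false p w' h1 (vertP _)); left; left.
by apply: out; [left|apply: (highJ true p); [lra|exact: vertP]].
Qed.

End FarTower.

(** * From the group to the manifold *)

Lemma compact_seq (Y : topologicalType) (U : eqType) (l : seq U) (A : U -> set Y) :
  (forall x, x \in l -> compact (A x)) -> compact [set y | exists2 x, x \in l & A x y].
Proof.
elim: l => [|x l IH] h.
  by rewrite (_ : [set y | _] = set0); [exact: compact0|apply/seteqP; split=> // y [x]].
rewrite (_ : [set y | _] = A x `|` [set y | exists2 x, x \in l & A x y]).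
  by apply: compactU; [apply: h; exact: mem_head|apply: IH => u ul; apply: h; rewrite inE ul orbT].
apply/seteqP; split=> y; first by move=> [u]; rewrite inE => /orP[/eqP->|ul] Ay; [left|right; exists u].
by move=> [Ay|[u ul Ay]]; [exists x; rewrite ?mem_head|exists u; rewrite // inE ul orbT].
Qed.

Lemma homotopy_modulus (R : realType) (N : nat) (M : topologicalType) (K0 A : set M) (T : atlas R N K0)
    (h : M * R -> M) : compact A -> A `<=` K0 -> {within A `*` `[0, 1], continuous h} ->
  forall e, 0 < e -> exists2 d : R, 0 < d & forall x y a b, A x -> A y -> 0 <= a <= 1 -> 0 <= b <= 1 ->
    dist T x y + `|a - b| < d -> dist T (h (x, a)) (h (y, b)) < e.
Proof.
move=> cA AK hc e e0; pose I01 : set R := `[0, 1]%classic.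
have cI : compact I01 by exact: segment_compact.
pose B := (A `*` A) `*` (I01 `*` I01).
have cB : compact B by apply: compact_setX; exact: compact_setX.
have cu : {within B, continuous (fun p : (M * M) * (R * R) => dist T p.1.1 p.1.2 + `|p.2.1 - p.2.2|)}.
  apply: continuous_subspaceT => p; apply: cvgD.
    exact: (cont_fst (f := fun q : M * M => dist T q.1 q.2) (@dist_cont _ _ _ _ T _)).
  apply: (cont_snd (f := fun q : R * R => `|q.1 - q.2|)).
  by apply: cvg_norm; apply: cvgB; [exact: cvg_fst|exact: cvg_snd].
have pr (f : (M * M) * (R * R) -> M * R) : continuous f -> (forall p, B p -> (A `*` I01) (f p)) ->
    {within B, continuous (h \o f)}.
  by move=> fc fA; apply: (within_comp hc) => //; exact: continuous_subspaceT.
have cv : {within B, continuous (fun p => dist T (h (p.1.1, p.2.1)) (h (p.1.2, p.2.2)))}.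
  apply: (within_pair (f := h \o (fun p => (p.1.1, p.2.1))) (g := h \o (fun p => (p.1.2, p.2.2)))
      (h := fun q : M * M => dist T q.1 q.2)); last exact: dist_cont.
    apply: pr; last by move=> p [[? ?] [? ?]].
    move=> p; exact: (cvg_pair (cont_fst (f := fst) cvg_fst) (cont_snd (f := fst) cvg_fst)).
  apply: pr; last by move=> p [[? ?] [? ?]].
  move=> p; exact: (cvg_pair (cont_fst (f := snd) cvg_snd) (cont_snd (f := snd) cvg_snd)).
have [||d d0 hd] := compact_uniform cB cu cv _ _ e0.
- by move=> p _; rewrite addr_ge0 // dist_ge0.
- move=> [[x y] [a b]] [[/= Ax Ay] _] /eqP; rewrite paddr_eq0 ?dist_ge0 //.
  by move=> /andP[/eqP/(dist_sep (AK x Ax)) -> /eqP/normr0_eq0/subr0_eq ->]; rewrite distxx.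
by exists d => // x y a b Ax Ay Ia Ib; apply: (hd ((x, y), (a, b))); split; split; rewrite /I01 /= ?in_itv.
Qed.

(** * Realizing the group tower in the manifold *)

Section NoAction.
Variables (R : realType) (n m : nat) (M : topologicalType) (G : groupType) (act : G -> M -> M).
Hypotheses (mM : manifold R n.+1 M) (ctrM : contractible R M).
Hypothesis actM : properly_discontinuous_action act.
Hypothesis nm : (n <= m)%N.
Variable B : seq G.
Hypothesis far : forall F : seq G, exists c : nat -> chain (seq (G * G)),
  tower (@swap G) m.+1 c /\ forall j, allc (fun s : seq (G * G) =>
    (forall p q, p \in s -> q \in s -> (p.1^-1 * q.1)%g \in B /\ (p.2^-1 * q.2)%g \in B) /\
    forall p, p \in s -> (p.1^-1 * p.2)%g \notin F) (c j).

(** Tuples of pairs in the group become chains in [M x M], filled by the contraction conjugated with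
    the first pair of the tuple. Each compact set [C k.+1] absorbs one round of bounded differences
    and contraction, so a tuple of length [k] lands in translates of [C k]. Proper discontinuity
    makes the two translates disjoint for pairs outside a finite set, which keeps the chain off the
    diagonal. *)
Lemma no_action : False.
Proof.
have [x0 [H [Hc H0 H1]]] := ctrM; have [a1 aM ac apd] := actM.
have actK g x : act g (act g^-1%g x) = x by rewrite -aM mulgV a1.
have actVK g x : act g^-1%g (act g x) = x by rewrite -aM mulVg a1.
pose I01 : set R := `[0, 1]%classic.
have cI : compact I01 by exact: segment_compact.
have cact g (C : set M) : compact C -> compact (act g @` C).
  by move=> cC; apply: continuous_compact => //; apply: continuous_subspaceT; exact: ac.
pose B' := 1%g :: B.
pose P (C : set M) := [set y | exists2 g, g \in B' & (act g @` C) y].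
have cP C : compact C -> compact (P C) by move=> cC; apply: compact_seq => g _; exact: cact.
have PC C : C `<=` P C by move=> x Cx; exists 1%g; [exact: mem_head|exists x; rewrite ?a1].
pose C := fix C k := if k is k'.+1 then H @` (P (C k') `*` I01) else [set x0].
have cC k : compact (C k).
  elim: k => [|k IH]; first exact: compact_set1.
  apply: continuous_compact; last by apply: compact_setX; [exact: cP|].
  by apply: continuous_subspaceW Hc => -[x a] [_ h].
have PCS k : P (C k) `<=` C k.+1.
  by move=> x Px; exists (x, 0); rewrite ?H0 //; split=> //=; rewrite /I01 /= in_itv /= lexx ler01.
have CS k : C k `<=` C k.+1 by move=> x /PC/PCS.
have CC k j : (k <= j)%N -> C k `<=` C j by move=> /subnK <-; elim: (j - k)%N => [|i IH] x // /IH/CS.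
have Cx0 k : C k x0 by apply: (CC 0%N k).
pose N := n.+2.
(* If [p.1^-1 * p.2] avoids this finite set, the two translates of [C N] by [p] are disjoint. *)
pose F := enum_fset (fset_set [set g | act g @` C N `&` C N !=set0]).
have FP g : g \notin F -> forall x, C N x -> C N (act g x) -> False.
  move=> gF x Cx Cgx; case/negP: gF; rewrite -[_ \in _]/(g \in fset_set _) in_fset_set; last exact: apd.
  by rewrite inE; exists (act g x); split=> //; exists x.
have [c [tc hc]] := far F.
have tc' : tower (@swap G) n.+1 c by apply: tower_leq tc.
pose Gam0 := flatten (flatten [seq enum_fset (c j) | j <- iota 0 N]).
have inGam0 j s p : (j < N)%N -> coef (c j) s -> p \in s -> p \in Gam0.
  move=> jN cs ps; apply/flattenP; exists s => //; apply/flattenP; exists (enum_fset (c j)) => //.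
  by apply/mapP; exists j; rewrite // mem_iota.
pose off (p : G * G) := forall x, (act p.1 @` C N) x -> (act p.2 @` C N) x -> False.
(* Only finitely many pairs occur in the tower; closed under the swap, they form a finite set over
   which moduli can be made uniform. *)
pose Gam := [seq p <- Gam0 ++ map (@swap G) Gam0 | `[< off p >]].
have offP p : (p.1^-1 * p.2)%g \notin F -> off p.
  move=> pF x [y Cy yx] [z Cz zx]; apply: (FP _ pF z Cz).
  by rewrite aM zx -yx actVK.
have offS p : off p -> off (swap p) by move=> h x h1 h2; exact: (h x).
have GamS p : p \in Gam -> swap p \in Gam.
  rewrite !mem_filter => /andP[/asboolP o]; rewrite !mem_cat => h; apply/andP; split; first by apply/asboolP; exact: offS.
  case/orP: h => [h|/mapP[q qG ->]]; first by rewrite map_f ?orbT.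
  by rewrite swapK qG.
pose Gam1 := map fst Gam.
pose K := [set y | exists2 g, g \in Gam1 & (act g @` C N) y].
have cK : compact K by apply: compact_seq => g _; exact: cact.
pose CM := [set q : M * M | exists2 p, p \in Gam & (act p.1 @` C N `*` act p.2 @` C N) q].
have cCM : compact CM by apply: compact_seq => p _; apply: compact_setX; exact: cact.
have offCM q : CM q -> q.1 <> q.2.
  by move=> [p]; rewrite mem_filter => /andP[/asboolP o _] [h1 h2] e; apply: (o q.1) => //; rewrite e.
have [K0 [T [KK0 [e e0 he]]]] := no_tower mM ctrM cCM offCM cK.
(* The contraction conjugated by [g]; it ends at [act g x0]. *)
pose hg g (p : M * R) := act g (H (act g^-1%g p.1, p.2)).
have hgc g (A : set M) : {within A `*` I01, continuous (hg g)}.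
  apply: (@continuous_subspaceW _ _ _ ([set: M] `*` I01)); first by move=> [x a] [_ h].
  have c1 : {within [set: M] `*` I01, continuous (fun p : M * R => H (act g^-1%g p.1, p.2))}.
    apply: (within_comp Hc (u := fun p : M * R => (act g^-1%g p.1, p.2))); last by move=> p [].
    apply: continuous_subspaceT => p; exact: (cvg_pair (cont_fst (ac g^-1%g p.1)) cvg_snd).
  by move=> p; apply: (continuous_comp (c1 p)); exact: ac.
have GamK p k x : p \in Gam -> (k < N)%N -> (act p.1 @` P (C k)) x -> K0 x.
  move=> pG kN [y Py <-]; apply: KK0; exists p.1; first exact: map_f.
  by exists y => //; apply: (CC k.+1 N) => //; exact: PCS.
have modul k (e1 : R) : exists e2 : R, (k < N)%N -> 0 < e1 -> [/\ 0 < e2, e2 <= e1 &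
    forall p, p \in Gam -> forall x y a b, (act p.1 @` P (C k)) x -> (act p.1 @` P (C k)) y -> 0 <= a <= 1 -> 0 <= b <= 1 ->
      dist T x y < e2 -> `|a - b| < e2 -> dist T (hg p.1 (x, a)) (hg p.1 (y, b)) < e1].
  have [/andP[kN e10]|h] := boolP ((k < N)%N && (0 < e1)); last by exists 1 => h1 h2; rewrite h1 h2 in h.
  have [d d0 hd] : exists2 d : R, 0 < d & forall p, p \in Gam -> forall x y a b, (act p.1 @` P (C k)) x ->
      (act p.1 @` P (C k)) y -> 0 <= a <= 1 -> 0 <= b <= 1 -> dist T x y < d -> `|a - b| < d ->
      dist T (hg p.1 (x, a)) (hg p.1 (y, b)) < e1.
    apply: uniform_radius => [p a b _ ab h x y s t Ax Ay hs ht xy st|p pG].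
      by apply: h => //; [exact: lt_le_trans xy ab|exact: lt_le_trans st ab].
    have cA : compact (act p.1 @` P (C k)) by apply/cact/cP/cC.
    have AK : act p.1 @` P (C k) `<=` K0 by move=> x; exact: GamK.
    have [d d0 hd] := homotopy_modulus T cA AK (hgc p.1 _) e10.
    exists (d / 2); first by rewrite divr_gt0.
    by move=> x y a b Ax Ay Ia Ib xy ab; apply: hd => //; lra.
  exists (Num.min d e1); rewrite lt_min d0 e10 ge_min lexx orbT; split=> // p pG x y a b Ax Ay Ia Ib.
  by rewrite !lt_min => /andP[xy _] /andP[ab _]; exact: hd.
have [st stP] := choice (fun ke : nat * R => modul ke.1 ke.2).
(* Meshes are chosen backwards from [e]: each level is fine enough for the contraction to respect
   the mesh of the next. *)
pose E := fix E i := if i is i'.+1 then st ((N - i'.+1)%N, E i') else e.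
have EP i : (i <= N)%N -> 0 < E i /\ E i <= e.
  elim: i => [|i IH] iN; first by rewrite /= e0 lexx.
  have [E0 Ee] := IH (ltnW iN); have [|//|s0 s1 _] := stP ((N - i.+1)%N, E i); first by rewrite /= ltn_subrL.
  by split=> //; exact: le_trans s1 Ee.
pose el k := E (N - k)%N.
have el0 k : 0 < el k by apply: (EP _ _).1; exact: leq_subr.
have ele k : el k <= e by apply: (EP _ _).2; exact: leq_subr.
have elS k : (k < N)%N -> forall p, p \in Gam -> forall x y a b, (act p.1 @` P (C k)) x -> (act p.1 @` P (C k)) y ->
    0 <= a <= 1 -> 0 <= b <= 1 -> dist T x y < el k -> `|a - b| < el k ->
    dist T (hg p.1 (x, a)) (hg p.1 (y, b)) < el k.+1.
  move=> kN; have eE : el k = st (k, el k.+1).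
    by rewrite /el -(subnSK kN) /= -/E; congr (st (_, _)); lia.
  have [_ _ h] := stP (k, el k.+1) kN (el0 k.+1).
  by move=> p pG x y a b Ax Ay Ia Ib xy ab; apply: (h p pG) => //; rewrite -eE.
pose inC k (p : G * G) (q : M * M) := (act p.1 @` C k) q.1 /\ (act p.2 @` C k) q.2.
pose Dom (s : seq (G * G)) := (forall p, p \in s -> p \in Gam) /\
  forall p q, p \in s -> q \in s -> (p.1^-1 * q.1)%g \in B' /\ (p.2^-1 * q.2)%g \in B'.
pose Good (s : seq (G * G)) (z : chain (seq (M * M))) := sized (size s) z /\
  allc (fun u : seq (M * M) => small (pd T) (el (size s)) u /\
    forall q, q \in u -> exists2 p, p \in s & inC (size s) p q) z.
have [th thP] : exists th, forall s, Dom s -> (size s <= N)%N ->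
    carried (@bdt (G * G)%type) size (map (@swap G)) (@swap M) Good th s.
  apply: acyclic_carrier.
  - move=> s u [d1 d2] /coef_bdt[us ss]; split=> //; split=> [p /us/d1//|p q /us ps /us qs]; exact: d2.
  - by move=> s _; rewrite -[lin _ _]/(bd (bdt s)) -bd_sg bdbd.
  - by move=> s; rewrite -map_comp map_id_in // => p _; exact: swapK.
  - move=> s [d1 d2]; split=> [_ /mapP[p ps ->]|_ _ /mapP[p ps ->] /mapP[q qs ->]]; first exact/GamS/d1.
    by have [h1 h2] := d2 p q ps qs.
  - by move=> s; rewrite size_map.
  - by move=> s _; rewrite -push_bdt.
  (* A tuple fixed by the swap would start with a pair of equal elements, whose translates meet. *)
  - move=> [|p s] [d1 _] // _; apply/negP => /eqP [] e1 _; have pG := d1 p (mem_head _ _).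
    move: pG; rewrite mem_filter => /andP[/asboolP o _]; apply: (o (act p.1 x0)); first by exists x0.
    by exists x0 => //; have /= -> := congr1 fst e1.
  - exact: swapK.
  - move=> s z _ [sz hz]; split; first by rewrite size_map; exact: sized_push.
    move=> _ /coef_push[u cu ->]; have [sm hu] := hz u cu; rewrite size_map; split.
      by move=> _ _ /mapP[p ps ->] /mapP[q qs ->]; have /pd_lt[h1 h2] := sm p q ps qs; apply/pd_lt.
    by move=> _ /mapP[q qu ->]; have [p ps [h1 h2]] := hu q qu; exists (swap p); [exact: map_f|].
  - move=> s _ s0; split; first by move=> u; rewrite coef_sg => /eqP ->.
    by apply: allc_sg; split=> // q.
  (* All pairs differ from the first one by elements of [B'], so the values on the faces lie in
     translates of [P (C k)] by the first pair. *)
  move=> [|p s] th [d1 d2] // /andP[_ sN] hth; set z := lin th _ => bz.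
  have pG := d1 p (mem_head _ _); have spG := GamS p pG; set k := size s in sN *.
  have hz u : coef z u -> [/\ size u = k, small (pd T) (el k) u &
      forall q, q \in u -> (act p.1 @` P (C k)) q.1 /\ (act p.2 @` P (C k)) q.2].
    move=> /coef_linP[v cv cu]; have [sv hv] := hth v cv; have [sm hq] := hv u cu.
    have [vs [vk]] := coef_bdt cv; rewrite -/k in vk; rewrite -vk in sm hq; split=> //; first by rewrite (sv u cu).
    move=> q qu; have [p' p'v [[x Cx xq] [y Cy yq]]] := hq q qu.
    have [b1 b2] := d2 p p' (mem_head _ _) (vs _ p'v); split.
      exists (act (p.1^-1 * p'.1)%g x); last by rewrite -aM mulVKg.
      by exists (p.1^-1 * p'.1)%g => //; exists x.
    exists (act (p.2^-1 * p'.2)%g y); last by rewrite -aM mulVKg.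
    by exists (p.2^-1 * p'.2)%g => //; exists y.
  pose FF (a : R) (q : M * M) : M * M := (hg p.1 (q.1, a), hg p.2 (q.2, a)).
  pose v : M * M := (act p.1 x0, act p.2 x0).
  have sz : sized k z by move=> u /hz[].
  have [|b [sb bb hb]] := @homotopy_small R (M * M)%type (M * M)%type (pd T) FF (el k.+1) (el k) z k (el0 k) sz bz.
    move=> u q q' a b cu qu q'u Ia Ib ab; have [_ sm hq] := hz u cu; have /pd_lt[h1 h2] := sm q q' qu q'u.
    have [i1 i2] := hq q qu; have [j1 j2] := hq q' q'u.
    by apply/pd_lt; split; [exact: (elS k sN p pG)|exact: (elS k sN (swap p) spG)].
  have F1 q : FF 1 q = v by rewrite /FF /hg /= !H1.
  have inH g a x : 0 <= a <= 1 -> (act g @` P (C k)) x -> (act g @` C k.+1) (hg g (x, a)).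
    move=> Ia [y Py <-]; exists (H (y, a)); last by rewrite /hg /= actVK.
    by exists (y, a) => //; split=> //=; rewrite /I01 /= in_itv.
  exists (b + consc v (push (FF 1) z)).
    split; first apply: sizedD => //.
      by move=> _ /coef_consc[w /coef_push[u cu ->] ->]; rewrite /= size_map; have [-> _ _] := hz u cu.
    apply: allcD => [u cu|_ /coef_consc[w /coef_push[u cu ->] ->]].
      have [sm [w cw hw]] := hb u cu; split=> // q qu; have [a [q' [Ia q'w ->]]] := hw q qu.
      have [_ _ hq] := hz w cw; have [i1 i2] := hq q' q'w; exists p; first exact: mem_head.
      by split; exact: inH.
    have ev q : q \in v :: map (FF 1) u -> q = v by rewrite inE => /orP[/eqP//|/mapP[x _ ->]].
    split=> [q q' /ev -> /ev ->|q /ev ->]; first by apply/pd_lt; rewrite !distxx; split.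
    by exists p; [exact: mem_head|split; exists x0].
  rewrite bdD bb bd_consc -push_bd bz push0 consc0 addr0 addcK.
  by rewrite push_id // => u _ q _; rewrite /FF /hg /= !H0 !actK -surjective_pairing.
have domc j s : (j < N)%N -> coef (c j) s -> Dom s.
  move=> jN cs; have [h1 h2] := hc j s cs; split=> [p ps|p q ps qs].
    rewrite mem_filter mem_cat (inGam0 j s p) // andbT; apply/asboolP/offP; exact: h2.
  by have [i1 i2] := h1 p q ps qs; rewrite !inE i1 i2 !orbT.
have [sc b0 bS] := tc'.
have sizc j s : (j < N)%N -> coef (c j) s -> size s = j.+1 by move=> jN; exact: sc.
have bdlin j : (j < N)%N -> bd (lin th (c j)) = lin th (bd (c j)).
  move=> jN; rewrite /bd !lin_lin; apply: eq_lin => s cs.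
  by have [|_ h _ _] := thP s (domc j s jN cs); rewrite ?(sizc j).
apply: (he (fun j => lin th (c j))).
  split=> [j jn s /coef_linP[u cu cs]||j jn].
  - have [|[sz _] _ _ _] := thP u (domc j u jn cu); first by rewrite (sizc j).
    by rewrite (sz s cs) (sizc j).
  - rewrite bdlin // b0 lin_sg; have [||_ _ _ ->] // := thP [::].
  - rewrite bdlin ?bS // linD; congr (_ + _); rewrite /push !lin_lin; apply: eq_lin => s cs.
    have jN : (j < N)%N by rewrite ltnW.
    by rewrite lin_sg; have [|_ _ h _] := thP s (domc j s jN cs); rewrite ?(sizc j) // ltnW.
move=> j jn s /coef_linP[u cu cs]; have du := domc j u jn cu.
have [|[_ gz] _ _ _] := thP u du; first by rewrite (sizc j).
have [sm hq] := gz s cs; split=> [p q ps qs|q qs]; first exact: lt_le_trans (sm p q ps qs) (ele _).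
have [p pu [[x Cx xq] [y Cy yq]]] := hq q qs; have [d1 _] := du; exists p; first exact: d1.
rewrite (sizc j u jn cu) in Cx Cy.
by split; [exists x => //; exact: (CC j.+1 N)|exists y => //; exact: (CC j.+1 N)].
Qed.

End NoAction.

(** * The tripod as a cone on three points *)

Section Tripod.
Variable R : realType.
Local Notation W := (option ('I_3 * nat)).
Implicit Types (a b : 'I_3) (n k : nat) (w : W) (t u : R).

Definition tripod_base_faces : set {fset 'I_3} := [set s | exists a, s = [fset a]%fset].

Lemma tripod_base_sub (s t : {fset 'I_3}) :
  tripod_base_faces s -> t != fset0 -> (t `<=` s)%fset -> tripod_base_faces t.
Proof.
move=> [a ->] /fset0Pn[b bt] /fsubsetP h; exists a; apply/fsetP => c; rewrite inE.
have := h b bt; rewrite inE => /eqP eb; apply/idP/eqP => [/h|->]; first by rewrite inE => /eqP.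
by rewrite -eb.
Qed.

Definition tripod_base : complex 'I_3.
Proof.
apply: (@Complex _ tripod_base_faces); [|exact: tripod_base_sub|by move=> a; exists a].
by move=> s [a ->]; apply/fset0Pn; exists a; rewrite inE.
Defined.

(** The vertex at distance [n] on leg [a]; at [n = 0] the three legs share the vertex [None]. *)
Definition vt a n : W := if n is k.+1 then Some (a, k) else None.
Definition lev w : nat := if w is Some (_, k) then k.+1 else 0%N.
Definition onleg a w : bool := if w is Some (b, _) then b == a else true.

Lemma vtP a n w : (w == vt a n) = onleg a w && (lev w == n).
Proof.
by case: w n => [[b k]|] [|n] //=; rewrite andbF.
Qed.

Lemma lev_vt a n : lev (vt a n) = n. Proof. by case: n. Qed.
Lemma onleg_vt a n : onleg a (vt a n). Proof. by case: n => /=. Qed.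
Lemma onleg_exists w : exists a, onleg a w.
Proof. by case: w => [[b k]|]; [exists b => /=|exists ord0]. Qed.

Definition tripod_faces : set {fset W} :=
  [set s | s != fset0 /\ exists a n, forall w, w \in s -> w = vt a n \/ w = vt a n.+1].

Definition tripod : complex W.
Proof.
apply: (@Complex _ tripod_faces); first by move=> s [].
  by move=> s t [_ [a [n h]]] t0 /fsubsetP ts; split=> //; exists a, n => w /ts/h.
move=> w; split; first by apply/fset0Pn; exists w; rewrite inE.
have [a aw] := onleg_exists w; exists a, (lev w) => u; rewrite inE => /eqP ->; left.
by apply/eqP; rewrite vtP aw eqxx.
Defined.

(** The barycentric coordinate at vertex [n] of a half-line subdivided at the integers. *)
Definition hat n t : R := Num.max 0 (1 - `|t - n%:R|).
Definition leg_point a t : {ptws W -> R} := fun w => if onleg a w then hat (lev w) t else 0.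

Lemma hat_ge0 n t : 0 <= hat n t. Proof. by rewrite /hat le_max lexx. Qed.

Lemma hat_continuous n : continuous (hat n).
Proof.
move=> t; have c1 : continuous_at t (fun=> 0 : R) by exact: cst_continuous.
have c2 : continuous_at t (fun t => 1 - `|t - n%:R|).
  apply: cvgB; first exact: cvg_cst.
  by apply: cvg_norm; apply: cvgB; [exact: cvg_id|exact: cvg_cst].
exact: (continuous_max c1 c2).
Qed.

Lemma hat_low n t : n%:R <= t <= n%:R + 1 -> hat n t = 1 - (t - n%:R).
Proof. by move=> /andP[h1 h2]; rewrite /hat ger0_norm ?max_r; lra. Qed.
Lemma hat_high n t : n%:R <= t <= n%:R + 1 -> hat n.+1 t = t - n%:R.
Proof. by move=> /andP[h1 h2]; rewrite /hat ler0_norm -?natr1 ?max_r; lra. Qed.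
Lemma hat_out n k t : n%:R <= t <= n%:R + 1 -> k != n -> k != n.+1 -> hat k t = 0.
Proof.
move=> /andP[h1 h2] kn kn1; rewrite /hat max_l //.
have [lt|ge] := ltnP k n.
  have : k.+1%:R <= n%:R :> R by rewrite ler_nat.
  by rewrite -natr1 => h3; rewrite ger0_norm; lra.
have gt : (n.+2 <= k)%N by rewrite ltn_neqAle eq_sym kn1 ltn_neqAle eq_sym kn ge.
have : n.+2%:R <= k%:R :> R by rewrite ler_nat.
by rewrite -!natr1 => h3; rewrite ler0_norm; lra.
Qed.

Lemma nat_part t : 0 <= t -> exists n, n%:R <= t <= n%:R + 1 /\ t < n%:R + 1.
Proof.
move=> t0; have h := Num.Theory.truncn_itv t0; exists (Num.truncn t).
by move: h; rewrite -natr1 => /andP[h1 h2]; rewrite h1 h2 (ltW h2).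
Qed.

Lemma leg_point_vt a n t : leg_point a t (vt a n) = hat n t.
Proof. by rewrite /leg_point onleg_vt lev_vt. Qed.

Lemma sum_edge a n (s : {fset W}) (x : {ptws W -> R}) : (forall w, w \in s -> w = vt a n \/ w = vt a n.+1) ->
  (forall w, w \notin s -> x w = 0) -> \sum_(w <- s) x w = x (vt a n) + x (vt a n.+1).
Proof.
move=> hs x0; have ne : vt a n != vt a n.+1 by rewrite vtP onleg_vt lev_vt /= neq_ltn ltnSn.
have sE : (s `<=` [fset vt a n; vt a n.+1])%fset.
  by apply/fsubsetP => w /hs[->|->]; rewrite !inE eqxx ?orbT.
rewrite (big_fset_incl _ sE) /=; last by move=> w _ /x0.
by rewrite big_fsetU1 /= ?inE // big_seq_fset1.
Qed.

Lemma simplex_leg a n (s : {fset W}) (x : {ptws W -> R}) : (forall w, w \in s -> w = vt a n \/ w = vt a n.+1) ->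
  simplex R s x -> let t := n%:R + x (vt a n.+1) in 0 <= t /\ x = leg_point a t.
Proof.
move=> hs [x0 xs x1] t; rewrite (sum_edge hs xs) in x1.
have h0 := x0 (vt a n); have h1 := x0 (vt a n.+1); have n0 : 0 <= n%:R :> R by [].
have ht : n%:R <= t <= n%:R + 1 by rewrite /t; apply/andP; split; lra.
split; first by rewrite /t; lra.
apply/funext => w; rewrite /leg_point; case: ifPn => [lw|lw]; last first.
  by apply: xs; apply: contra lw => /hs[->|->]; exact: onleg_vt.
have [e|ne] := eqVneq (lev w) n.
  have -> : w = vt a n by apply/eqP; rewrite vtP lw e eqxx.
  by rewrite lev_vt hat_low // /t; lra.
have [e|ne1] := eqVneq (lev w) n.+1.
  have -> : w = vt a n.+1 by apply/eqP; rewrite vtP lw e eqxx.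
  by rewrite lev_vt hat_high // /t; lra.
rewrite (hat_out ht) //; apply: xs; apply/negP => /hs[] e; rewrite e lev_vt eqxx in ne ne1 => //.
Qed.

Lemma leg_simplex a n t : n%:R <= t <= n%:R + 1 -> simplex R [fset vt a n; vt a n.+1]%fset (leg_point a t).
Proof.
move=> ht; have out w : w \notin [fset vt a n; vt a n.+1]%fset -> leg_point a t w = 0.
  rewrite !inE !vtP negb_or /leg_point; case: ifP => //= _ /andP[h1 h2]; exact: hat_out ht h1 h2.
split=> // [w|]; first by rewrite /leg_point; case: ifP => // _; exact: hat_ge0.
rewrite (@sum_edge a n _ _ _ out) => [|w]; last by rewrite !inE => /orP[]/eqP ->; [left|right].
by rewrite !leg_point_vt hat_low // hat_high //; ring.
Qed.

Lemma leg_realization a t : 0 <= t -> realization R tripod (leg_point a t).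
Proof.
move=> /nat_part[n [ht _]]; exists [fset vt a n; vt a n.+1]%fset; last exact: leg_simplex.
split; first by apply/fset0Pn; exists (vt a n); rewrite !inE eqxx.
by exists a, n => w; rewrite !inE => /orP[]/eqP ->; [left|right].
Qed.

Lemma realization_leg x : realization R tripod x -> exists at0 : 'I_3 * R, 0 <= at0.2 /\ x = leg_point at0.1 at0.2.
Proof. by move=> [s [_ [a [n hs]]] /(simplex_leg hs)[h1 h2]]; exists (a, n%:R + x (vt a n.+1)). Qed.

(* The parameter of a point of the tripod is determined, continuously, by the
   coordinates at the two vertices next to it. *)
Lemma leg_close a b t e : 0 <= t -> 0 < e -> exists n d, 0 < d /\ forall u, 0 <= u ->
  `|leg_point b u (vt a n) - hat n t| < d -> `|leg_point b u (vt a n.+1) - hat n.+1 t| < d ->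
  `|u - t| < e /\ (b = a \/ t = 0).
Proof.
move=> t0 e0; have [n [ht tn]] := nat_part t0; exists n.
have nt : n%:R <= t by case/andP: ht.
have tau : 0 < (n%:R + 1 - t) / 2 by lra.
(* On the first edge, the coordinate [t] at vertex [1] is what tells the leg, so there [d] must not
   exceed [t]. *)
pose z := if t == 0 then 1 else (if n == 0%N then t else 1) : R.
have z0 : 0 < z by rewrite /z; case: eqP => // tn0; case: eqP => // _; rewrite lt_neqAle eq_sym t0 andbT; exact/eqP.
have [d [d0 d1 d2 d3]] := exists_min3 (divr_gt0 e0 (ltr0Sn R 2)) tau z0.
exists d; split=> // u u0; rewrite (hat_low ht) (hat_high ht) => h1 h2.
have hb : b = a \/ t = 0.
  have [->|tn0] := eqVneq t 0; [by right|left].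
  move: d3; rewrite /z (negPf tn0); case: eqP => [n0 dt|n0 _].
    move: h2; rewrite n0 /= /leg_point /= subr0; case: eqP => [->//|_].
    by rewrite sub0r normrN ger0_norm // => h2; exfalso; lra.
  move: h1; rewrite /leg_point; case: n n0 ht tn nt tau d2 z {z0 h2} => //= k _ ht tn nt tau d2 _.
  by case: eqP => [->//|_]; rewrite sub0r normrN ger0_norm => [h1|]; [exfalso|]; lra.
split=> //.
have l1 : leg_point b u (vt a n) = hat n u.
  case: hb => [->|tz]; first exact: leg_point_vt.
  have n0 : n = 0%N by move: nt; rewrite tz (ler_nat R n 0) leqn0 => /eqP.
  by rewrite n0 /leg_point.
have l2 : leg_point b u (vt a n.+1) = hat n.+1 u \/ t = 0.
  by case: hb => [->|]; [left; exact: leg_point_vt|right].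
rewrite l1 in h1; have hpos : 0 < hat n u by move: h1; rewrite ltr_norml => /andP[h _]; lra.
have hE : hat n u = 1 - `|u - n%:R|.
  by move: hpos; rewrite /hat; case: (leP 0 (1 - `|u - n%:R|)) => // h; rewrite ltxx.
rewrite hE ltr_norml in h1; case/andP: h1 => h1 h1'.
have [un|un] := leP n%:R u.
  by rewrite ger0_norm in h1 h1' => //; rewrite ?subr_ge0 // ltr_norml; apply/andP; split; lra.
rewrite ltr0_norm ?subr_lt0 // in h1 h1'; have td : t - n%:R < d.
  case: l2 => [l2|tz]; last by have : 0 <= n%:R :> R by []; lra.
  move: h2; rewrite l2 (_ : hat n.+1 u = 0) ?sub0r ?normrN ?ger0_norm ?subr_ge0 //.
  by rewrite /hat max_l // ler0_norm -?natr1; lra.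
by rewrite ltr_norml; apply/andP; split; lra.
Qed.

Lemma leg_inj a b t u : 0 <= t -> 0 <= u -> leg_point a t = leg_point b u -> t = u /\ (a = b \/ t = 0).
Proof.
move=> t0 u0 e; have key ep : 0 < ep -> `|u - t| < ep /\ (b = a \/ t = 0).
  move=> ep0; have [n [d [d0 h]]] := leg_close a b t0 ep0; apply: h => //.
    by rewrite -e leg_point_vt subrr normr0.
  by rewrite -e leg_point_vt subrr normr0.
split; last by have [_ [->|]] := key 1 ltr01; [left|right].
apply/eqP; apply: contraT => ne; have : 0 < `|u - t| by rewrite normr_gt0 subr_eq0 eq_sym.
by move=> /[dup] /key[]; rewrite ltxx.
Qed.

End Tripod.

(** * The homeomorphism between the tripod and the open cone *)

Section TripodCone.
Variable R : realType.
Local Notation W := (option ('I_3 * nat)).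
Local Notation OC := (open_cone R tripod_base).
Implicit Types (a b : 'I_3) (n k : nat) (w : W) (t u : R).

Lemma vertex_point_fset1 (V : choiceType) (v : V) : simplex R [fset v]%fset (vertex_point R v).
Proof. by apply: vertex_point_simplex; rewrite inE. Qed.

Lemma simplex_fset1 (V : choiceType) (v : V) x : simplex R [fset v]%fset x -> x = vertex_point R v.
Proof.
move=> [x0 xv x1]; apply/funext => u; rewrite /vertex_point; case: eqP => [->|/eqP h].
  by move: x1; rewrite big_seq_fset1.
by apply: xv; rewrite inE.
Qed.

Lemma ka_in a : vertex_point R a \in realization R tripod_base.
Proof. by apply/mem_set; exists [fset a]%fset; [exists a|exact: vertex_point_fset1]. Qed.
Definition ka a : set_type (realization R tripod_base) := Sub (vertex_point R a) (ka_in a).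

Lemma rt_in u : Num.max 0 u \in `[0 : R, +oo[%classic.
Proof. by apply/mem_set; rewrite /= in_itv /= andbT le_max lexx. Qed.
Definition rt u : set_type `[0 : R, +oo[ := Sub (Num.max 0 u) (rt_in u).

Lemma val_ka a : \val (ka a) = vertex_point R a. Proof. exact: SubK. Qed.
Lemma val_rt t : 0 <= t -> \val (rt t) = t. Proof. by move=> t0; rewrite SubK max_r. Qed.

Definition phi a u : OC := cone_pi (ka a, rt u).

Lemma cylinder_leg (p : cylinder R tripod_base) : exists a t, 0 <= t /\ p = (ka a, rt t).
Proof.
have : realization R tripod_base (\val p.1) by apply: set_mem; exact: valP.
move=> [s [a ->] /simplex_fset1 e]; exists a, (\val p.2).
have t0 : 0 <= \val p.2 by have := set_mem (valP p.2); rewrite /= in_itv /= andbT.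
split=> //; case: p e t0 => x t e t0; congr (_, _); apply: val_inj; first exact: (etrans e (esym (val_ka a))).
exact: (esym (val_rt t0)).
Qed.

Lemma phi_eq a b t u : 0 <= t -> t = u -> a = b \/ t = 0 -> phi a t = phi b u.
Proof.
move=> t0 <- [->//|t0']; apply: cone_pi_eq; apply/orP; right.
by apply/andP; split; apply/eqP; exact: (etrans (val_rt t0) t0').
Qed.

Lemma phi_inj a b t u : 0 <= t -> 0 <= u -> phi a t = phi b u -> t = u /\ (a = b \/ t = 0).
Proof.
move=> t0 u0 /cone_pi_rel /orP[/eqP e|/andP[/eqP h1 /eqP h2]]; last first.
  have e1 : t = 0 := etrans (esym (val_rt t0)) h1; have e2 : u = 0 := etrans (esym (val_rt u0)) h2.
  by split; [rewrite e1 e2|right].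
have e2 : t = u := etrans (esym (val_rt t0)) (etrans (congr1 (fun p : cylinder R tripod_base => \val p.2 : R) e) (val_rt u0)).
have e1 := etrans (esym (val_ka a)) (etrans (congr1 (fun p : cylinder R tripod_base => \val p.1) e) (val_ka b)).
split=> //; left.
have := congr1 (fun g => g a) e1; rewrite /vertex_point eqxx.
by case: eqP => // _ /eqP; rewrite oner_eq0.
Qed.

Lemma phi_surj z : exists a t, 0 <= t /\ z = phi a t.
Proof. by have [c <-] := cone_pi_surj z; have [a [t [t0 ->]]] := cylinder_leg c; exists a, t. Qed.

Lemma rt_continuous : continuous rt.
Proof.
move=> t; apply: cvg_set_type; rewrite SubK; under eq_fun do rewrite SubK.
have c1 : continuous_at t (fun=> 0 : R) by exact: cst_continuous.
have c2 : continuous_at t (fun t : R => t) by exact: cvg_id.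
exact: (continuous_max c1 c2).
Qed.

Lemma phi_continuous a : continuous (phi a).
Proof.
move=> t; apply: (@continuous_comp _ _ _ (fun u => (ka a, rt u) : cylinder R tripod_base) (@cone_pi R _ _)).
  by apply: (@cvg_pair _ _ _ _ (nbhs (ka a)) (nbhs (rt t))); [exact: cvg_cst|exact: rt_continuous].
exact: cone_pi_continuous.
Qed.

(** The leg enters as a coordinate of the base point, which makes continuity on the cylinder
    evident. *)
Definition leg_of (p : cylinder R tripod_base) : {ptws W -> R} := fun w =>
  if w is Some (b, k) then (\val p.1 : {ptws 'I_3 -> R}) b * hat k.+1 (\val p.2 : R) else hat 0 (\val p.2 : R).

Lemma leg_ofE a t : 0 <= t -> leg_of (ka a, rt t) = leg_point a t.
Proof.
move=> t0; apply/funext => -[[b k]|]; last exact: (congr1 (hat 0) (val_rt t0)).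
apply: (etrans (congr2 (fun (x : {ptws 'I_3 -> R}) y => x b * hat k.+1 y) (val_ka a) (val_rt t0))).
by rewrite /leg_point /vertex_point /=; case: eqP; rewrite ?mul1r ?mul0r.
Qed.

Lemma leg_of_in p : leg_of p \in realization R tripod.
Proof. by have [a [t [t0 ->]]] := cylinder_leg p; apply/mem_set; rewrite leg_ofE //; exact: leg_realization. Qed.

Definition unroll p : set_type (realization R tripod) := Sub (leg_of p) (leg_of_in p).

Lemma unroll_continuous : continuous unroll.
Proof.
move=> p; apply: cvg_set_type; rewrite (_ : (fun q => \val (unroll q)) = leg_of); last by apply/funext => q; exact: SubK.
have -> : \val (unroll p) = leg_of p by exact: SubK.
have c2 : continuous_at p (fun p : cylinder R tripod_base => \val p.2 : R).
  by apply: (cont_snd (f := fun t : set_type `[0 : R, +oo[ => \val t : R)); exact: val_continuous.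
apply: (@cvg_ptws _ _ _ (nbhs p) _) => -[[b k]|]; rewrite /leg_of; last first.
  exact: (@continuous_comp _ _ _ (fun p : cylinder R tripod_base => \val p.2 : R) (hat 0) p c2 (@hat_continuous R 0 _)).
apply: (@cvgM _ _ (nbhs p) _ (fun p : cylinder R tripod_base => (\val p.1 : {ptws 'I_3 -> R}) b)).
  apply: (cont_fst (f := fun x : set_type (realization R tripod_base) => (\val x : {ptws 'I_3 -> R}) b)).
  apply: (@continuous_comp _ _ _ (fun x : set_type (realization R tripod_base) => \val x : {ptws 'I_3 -> R}) (fun x => x b)).
    exact: val_continuous.
  exact: eval_ptws.
exact: (@continuous_comp _ _ _ (fun p : cylinder R tripod_base => \val p.2 : R) (hat k.+1) p c2 (@hat_continuous R k.+1 _)).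
Qed.

Lemma unroll_phi p q : cone_pi p = cone_pi q -> unroll p = unroll q.
Proof.
have [a [t [t0 ->]]] := cylinder_leg p; have [b [u [u0 ->]]] := cylinder_leg q.
move=> /(phi_inj t0 u0)[<- h]; apply: val_inj; apply: (etrans (SubK _ _)); apply: esym; apply: (etrans (SubK _ _)); rewrite !leg_ofE //.
case: h => [->//|->]; apply/funext => -[[c k]|] //; rewrite /leg_point /=.
have -> : hat k.+1 0 = 0 :> R.
  rewrite /hat max_l // sub0r normrN ger0_norm // subr_le0; by rewrite (ler_nat R 1).
by rewrite !if_same.
Qed.

Definition tripod_inv (z : OC) := unroll (repr z).

Lemma tripod_inv_phi a t : 0 <= t -> \val (tripod_inv (phi a t)) = leg_point a t.
Proof.
move=> t0; rewrite /tripod_inv (@unroll_phi _ (ka a, rt t)); last by rewrite /phi /cone_pi reprK.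
by apply: (etrans (SubK _ _)); exact: leg_ofE.
Qed.

Lemma tripod_inv_continuous : continuous tripod_inv.
Proof.
apply: (@repr_comp_continuous _ _ _ unroll); first exact: unroll_continuous.
by move=> p q /eqP h; apply/eqP/unroll_phi.
Qed.

Lemma tripod_coords (x : set_type (realization R tripod)) :
  exists c : 'I_3 * R, 0 <= c.2 /\ \val x = leg_point c.1 c.2.
Proof. by apply: realization_leg; apply: set_mem; exact: valP. Qed.

(** At the apex the leg is not unique, but [phi] takes the same value for all of them. *)
Definition tripod_tri (x : set_type (realization R tripod)) : OC :=
  let c := projT1 (cid (tripod_coords x)) in phi c.1 c.2.

Lemma tripod_triE x a t : 0 <= t -> \val x = leg_point a t -> tripod_tri x = phi a t.
Proof.
rewrite /tripod_tri; case: (cid _) => -[b u] /= [u0 ->] t0 /(leg_inj u0 t0)[e h].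
exact: phi_eq.
Qed.

(** Near a point of leg [a] other than the apex only leg [a] occurs; near the apex all three do.
    Each leg is handled by [leg_close], and there are finitely many. *)
Lemma tripod_tri_continuous : continuous tripod_tri.
Proof.
move=> x O; have [[a t] /= [t0 xE]] := tripod_coords x; rewrite (tripod_triE t0 xE) => nO.
have ex b : exists e, 0 < e /\ (b = a \/ t = 0 -> forall u, 0 <= u -> `|u - t| < e -> O (phi b u)).
  have [h|h] := pselect (b = a \/ t = 0); last by exists 1.
  have nb : nbhs (phi b t) O by rewrite (@phi_eq b a t t t0 erefl h).
  have /nbhs_ballP[e /= e0 he] := @phi_continuous b t O nb.
  by exists e; split=> // _ u u0 ut; apply: he; rewrite -ball_normE /ball_ /= distrC.
have [e0 e0P] := choice ex.
have [e ep he] : exists2 e, 0 < e & forall b, b \in enum 'I_3 -> e <= e0 b.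
  apply: uniform_radius => [b c d _ cd|b _]; first exact: le_trans.
  by have [h _] := e0P b; exists (e0 b).
have [b0 _] : exists b0 : 'I_3, True by exists ord0.
have nv w d : 0 < d -> nbhs x [set y : set_type (realization R tripod) |
    `|(\val y : {ptws W -> R}) w - (\val x : {ptws W -> R}) w| < d].
  move=> d0; have c : continuous_at x (fun y : set_type (realization R tripod) => (\val y : {ptws W -> R}) w).
    apply: (@continuous_comp _ _ _ (fun y : set_type (realization R tripod) => \val y : {ptws W -> R}) (fun y => y w)).
      exact: val_continuous.
    exact: eval_ptws.
  by have /cvgrPdist_lt/(_ d d0) := c; apply: filterS => y; rewrite distrC.
have [n [d [d0 _]]] := leg_close a a t0 ep.
have key b : nbhs x [set y | forall u, 0 <= u -> \val y = leg_point b u -> O (tripod_tri y)].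
  have [n' [d' [d'0 hd]]] := leg_close a b t0 ep.
  apply: filterS (filterI (nv (vt a n') d' d'0) (nv (vt a n'.+1) d' d'0)) => y [h1 h2] u u0 yE.
  rewrite (tripod_triE u0 yE).
  have e1 w : (\val y : {ptws W -> R}) w = leg_point b u w by exact: (congr1 (fun g => g w) yE).
  have e2 w : (\val x : {ptws W -> R}) w = leg_point a t w by exact: (congr1 (fun g => g w) xE).
  have h1' : `|leg_point b u (vt a n') - hat n' t| < d' by rewrite -(leg_point_vt a n' t) -e1 -e2; exact: h1.
  have h2' : `|leg_point b u (vt a n'.+1) - hat n'.+1 t| < d' by rewrite -(leg_point_vt a n'.+1 t) -e1 -e2; exact: h2.
  have [h3 h4] := hd u u0 h1' h2'; have [_ h5] := e0P b; apply: h5 => //.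
  by apply: lt_le_trans h3 (he b _); rewrite mem_enum.
pose Q b (y : set_type (realization R tripod)) := forall u, 0 <= u -> \val y = leg_point b u -> O (tripod_tri y).
have hall (l : seq 'I_3) : nbhs x [set y | forall b, b \in l -> Q b y].
  elim: l => [|b l IH]; first by apply: (@filterS _ (nbhs x) (nbhs_filter x) _ _ _ filterT) => y _ b.
  apply: (@filterS _ (nbhs x) (nbhs_filter x) _ _ _ (@filterI _ (nbhs x) (nbhs_filter x) _ _ (key b) IH)) => y [h1 h2] c.
  by rewrite inE => /orP[/eqP ->|/h2].
apply: (@filterS _ (nbhs x) (nbhs_filter x) _ _ _ (hall (enum 'I_3))) => y h; have [[b u] /= [u0 yE]] := tripod_coords y.
by apply: (h b) yE; rewrite ?mem_enum.
Qed.

Lemma tripod_homeomorphism : is_homeomorphism tripod_tri.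
Proof.
split; first exact: tripod_tri_continuous.
exists tripod_inv; split; first exact: tripod_inv_continuous.
  move=> x; have [[a t] /= [t0 xE]] := tripod_coords x; apply: val_inj.
  by rewrite (tripod_triE t0 xE) tripod_inv_phi.
by move=> z; have [a [t [t0 ->]]] := phi_surj z; apply: tripod_triE => //; rewrite tripod_inv_phi.
Qed.

Lemma lev_finite N : finite_set [set w : W | (lev w <= N)%N].
Proof.
apply: (@sub_finite_set _ _ [set` None :: [seq Some (a, k) | a <- enum 'I_3, k <- iota 0 N]]); last exact: finite_seq.
move=> [[a k]|] /= h; rewrite inE //=; apply/allpairsP; exists (a, k); split=> //=; first by rewrite mem_enum.
by rewrite mem_iota.
Qed.

Lemma phi_subcone a b t : 0 <= t -> subcone R tripod_base [fset a]%fset (phi b t) <-> b = a \/ t = 0.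
Proof.
move=> t0; split=> [[p sp]|h].
  have [c [u [u0 pE]]] := cylinder_leg p; rewrite pE /= in sp *.
  move=> /(phi_inj u0 t0)[<- h]; case: h => [<-|->]; [left|by right].
  have sp' : simplex R [fset a]%fset (vertex_point R c) by rewrite -(val_ka c).
  have := simplex_fset1 sp' => /(congr1 (fun g => g c)).
  by rewrite /vertex_point eqxx; case: eqP => // _ /eqP; rewrite oner_eq0.
have h1 : simplex R [fset a]%fset (\val (ka a)) by rewrite val_ka; exact: vertex_point_fset1.
by rewrite (@phi_eq b a t t) //; exists (ka a, rt t).
Qed.

Lemma tripod_triangulation : cone_triangulation tripod_tri.
Proof.
split; last 2 first.
- exact: tripod_homeomorphism.
- move=> s [a ->]; exists [set t | faces tripod t /\ forall w, w \in t -> onleg a w].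
    split=> [t []//|t u [tT h] u0 ut]; split; first exact: Defs.face_sub tT u0 ut.
    by move=> w /(fsubsetP ut)/h.
  apply/seteqP; split=> x /=.
    have [[b t] /= [t0 xE]] := tripod_coords x; rewrite (tripod_triE t0 xE) => /(phi_subcone _ _ t0) h.
    have xE' : \val x = leg_point a t.
      apply: (etrans xE); have e := @phi_eq b a t t t0 erefl h.
      by rewrite -(tripod_inv_phi b t0) -(tripod_inv_phi a t0) e.
    have [n [ht _]] := nat_part t0; exists [fset vt a n; vt a n.+1]%fset; last by rewrite xE'; exact: leg_simplex.
    split; last by move=> w; rewrite !inE => /orP[]/eqP ->; exact: onleg_vt.
    split; first by apply/fset0Pn; exists (vt a n); rewrite !inE eqxx.
    by exists a, n => w; rewrite !inE => /orP[]/eqP ->; [left|right].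
  move=> [t [[_ [b [n ht]]] ha] sx]; have [u0 xE] := simplex_leg ht sx.
  rewrite (tripod_triE u0 xE); apply/phi_subcone => //.
  have [h0|h0] := eqVneq (n%:R + (\val x : {ptws W -> R}) (vt b n.+1)) 0; [by right|left].
  have [x0 xt x1] := sx.
  have [c1|c1] := boolP (vt b n.+1 \in t); first by have /eqP := ha _ c1.
  have e1 : (\val x : {ptws W -> R}) (vt b n.+1) = 0 := xt _ c1.
  move: h0; rewrite e1 addr0 pnatr_eq0 => n0.
  have [c0|c0] := boolP (vt b n \in t); first by have := ha _ c0; case: n n0 {ht u0 xE c1 c0 e1} => //= k _ /eqP.
  have e0 : (\val x : {ptws W -> R}) (vt b n) = 0 := xt _ c0.
  by have := etrans (esym (sum_edge ht xt)) x1; rewrite e0 e1 addr0 => /eqP; rewrite eq_sym oner_eq0.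
move=> v; apply: (@sub_finite_set _ _ [set` fpowerset (fset_set [set w : W | (lev w <= (lev v).+1)%N])]); last exact: finite_fset.
move=> s /= [[_ [a [n hs]]] vs]; rewrite fpowersetE; apply/fsubsetP => w ws.
rewrite in_fset_set; last exact: lev_finite.
rewrite inE /=; have [->|->] := hs w ws; have [->|->] := hs v vs; rewrite !lev_vt //.
by rewrite ltnW.
Qed.

End TripodCone.

(** * Three points as a 0-obstructor complex *)

Section TripodObstructor.
Variables (R : realType).
Implicit Types a b : 'I_3.

Lemma disjoint_fset1 a b : a != b -> disjoint_faces tripod_base [fset a]%fset [fset b]%fset.
Proof.
move=> ab; split; [by exists a|by exists b|].
by rewrite fdisjoint1X inE.
Qed.

(** Each of the three pairs has one intersection point in [R^0], and three is odd; each point lies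
    in two pairs. The cycle condition is vacuous, since a vertex has no nonempty facet. *)
Lemma tripod_obstructor_complex : obstructor_complex R tripod_base 0.
Proof.
pose pr a b : {fset {fset 'I_3}} := [fset [fset a]; [fset b]]%fset.
have pr_eq a b c d : pr a b = pr c d -> (a = c /\ b = d) \/ (a = d /\ b = c).
  by move=> /fset2_eq[[/fset1_inj -> /fset1_inj ->]|[/fset1_inj -> /fset1_inj ->]]; [left|right].
pose L : seq ('I_3 * 'I_3) := [seq p : 'I_3 * 'I_3 <- [seq (a, b) | a <- enum 'I_3, b <- enum 'I_3] | (p.1 < p.2)%N].
pose Sigma : {fset {fset {fset 'I_3}}} := [fset pr p.1 p.2 | p in L]%fset.
have LP (p : 'I_3 * 'I_3) : (p \in L) = (p.1 < p.2)%N.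
  rewrite mem_filter; case: (_ < _)%N => //=; apply/allpairsP; exists p; rewrite !mem_enum; split=> //.
  exact: surjective_pairing.
have SP P : P \in Sigma -> exists a b, a != b /\ P = pr a b.
  move=> /imfsetP[[a b] /= ab ->]; exists a, b; split=> //.
  by move: ab; rewrite LP /=; apply: contraTneq => ->; rewrite ltnn.
have prC a b : pr a b = pr b a by rewrite /pr fsetUC.
have inS a b : (pr a b \in Sigma) = (b != a).
  apply/idP/idP => [/SP[c [d [cd /pr_eq[[-> ->]|[-> ->]]]]] //|ab]; first by rewrite eq_sym.
  have : (a < b)%N || (b < a)%N by rewrite -neq_ltn eq_sym; exact: ab.
  case/orP => h; first by apply/imfsetP; exists (a, b) => //=; rewrite LP.
  by apply/imfsetP; exists (b, a) => //=; rewrite ?LP // prC.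
have uL : uniq L by rewrite filter_uniq // allpairs_uniq ?enum_uniq // => -[? ?] [].
have sL : size L = 3%N.
  rewrite size_filter -(count_map (fun p : 'I_3 * 'I_3 => (val p.1, val p.2)) (fun p : nat * nat => (p.1 < p.2)%N)).
  rewrite (_ : map _ _ = [seq (i, j) | i <- iota 0 3, j <- iota 0 3]) //.
  by rewrite -val_enum_ord map_allpairs allpairs_mapl allpairs_mapr.
have cS : #|` Sigma| = 3%N.
  apply: etrans sL; rewrite -[RHS](size_map (fun p : 'I_3 * 'I_3 => pr p.1 p.2) L); apply/perm_size/uniq_perm.
  - exact: fset_uniq.
  - rewrite map_inj_in_uniq // => -[a b] [c d]; rewrite !LP /= => ab cd /pr_eq[[-> ->] //|[e1 e2]].
    by move: ab cd; rewrite e1 e2 => h1 h2; have := ltn_trans h1 h2; rewrite ltnn.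
  by move=> P; apply/imfsetP/mapP => [[p /= pL ->]|[p pL ->]]; exists p.
split.
- apply: (@sub_finite_set _ _ [set` fpowerset (seq_fset tt (enum 'I_3))]); last exact: finite_fset.
  move=> s _; have : s \in fpowerset (seq_fset tt (enum 'I_3)) by rewrite fpowersetE; apply/fsubsetP => a _; rewrite seq_fsetE mem_enum.
  by [].
- by move=> s [a ->]; rewrite cardfs1.
exists Sigma; split.
- split.
    move=> P /SP[a [b [ab ->]]]; exists [fset a]%fset, [fset b]%fset.
    by split; rewrite ?cardfs1 //; exact: disjoint_fset1.
  move=> Q; rewrite (_ : [fset P in Sigma | _]%fset = fset0) ?cardfs0 //.
  apply/fsetP => P; rewrite !inE; apply/negP => /andP[/SP[a [b [_ ->]]] /asboolP[s [t [v [e vs s0 _]]]]].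
  have [c sE] : exists c, s = [fset c]%fset.
    have : s \in pr a b by rewrite e !inE eqxx.
    by rewrite !inE => /orP[]/eqP ->; [exists a|exists b].
  by move: vs s0; rewrite sE inE => /eqP ->; rewrite fsetDv eqxx.
- exists (fun=> 0); last first.
    rewrite /intersection_number (eq_big_seq (fun=> 1%N)).
      by rewrite big_const_seq count_predT iter_addn_0 mul1n cS.
    move=> P /SP[a [b [_ ->]]].
    rewrite (_ : \bigcap_(s in _) _ = [set (0 : 'rV[R]_0)]); first by rewrite fset_set1 cardfs1.
    apply/seteqP; split=> y; first by move=> _; rewrite /= (thinmx0 y).
    move=> -> s; rewrite /= !inE => /orP[]/eqP ->.
      by exists (vertex_point R a) => //; exact: vertex_point_fset1.
    by exists (vertex_point R b) => //; exact: vertex_point_fset1.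
  split.
  + by move=> x; exact: cvg_cst.
  + by move=> s t [[a ->] [b ->] _]; rewrite !cardfs1.
  move=> s t [[a ->] [b ->] _] _; split.
  + by apply: (@sub_finite_set _ _ [set 0]); [move=> _ [[x _ <-] _]|exact: finite_set1].
  + by move=> x x' y y' /simplex_fset1 -> /simplex_fset1 -> /simplex_fset1 -> /simplex_fset1 ->.
  move=> x y _ _ _; exists setT, setT; split; try exact: filterT.
  move=> [x1 y1] [x2 y2]; rewrite !inE /= => -[[_ /simplex_fset1 ->] [_ /simplex_fset1 ->]].
  by move=> [[_ /simplex_fset1 ->] [_ /simplex_fset1 ->]].
move=> s [a ->] _.
rewrite (_ : [set v | _] = [set` [fset b in 'I_3 | b != a]%fset]).
  rewrite set_fsetK; have -> : [fset b in 'I_3 | b != a]%fset = ([fset b in 'I_3] `\ a)%fset.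
    by apply/fsetP => b; rewrite !inE andbC.
  have := cardfsD1 a [fset b in 'I_3]%fset; rewrite inE /= add1n.
  have -> : #|` [fset b in 'I_3]%fset| = 3%N by rewrite card_imfset //= -cardE card_ord.
  by move=> [<-].
by apply/seteqP; split=> b; rewrite /= inS !inE.
Qed.

Variables (G : groupType) (S : seq G).
Hypothesis gS : generates S.
Variable ray : 'I_3 -> nat -> G.
Hypotheses (ray0 : forall a, ray a 0%N = 1%g)
  (ray_step : forall a n, ((ray a n)^-1 * ray a n.+1)%g \in gens S)
  (ray_far : forall a n k, ray a n \in ball S k -> (n <= k)%N)
  (ray_diverge : forall a b i j k, a != b -> ((ray a i)^-1 * ray b j)%g \in ball S k ->
    (i <= 2 * k)%N /\ (j <= 2 * k)%N).

Let h (w : option ('I_3 * nat)) : G := if w is Some (a, k) then ray a k.+1 else 1%g.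

Let h_vt a n : h (vt a n) = ray a n.
Proof. by case: n => [|n] //=; rewrite ray0. Qed.

Let leg_vt a w : onleg a w -> w = vt a (lev w).
Proof. by move=> aw; apply/eqP; rewrite vtP aw eqxx. Qed.

(** The vertices of leg [a] follow [ray a]. Properness comes from [ray_far], and divergence from
    [ray_diverge] after removing the vertices up to level [2 * k]. *)
Lemma tripod_has_obstructor : has_obstructor R S 0.
Proof.
exists 'I_3, tripod_base, (option ('I_3 * nat)), tripod, (@tripod_tri R), h; split.
- exact: tripod_obstructor_complex.
- exact: tripod_triangulation.
- move=> F fF; have [D hD] := seq_ball gS (enum_fset (fset_set F)).
  apply: sub_finite_set (lev_finite D) => w /= Fw.
  have /hD : h w \in enum_fset (fset_set F) by rewrite -[_ \in _]/(h w \in fset_set F) in_fset_set // inE.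
  by have [a aw] := onleg_exists w; rewrite {1}(leg_vt aw) h_vt => /ray_far.
- exists 1 => // x y; rewrite mul1e; apply: le_ereal_inf_tmp => _ [p [pp <-] <-].
  apply: ball_dist; elim: p x pp => [|z p IH] x /=; first by rewrite mulVg inE.
  move=> /andP[xz /IH pz].
  suff xzg : ((h x)^-1 * h z)%g \in gens S by have := ballM (ball_gens xzg) pz; rewrite add1n -mulgA mulVKg.
  move: xz => /andP[xz /set_mem[_ [a [n hn]]]].
  have hx := hn x; have hz := hn z; rewrite !inE !eqxx ?orbT in hx hz.
  have [xE|xE] := hx isT; have [zE|zE] := hz isT; rewrite xE zE !h_vt.
  + by rewrite mulVg gensE eqxx.
  + exact: ray_step.
  + by have := gensV (ray_step a n); rewrite invgM invgK.
  + by rewrite mulVg gensE eqxx.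
move=> s t [[a ->] [b ->] dj] D D0.
have ab : a != b by move: dj; rewrite fdisjoint1X inE.
have cv c w : cone_vertices (@tripod_tri R) [fset c]%fset w -> onleg c w.
  move=> [x xw]; have [d dw] := onleg_exists w.
  have t0 : 0 <= (lev w)%:R :> R by [].
  have xE : \val x = leg_point d (lev w)%:R :> {ptws _ -> R}.
    rewrite xw; apply/funext => u; rewrite /vertex_point /leg_point {1}(leg_vt dw) vtP.
    case: ifP => //= _; have [->|ne] := eqVneq (lev u) (lev w).
      by rewrite /hat subrr normr0 subr0 max_r.
    have wi : (lev w)%:R <= ((lev w)%:R : R) <= (lev w)%:R + 1 by rewrite lexx /= lerDl.
    have [->|ne1] := eqVneq (lev u) (lev w).+1; first by rewrite hat_high // subrr.
    by rewrite (hat_out wi).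
  rewrite (tripod_triE t0 xE) => /(phi_subcone _ _ t0)[<- //|/eqP].
  by rewrite pnatr_eq0 => /eqP l0; case: w l0 {dw t0 xE xw} => // -[].
pose k := Num.bound D; have Dk : D < k%:R by apply: archi_boundP; exact: ltW.
pose A c := [set w | cone_vertices (@tripod_tri R) [fset c]%fset w /\ (lev w <= 2 * k)%N].
have fA c : finite_set (A c) by apply: sub_finite_set (lev_finite (2 * k)) => w [].
exists (A a), (A b); split=> //; try by move=> w [].
apply: (@lt_le_trans _ _ k%:R%:E); first by rewrite lte_fin.
apply: le_ereal_inf_tmp => _ [[_ _] /= [[w [cw nw] <-] [w' [cw' nw'] <-]] <-].
rewrite leNgt; apply/negP => /ltW /(@dist_ball R) hb.
have wa := leg_vt (cv a w cw); have wb := leg_vt (cv b w' cw').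
rewrite wa wb !h_vt in hb; have [l1 l2] := ray_diverge ab hb.
by apply: nw; split.
Qed.

End TripodObstructor.

(** * Geodesics in infinite groups that are not two-ended *)

Local Open Scope card_scope.

(** Each coordinate has finitely many values, so it is constant along an ultrafilter. Agreement at
    two indices at a time is enough to pass distances to the limit. *)
Lemma ultra_limit (I : Type) (T : choiceType) (x : nat -> I -> T) (b : I -> seq T) :
  (forall k i, x k i \in b i) -> exists f : I -> T, forall i j K,
    exists2 k, (K <= k)%N & x k i = f i /\ x k j = f j.
Proof.
move=> xb; have [U [uU oU]] := ultraFilterLemma (F := \oo) _.
have h i : exists g, U [set k | x k i = g].
  apply: contrapT => hn; have nU g : U [set k | x k i <> g].
    have [h|//] := in_ultra_setVsetC [set k | x k i = g] uU; by case: hn; exists g.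
  have : U [set k | x k i \notin b i].
    elim: (b i) => [|g l IH]; first by apply: filterS filterT => k.
    apply: filterS (filterI (nU g) IH) => k [/= /eqP h1 h2]; by rewrite inE negb_or h1.
  by rewrite (_ : [set k | _] = set0); [exact: filter_not_empty|apply/seteqP; split=> // k /=; rewrite xb].
have [f fP] := choice h; exists f => i j K.
have : U ([set k | (K <= k)%N] `&` ([set k | x k i = f i] `&` [set k | x k j = f j])).
  by apply: filterI; [apply: oU; exists K|apply: filterI; exact: fP].
by move=> /filter_ex[k [h1 h2]]; exists k.
Qed.

Section WordMetric.
Variables (G : groupType) (S : seq G).
Hypothesis gS : generates S.
Implicit Types x y : G.

Definition wl x : nat := ex_minn (generates_ball gS x).
Definition wd x y := wl (x^-1 * y)%g.

Lemma wlP x n : (x \in ball S n) = (wl x <= n)%N.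
Proof.
rewrite /wl; case: ex_minnP => k xk hk; apply/idP/idP => [/hk//|kn]; exact: ball_leq xk.
Qed.

Lemma wl1 : wl 1%g = 0%N. Proof. by apply/eqP; rewrite -leqn0 -wlP inE. Qed.
Lemma wlM x y : (wl (x * y)%g <= wl x + wl y)%N.
Proof. by rewrite -wlP; apply: ballM; rewrite wlP. Qed.
Lemma wlV x : wl (x^-1)%g = wl x.
Proof.
apply/eqP; rewrite eqn_leq -!wlP ballV ?wlP //=; rewrite -{1}(invgK x) -wlP; apply: ballV; by rewrite wlP.
Qed.
Lemma wdC x y : wd x y = wd y x. Proof. by rewrite /wd -wlV invgM invgK. Qed.
Lemma wd_tri x y z : (wd x z <= wd x y + wd y z)%N.
Proof. by apply: leq_trans (wlM _ _); rewrite /wd -mulgA mulVKg. Qed.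
Lemma wdM g x y : wd (g * x)%g (g * y)%g = wd x y.
Proof. by rewrite /wd invgM -mulgA mulKg. Qed.
Lemma wdxx x : wd x x = 0%N. Proof. by rewrite /wd mulVg wl1. Qed.
Lemma wd1 x : wd 1%g x = wl x. Proof. by rewrite /wd invg1 mul1g. Qed.
Lemma wd_wl x y : (wl y <= wl x + wd x y)%N.
Proof. by rewrite -!wd1; exact: wd_tri. Qed.

Lemma geodesic_steps n g : wl g = n -> exists p : nat -> G,
  [/\ p 0%N = 1%g, p n = g & forall i, (i < n)%N -> (wd (p i) (p i.+1) <= 1)%N].
Proof.
elim: n g => [|n IH] g gn.
  exists (fun=> 1%g); split=> //; have : g \in ball S 0 by rewrite wlP gn.
  by rewrite inE => /eqP.
have : g \in ball S n.+1 by rewrite wlP gn.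
move=> /ballSP[u [v [un vg gE]]]; have v1 : (wl v <= 1)%N by rewrite -wlP ball_gens.
have uN : wl u = n.
  by apply/eqP; rewrite eqn_leq -wlP un /=; have := wlM u v; rewrite -gE gn; lia.
have [p [p0 pn ps]] := IH u uN; exists (fun i => if (i <= n)%N then p i else g); split=> //.
  by rewrite ltnn.
move=> i; rewrite ltnS => il; rewrite il; case: ltnP => [lt|ge]; first exact: ps.
have -> : i = n by apply/eqP; rewrite eqn_leq il.
by rewrite pn /wd gE mulKg.
Qed.

(** A path of [n] steps of length at most one that reaches distance [n] cannot waste any of them. *)
Lemma geodesic n g : wl g = n -> exists p : nat -> G,
  [/\ p 0%N = 1%g, p n = g & forall i j, (i <= j <= n)%N -> wd (p i) (p j) = (j - i)%N].
Proof.
move=> gn; have [p [p0 pn ps]] := geodesic_steps gn; exists p; split=> //.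
have up i k : (i + k <= n)%N -> (wd (p i) (p (i + k)%N) <= k)%N.
  elim: k => [|k IH] ik; first by rewrite addn0 wdxx.
  have h1 := wd_tri (p i) (p (i + k)%N) (p (i + k.+1)%N).
  have h2 : (wd (p (i + k)%N) (p (i + k.+1)%N) <= 1)%N by rewrite addnS; apply: ps; rewrite -addnS.
  have h3 : (i + k <= n)%N by lia.
  by have := IH h3; lia.
move=> i j /andP[ij jn]; have h1 := up i (j - i)%N; have h2 := up 0%N i; have h3 := up j (n - j)%N.
rewrite ?subnKC // in h1 h3; rewrite add0n p0 pn in h2 h3.
have h4 := wd_tri 1%g (p i) g; have h5 := wd_tri (p i) (p j) g.
rewrite wd1 gn in h4; have {}h1 := h1 jn; have {}h2 := h2 (leq_trans ij jn); have {}h3 := h3 (leqnn n); lia.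
Qed.

Hypothesis infG : infinite_set [set: G].

Lemma long_element n : exists g, wl g = n.
Proof.
have [g ng] : exists g, (n <= wl g)%N.
  apply: contrapT => h; apply: infG; apply: (@sub_finite_set _ _ [set` ball S n]); last exact: finite_seq.
  by move=> g _ /=; rewrite wlP ltnW // ltnNge; apply/negP => ng; apply: h; exists g.
have [p [p0 pn ps]] := geodesic (erefl (wl g)); exists (p n).
by rewrite -wd1 -p0 ps ?subn0 // ng.
Qed.

Definition is_line (L : int -> G) := L 0 = 1%g /\ forall z w, wd (L z) (L w) = `|z - w|%N.

Lemma wl_line L z : is_line L -> wl (L z) = `|z|%N.
Proof. by move=> [L0 Ld]; rewrite -wd1 -L0 Ld sub0r abszN. Qed.

(** Geodesic segments of length [2 k] are translated so that their midpoints are the identity, and a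
    limit is taken. *)
Lemma exists_line : exists L, is_line L.
Proof.
have hp k : exists p : nat -> G, forall i j, (i <= j <= k.*2)%N -> wd (p i) (p j) = (j - i)%N.
  by have [g /geodesic[p [_ _ h]]] := long_element k.*2; exists p.
have [p pP] := choice hp.
pose x k (z : int) : G := if (`|z| <= k)%N then ((p k k)^-1 * p k `|(k%:Z + z)%R|%N)%g else 1%g.
have pd k i j : (i <= k.*2)%N -> (j <= k.*2)%N -> wd (p k i) (p k j) = `|(i%:Z - j%:Z)%R|%N.
  move=> ik jk; have [ij|/ltnW ji] := leqP i j; first by rewrite pP ?ij //; lia.
  by rewrite wdC pP ?ji //; lia.
have xb k z : x k z \in ball S `|z|%N.
  rewrite /x; case: leqP => zk; last exact: ball1.
  by rewrite wlP -[wl _]/(wd _ _) pd; lia.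
have [f fP] := ultra_limit xb; exists f.
split; first by have [k _ [h _]] := fP 0 0 0%N; move: h; rewrite /x absz0 leq0n addr0 /= mulVg => <-.
move=> z w; have [k kz [<- <-]] := fP z w (maxn `|z|%N `|w|%N).
by rewrite /x !ifT ?wdM ?pd; lia.
Qed.

(** A geodesic from the line to a far point, starting at a nearest point of the line, leaves the
    line at unit speed. Translating that nearest point to the identity moves the line as well, so
    the segments and the translated lines are passed to the limit together. *)
Lemma line_and_ray L : is_line L -> (forall k, exists g, forall z, (k <= wd g (L z))%N) ->
  exists L' r, [/\ is_line L', r 0%N = 1%g, forall i j, (i <= j)%N -> wd (r i) (r j) = (j - i)%N
    & forall i z, (i <= wd (r i) (L' z))%N].
Proof.
move=> [L0 Ld] far.
have hq k : exists zq : int * (nat -> G), [/\ zq.2 0%N = 1%g,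
    forall i j, (i <= j <= k)%N -> wd (zq.2 i) (zq.2 j) = (j - i)%N &
    forall i z, (i <= k)%N -> (i <= wd (zq.2 i) ((L zq.1)^-1 * L (zq.1 + z)%R)%g)%N].
  have [g hg] := far k.
  have ex : exists n, `[< exists z, wd g (L z) = n >] by exists (wd g (L 0)); apply/asboolP; exists 0.
  have [D /asboolP[z zD] hmin] := ex_minnP ex.
  have kD : (k <= D)%N by rewrite -zD.
  have gD : wl ((L z)^-1 * g)%g = D by rewrite -zD wdC.
  have [q [q0 qD qd]] := geodesic gD; exists (z, q) => /=; split=> //.
    by move=> i j /andP[ij jk]; apply: qd; rewrite ij (leq_trans jk).
  move=> i w ik; have h1 : (D <= wd g (L (z + w)%R))%N by apply: hmin; apply/asboolP; exists (z + w).
  rewrite -(wdM (L z)^-1%g) -qD in h1; have h2 := wd_tri (q D) (q i) ((L z)^-1 * L (z + w)%R)%g.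
  have h3 : wd (q D) (q i) = (D - i)%N by rewrite wdC qd // (leq_trans ik) //=.
  have iD := leq_trans ik kD; rewrite h3 in h2.
  by rewrite -(leq_add2l (D - i)) subnK //; exact: leq_trans h1 h2.
have [zq zqP] := choice hq.
pose x k (c : int + nat) : G := match c with
  | inl z => ((L (zq k).1)^-1 * L ((zq k).1 + z)%R)%g
  | inr i => if (i <= k)%N then (zq k).2 i else 1%g end.
pose b (c : int + nat) := match c with inl z => ball S `|z|%N | inr i => ball S i end.
have xb k c : x k c \in b c.
  have [q0 qd _] := zqP k; case: c => [z|i] /=.
    by rewrite wlP -[wl _]/(wd _ _) Ld; lia.
  case: leqP => ik; last exact: ball1.
  by rewrite wlP -wd1 -q0 qd ?subn0 // ik.
have [f two] := ultra_limit xb.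
exists (f \o inl), (f \o inr); split=> /=.
- split=> [|z w].
    have [k _ [h _]] := two (inl 0%R) (inl 0%R) 0%N.
    have e : ((zq k).1 + 0 = (zq k).1)%R by rewrite addr0.
    exact: (etrans (esym h) (etrans (congr1 (fun z => ((L (zq k).1)^-1 * L z)%g) e) (mulVg _))).
  have [k _ [h1 h2]] := two (inl z) (inl w) 0%N; rewrite /comp /= -h1 -h2 /= wdM Ld; congr absz; ring.
- by have [k _ [<- _]] := two (inr 0%N) (inr 0%N) 0%N; have [q0 _ _] := zqP k.
- move=> i j ij; have [k kj [<- <-]] := two (inr i) (inr j) j; have [_ qd _] := zqP k.
  by rewrite /= kj (leq_trans ij kj) qd // ij.
move=> i z; have [k ki [<- <-]] := two (inr i) (inl z) i; have [_ _ h] := zqP k.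
by rewrite /= ki; exact: h.
Qed.

Definition comp (F : set G) x := [set y | exists p, [/\ path (cayley S) x p, last x p = y & forall z, z \in p -> ~ F z]].

Lemma comp_step F x y : ~ F x -> ~ F y -> cayley S x y -> comp F x = comp F y.
Proof.
have half u v : ~ F v -> cayley S u v -> comp F v `<=` comp F u.
  move=> nv uv z [p [pp lp np]]; exists (v :: p); rewrite /= uv pp; split=> // w.
  by rewrite inE => /orP[/eqP ->//|/np].
move=> nx ny xy; apply/seteqP; split; last exact: half.
by apply: half => //; rewrite /cayley orbC.
Qed.

Lemma comp_eq F x y : ~ F x -> comp F x y -> comp F x = comp F y.
Proof.
move=> nx [p [pp <- np]]; elim: p x nx pp np => //= z p IH x nx /andP[xz pp] np.
have nz : ~ F z by apply: np; exact: mem_head.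
rewrite (comp_step nx nz xz); apply: IH => // w wp; apply: np; by rewrite inE wp orbT.
Qed.

Lemma comp_refl F x : comp F x x. Proof. by exists [::]. Qed.

Lemma comp_near F rho n x y : (forall u, F u -> (wl u <= rho)%N) -> (wd x y <= n)%N -> (rho + n < wl x)%N ->
  comp F x = comp F y.
Proof.
move=> hF; rewrite -[(wd x y <= n)%N]wlP => /(ball_path x)[p [pp lp sp]] hx.
rewrite mulVKg in lp; rewrite -lp; elim: p n x pp sp hx {lp} => //= z p IH [//|n] x /andP[xz pp] sp hx.
have xz1 : (wd x z <= 1)%N by rewrite -wlP ball_gens // cayley_gens.
have wz := wd_wl z x; rewrite wdC in wz.
rewrite (@comp_step F x z) //; last 2 first.
- by move=> /hF; lia.
- by move=> /hF; lia.
by apply: (IH n) => //; lia.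
Qed.

(** Every element is near the line, so an infinite component outside a finite set contains one of
    the two ends of the line, and a large ball separates these ends. *)
Lemma line_two_ended L R0 : is_line L -> (forall g, exists z, (wd g (L z) <= R0)%N) -> two_ended S.
Proof.
move=> lL nearL; have [L0 Ld] := lL; have wlL z := wl_line z lL.
have far F rho N0 : (forall u, F u -> (wl u <= rho)%N) -> (rho + R0 + 2 <= N0)%N ->
    (forall z : int, (N0%:Z <= z) -> comp F (L z) = comp F (L N0%:Z)) /\
    (forall z : int, (N0%:Z <= z) -> comp F (L (- z)) = comp F (L (- N0%:Z))).
  move=> hF hN; have key (s : int) (i : nat) : `|s|%N = 1%N -> comp F (L (s * (N0 + i)%:Z)) = comp F (L (s * N0%:Z)).
    move=> s1; elim: i => [|i <-]; first by rewrite addn0.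
    by apply: (comp_near (n := 1%N) hF); rewrite ?Ld ?wlL; nia.
  split=> z hz.
    by have := key 1 (`|z| - N0)%N erefl; rewrite !mul1r; rewrite (_ : (_ + _)%:Z = z) //; lia.
  by have := key (-1) (`|z| - N0)%N erefl; rewrite !mulN1r; rewrite (_ : (_ + _)%:Z = z) //; lia.
have sub F rho N0 : (forall u, F u -> (wl u <= rho)%N) -> (rho + R0 + 2 <= N0)%N ->
    infinite_components S F `<=` [set comp F (L N0%:Z); comp F (L (- N0%:Z))].
  move=> hF hN C [infC [x nx CE]]; have [hp hm] := far F rho N0 hF hN.
  have [y [Cy yb]] : exists y, C y /\ (N0 + rho + R0 < wl y)%N.
    apply: contrapT => h; apply: infC; apply: (@sub_finite_set _ _ [set` ball S (N0 + rho + R0)]); last exact: finite_seq.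
    by move=> y Cy /=; rewrite wlP leqNgt; apply/negP => hy; apply: h; exists y.
  have Ey : C = comp F y by rewrite CE; apply: comp_eq => //; rewrite CE in Cy.
  have [z yz] := nearL y; have h1 := wd_wl (L z) y; rewrite wlL wdC in h1.
  rewrite Ey (comp_near hF yz); last by lia.
  have [z0|z0] : (N0%:Z <= z) \/ (N0%:Z <= - z) by lia.
    by left; exact: hp.
  by right; have := hm (- z) z0; rewrite opprK.
have bnd F : finite_set F -> exists rho, forall u, F u -> (wl u <= rho)%N.
  move=> fF; exists (\max_(u <- fset_set F) wl u)%N => u Fu; apply: leq_bigmax_seq => //.
  by rewrite in_fset_set // inE.
have card2 (A B : set G) : [set A; B] #<= `I_2.
  have -> : [set A; B] = [set` [fset A; B]%fset] by apply/seteqP; split=> C /=; rewrite !inE; [move=> [->|->]; rewrite eqxx ?orbT|move=> /orP[]/eqP ->; [left|right]].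
  have /card_eqPle[h1 _] : [set` [fset A; B]%fset] #= `I_(#|` [fset A; B]%fset|) by apply/card_eq_fsetP.
  apply: card_le_trans h1 _.
  by rewrite card_le_II cardfs2; case: (_ != _).
split; last first.
  move=> F /bnd[rho hF]; apply: (card_le_trans (subset_card_le (sub F rho _ hF (leqnn _)))); exact: card2.
(* An element of length above [P] is near line points of parameter above [2 R0 + 3] in absolute
   value, while one step of a path moves such a parameter by at most [2 R0 + 1]. Its sign therefore
   cannot change outside the ball. *)
pose P := (3 * R0 + 3)%N; pose F := [set g | (wl g <= P)%N]; pose N0 := (P + R0 + 2)%N.
have hF u : F u -> (wl u <= P)%N by [].
have [hp hm] := far F P N0 hF (leqnn _).
have nF (z : int) : (P < `|z|)%N -> ~ F (L z) by move=> h; rewrite /F /= wlL leqNgt h.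
have infA (s : int) (A : set G) : `|s|%N = 1%N -> (forall i : nat, A (L (s * (N0 + i)%:Z))) -> infinite_set A.
  move=> s1 hA fA; suff : finite_set [set: nat] by exact: infinite_nat.
  have : finite_set ((fun i : nat => L (s * (N0 + i)%:Z)) @^-1` A).
    apply: finite_preimage => // i j _ _ e.
    by have := Ld (s * (N0 + i)%:Z) (s * (N0 + j)%:Z); rewrite e wdxx; nia.
  by apply: sub_finite_set => i _; exact: hA.
have AB : comp F (L N0%:Z) <> comp F (L (- N0%:Z)).
  move=> e; have : comp F (L N0%:Z) (L (- N0%:Z)) by rewrite e; exact: comp_refl.
  move=> [p [pp lp np]].
  have ap : forall z, (wd (L N0%:Z) (L z) <= R0)%N -> 0 < z by move=> z; rewrite Ld /N0; lia.
  have n0 : ~ F (L N0%:Z) by apply: nF; rewrite /N0; lia.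
  suff H : forall z, (wd (last (L N0%:Z) p) (L z) <= R0)%N -> 0 < z.
    by have := H (- N0%:Z); rewrite lp wdxx => /(_ isT); rewrite /N0; lia.
  elim: p (L N0%:Z) ap n0 pp np {lp e} => //= v p IH u ap nu /andP[uv pp] np.
  have nv : ~ F v by apply: np; exact: mem_head.
  apply: IH => //; last by move=> w wp; apply: np; rewrite inE wp orbT.
  move=> w vw; have [z uz] := nearL u; have z0 := ap z uz.
  have uv1 : (wd u v <= 1)%N by rewrite -wlP ball_gens // cayley_gens.
  have h1 := wd_wl (L w) v; rewrite wlL wdC in h1.
  have h2 : (P < wl v)%N by rewrite ltnNge; apply/negP.
  have h3 := wd_tri (L z) u (L w); have h4 := wd_tri u v (L w); rewrite Ld (wdC (L z)) in h3.
  rewrite /P in h2; lia.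
exists F; first by apply: sub_finite_set (finite_seq (ball S P)) => g /=; rewrite wlP.
have -> : infinite_components S F = [set comp F (L N0%:Z); comp F (L (- N0%:Z))].
  apply/seteqP; split; first exact: sub hF (leqnn _).
  move=> C [->|->]; split.
  - apply: (infA 1) => // i; rewrite mul1r -(hp (N0 + i)%:Z); [exact: comp_refl|lia].
  - by exists (L N0%:Z) => //; apply: nF; rewrite /N0; lia.
  - apply: (infA (-1)) => // i; rewrite mulN1r -(hm (N0 + i)%:Z); [exact: comp_refl|lia].
  - by exists (L (- N0%:Z)) => //; apply: nF; rewrite /N0; lia.
have -> : [set comp F (L N0%:Z); comp F (L (- N0%:Z))] = [set` [fset comp F (L N0%:Z); comp F (L (- N0%:Z))]%fset].
  by apply/seteqP; split=> C /=; rewrite !inE; [move=> [->|->]; rewrite eqxx ?orbT|move=> /orP[]/eqP ->; [left|right]].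
have -> : `I_2 = `I_(#|` [fset comp F (L N0%:Z); comp F (L (- N0%:Z))]%fset|).
  by rewrite cardfs2; case: eqP AB.
exact/card_eq_fsetP.
Qed.

End WordMetric.

(** * Three diverging rays *)

Section ThreeRays.
Variables (R : realType) (G : groupType) (S : seq G).
Hypotheses (gS : generates S) (infG : infinite_set [set: G]) (nte : ~ two_ended S).

Lemma ball1_gens (x : G) : x \in ball S 1 -> x \in gens S.
Proof. by move=> /ballSP[u [v [/=]]]; rewrite inE => /eqP -> vg ->; rewrite mul1g. Qed.

(* Three points form a 0-obstructor complex; the three rays of its cone go to the
   two halves of a bi-infinite geodesic and to a ray leaving it at unit speed. *)
Lemma has_obstructor0 : has_obstructor R S 0.
Proof.
have [L0 lL0] := exists_line gS infG.
have far k : exists g, forall z, (k <= wd gS g (L0 z))%N.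
  apply: contrapT => h; apply: nte; apply: (line_two_ended (R0 := k) lL0) => g.
  apply: contrapT => hg; apply: h; exists g => z; rewrite leqNgt; apply/negP => lt.
  by apply: hg; exists z; exact: ltnW.
have [L [r [lL r0 rd rL]]] := line_and_ray lL0 far; have [L1 Ld] := lL.
pose ray (a : 'I_3) (i : nat) : G := if a == ord0 then L i%:Z else if a == lift ord0 ord0 then L (- i%:Z) else r i.
have wr i : wl gS (r i) = i by rewrite -wd1 -r0 rd ?subn0.
have wray a i : wl gS (ray a i) = i.
  by rewrite /ray; case: ifP => _; [|case: ifP => _]; rewrite ?(wl_line _ lL) ?wr //; lia.
(* The point [r i] is at distance at least [i] from the line, so both [i] and this distance bound
   the parameter of a line point near it. *)
have rline z i : (`|z|%N <= 2 * wd gS (r i) (L z))%N.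
  have h1 := rL i z; have h2 := wd_wl gS (r i) (L z); rewrite wr (wl_line _ lL) in h2; lia.
apply: (tripod_has_obstructor R gS (ray := ray)).
- by move=> a; rewrite /ray ?oppr0 L1 r0; case: (a == _); case: (a == _).
- move=> a n; apply: ball1_gens; rewrite (wlP gS) -/(wd gS _ _) /ray.
  by case: ifP => _; [|case: ifP => _]; rewrite ?Ld ?rd //; lia.
- by move=> a n k; rewrite (wlP gS) wray.
move=> a b i j k ab; rewrite (wlP gS) -/(wd gS _ _).
(* Two different rays cannot both follow [r], so one of them may be taken to be a half of the
   line. *)
have key c d i' j' : (wd gS (ray c i') (ray d j') <= k)%N -> c != d -> (d : nat) <> 2%N -> (i' <= 2 * k)%N /\ (j' <= 2 * k)%N.
  move=> h cd d2; have dd : (d == ord0) || (d == lift ord0 ord0) by case: d d2 {h cd} => -[|[|[|?]]].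
  have [z [dz zj]] : exists z, ray d j' = L z /\ `|z|%N = j' /\ ((d == ord0) = true -> z = j'%:Z) /\ ((d == ord0) = false -> z = - j'%:Z).
    rewrite /ray; case: (d == ord0) dd => /= [_|->]; first by exists j'%:Z; split=> //; split.
    by exists (- j'%:Z); split=> //; split=> //; lia.
  rewrite dz in h; move: h zj; rewrite {1}/ray; case: ifP => c0.
    move=> h [zj [z1 z2]]; rewrite Ld in h; have d0 : (d == ord0) = false.
      by apply: contraNF cd => /eqP ->.
    by rewrite (z2 d0) in h; lia.
  case: ifP => c1 h [zj [z1 z2]].
    rewrite Ld in h; have d0 : (d == ord0) = true.
      by move: dd; case: (d == ord0) => //= /eqP dE; move: cd; rewrite (eqP c1) dE eqxx.
    by rewrite (z1 d0) in h; lia.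
  have h1 := rL i' z; have h2 := rline z i'; lia.
move=> h; have [b2|b2] := pselect ((b : nat) = 2%N); last exact: key h ab b2.
have a2 : (a : nat) <> 2%N by move=> a2; case/eqP: ab; apply: val_inj; rewrite /= a2 b2.
rewrite wdC in h; have [|h1 h2] := key b a j i h _ a2; first by rewrite eq_sym.
by [].
Qed.

End ThreeRays.

(** A manifold of dimension zero is discrete, while the track of a point under the contraction is
    connected. *)
Lemma manifold0_point (R : realType) (M : topologicalType) : manifold R 0 M -> contractible R M ->
  exists x0 : M, forall x, x = x0.
Proof.
move=> [hM _ ch] [x0 [H [Hc H0 H1]]]; exists x0 => x.
have [U [phi [psi [[oU Ux] _ _ _ phiK]]]] := ch x.
have UE : U = [set x].
  apply/seteqP; split=> [y Uy|y -> //]; have iU z : U z -> z \in U by rewrite inE.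
  by rewrite /= -(phiK _ (iU _ Uy)) -(phiK _ (iU _ Ux)) (thinmx0 (phi y)) (thinmx0 (phi x)).
have hc : {within `[(0 : R), 1], continuous (fun t => H (x, t))}.
  apply: (within_comp Hc (u := fun t : R => (x, t))); last by move=> t.
  by apply: continuous_subspaceT => t; exact: (cvg_pair (cvg_cst x) cvg_id).
have cI : connected `[(0 : R), 1]%classic := @segment_connected R 0 1.
have cA := connected_continuous_connected cI hc.
have I0 : `[(0 : R), 1]%classic 0 by rewrite /= in_itv /= lexx ler01.
have I1 : `[(0 : R), 1]%classic 1 by rewrite /= in_itv /= lexx ler01.
have Ax : [set H (x, t) | t in `[(0 : R), 1]] x by exists 0.
have E : [set x] = [set H (x, t) | t in `[(0 : R), 1]].
  have xE : [set x] = [set H (x, t) | t in `[(0 : R), 1]] `&` [set x].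
    by apply/seteqP; split=> [y ->|y []].
  apply: cA; first by exists x.
    by exists [set x] => //; rewrite -UE.
  by exists [set x] => //; exact: accessible_closed_set1 (hausdorff_accessible hM) x.
have : [set H (x, t) | t in `[(0 : R), 1]] x0 by exists 1.
by rewrite -E => ->.
Qed.

Theorem theorem1 (R : realType) (G : groupType) (S : seq G) (m : int) :
  generates S -> (m%:E <= obdim R S)%E ->
  forall (M : topologicalType) (n : nat),
    manifold R n M -> contractible R M -> n%:Z < m ->
    ~ exists act : G -> M -> M, properly_discontinuous_action act.
Proof.
move=> gS hm M n mM cM nm [act hact].
have [finG|infG] := pselect (finite_set [set: G]).
  by move: hm; rewrite /obdim (asboolT finG) lee_fin; lia.
(* On a one-point space every group element meets the compact set, so proper discontinuity would
   make the group finite. *)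
have n0 : n <> 0%N.
  move=> n0; rewrite n0 in mM; have [x0 Mx] := manifold0_point mM cM; apply: infG.
  have [_ _ _ pd] := hact; have cx : compact [set x0] := @compact_set1 _ x0.
  by apply: sub_finite_set (pd _ cx) => g _; exists (act g x0); split; [exists x0|rewrite /= (Mx (act g x0))].
have [te|nte] := pselect (two_ended S).
  by move: hm; rewrite /obdim (asboolF infG) (asboolT te) lee_fin; lia.
case: n n0 mM nm => // n _ mM nm.
(* The manifold now has dimension [n+1] and a [k]-obstructor gives a tower of length [k+1], so
   [n <= k] is what is needed. If the obstructor dimension is finite, it is [k + 2], which is at
   least [m] and hence exceeds [n + 1]. *)
have [k hk nk] : exists2 k, has_obstructor R S k & (n <= k)%N.
  have [[k [hk kmax]]|nmax] := pselect (exists k, has_obstructor R S k /\ forall j, has_obstructor R S j -> (j <= k)%N).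
    have : exists d, [set d | exists2 k : nat, d = (k + 2)%N%:Z%:E &
        has_obstructor R S k /\ forall j : nat, has_obstructor R S j -> (j <= k)%N] d.
      by exists (k + 2)%N%:Z%:E, k.
    move=> /(xgetPex (+oo%E : \bar int))[j jE [hj _]]; exists j => //.
    by move: hm; rewrite /obdim (asboolF infG) (asboolF nte) jE lee_fin; lia.
  (* Without a maximum, obstructors exist in arbitrarily large dimensions: a bounded set of
     dimensions would have a maximum, as it contains zero by [has_obstructor0]. *)
  apply: contrapT => hn; apply: nmax.
  have ex : exists k, `[< has_obstructor R S k >].
    by exists 0%N; apply/asboolP; exact: has_obstructor0.
  have bd k : `[< has_obstructor R S k >] -> (k <= n)%N.
    by move=> /asboolP hk; rewrite leqNgt; apply/negP => nk; apply: hn; exists k => //; exact: ltnW.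
  by have [k /asboolP hk kmax] := ex_maxnP ex bd; exists k; split=> // j hj; apply: kmax; apply/asboolP.
have [V [K [W [T [tri [h [obs trP hp hl he]]]]]]] := hk.
have [B hB] := far_tower gS obs trP hp hl he.
exact: (no_action mM cM hact nk hB).
Qed.
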